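(* Let $\mathcal{H}$ be an infinite-dimensional separable Hilbert space and let $\alpha$ be an $E_0$-semigroup on $\mathcal{B}(\mathcal{H})$. Then: (1) $\alpha$ is modularly extendable. (2) $\alpha$ has type EI, EII or EIII, respectively, if and only if $\alpha$ has type I, II or III, respectively, in the sense of Arveson and Powers.
   Context: An $E_0$-semigroup on a von Neumann algebra $M$ is a family $\{\alpha_t\}_{t\ge0}$ of normal unital $*$-endomorphisms of $M$ with $\alpha_0=\mathrm{id}$, $\alpha_s\circ\alpha_t=\alpha_{s+t}$, and $t\mapsto\rho(\alpha_t(x))$ continuous for all $\rho\in M_*$, $x\in M$. For a faithful normal semifinite weight $\phi$ on a factor $M$, let $\mathcal{H}_\phi$ be the GNS space and $J_\phi$ the modular conjugation; $M$ is identified with its image in $\mathcal{B}(\mathcal{H}_\phi)$, with commutant $M'$ there. A normal unital endomorphism $\theta$ of $M$ is modularly extendable if, for some (equivalently, every) faithful normal semifinite weight $\phi$, there exists a normal endomorphism $\widetilde\theta_\phi$ of $\mathcal{B}(\mathcal{H}_\phi)$ with $\widetilde\theta_\phi(xy')=\theta(x)\,J_\phi\theta(J_\phi y'J_\phi)J_\phi$ for all $x\in M$, $y'\in M'$; then $\widetilde\theta_\phi$ is unique. An $E_0$-semigroup $\alpha$ on $M$ is modularly extendable if every $\alpha_t$ is; its modular extension is the $E_0$-semigroup $\{(\widetilde{\alpha_t})_\phi\}_{t\ge0}$ on $\mathcal{B}(\mathcal{H}_\phi)$; for different weights these are conjugate. A unit of an $E_0$-semigroup $\sigma$ on $\mathcal{B}(\mathcal{K})$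 is a strongly continuous semigroup $\{T_t\}_{t\ge0}$ of bounded operators with $T_0=I$ and $\sigma_t(x)T_t=T_tx$ for all $x\in\mathcal{B}(\mathcal{K})$. In the sense of Arveson and Powers, $\sigma$ has type I if it has units and for every $t>0$ the space $\{T:\sigma_t(x)T=Tx\ \forall x\in\mathcal{B}(\mathcal{K})\}$ is the closed linear span of products $T^{(1)}_{t_1}\cdots T^{(n)}_{t_n}$ with $T^{(i)}$ units and $t_1+\dots+t_n=t$; type II if it has units but is not of type I; type III if it has no units. A modularly extendable $E_0$-semigroup on a factor has type EI, EII or EIII if its modular extension has type I, II or III respectively. *)

(* Defs.v *)
From HB Require Import structures.
From mathcomp Require Import all_boot all_order all_algebra.
From mathcomp Require Import boolp classical_sets functions cardinality reals.
From mathcomp Require Import ereal topology normedtype sequences.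
From mathcomp Require Import complex sesquilinear ring.

Set Implicit Arguments.
Unset Strict Implicit.
Unset Printing Implicit Defensive.
Import Order.TTheory GRing.Theory Num.Theory.
Import numFieldNormedType.Exports.
Local Open Scope classical_set_scope.
Local Open Scope ring_scope.

(* R[i] itself carries no topology; going through the structure makes that of
   a numFieldType available *)
Definition Cx (R : realType) : numClosedFieldType := R[i].

(* linear in the first variable *)
HB.mixin Record isHilbert (R : realType) H
    of CompleteNormedModule (Cx R) H := {
  inner : {dot H for (Num.conj : Cx R -> Cx R)};
  sqr_normE : forall u : H, `|u| ^+ 2 = inner u u
}.

#[short(type="hilbertType")]
HB.structure Definition Hilbert (R : realType) :=
  {H of CompleteNormedModule (Cx R) H & isHilbert R H}.

Notation "'[ u , v ]" := (inner u v) : ring_scope.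

Definition separable_space (T : topologicalType) :=
  exists2 D : set T, countable D & dense D.

Definition infinite_dimensional (K : nzRingType) (V : lmodType K) :=
  forall (n : nat) (e : 'I_n -> V),
    exists v, forall c : 'I_n -> K, v <> \sum_i c i *: e i.

Section BoundedOperators.
Variables (R : realType) (H : hilbertType R).

Record bop := Bop {
  bop_fun :> H -> H;
  bop_lin : linear bop_fun;
  bop_cont : continuous bop_fun }.

HB.instance Definition _ (x : bop) :=
  GRing.isLinear.Build (Cx R) H H *:%R (bop_fun x) (@bop_lin x).

Lemma bopP (x y : bop) : (forall u, x u = y u) -> x = y.
Proof.
case: x y => [f fl fc] [g gl gc] /= /funext fg; subst g.
by congr Bop; exact: Prop_irrelevance.
Qed.

HB.instance Definition _ := gen_eqMixin bop.
HB.instance Definition _ := gen_choiceMixin bop.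

Program Definition bop0 := @Bop (fun=> 0) _ _.
Next Obligation. by move=> a u v; rewrite scaler0 addr0. Qed.
Next Obligation. by move=> u; exact: cvg_cst. Qed.

Program Definition bop1 := @Bop id _ _.
Next Obligation. by []. Qed.
Next Obligation. by move=> u; exact: cvg_id. Qed.

Program Definition bopN (x : bop) := @Bop (fun u => - x u) _ _.
Next Obligation. by move=> x a u v; rewrite linearP opprD scalerN. Qed.
Next Obligation. by move=> x u; apply: cvgN; exact: bop_cont. Qed.

Program Definition bopD (x y : bop) := @Bop (fun u => x u + y u) _ _.
Next Obligation. by move=> x y a u v; rewrite !linearP scalerDr addrACA. Qed.
Next Obligation. by move=> x y u; apply: cvgD; exact: bop_cont. Qed.

Program Definition bopZ (c : Cx R) (x : bop) := @Bop (fun u => c *: x u) _ _.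
Next Obligation.
by move=> c x a u v; rewrite !linearP !scalerA mulrC.
Qed.
Next Obligation. by move=> c x u; apply: cvgZr; exact: bop_cont. Qed.

Program Definition bopM (x y : bop) := @Bop (fun u => x (y u)) _ _.
Next Obligation. by move=> x y a u v; rewrite !linearP. Qed.
Next Obligation.
move=> x y u; apply: (@continuous_comp _ _ _ y x); exact: bop_cont.
Qed.

Fact bopDA : associative bopD.
Proof. by move=> x y z; apply: bopP => u /=; rewrite addrA. Qed.
Fact bopDC : commutative bopD.
Proof. by move=> x y; apply: bopP => u /=; rewrite addrC. Qed.
Fact bop0D : left_id bop0 bopD.
Proof. by move=> x; apply: bopP => u /=; rewrite add0r. Qed.
Fact bopND : left_inverse bop0 bopN bopD.
Proof. by move=> x; apply: bopP => u /=; rewrite addNr. Qed.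
HB.instance Definition _ :=
  GRing.isZmodule.Build bop bopDA bopDC bop0D bopND.

Fact bopMA : associative bopM.
Proof. by move=> x y z; exact: bopP. Qed.
Fact bop1M : left_id bop1 bopM.
Proof. by move=> x; exact: bopP. Qed.
Fact bopM1 : right_id bop1 bopM.
Proof. by move=> x; exact: bopP. Qed.
Fact bopMDl : left_distributive bopM bopD.
Proof. by move=> x y z; exact: bopP. Qed.
Fact bopMDr : right_distributive bopM bopD.
Proof. by move=> x y z; apply: bopP => u /=; rewrite linearD. Qed.
HB.instance Definition _ :=
  GRing.Zmodule_isPzRing.Build bop bopMA bop1M bopM1 bopMDl bopMDr.

Fact bopZA a b x : bopZ a (bopZ b x) = bopZ (a * b) x.
Proof. by apply: bopP => u /=; rewrite scalerA. Qed.
Fact bop1Z : left_id 1 bopZ.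
Proof. by move=> x; apply: bopP => u /=; rewrite scale1r. Qed.
Fact bopZDr : right_distributive bopZ +%R.
Proof. by move=> a x y; apply: bopP => u /=; rewrite scalerDr. Qed.
Fact bopZDl x : {morph bopZ^~ x : a b / a + b}.
Proof. by move=> a b; apply: bopP => u /=; rewrite scalerDl. Qed.
HB.instance Definition _ :=
  GRing.Zmodule_isLmodule.Build (Cx R) bop bopZA bop1Z bopZDr bopZDl.

End BoundedOperators.
Arguments bop {R} H.

Section HilbertSpaces.
Variables (R : realType) (H : hilbertType R).
Implicit Types u v w : H.

Lemma innerC u v : '[u, v] = '[v, u]^*.
Proof. by rewrite (hermC inner) expr0 mul1r. Qed.

Lemma inner_eqr v w : (forall u, '[u, v] = '[u, w]) -> v = w.
Proof.
move=> vw; apply/eqP; rewrite -subr_eq0 -(dnorm_eq0 inner).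
by rewrite linearBr /= vw subrr.
Qed.

Lemma cauchy_schwarz u v : `|'[u, v]| <= `|u| * `|v|.
Proof.
have [->|v0] := eqVneq v 0; first by rewrite linear0r !normr0 mulr0.
have vp : 0 < `|v| by rewrite normr_gt0.
have v2 : '[v, v] = `|v| ^+ 2 by rewrite sqr_normE.
have [a aN] : exists a, a * `|v| ^+ 2 = '[u, v].
  by exists ('[u, v] / `|v| ^+ 2); rewrite divfK// expf_neq0 ?gt_eqF.
have : 0 <= '[u - a *: v, u - a *: v] by exact: dnorm_ge0.
rewrite dnormB dnormZ -!sqr_normE linearZr_LR /= rmorphM /= conjCK.
have -> : a^* * '[u, v] = `|a| ^+ 2 * `|v| ^+ 2.
  by rewrite -aN mulrA mulrC normCK [a^* * _]mulrC mulrC.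
have -> : a * ('[u, v])^* = `|a| ^+ 2 * `|v| ^+ 2.
  rewrite -aN rmorphM /= mulrA -normCK; congr (_ * _).
  by apply: conj_Creal; rewrite realX// normr_real.
rewrite opprD addrA addrK subr_ge0 => h.
rewrite -(ler_pXn2r (n := 2))// ?nnegrE ?mulr_ge0//.
rewrite exprMn -aN normrM (ger0_norm (exprn_ge0 _ (normr_ge0 v))).
by rewrite exprMn expr2 mulrA ler_wpM2r// exprn_ge0.
Qed.

Lemma riesz (f : H -> Cx R) (c : Cx R) : scalar f -> 0 <= c ->
  (forall u, `|f u| <= c * `|u|) -> exists v, forall u, f u = '[u, v].
Proof.
move=> fl c0 fc.
have fD u v : f (u + v) = f u + f v by have := fl 1 u v; rewrite scale1r mul1r.
have f0 : f 0 = 0 by have := fl (-1) 0 0; rewrite scaler0 addr0 mulN1r addNr.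
have fZ a u : f (a *: u) = a * f u by have := fl a u 0; rewrite f0 !addr0.
pose J u : Cx R := `|u| ^+ 2 - (f u + (f u)^*).
have Jreal u : J u \is Num.real.
  apply: realB; first by rewrite realX// normr_real.
  by apply/CrealP; rewrite rmorphD /= conjCK addrC.
pose S := range (fun u => complex.Re (J u)).
have ReJ u : ((complex.Re (J u))%:C)%C = J u by exact: RRe_real.


have Jge u : - c ^+ 2 <= J u.
  have fu2 : f u + (f u)^* <= c * `|u| + c * `|u|.
    have fr : f u + (f u)^* \is Num.real.
      by apply/CrealP; rewrite rmorphD /= conjCK addrC.
    apply: (le_trans (real_ler_norm fr)); apply: (le_trans (ler_normD _ _)).
    by rewrite norm_conjC lerD// fc.
  rewrite -subr_ge0 opprK /J.
  have : 0 <= (`|u| - c) ^+ 2.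
    by apply: real_exprn_even_ge0 => //; rewrite realB ?normr_real ?ger0_real.
  rewrite sqrrB => /le_trans; apply.
  by rewrite lerD2r lerD2l lerN2 mulr2n mulrC.
have Sinf : has_inf S.
  split; first by exists (complex.Re (J 0)); exists 0.
  exists (complex.Re (- c ^+ 2)) => _ [u _ <-].
  by rewrite -lecR ReJ RRe_real ?Jge// rpredN realX// ger0_real.
have approx (e : Cx R) : 0 < e ->
    exists u, forall w, `|'[w, u] - f w| <= e * `|w|.
  move=> e0.
  have ee : ((complex.Re (e ^+ 2))%:C)%C = e ^+ 2.
    by rewrite RRe_real// realX// gtr0_real.
  have e2 : 0 < complex.Re (e ^+ 2) by rewrite -ltcR ee exprn_gt0.
  have [_ [u _ <-] uS] := inf_adherent e2 Sinf.
  exists u => w.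
  have Jmin v : J u <= J v + e ^+ 2.
    rewrite -[J u]ReJ -[J v]ReJ -ee -raddfD lecR; apply: (le_trans (ltW uS)).
    by rewrite lerD2r; apply: ge_inf; [case: Sinf | exists v].
  have [->|w0] := eqVneq w 0.
    by rewrite linear0l f0 subrr !normr0 mulr0.
  have [d dE] : exists d : Cx R, '[w, u] = d + f w.
    by exists ('[w, u] - f w); rewrite subrK.
  rewrite dE addrK.
  have wp : 0 < `|w| ^+ 2 by rewrite exprn_gt0 ?normr_gt0.

  have [s sN] : exists s : Cx R, s * `|w| ^+ 2 = 1.
    by exists (`|w| ^+ 2)^-1; rewrite mulVf// gt_eqF.
  have s0 : 0 < s by rewrite -(pmulr_lgt0 _ wp) sN.
  have sr : s^* = s by apply: conj_Creal; rewrite gtr0_real.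
  have := Jmin (u + (- (d^* * s)) *: w).
  rewrite /J [`|u + _| ^+ 2]sqr_normE dnormD dnormZ -!sqr_normE.
  rewrite fD fZ linearZr_LR /= normCK !rmorphD !rmorphN !rmorphM /= !conjCK.
  rewrite rmorphN rmorphM /= conjCK sr -(innerC w u) (innerC u w) dE rmorphD /=.
  rewrite !(rmorphN, rmorphM) /= conjCK sr.
  rewrite -subr_ge0.
  set X := (X in 0 <= X).
  have -> : X = e ^+ 2 - s * (d * d^*).
    transitivity (e ^+ 2 + s * (d * d^*) * (s * `|w| ^+ 2 - 2)); last first.
      by rewrite sN; ring.
    by rewrite /X; ring.
  rewrite subr_ge0 -normCK => h.
  rewrite -(ler_pXn2r (n := 2))// ?nnegrE ?mulr_ge0 ?(ltW e0)//.
  rewrite exprMn -[leLHS]mul1r -sN mulrAC.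
  by rewrite ler_wpM2r ?(ltW wp).
pose A (e : Cx R) := [set u | forall w, `|'[w, u] - f w| <= e * `|w|].
pose F := filter_from [set e : Cx R | 0 < e] A.
have FF : ProperFilter F.
  apply: filter_from_proper => [|e /approx //].
  apply: filter_from_filter; first by exists 1 => /=.
  move=> e1 e2 /= p1 p2; exists (Order.min e1 e2).
    by rewrite /= /Order.min; case: ifP.
  have cmp : (e1 >=< e2)%O by rewrite real_comparable ?gtr0_real.
  move=> u uA; split=> w; apply: (le_trans (uA w)); rewrite ler_wpM2r//.
    by rewrite comparable_ge_min// lexx.
  by rewrite comparable_ge_min// lexx orbT.
have close e1 e2 u v : A e1 u -> A e2 v ->
    forall w, `|'[w, u - v]| <= (e1 + e2) * `|w|.
  move=> Au Av w; rewrite linearBr /= mulrDl.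
  have -> : '[w, u] - '[w, v] = ('[w, u] - f w) - ('[w, v] - f w).
    by rewrite opprB addrA subrK.
  by apply: (le_trans (ler_normB _ _)); rewrite lerD ?Au ?Av.
have norm_le (u : H) k : 0 <= k -> (forall w, `|'[w, u]| <= k * `|w|) ->
    `|u| <= k.
  move=> k0 h; have [->|u0] := eqVneq u 0; first by rewrite normr0.
  have up : 0 < `|u| by rewrite normr_gt0.
  by have := h u; rewrite -sqr_normE ger0_norm ?exprn_ge0// expr2 ler_pM2r.
have Fc : cauchy F.
  apply: cauchy_exP => e e0; rewrite /fmapE.
  have e3 : 0 < e / 3 by rewrite divr_gt0.
  have [u Au] := approx _ e3; exists u; exists (e / 3) => //= v Av.
  rewrite -ball_normE /=.
  apply: (@le_lt_trans _ _ (e / 3 + e / 3)).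
    by apply: norm_le; [rewrite addr_ge0 ?ltW | exact: close].
  by rewrite [ltRHS](_ : e = e / 3 + e / 3 + e / 3) ?ltrDl//; field.
have /cvg_ex[v Fv] : cvg F by exact: cauchy_cvg.
exists v => w; apply/eqP; rewrite -subr_eq0 -normr_le0.
apply/ler_addgt0Pl => e e0; rewrite addr0.
have n0 : 0 < 2 * `|w| + 1 by rewrite ltr_wpDl ?mulr_ge0.
pose k := e / (2 * `|w| + 1); have k0 : 0 < k by rewrite divr_gt0.
have Fk : F (A k `&` ball v k).
  by apply: filterI; [exists k | apply: Fv; exact: nbhsx_ballx].
have [u [Au]] := filter_ex Fk; rewrite -ball_normE /= => uv.
have -> : f w - '[w, v] = '[w, u - v] - ('[w, u] - f w).
  by rewrite linearBr /=; ring.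
apply: (le_trans (ler_normB _ _)).
apply: (@le_trans _ _ (`|w| * k + k * `|w|)).
  apply: lerD (Au w); apply: (le_trans (cauchy_schwarz _ _)).
  by rewrite ler_wpM2l// distrC ltW.
have -> : `|w| * k + k * `|w| = (2 * `|w|) * k by ring.
rewrite /k mulrA ler_pdivrMr// mulrC ler_wpM2l ?(ltW e0)//.
by rewrite lerDl.
Qed.

Lemma bounded_continuous (f : H -> H) (c : Cx R) : linear f -> 0 <= c ->
  (forall u, `|f u| <= c * `|u|) -> continuous f.
Proof.
move=> fl c0 fc.
pose g : {linear H -> H} := HB.pack f (GRing.isLinear.Build _ _ _ *:%R f fl).
suff : continuous g by [].
apply: bounded_linear_continuous; apply/linear_boundedP.
exists c; split; first exact: ger0_real.
by move=> r cr u; apply: (le_trans (fc u)); rewrite ler_wpM2r// ltW.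
Qed.

Lemma bop_bounded (x : bop H) : exists2 c : Cx R, 0 < c &
  forall u, `|x u| <= c * `|u|.
Proof.
have /continuous_linear_bounded/linear_boundedP/pinfty_ex_gt0 [c c0 h] :
  {for 0, continuous x} by exact: bop_cont.
by exists c.
Qed.

End HilbertSpaces.

Section VonNeumannAlgebras.
Variables (R : realType) (H : hilbertType R).
Implicit Types (x y z : bop H) (M S : set (bop H)).

Definition adj x : bop H :=
  xget 0 [set y : bop H | forall u v, '[x u, v] = '[u, y v]].

Lemma adjP (x : bop H) u v : '[x u, v] = '[u, adj x v].
Proof.
suff [y yP] : exists y : bop H, forall u v, '[x u, v] = '[u, y v].
  exact: (@xgetPex _ 0 [set y : bop H | forall u v, '[x u, v] = '[u, y v]]
    (ex_intro _ y yP)).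
have [c c0 xc] := bop_bounded x.
have /choice[y yP] w : exists v, forall u, '[x u, w] = '[u, v].
  apply: (@riesz R H (fun u => '[x u, w]) (c * `|w|)).
  - by move=> a u1 u2; rewrite !linearP linearPl.
  - by rewrite mulr_ge0 // ltW.
  - move=> u1; apply: (le_trans (cauchy_schwarz _ _)).
    by rewrite mulrAC ler_wpM2r.
have yl : linear y.
  move=> a u1 u2; apply: inner_eqr => w.
  by rewrite -yP !linearPr /= !yP.
have yc : continuous y.
  apply: (@bounded_continuous R H y c) => // [|w]; first exact: ltW.
  have [->|yw] := eqVneq (y w) 0.
    by rewrite normr0 mulr_ge0// ltW.
  have yp : 0 < `|y w| by rewrite normr_gt0.
  rewrite -(ler_pM2l yp) -expr2 sqr_normE -yP -[leLHS]ger0_norm; last first.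
    by rewrite yP dnorm_ge0.
  apply: (le_trans (cauchy_schwarz _ _)).
  by rewrite mulrCA mulrA ler_wpM2r.
by exists (Bop yl yc).
Qed.

Definition pos_op x := forall u, 0 <= '[x u, u].
Definition le_op x y := pos_op (y - x).

Definition commutant S : set (bop H) :=
  [set y | forall x, S x -> x * y = y * x].

Record vnAlgebra := VnAlgebra {
  vn_set :> set (bop H);
  vn_adj : forall x, vn_set x -> vn_set (adj x);
  vn_bicommutant : commutant (commutant vn_set) = vn_set }.

Record vnFactor := VnFactor {
  factor_vn :> vnAlgebra;
  factor_center : forall x, vn_set factor_vn x -> commutant factor_vn x ->
    exists c : Cx R, x = c *: (1 : bop H) }.

(* the elements of the predual M_*, i.e. the sigma-weakly continuous
   functionals; only the values of [rho] on [M] are constrained *)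
Definition predual M (rho : bop H -> Cx R) :=
  exists u v : nat -> H,
    [/\ cvgn (series (fun n => `|u n| ^+ 2)),
        cvgn (series (fun n => `|v n| ^+ 2))
      & forall x, M x -> series (fun n => '[x (u n), v n]) @ \oo --> rho x].

Record normal_unital_endo M (theta : bop H -> bop H) : Prop := {
  endo_stable : forall x, M x -> M (theta x);
  endo_linear : forall (c : Cx R) x y, M x -> M y ->
    theta (c *: x + y) = c *: theta x + theta y;
  endo_mul : forall x y, M x -> M y -> theta (x * y) = theta x * theta y;
  endo_adj : forall x, M x -> theta (adj x) = adj (theta x);
  endo_one : theta 1 = 1;
  endo_normal : forall rho, predual M rho -> predual M (rho \o theta) }.

(* the values of [alpha t] for [t < 0] are irrelevant *)
Record e0_semigroup M (alpha : R -> bop H -> bop H) : Prop := {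
  e0_endo : forall t, 0 <= t -> normal_unital_endo M (alpha t);
  e0_zero : forall x, M x -> alpha 0 x = x;
  e0_add : forall s t x, 0 <= s -> 0 <= t -> M x ->
    alpha s (alpha t x) = alpha (s + t) x;
  e0_cont : forall rho x, predual M rho -> M x ->
    {within [set t : R | 0 <= t], continuous (fun t => rho (alpha t x))} }.

(* the left ideal n_phi; a weight is only evaluated at positive elements *)
Definition left_ideal M (phi : bop H -> \bar R) : set (bop H) :=
  [set x | M x /\ (phi (adj x * x)%R < +oo)%E].

Definition pos_part M : set (bop H) := [set x | M x /\ pos_op x].

(* Normality is preservation of suprema of bounded increasing families;
   semifiniteness is sigma-weak density of n_phi in M. *)
Record fns_weight M (phi : bop H -> \bar R) : Prop := {
  weight_ge0 : forall x, pos_part M x -> (0 <= phi x)%E;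
  weight_add : forall x y, pos_part M x -> pos_part M y ->
    phi (x + y) = (phi x + phi y)%E;
  weight_scale : forall (a : R) x, 0 <= a -> pos_part M x ->
    phi ((a%:C)%C *: x) = (a%:E * phi x)%E;
  weight_faithful : forall x, pos_part M x -> phi x = 0%E -> x = 0;
  weight_normal : forall (D : set (bop H)) x,
    D `<=` pos_part M -> D !=set0 ->
    (forall a b, D a -> D b -> exists c, [/\ D c, le_op a c & le_op b c]) ->
    pos_part M x -> (forall d, D d -> le_op d x) ->
    (forall y, pos_part M y -> (forall d, D d -> le_op d y) -> le_op x y) ->
    phi x = ereal_sup (phi @` D);
  weight_semifinite : forall x, M x ->
    forall (n : nat) (rho : 'I_n -> bop H -> Cx R),
    (forall i, predual M (rho i)) -> forall e : R, 0 < e ->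
    exists2 y, left_ideal M phi y
      & forall i, `|rho i x - rho i y| < (e%:C)%C }.

End VonNeumannAlgebras.

Section FullAlgebra.
Variables (R : realType) (H : hilbertType R).

Lemma setT_bicommutant : commutant (commutant setT) = setT :> set (bop H).
Proof. by apply/seteqP; split => // x _ y yT; rewrite (yT x). Qed.

Definition fullvn : vnAlgebra H :=
  @VnAlgebra R H setT (fun=> fun=> I) setT_bicommutant.

Lemma fullvn_center (x : bop H) : vn_set fullvn x -> commutant fullvn x ->
  exists c : Cx R, x = c *: (1 : bop H).
Proof.
move=> _ xC.
have [[w w0]|H0] := pselect (exists w : H, w != 0); last first.
  exists 0; apply: bopP => u; rewrite /= scale0r; apply/eqP.
  by apply: contrapT => /negP xu; apply: H0; exists (x u).
have ww : '[w, w] != 0 by rewrite dnorm_eq0.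
exists ('[x w, w] / '[w, w]); apply: bopP => u /=.
pose f v := '[v, w] *: u.
have fl : linear f by move=> a v1 v2; rewrite /f linearPl scalerDl scalerA.
have fc : continuous f.
  apply: (@bounded_continuous R H f (`|w| * `|u|)) => // v.
  by rewrite normrZ mulrAC ler_wpM2r// mulrC cauchy_schwarz.
have /(congr1 (fun y : bop H => y w)) := xC (Bop fl fc) I.
rewrite /= /f linearZ /= => h.
by apply: (scalerI ww); rewrite -h scalerA mulrC divfK.
Qed.

Definition Bfactor : vnFactor H := @VnFactor R H fullvn fullvn_center.

End FullAlgebra.

Section ModularTheory.
Variables (R : realType).

(* [pi] and [Lam] are the GNS representation and the GNS map n_phi -> K;
   by polarization [gns_norm] says <Lam x, Lam y> = phi (y^* x) *)
Record gns (H : hilbertType R) (M : set (bop H)) (phi : bop H -> \bar R)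
    (K : hilbertType R) (pi : bop H -> bop K) (Lam : bop H -> K) : Prop := {
  gns_linear : forall (c : Cx R) x y,
    left_ideal M phi x -> left_ideal M phi y ->
    Lam (c *: x + y) = c *: Lam x + Lam y;
  gns_norm : forall x, left_ideal M phi x ->
    `|Lam x| ^+ 2 = ((fine (phi (adj x * x)))%:C)%C;
  gns_dense : dense (Lam @` left_ideal M phi);
  gns_rep : forall x y, M x -> left_ideal M phi y ->
    pi x (Lam y) = Lam (x * y) }.

(* graph of Lam x |-> Lam (x^* ), x in n_phi and n_phi^*; its closure is
   Tomita's operator S *)
Definition tomita_graph (H : hilbertType R) (M : set (bop H))
    (phi : bop H -> \bar R) (K : hilbertType R) (Lam : bop H -> K) :
    set (K * K) :=
  [set p | exists x, [/\ left_ideal M phi x, left_ideal M phi (adj x)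
    & p = (Lam x, Lam (adj x))]].

(* [G] is the graph of a densely defined positive self-adjoint operator *)
Record positive_selfadjoint (K : hilbertType R) (G : set (K * K)) : Prop := {
  psa_fun : forall u v w, G (u, v) -> G (u, w) -> v = w;
  psa_linear : forall (c : Cx R) u u' v v', G (u, u') -> G (v, v') ->
    G (c *: u + v, c *: u' + v');
  psa_dense : dense [set u | exists u', G (u, u')];
  psa_adj : forall v w,
    G (v, w) <-> forall u u', G (u, u') -> '[u', v] = '[u, w];
  psa_pos : forall u u', G (u, u') -> 0 <= '[u', u] }.

Record antiunitary (K : hilbertType R) (J : K -> K) : Prop := {
  antiunitary_linear : forall (c : Cx R) u v,
    J (c *: u + v) = c^* *: J u + J v;
  antiunitary_inner : forall u v, '[J u, J v] = '[v, u];
  antiunitary_surj : forall v, exists u, J u = v }.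

(* polar decomposition S = J Delta^(1/2), with [P] the graph of Delta^(1/2) *)
Definition modular_conjugation (H : hilbertType R) (M : set (bop H))
    (phi : bop H -> \bar R) (K : hilbertType R) (Lam : bop H -> K)
    (J : K -> K) :=
  antiunitary J /\
  exists2 P : set (K * K), positive_selfadjoint P
    & closure (tomita_graph M phi Lam) = [set (p.1, J p.2) | p in P].

(* a faithful normal semifinite weight with its GNS space, representation
   and map, and its modular conjugation *)
Record modular_data (H : hilbertType R) (M : vnFactor H) := ModularData {
  md_weight : bop H -> \bar R;
  md_space : hilbertType R;
  md_rep : bop H -> bop md_space;
  md_map : bop H -> md_space;
  md_J : md_space -> md_space;
  md_fns : fns_weight M md_weight;
  md_gns : gns M md_weight md_rep md_map;
  md_conj : modular_conjugation M md_weight md_map md_J }.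

(* [thetat (x y') = theta x (J theta (J y' J) J)] for x in M, y' in M',
   where M is identified with its image under [md_rep D]: the element
   J y' J of M is [z] *)
Definition modular_extension (H : hilbertType R) (M : vnFactor H)
    (D : modular_data M) (theta : bop H -> bop H)
    (thetat : bop (md_space D) -> bop (md_space D)) :=
  let pi := @md_rep _ _ D in let J := @md_J _ _ D in
  normal_unital_endo setT thetat /\
  forall x z (y' : bop (md_space D)), vn_set M x -> vn_set M z ->
    commutant (pi @` vn_set M) y' -> (forall u, pi z u = J (y' (J u))) ->
    forall u, thetat (pi x * y') u = pi (theta x) (J (pi (theta z) (J u))).

Definition modularly_extendable_endo (H : hilbertType R) (M : vnFactor H)
    (theta : bop H -> bop H) :=
  exists (D : modular_data M) thetat, @modular_extension H M D theta thetat.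

Definition modularly_extendable (H : hilbertType R) (M : vnFactor H)
    (alpha : R -> bop H -> bop H) :=
  forall t, 0 <= t -> modularly_extendable_endo M (alpha t).

End ModularTheory.

Section Types.
Variables (R : realType).

Section ArvesonPowers.
Variables (K : hilbertType R) (sigma : R -> bop K -> bop K).

Definition intertwiners (t : R) : set (bop K) :=
  [set T | forall x, sigma t x * T = T * x].

Record is_unit (T : R -> bop K) : Prop := {
  unit_zero : T 0 = 1;
  unit_add : forall s t, 0 <= s -> 0 <= t -> T (s + t) = T s * T t;
  unit_cont : forall u : K,
    {within [set t : R | 0 <= t], continuous (fun t => T t u)};
  unit_intertw : forall t, 0 <= t -> intertwiners t (T t) }.

Definition unit_products (t : R) : set (bop K) :=
  [set S | exists (n : nat) (T : 'I_n -> R -> bop K) (s : 'I_n -> R),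
    [/\ forall i, is_unit (T i), forall i, 0 <= s i, \sum_i s i = t
      & S = \prod_i T i (s i)]].

Definition linear_span (A : set (bop K)) : set (bop K) :=
  [set S | exists (n : nat) (c : 'I_n -> Cx R) (B : 'I_n -> bop K),
    (forall i, A (B i)) /\ S = \sum_i c i *: B i].

(* closure in operator norm *)
Definition norm_closure (A : set (bop K)) : set (bop K) :=
  [set T | forall e : R, 0 < e ->
    exists2 S, A S & forall u, `|T u - S u| <= (e%:C)%C * `|u|].

Definition has_units := exists T, is_unit T.

Definition type_I := has_units /\ forall t, 0 < t ->
  intertwiners t = norm_closure (linear_span (unit_products t)).
Definition type_II := has_units /\ ~ type_I.
Definition type_III := ~ has_units.

End ArvesonPowers.

(* [P] holds of the modular extension of [alpha] with respect to some weight;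
   [P] is meant to be conjugacy-invariant, so that the weight is immaterial *)
Definition on_modular_extension
    (P : forall K : hilbertType R, (R -> bop K -> bop K) -> Prop)
    (H : hilbertType R) (M : vnFactor H) (alpha : R -> bop H -> bop H) :=
  exists (D : modular_data M) (sigma : R -> bop (md_space D) -> bop (md_space D)),
    [/\ e0_semigroup setT sigma,
        forall t, 0 <= t -> @modular_extension R H M D (alpha t) (sigma t)
      & P (md_space D) sigma].

Definition type_EI := on_modular_extension type_I.
Definition type_EII := on_modular_extension type_II.
Definition type_EIII := on_modular_extension type_III.

End Types.

(* Main.v *)
(* In standard form, B(H) acts on the space K of Hilbert-Schmidt operators, which
   is the tensor product of H with its conjugate: with [tau u v] = |u><v|, B(H)
   acts by [tau u v |-> tau (x u) v] and the modular conjugation is the flip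
   [tau u v |-> tau v u]. For the trace this is immediate. For an arbitrary
   weight phi, the brackets [Lam (|u><v|)] give a tensor structure on the GNS
   space once rescaled by the density of phi, and the polar decomposition of
   Tomita's operator is compared with the flip through uniqueness of positive
   square roots. The modular extension of alpha is therefore always the
   semigroup sigma with [sigma_t (x (x) y) = alpha_t x (x) alpha_t y] (the tensor
   square of alpha with its conjugate). It exists because alpha_t is implemented
   by an orthogonal family V_i of intertwining isometries, hence sigma_t by the
   V_i (x) V_j.

   It remains to compare the types of sigma and alpha. If S and T are units of
   alpha then [S_t (x) T_t] is a unit of sigma. Conversely let U be a unit of
   sigma. As Hilbert-Schmidt operators the vectors k_t = U_t k_0 have Schatten
   norms that are multiplicative in t, and an inequality between the 2-, 4- and
   8-norms at time t / n forces, as n goes to infinity, k_t to have rank one.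
   Hence [U_t = A_t (x) B_t] with A and B semigroups up to phases, and the phases
   can be removed by choosing compatible square roots along dyadic times. So all
   units of sigma are tensor products of units, from which the equivalence of the
   types follows. *)
Require Import Defs.
From HB Require Import structures.
From mathcomp Require Import all_boot all_order all_algebra.
From mathcomp Require Import boolp classical_sets functions cardinality reals.
From mathcomp Require Import ereal topology normedtype sequences.
From mathcomp Require Import complex sesquilinear ring lra.

Set Implicit Arguments.
Unset Strict Implicit.
Unset Printing Implicit Defensive.
Import Order.TTheory GRing.Theory Num.Theory.
Import numFieldNormedType.Exports.
Local Open Scope classical_set_scope.
Local Open Scope ring_scope.

(** * Real norms and inner products *)

(** The types EI, EII and EIII only ask for some weight. So one direction of each equivalence must
    handle an arbitrary weight, while the trace is enough for the other; for the trace the space [K]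
    can be taken to be [H] itself. The density [h] of a weight may be unbounded. It is never formed:
    it is replaced by [a = (1 + h)^-1], which comes from Riesz representation for the closed form of
    [1 + h], and by [s = h^(1/2) a], the square root of [a - a^2]. Both are bounded, positive and
    injective, and they commute. The tensor structure is then forced by
    [tau u (s v) = Lam |u><a v|], and Tomita's operator is explicit on the range of [a (x) s]. For
    units the obstacle is that the two factors of [U_t] are found separately for each [t], up to
    scalars without any regularity in [t]. Slicing the second leg of [U_t] gives a continuous
    representative of the first factor near time 0, multiplicative up to a scalar cocycle that tends
    to 1 at the origin. Estimates near 1 then replace measurability arguments. *)

Section RealNorm.
Variable R : realType.

(** The norm takes values in [Cx R], whose order is only partial; its real part lives in [R], where
    the order is total and [lra] and [nra] apply. *)
Definition rnorm (V : normedModType (Cx R)) (u : V) : R := complex.Re `|u|.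

Section Generic.
Variable V : normedModType (Cx R).
Implicit Types u v w : V.

Lemma rnormE u : `|u| = ((rnorm u)%:C)%C.
Proof. by rewrite /rnorm RRe_real // normr_real. Qed.

Lemma rnorm_ge0 u : 0 <= rnorm u.
Proof. by rewrite -ler0c -rnormE. Qed.

Lemma rnorm0 : rnorm (0 : V) = 0.
Proof. by rewrite /rnorm normr0. Qed.

Lemma rnorm_eq0 u : (rnorm u == 0) = (u == 0).
Proof.
rewrite -(normr_eq0 u) rnormE; apply/eqP/eqP => [->//|h].
exact: (@complexI R _ 0).
Qed.

Lemma rnorm0_eq0 u : rnorm u = 0 -> u = 0.
Proof. by move/eqP; rewrite rnorm_eq0 => /eqP. Qed.

Lemma rnorm_gt0 u : (0 < rnorm u) = (u != 0).
Proof. by rewrite lt_neqAle rnorm_ge0 andbT eq_sym rnorm_eq0. Qed.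

Lemma rnormN u : rnorm (- u) = rnorm u.
Proof. by rewrite /rnorm normrN. Qed.

Lemma rnormBC u v : rnorm (u - v) = rnorm (v - u).
Proof. by rewrite /rnorm distrC. Qed.

Lemma rnormD u v : rnorm (u + v) <= rnorm u + rnorm v.
Proof. by rewrite -lecR rmorphD /= -!rnormE ler_normD. Qed.

Lemma rnormB u v : rnorm (u - v) <= rnorm u + rnorm v.
Proof. by rewrite -[rnorm v]rnormN rnormD. Qed.

Lemma rnorm_tri w u v : rnorm (u - v) <= rnorm (u - w) + rnorm (w - v).
Proof. by rewrite -[u - v](subrKA w) rnormD. Qed.

Lemma rnormZ (c : Cx R) u : rnorm (c *: u) = rnorm (c : Cx R) * rnorm u.
Proof.
by apply: (@complexI R); rewrite rmorphM /= -!rnormE normrZ.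
Qed.

Lemma cvg_rnorm {T} {F : set_system T} {FF : Filter F} (f : T -> V) l :
  f @ F --> l <-> forall e : R, 0 < e -> \forall x \near F, rnorm (l - f x) < e.
Proof.
split=> [/cvgrPdist_lt h e e0|h].
  have e0' : 0 < (e%:C)%C by rewrite ltcR.
  have := h _ e0'; apply: filterS => x.
  by rewrite rnormE ltcR.
apply/cvgrPdist_lt => e e0.
have er : ((complex.Re e)%:C)%C = e by rewrite RRe_real// gtr0_real.
have := h (complex.Re e); rewrite -ltcR er => /(_ e0).
by apply: filterS => x; rewrite -ltcR er -rnormE.
Qed.

Lemma cvg_rnormn (f : nat -> V) l :
  f @ \oo --> l <-> forall e : R, 0 < e ->
    exists N, forall n, (N <= n)%N -> rnorm (l - f n) < e.
Proof.
rewrite cvg_rnorm; split=> h e /h; first by case=> N _ NP; exists N.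
by case=> N NP; exists N.
Qed.

Lemma cvg_rnorm_le {T} {F : set_system T} {FF : ProperFilter F} (f : T -> V) l
    (C : R) : f @ F --> l -> (\forall x \near F, rnorm (f x) <= C) ->
  rnorm l <= C.
Proof.
move=> /cvg_rnorm fl fC; apply/ler_addgt0Pr => e e0.
near F => x.
rewrite -[l](subrK (f x)); apply: (le_trans (rnormD _ _)).
rewrite addrC lerD //; first by near: x.
by apply: ltW; near: x; exact: fl.
Unshelve. all: by end_near. Qed.

Lemma rnorm_cvg_unique {T} {F : set_system T} {FF : ProperFilter F} (f : T -> V)
    (l m : V) : f @ F --> l -> f @ F --> m -> l = m.
Proof.
move=> fl fm; rewrite -(cvg_lim _ fl); last exact: norm_hausdorff.
by rewrite -(cvg_lim _ fm)//; exact: norm_hausdorff.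
Qed.

Lemma cvg_sum {T} {F : set_system T} {FF : Filter F} n (f : nat -> T -> V)
    (l : nat -> V) : (forall i, (i < n)%N -> f i @ F --> l i) ->
  (fun x => \sum_(0 <= i < n) f i x) @ F --> \sum_(0 <= i < n) l i.
Proof.
elim: n => [|n IH] h.
  rewrite big_geq//; under eq_fun do rewrite big_geq//; exact: cvg_cst.
rewrite big_nat_recr//=; under eq_fun do rewrite big_nat_recr//=.
by apply: cvgD; [apply: IH => i /ltnW; exact: h | exact: h].
Qed.

Lemma cvg0_rnorm_le {T} {F : set_system T} {FF : Filter F} (f : T -> V) (g : T -> R) l :
  (\forall x \near F, rnorm (l - f x) <= g x) -> g @ F --> 0 -> f @ F --> l.
Proof.
move=> fg /cvgrPdist_lt g0; apply/cvg_rnorm => e /g0 ge.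
near=> x; apply: le_lt_trans (_ : g x < e); first by near: x.
have : `|0 - g x| < e by near: x.
by rewrite sub0r normrN; apply: le_lt_trans; exact: ler_norm.
Unshelve. all: by end_near. Qed.

Lemma ler_dist_rnorm u v : `|rnorm u - rnorm v| <= rnorm (u - v).
Proof.
have h (a b : V) : rnorm a - rnorm b <= rnorm (a - b).
  by rewrite lerBlDr; have := rnormD (a - b) b; rewrite subrK.
by rewrite ler_norml h andbT lerNl opprB rnormBC h.
Qed.

Lemma cvg_rnormr {T} {F : set_system T} {FF : Filter F} (f : T -> V) l :
  f @ F --> l -> (fun x => rnorm (f x)) @ F --> rnorm l.
Proof.
move=> /cvg_rnorm fl; apply/cvgrPdist_lt => e /fl; apply: filterS => x.
by apply: le_lt_trans; exact: ler_dist_rnorm.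
Qed.

End Generic.

Lemma rnormC_real (x : R) : rnorm ((x%:C)%C : Cx R) = `|x|.
Proof.
apply: (@complexI R); rewrite -rnormE.
by rewrite normc_def /= expr0n addr0 sqrtr_sqr.
Qed.

Lemma rnormM (a b : Cx R) : rnorm (a * b) = rnorm a * rnorm b.
Proof. by rewrite -rnormZ. Qed.

Lemma crnorm0_eq0 (a : Cx R) : rnorm a = 0 -> a = 0.
Proof. exact: rnorm0_eq0. Qed.

Lemma rnorm1 : rnorm (1 : Cx R) = 1.
Proof. by rewrite /rnorm normr1. Qed.

Lemma rnorm_conj (a : Cx R) : rnorm (a^* : Cx R) = rnorm a.
Proof. by rewrite /rnorm norm_conjC. Qed.

Lemma ReC (x : R) : complex.Re ((x%:C)%C : Cx R) = x.
Proof. by []. Qed.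

Lemma norm_Re_le (a : Cx R) : `|complex.Re a| <= rnorm a.
Proof. by rewrite -lecR -rnormE; exact: normc_ge_Re. Qed.

Lemma ler_Re_rnorm (a : Cx R) : complex.Re a <= rnorm a.
Proof. exact: le_trans (ler_norm _) (norm_Re_le _). Qed.

Lemma ge0_Re (a : Cx R) : 0 <= a -> 0 <= complex.Re a.
Proof. by rewrite lecE => /andP[]. Qed.

Lemma ge0_ReE (a : Cx R) : 0 <= a -> a = ((complex.Re a)%:C)%C.
Proof. by move=> a0; rewrite RRe_real// ger0_real. Qed.

Lemma Re_sum I (r : seq I) (P : pred I) (F : I -> Cx R) :
  complex.Re (\sum_(i <- r | P i) F i) = \sum_(i <- r | P i) complex.Re (F i).
Proof. by elim/big_rec2: _ => // i y1 y2 _ <-; case: (F i) y2 => ? ? []. Qed.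

Lemma ReD (a b : Cx R) : complex.Re (a + b) = complex.Re a + complex.Re b.
Proof. by case: a b => ? ? []. Qed.

Lemma ReN (a : Cx R) : complex.Re (- a) = - complex.Re a.
Proof. by case: a. Qed.

Lemma ReMr (a : R) (b : Cx R) : complex.Re ((a%:C)%C * b) = a * complex.Re b.
Proof. by case: b => x y /=; rewrite mul0r subr0. Qed.

End RealNorm.

Section InnerLemmas.
Variables (R : realType) (H : hilbertType R).
Implicit Types (u v w : H) (c : Cx R).

Lemma innerDl u v w : '[u + v, w] = '[u, w] + '[v, w].
Proof. exact: linearDl. Qed.
Lemma innerDr u v w : '[w, u + v] = '[w, u] + '[w, v].
Proof. exact: linearDr. Qed.
Lemma innerBl u v w : '[u - v, w] = '[u, w] - '[v, w].
Proof. exact: linearBl. Qed.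
Lemma innerBr u v w : '[w, u - v] = '[w, u] - '[w, v].
Proof. exact: linearBr. Qed.
Lemma innerNl u w : '[- u, w] = - '[u, w].
Proof. exact: linearNl. Qed.
Lemma innerNr u w : '[w, - u] = - '[w, u].
Proof. exact: linearNr. Qed.
Lemma inner0l w : '[0, w] = 0.
Proof. exact: linear0l. Qed.
Lemma inner0r w : '[w, 0] = 0.
Proof. exact: linear0r. Qed.
Lemma innerZl c u w : '[c *: u, w] = c * '[u, w].
Proof. by rewrite linearZl_LR. Qed.
Lemma innerZr c u w : '[w, c *: u] = c^* * '[w, u].
Proof. by rewrite linearZr_LR. Qed.
Lemma inner_suml I (r : seq I) (P : pred I) (F : I -> H) w :
  '[\sum_(i <- r | P i) F i, w] = \sum_(i <- r | P i) '[F i, w].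
Proof. by elim/big_rec2: _ => [|i y1 y2 _ <-]; rewrite ?inner0l ?innerDl. Qed.
Lemma inner_sumr I (r : seq I) (P : pred I) (F : I -> H) w :
  '[w, \sum_(i <- r | P i) F i] = \sum_(i <- r | P i) '[w, F i].
Proof. by elim/big_rec2: _ => [|i y1 y2 _ <-]; rewrite ?inner0r ?innerDr. Qed.

Lemma inner_ge0 u : 0 <= '[u, u].
Proof. exact: dnorm_ge0. Qed.

Lemma inner_eq0 u : ('[u, u] == 0) = (u == 0).
Proof. by rewrite dnorm_eq0. Qed.

Lemma inner_rnorm u : '[u, u] = ((rnorm u ^+ 2)%:C)%C.
Proof. by rewrite -sqr_normE rnormE rmorphXn. Qed.

Lemma rnorm_inner u : rnorm u ^+ 2 = complex.Re '[u, u].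
Proof. by rewrite inner_rnorm. Qed.

Lemma inner_eql v w : (forall u, '[v, u] = '[w, u]) -> v = w.
Proof.
by move=> vw; apply: inner_eqr => u; rewrite innerC vw -innerC.
Qed.

Lemma inner_eq0l v : (forall u, '[v, u] = 0) -> v = 0.
Proof. by move=> h; apply: inner_eql => u; rewrite h inner0l. Qed.

Lemma rnorm_cs u v : rnorm ('[u, v] : Cx R) <= rnorm u * rnorm v.
Proof. by rewrite -lecR rmorphM /= -!rnormE cauchy_schwarz. Qed.

Lemma rnormDsqr u v : '[u, v] = 0 ->
  rnorm (u + v) ^+ 2 = rnorm u ^+ 2 + rnorm v ^+ 2.
Proof.
move=> uv; rewrite !rnorm_inner innerDl !innerDr uv (innerC v u) uv.
by rewrite conjC0 addr0 add0r ReD.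
Qed.

Lemma rnorm_sum_sqr n (f : nat -> H) m :
  (forall i j, i != j -> '[f i, f j] = 0) ->
  rnorm (\sum_(m <= i < n) f i) ^+ 2 = \sum_(m <= i < n) rnorm (f i) ^+ 2.
Proof.
move=> fo; elim: n => [|n IH]; first by rewrite !big_geq// rnorm0 expr0n.
have [mn|nm] := leqP m n; last by rewrite !big_geq// rnorm0 expr0n.
rewrite !big_nat_recr//= rnormDsqr ?IH//.
rewrite inner_suml big_nat big1// => i /andP[_ iN].
by apply: fo; rewrite ltn_eqF.
Qed.

Lemma cvg_innerl {T} {F : set_system T} {FF : Filter F} (f : T -> H) l w :
  f @ F --> l -> (fun x => '[f x, w] : Cx R) @ F --> ('[l, w] : Cx R).
Proof.
move=> /cvg_rnorm fl; apply/cvg_rnorm => e e0.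
have w0 : 0 < rnorm w + 1 by rewrite ltr_wpDl ?rnorm_ge0.
have := fl (e / (rnorm w + 1)) (divr_gt0 e0 w0); apply: filterS => x.
rewrite ltr_pdivlMr// -innerBl; apply: le_lt_trans.
apply: le_trans (rnorm_cs _ _) _.
by rewrite ler_wpM2l ?rnorm_ge0 ?lerDl.
Qed.

Lemma cvg_innerr {T} {F : set_system T} {FF : Filter F} (f : T -> H) l w :
  f @ F --> l -> (fun x => '[w, f x] : Cx R) @ F --> ('[w, l] : Cx R).
Proof.
move=> fl; have /cvg_rnorm h := @cvg_innerl T F FF f l w fl; apply/cvg_rnorm => e /h.
apply: filterS => x; rewrite -innerBl -innerBr -rnorm_conj -innerC.
by [].
Qed.

Lemma cvg_inner {T} {F : set_system T} {FF : ProperFilter F} (f g : T -> H) l m :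
  f @ F --> l -> g @ F --> m ->
  (fun x => '[f x, g x] : Cx R) @ F --> ('[l, m] : Cx R).
Proof.
move=> fl gm.
have -> : (fun x => '[f x, g x]) = (fun x => '[f x - l, g x - m] + '[l, g x - m]) \+ (fun x => '[f x, m]).
  by apply/funext => x /=; rewrite -innerDl subrK innerBr subrK.
rewrite -['[l, m]]add0r; apply: cvgD; last exact: cvg_innerl.
rewrite -[0 : Cx R]addr0; apply: cvgD; last first.
  rewrite -(inner0r l) -(subrr m); apply: cvg_innerr; apply: cvgB => //.
  exact: cvg_cst.
have f0 : (fun x => f x - l) @ F --> (0 : H).
  by rewrite -(subrr l); apply: cvgB => //; exact: cvg_cst.
have g0 : (fun x => g x - m) @ F --> (0 : H).
  by rewrite -(subrr m); apply: cvgB => //; exact: cvg_cst.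
apply/cvg_rnorm => e e0.
have := (@cvg_rnorm _ _ T F FF _ _).1 f0 _ e0.
have := (@cvg_rnorm _ _ T F FF _ _).1 g0 _ ltr01.
apply: filterS2 => x; rewrite !sub0r !rnormN => h1 h2.
apply: le_lt_trans (rnorm_cs _ _) _.
rewrite -[e]mulr1; apply: ltr_pM => //; exact: rnorm_ge0.
Qed.

Lemma complete_rnorm (f : nat -> H) :
  (forall e : R, 0 < e -> exists N, forall m n, (N <= m)%N -> (N <= n)%N ->
     rnorm (f m - f n) < e) -> exists l : H, f @ \oo --> l.
Proof.
move=> h; apply/cvg_ex; apply: cauchy_cvg; apply: cauchy_exP => e e0.
have er : ((complex.Re e)%:C)%C = e by rewrite RRe_real// gtr0_real.
have := h (complex.Re e); rewrite -ltcR er => /(_ e0)[N NP].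
exists (f N); exists N => // n /= Nn.
by rewrite -ball_normE /= rnormE -er ltcR NP.
Qed.

(** By Pythagoras the squared norm of a block of the series is a block of a bounded increasing real
    sequence, so the partial sums are Cauchy. *)
Lemma orth_series_cvg (f : nat -> H) (B : R) :
  (forall i j, i != j -> '[f i, f j] = 0) ->
  (forall n, \sum_(0 <= i < n) rnorm (f i) ^+ 2 <= B) ->
  exists l : H, series f @ \oo --> l.
Proof.
move=> fo fB; apply: complete_rnorm => e e0.
pose s n := \sum_(0 <= i < n) rnorm (f i) ^+ 2.
have sc : cvgn s.
  apply: nondecreasing_is_cvgn.
    apply/nondecreasing_seqP => n.
    by rewrite /s big_nat_recr//= lerDl sqr_ge0.
  by exists B => _ [n _ <-]; exact: fB.
have /cauchy_cvgP/cauchy_ballP/(_ (e ^+ 2)) : cvg (s @ \oo) by [].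
case; first by rewrite exprn_gt0.
move=> [A1 A2] /= [[N1 _ N1P] [N2 _ N2P]] AB.
exists (maxn N1 N2).
suff W m n : (maxn N1 N2 <= m)%N -> (m <= n)%N ->
    rnorm (series f n - series f m) < e.
  move=> m n hm hn; have [mn|nm] := leqP m n; last exact/W/ltnW.
  by rewrite rnormBC; exact: W.
move=> hm mn; rewrite /series/= (big_cat_nat (n := m))//= [_ + _ - _]addrAC subrr add0r.
rewrite -(ltr_pXn2r (n := 2))// ?nnegrE ?rnorm_ge0 ?(ltW e0)// rnorm_sum_sqr//.
have /AB /= : (A1 `*` A2) (s m, s n).
  split; [apply: N1P => /= | apply: N2P => /=].
    by apply: leq_trans hm; exact: leq_maxl.
  by apply: leq_trans mn; apply: leq_trans hm; exact: leq_maxr.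
rewrite -ball_normE /= distrC /s (big_cat_nat (n := m) (p := n))//= addrAC subrr add0r.
by apply: le_lt_trans; exact: ler_norm.
Qed.

End InnerLemmas.

(** * Bounded operators *)

Section OperatorBasics.
Variables (R : realType) (H : hilbertType R).
Implicit Types (x y z : bop H) (u v w : H) (c : Cx R).

Lemma bopDE x y u : (x + y) u = x u + y u. Proof. by []. Qed.
Lemma bopNE x u : (- x) u = - x u. Proof. by []. Qed.
Lemma bopBE x y u : (x - y) u = x u - y u. Proof. by []. Qed.
Lemma bopZE c x u : (c *: x) u = c *: x u. Proof. by []. Qed.
Lemma bopME x y u : (x * y) u = x (y u). Proof. by []. Qed.
Lemma bop1E u : (1 : bop H) u = u. Proof. by []. Qed.
Lemma bop0E u : (0 : bop H) u = 0. Proof. by []. Qed.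

Lemma bop_linD x u v : x (u + v) = x u + x v. Proof. exact: linearD. Qed.
Lemma bop_linB x u v : x (u - v) = x u - x v. Proof. exact: linearB. Qed.
Lemma bop_linZ x c u : x (c *: u) = c *: x u. Proof. exact: linearZ. Qed.
Lemma bop_lin0 x : x 0 = 0. Proof. exact: linear0. Qed.
Lemma bop_lin_sum I (r : seq I) (P : pred I) (F : I -> H) x :
  x (\sum_(i <- r | P i) F i) = \sum_(i <- r | P i) x (F i).
Proof. exact: linear_sum. Qed.

Lemma bop_sumE I (r : seq I) (P : pred I) (F : I -> bop H) u :
  (\sum_(i <- r | P i) F i) u = \sum_(i <- r | P i) F i u.
Proof. by elim/big_rec2: _ => // i y1 y2 _ <-. Qed.

Lemma bopZAl c x y : (c *: x) * y = c *: (x * y).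
Proof. exact: bopP. Qed.

Lemma bopZAr c x y : x * (c *: y) = c *: (x * y).
Proof. by apply: bopP => u /=; rewrite linearZ. Qed.

Lemma bop_rbound x : exists2 C : R, 0 < C & forall u, rnorm (x u) <= C * rnorm u.
Proof.
have [c c0 h] := bop_bounded x; have cr := ge0_ReE (ltW c0).
exists (complex.Re c) => [|u]; first by rewrite -ltcR -cr.
by rewrite -lecR rmorphM /= -!rnormE -cr.
Qed.

Lemma bop_of_rbound (f : H -> H) (C : R) : linear f ->
  (forall u, rnorm (f u) <= C * rnorm u) -> exists x : bop H, forall u, x u = f u.
Proof.
move=> fl fC.
have fc : continuous f.
  apply: (@bounded_continuous _ _ f ((Num.max C 0)%:C)%C) => // [|u].
    by rewrite ler0c le_max lexx orbT.
  rewrite !rnormE -rmorphM /= lecR; apply: le_trans (fC u) _.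
  by rewrite ler_wpM2r ?rnorm_ge0// le_max lexx.
by exists (Bop fl fc).
Qed.

Lemma cvg_bop {T} {F : set_system T} {FF : Filter F} x (f : T -> H) l :
  f @ F --> l -> (fun t => x (f t)) @ F --> x l.
Proof.
move=> fl; apply: (@cvg_comp _ _ _ f x F (nbhs l)) => //.
exact: bop_cont.
Qed.

Lemma adj_unique x y : (forall u v, '[x u, v] = '[u, y v]) -> adj x = y.
Proof. by move=> h; apply: bopP => v; apply: inner_eqr => u; rewrite -adjP h. Qed.

Lemma adjPr x u v : '[u, x v] = '[adj x u, v].
Proof. by rewrite innerC adjP -innerC. Qed.

Lemma adjK x : adj (adj x) = x.
Proof. by apply: adj_unique => u v; rewrite -adjPr. Qed.

Lemma adjM x y : adj (x * y) = adj y * adj x.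
Proof. by apply: adj_unique => u v /=; rewrite !adjP. Qed.

Lemma adjD x y : adj (x + y) = adj x + adj y.
Proof. by apply: adj_unique => u v /=; rewrite innerDl innerDr !adjP. Qed.

Lemma adjZ c x : adj (c *: x) = c^* *: adj x.
Proof. by apply: adj_unique => u v /=; rewrite innerZl innerZr conjCK adjP. Qed.

Lemma adjN x : adj (- x) = - adj x.
Proof. by apply: adj_unique => u v /=; rewrite innerNl innerNr adjP. Qed.

Lemma adjB x y : adj (x - y) = adj x - adj y.
Proof. by rewrite adjD adjN. Qed.

Lemma adj1 : adj (1 : bop H) = 1. Proof. by apply: adj_unique. Qed.

Lemma adj0 : adj (0 : bop H) = 0.
Proof. by apply: adj_unique => u v; rewrite /= inner0l inner0r. Qed.

Fact rk1_lin u v : linear (fun w : H => '[w, v] *: u).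
Proof. by move=> a x y; rewrite innerDl innerZl scalerDl scalerA. Qed.

Fact rk1_cont u v : continuous (fun w : H => '[w, v] *: u).
Proof.
apply: (@bounded_continuous _ _ _ (`|v| * `|u|)) => [||w].
- exact: rk1_lin.
- exact: mulr_ge0.
- by rewrite normrZ mulrAC ler_wpM2r// mulrC cauchy_schwarz.
Qed.

Definition rk1 u v : bop H := Bop (@rk1_lin u v) (@rk1_cont u v).

Lemma rk1E u v w : rk1 u v w = '[w, v] *: u. Proof. by []. Qed.

Lemma adj_rk1 u v : adj (rk1 u v) = rk1 v u.
Proof.
apply: adj_unique => a b; rewrite !rk1E innerZl innerZr mulrC -innerC.
by [].
Qed.

Lemma mul_rk1 x u v : x * rk1 u v = rk1 (x u) v.
Proof. by apply: bopP => w /=; rewrite linearZ. Qed.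

Lemma rk1_mul x u v : rk1 u v * x = rk1 u (adj x v).
Proof. by apply: bopP => w /=; rewrite -adjP. Qed.

Lemma rk1M u v u' v' : rk1 u v * rk1 u' v' = '[u', v] *: rk1 u v'.
Proof. by apply: bopP => w /=; rewrite innerZl mulrC scalerA. Qed.

Lemma rk1Dl u u' v : rk1 (u + u') v = rk1 u v + rk1 u' v.
Proof. by apply: bopP => w /=; rewrite scalerDr. Qed.

Lemma rk1Zl c u v : rk1 (c *: u) v = c *: rk1 u v.
Proof. by apply: bopP => w /=; rewrite !scalerA mulrC. Qed.

Lemma rk1Dr u v v' : rk1 u (v + v') = rk1 u v + rk1 u v'.
Proof. by apply: bopP => w /=; rewrite innerDr scalerDl. Qed.

Lemma rk1Zr c u v : rk1 u (c *: v) = c^* *: rk1 u v.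
Proof. by apply: bopP => w /=; rewrite innerZr scalerA. Qed.

Lemma rk1_bound u v w : rnorm (rk1 u v w) <= rnorm u * rnorm v * rnorm w.
Proof.
rewrite rk1E rnormZ mulrC -mulrA ler_wpM2l ?rnorm_ge0// mulrC; exact: rnorm_cs.
Qed.

(** Complex polarization: [u + v] gives the sum of the two cross terms, [u + 'i *: v] their
    difference. *)
Lemma bop_eq0_diag x : (forall u, '[x u, u] = 0) -> x = 0.
Proof.
move=> h; apply: bopP => u; apply: inner_eql => v; rewrite inner0l.
have e1 : '[x u, v] + '[x v, u] = 0.
  have := h (u + v); rewrite bop_linD innerDl !innerDr !h.
  by rewrite add0r addr0.
have e2 : '[x u, v] - '[x v, u] = 0.
  have := h (u + 'i *: v); rewrite bop_linD bop_linZ innerDl !innerDr !h.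
  rewrite !innerZl !innerZr h conjCi !mulr0 addr0 add0r => /eqP.
  by rewrite mulNr addrC -mulrBr mulf_eq0 (negbTE (neq0Ci _)) /= subr_eq0 => /eqP ->; rewrite subrr.
have : '[x u, v] *+ 2 = 0 by rewrite mulr2n -[in RHS](addr0 0) -{1}e1 -e2; ring.
by move/eqP; rewrite mulrn_eq0 => /eqP.
Qed.

Lemma bop_eq_diag x y : (forall u, '[x u, u] = '[y u, u]) -> x = y.
Proof.
move=> h; apply/eqP; rewrite -subr_eq0; apply/eqP; apply: bop_eq0_diag => u.
by rewrite bopBE innerBl h subrr.
Qed.

Lemma pos_op_adj x : pos_op x -> adj x = x.
Proof.
move=> xp; apply: bop_eq_diag => u.
by rewrite -adjPr innerC; apply: conj_Creal; rewrite ger0_real.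
Qed.

Lemma pos_opD x y : pos_op x -> pos_op y -> pos_op (x + y).
Proof. by move=> xp yp u; rewrite bopDE innerDl addr_ge0. Qed.

Lemma pos_opZ (a : R) x : 0 <= a -> pos_op x -> pos_op ((a%:C)%C *: x).
Proof. by move=> a0 xp u; rewrite bopZE innerZl mulr_ge0 // ler0c. Qed.

Lemma pos_op1 : pos_op (1 : bop H).
Proof. by move=> u; exact: inner_ge0. Qed.

Lemma pos_op0 : pos_op (0 : bop H).
Proof. by move=> u; rewrite bop0E inner0l. Qed.

Lemma pos_adjM x : pos_op (adj x * x).
Proof. by move=> u; rewrite bopME -adjPr inner_ge0. Qed.

Lemma pos_rk1 u : pos_op (rk1 u u).
Proof. by move=> v; rewrite rk1E innerZl (innerC u) mul_conjC_ge0. Qed.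

Lemma pos_conj x y : pos_op x -> pos_op (adj y * x * y).
Proof. by move=> xp u; rewrite !bopME -adjPr. Qed.

End OperatorBasics.
Arguments cvg_bop {R H T F FF} x {f l}.

(** * Semidefinite Hermitian forms on a subspace, Riesz representation *)

Section Forms.
Variables (R : realType) (V : lmodType (Cx R)).
Variables (G : set V) (B : V -> V -> Cx R).
Hypothesis G0 : G 0.
Hypothesis GP : forall c u v, G u -> G v -> G (c *: u + v).
Hypothesis BP : forall c u v w, G u -> G v -> G w ->
  B (c *: u + v) w = c * B u w + B v w.
Hypothesis BC : forall u v, G u -> G v -> B v u = (B u v)^*.
Hypothesis B0 : forall u, G u -> 0 <= B u u.

Let q u : R := complex.Re (B u u).

Let qE u : G u -> B u u = ((q u)%:C)%C.
Proof. by move=> Gu; apply: ge0_ReE; exact: B0. Qed.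

Let BPr c u v w : G u -> G v -> G w -> B w (c *: u + v) = c^* * B w u + B w v.
Proof.
by move=> Gu Gv Gw; rewrite (BC (GP c Gu Gv) Gw) (BP c Gu Gv Gw) rmorphD rmorphM /= -(BC Gu Gw) -(BC Gv Gw).
Qed.

Let q_expand c u v : G u -> G v ->
  q (c *: u + v) = rnorm c ^+ 2 * q u + 2 * complex.Re (c * B u v) + q v.
Proof.
have Gw := GP c; move=> Gu Gv; rewrite {1}/q (BP c Gu Gv (Gw _ _ Gu Gv)) !BPr// (BC Gu Gv).
have -> : c * (c^* * B u u + B u v) + (c^* * (B u v)^* + B v v) =
  (c * c^*) * B u u + (c * B u v + (c * B u v)^*) + B v v.
  by rewrite rmorphM /=; ring.
have -> : c * c^* = (((rnorm c) ^+ 2)%:C)%C by rewrite -normCK rnormE rmorphXn.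
rewrite qE // [B v v]qE// -rmorphM !ReD /=; congr (_ + _ + _).
by rewrite mulr2n mulrDl mul1r; congr (_ + _); case: (c * B u v).
Qed.

(** Positivity at [- s b^* u + v] is a quadratic inequality in the real number [s]. Taking
    [s = 1 / q u] gives the bound; if [q u = 0], a large [s] forces [b = 0]. *)
Lemma form_cs u v : G u -> G v -> rnorm (B u v) ^+ 2 <= q u * q v.
Proof.
move=> Gu Gv; set b := B u v.
have qu0 : 0 <= q u by apply: ge0_Re; exact: B0.
have qv0 : 0 <= q v by apply: ge0_Re; exact: B0.
have h (s : R) : 0 <= s ^+ 2 * rnorm b ^+ 2 * q u - 2 * s * rnorm b ^+ 2 + q v.
  have : 0 <= q ((- (s%:C)%C * b^*) *: u + v) by apply/ge0_Re/B0; exact: GP.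
  rewrite q_expand// -/b rnormM rnormN rnorm_conj rnormC_real exprMn real_normK ?num_real//.
  have -> : - (s%:C)%C * b^* * b = ((- (s * rnorm b ^+ 2))%:C)%C.
    rewrite -mulrA [b^* * b]mulrC -normCK rnormE rmorphN rmorphM rmorphXn /=.
    by rewrite mulNr.
  by rewrite ReC; lra.
have [qu|qu] := eqVneq (q u) 0.
  have [->|b0] := eqVneq (rnorm b) 0; first by rewrite expr0n mulr_ge0.
  have b2 : 0 < rnorm b ^+ 2 by rewrite exprn_even_gt0.
  have := h ((q v + 1) / rnorm b ^+ 2); rewrite qu mulr0 add0r.
  rewrite mulrA mulfVK ?gt_eqF// => hh; exfalso; lra.
have qup : 0 < q u by rewrite lt_neqAle eq_sym qu.
have := h (q u)^-1; rewrite -(pmulr_rge0 _ qup).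
have -> : q u * (((q u)^-1) ^+ 2 * rnorm b ^+ 2 * q u - 2 * (q u)^-1 * rnorm b ^+ 2 + q v)
   = q u * q v - rnorm b ^+ 2 by field.
by rewrite subr_ge0.
Qed.

Hypothesis Bcomplete : forall u_ : nat -> V, (forall n, G (u_ n)) ->
  (forall e : R, 0 < e -> exists N, forall m n, (N <= m)%N -> (N <= n)%N ->
     q (u_ m - u_ n) < e) ->
  exists2 l, G l & forall e : R, 0 < e -> exists N, forall n, (N <= n)%N ->
     q (u_ n - l) < e.

(** The representing vector minimizes [q u - 2 Re (f u)]. The form lives on a subspace [G] complete
    for the form norm, because it is applied to the form of a weight, whose domain need not be
    closed in [H]. *)
Lemma form_riesz (f : V -> Cx R) (C : R) : 0 <= C ->
  (forall c u v, G u -> G v -> f (c *: u + v) = c * f u + f v) ->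
  (forall u, G u -> rnorm (f u) ^+ 2 <= C * q u) ->
  exists2 v, G v & forall u, G u -> f u = B u v.
Proof.
move=> C0 fl fC.
pose J u := q u - 2 * complex.Re (f u).
have q0 u : G u -> 0 <= q u by move=> Gu; apply: ge0_Re; exact: B0.
have GB u v : G u -> G v -> G (u - v).
  by move=> Gu Gv; rewrite addrC -scaleN1r; apply: GP.
have GZ c u : G u -> G (c *: u).
  by move=> Gu; rewrite -[c *: u]addr0; apply: GP.
have f0 : f 0 = 0.
  by have := fl (-1) 0 0 G0 G0; rewrite scaler0 addr0 mulN1r addNr.
have fZ c u : G u -> f (c *: u) = c * f u.
  by move=> Gu; have := fl c u 0 Gu G0; rewrite f0 !addr0.
have BBr w u v : G w -> G u -> G v -> B w (u - v) = B w u - B w v.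
  move=> Gw Gu Gv; rewrite -[u - v]addrC -scaleN1r BPr// rmorphN rmorph1 mulN1r.
  by rewrite addrC.
have BZ c u w : G u -> G w -> B (c *: u) w = c * B u w.
  move=> Gu Gw; have B0w : B 0 w = 0.
    by have := BP (-1) G0 G0 Gw; rewrite scaler0 addr0 mulN1r addNr.
  by have := BP c Gu G0 Gw; rewrite !addr0 B0w addr0.
have Jge u : G u -> - C <= J u.
  move=> Gu; have r : complex.Re (f u) ^+ 2 <= C * q u.
    apply: le_trans (fC u Gu); have := norm_Re_le (f u).
    by rewrite -ler_sqr ?nnegrE ?rnorm_ge0// real_normK ?num_real.
  rewrite /J; have := q0 u Gu => qu; move: r; set a := complex.Re _ => r.
  rewrite lerBrDl addrC -lerBrDl opprK; apply: le_trans (ler_norm _) _.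
  rewrite -(ler_pXn2r (n := 2))// ?nnegrE ?addr_ge0// real_normK ?num_real//.
  rewrite exprMn -subr_ge0; have := sqr_ge0 (q u - C); lra.
pose S := [set J u | u in G].
have Sinf : has_inf S.
  split; first by exists (J 0); exists 0.
  by exists (- C) => _ [u Gu <-]; exact: Jge.
pose d := inf S.
have dJ u : G u -> d <= J u by move=> Gu; apply: ge_inf; [case: Sinf | exists u].
have /choice[u_ uP] (n : nat) : exists u, G u /\ J u < d + n.+1%:R^-1.
  have n0 : 0 < n.+1%:R^-1 :> R by rewrite invr_gt0.
  by have [_ [u Gu <-] uS] := inf_adherent n0 Sinf; exists u.
have Jexp c w u : G w -> G u ->
    J (c *: w + u) = J u + rnorm c ^+ 2 * q w + 2 * complex.Re (c * (B w u - f w)).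
  move=> Gw Gu; rewrite /J q_expand// fl// mulrBr !ReD ReN; ring.
(* A minimizer up to [e] satisfies the Euler equation [B w u = f w] up to the square root of
   [e * q w]. *)
have near_opt u w (e : R) : G u -> G w -> J u <= d + e ->
    rnorm (B w u - f w) ^+ 2 <= e * q w.
  move=> Gu Gw Ju; set b := B w u - f w.
  have h (s : R) : 0 <= s ^+ 2 * rnorm b ^+ 2 * q w - 2 * s * rnorm b ^+ 2 + e.
    have := dJ _ (GP (- (s%:C)%C * b^*) Gw Gu); rewrite Jexp// -/b.
    rewrite rnormM rnormN rnorm_conj rnormC_real exprMn real_normK ?num_real//.
    have -> : - (s%:C)%C * b^* * b = ((- (s * rnorm b ^+ 2))%:C)%C.
      rewrite -mulrA [b^* * b]mulrC -normCK rnormE rmorphN rmorphM rmorphXn /=.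
      by rewrite mulNr.
    by rewrite ReC mulrN mulrA; lra.
  have [qw|qw] := eqVneq (q w) 0.
    have [->|b0] := eqVneq (rnorm b) 0; first by rewrite expr0n qw mulr0.
    have b2 : 0 < rnorm b ^+ 2 by rewrite exprn_even_gt0.
    have := h ((e + 1) / rnorm b ^+ 2); rewrite qw mulr0 add0r.
    have := h 0; rewrite expr0n /= !mul0r mulr0 mul0r subrr add0r => e0.
    rewrite mulrA mulfVK ?gt_eqF// => hh; exfalso; lra.
  have qwp : 0 < q w by rewrite lt_neqAle eq_sym qw q0.
  have := h (q w)^-1; rewrite -(pmulr_rge0 _ qwp).
  have -> : q w * (((q w)^-1) ^+ 2 * rnorm b ^+ 2 * q w - 2 * (q w)^-1 * rnorm b ^+ 2 + e)
     = e * q w - rnorm b ^+ 2 by field.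
  by rewrite subr_ge0.
have nE n : J (u_ n) <= d + n.+1%:R^-1 by apply: ltW; have [] := uP n.
have Gu_ n : G (u_ n) by have [] := uP n.
(* Two approximate Euler equations, subtracted and tested on [w = u_ m - u_ n] itself, bound
   [q w ^+ 2] by a multiple of [q w]. *)
have qdiff m n : q (u_ m - u_ n) <= 4 * (m.+1%:R^-1 + n.+1%:R^-1).
  set w := u_ m - u_ n; have Gw : G w by exact: GB.
  have h1 := near_opt _ _ _ (Gu_ m) Gw (nE m).
  have h2 := near_opt _ _ _ (Gu_ n) Gw (nE n).
  have wE : B w w = (B w (u_ m) - f w) - (B w (u_ n) - f w).
    rewrite opprB addrA subrK -BBr//.
  have qw : rnorm (B w w) = q w by rewrite qE// rnormC_real ger0_norm ?q0.
  have h3 : q w ^+ 2 <= 4 * (m.+1%:R^-1 + n.+1%:R^-1) * q w.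
    rewrite -qw {1}wE.
    have t : rnorm ((B w (u_ m) - f w) - (B w (u_ n) - f w)) <= rnorm (B w (u_ m) - f w) + rnorm (B w (u_ n) - f w) by exact: rnormB.
    have : rnorm ((B w (u_ m) - f w) - (B w (u_ n) - f w)) ^+ 2 <= (rnorm (B w (u_ m) - f w) + rnorm (B w (u_ n) - f w)) ^+ 2.
      by rewrite ler_sqr ?nnegrE ?addr_ge0 ?rnorm_ge0.
    move: h1 h2; rewrite qw.
    set a := rnorm (B w (u_ m) - f w); set b := rnorm (B w (u_ n) - f w) => h1 h2 h3.
    have i1 : 0 <= m.+1%:R^-1 * q w by rewrite mulr_ge0 ?q0 ?invr_ge0.
    have i2 : 0 <= n.+1%:R^-1 * q w by rewrite mulr_ge0 ?q0 ?invr_ge0.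
    apply: le_trans h3 _; have := sqr_ge0 (a - b); move: h1 h2 i1 i2.
    set M := m.+1%:R^-1; set N := n.+1%:R^-1; move: (q w) => Q h1 h2 i1 i2 h4.
    by nra.
  have [->|w0] := eqVneq (q w) 0.
    by rewrite mulr_ge0// addr_ge0// invr_ge0.
  have wp : 0 < q w by rewrite lt_neqAle eq_sym w0 q0.
  by rewrite -(ler_pM2r wp) -expr2.
have [l Gl lP] : exists2 l, G l & forall e : R, 0 < e -> exists N, forall n, (N <= n)%N ->
     q (u_ n - l) < e.
  apply: Bcomplete => // e e0.
  have e8 : 0 < e / 8 by rewrite divr_gt0.
  have [N _ NP] := near_infty_natSinv_lt (PosNum e8).
  exists N => m n Nm Nn; apply: le_lt_trans (qdiff m n) _.
  have := NP m Nm; have := NP n Nn => /=.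
  by set M := m.+1%:R^-1; set N' := n.+1%:R^-1; lra.
exists l => // u Gu; apply/eqP; rewrite -subr_eq0 -rnorm_eq0 -sqrf_eq0.
rewrite eq_le sqr_ge0 andbT; apply/ler_addgt0Pr => e e0; rewrite add0r.
have qp : 0 < 4 * (q u + 1) by rewrite mulr_gt0// ltr_wpDl// q0.
have e4 : 0 < e / (4 * (q u + 1)) by rewrite divr_gt0.
have [N1 _ N1P] := near_infty_natSinv_lt (PosNum e4).
have [N2 N2P] := lP _ e4.
pose n := maxn N1 N2.
have h1 := near_opt _ _ _ (Gu_ n) Gu (nE n).
have h2 := form_cs Gu (GB _ _ (Gu_ n) Gl).
have k1 := N1P n (leq_maxl _ _); have k2 := N2P n (leq_maxr _ _).
rewrite /= in k1.
have Bu : B u l = B u (u_ n) - B u (u_ n - l).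
  by rewrite BBr//; ring.
have -> : f u - B u l = - (B u (u_ n) - f u) + B u (u_ n - l) by rewrite Bu; ring.
have t := rnormD (- (B u (u_ n) - f u)) (B u (u_ n - l)).
rewrite rnormN in t.
have t2 : rnorm (- (B u (u_ n) - f u) + B u (u_ n - l)) ^+ 2 <= (rnorm (B u (u_ n) - f u) + rnorm (B u (u_ n - l))) ^+ 2.
  by rewrite ler_sqr ?nnegrE ?addr_ge0 ?rnorm_ge0.
apply: le_trans t2 _; move: h1 h2.
set a := rnorm (B u (u_ n) - f u); set b := rnorm (B u (u_ n - l)) => h1 h2.
have qu := q0 u Gu.
have eE : e = 4 * (e / (4 * (q u + 1)) * (q u + 1)) by field; rewrite gt_eqF// ltr_wpDl.
have := sqr_ge0 (a - b).
have j1 : n.+1%:R^-1 * q u <= e / (4 * (q u + 1)) * (q u + 1).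
  apply: ler_pM => //; rewrite ?invr_ge0// ?lerDl//; exact: ltW.
have j2 : q u * q (u_ n - l) <= e / (4 * (q u + 1)) * (q u + 1).
  rewrite mulrC; apply: ler_pM => //; rewrite ?lerDl//; last exact: ltW.
  by apply: q0; exact: GB.
move: h1 h2 j1 j2 eE; move: (n.+1%:R^-1 * q u) (q u * q (u_ n - l)) => P1 P2.
by move: (e / (4 * (q u + 1)) * (q u + 1)) => P3 h1 h2 j1 j2 eE h3; nra.
Qed.

End Forms.

(** * Density, orthogonality and extension by continuity *)

Section Projection.
Variables (R : realType) (H : hilbertType R).
Implicit Types (u v w : H) (c : Cx R).

Definition norm_dense (V : normedModType (Cx R)) (G : set V) :=
  forall h (e : R), 0 < e -> exists2 g, G g & rnorm (h - g) < e.

Lemma rnorm_small_eq0 (V : normedModType (Cx R)) (v : V) :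
  (forall e : R, 0 < e -> rnorm v < e) -> v = 0.
Proof.
move=> h; apply/eqP; rewrite -rnorm_eq0 eq_le rnorm_ge0 andbT.
by apply/ler_addgt0Pr => e /h /ltW; rewrite add0r.
Qed.

(** The closure [Gc] is complete, so [u |-> '[u, h]] is represented in it by some [v]. Then [h - v]
    is orthogonal to [G], hence [h = v] lies in the closure. *)
Lemma orth_norm_dense (G : set H) : G 0 ->
  (forall c u v, G u -> G v -> G (c *: u + v)) ->
  (forall v, (forall u, G u -> '[u, v] = 0) -> v = 0) -> norm_dense G.
Proof.
move=> G0 GP Gt h.
pose Gc := [set v : H | forall e : R, 0 < e -> exists2 g, G g & rnorm (v - g) < e].
have GGc u : G u -> Gc u by move=> Gu e e0; exists u => //; rewrite subrr rnorm0.
have GcP c u v : Gc u -> Gc v -> Gc (c *: u + v).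
  move=> Gu Gv e e0.
  have c1 : 0 < rnorm c + 1 by rewrite ltr_wpDl ?rnorm_ge0.
  have e1 : 0 < e / 2 / (rnorm c + 1) by rewrite !divr_gt0.
  have e2 : 0 < e / 2 by rewrite divr_gt0.
  have [g1 Gg1 h1] := Gu _ e1; have [g2 Gg2 h2] := Gv _ e2.
  exists (c *: g1 + g2); first exact: GP.
  have -> : c *: u + v - (c *: g1 + g2) = c *: (u - g1) + (v - g2).
    by rewrite scalerBr opprD addrACA.
  apply: le_lt_trans (rnormD _ _) _; rewrite rnormZ.
  have : rnorm c * rnorm (u - g1) <= e / 2.
    have -> : e / 2 = (rnorm c + 1) * (e / 2 / (rnorm c + 1)) by field; rewrite gt_eqF.
    by apply: ler_pM; rewrite ?rnorm_ge0 ?lerDl// ltW.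
  lra.
have [|||||||||v Gv vP] := @form_riesz R H Gc (fun u v => '[u, v]) _ _ _ _ _ _
   (fun u => '[u, h]) (rnorm h ^+ 2).
- exact: GGc.
- exact: GcP.
- by move=> c u v w _ _ _; rewrite innerDl innerZl.
- by move=> u v _ _; exact: innerC.
- by move=> u _; exact: inner_ge0.
- move=> u_ Gu_ uc; have [l ul] : exists l : H, u_ @ \oo --> l.
    apply: complete_rnorm => e e0.
    have [|N NP] := uc (e ^+ 2); first by rewrite exprn_gt0.
    exists N => m n mN nN; rewrite -(ltr_pXn2r (n := 2)) ?nnegrE ?rnorm_ge0 ?(ltW e0)//.
    by rewrite rnorm_inner NP.
  have {}ul e : 0 < e -> exists N, forall n, (N <= n)%N -> rnorm (l - u_ n) < e.
    exact: (cvg_rnormn _ _).1 ul e.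
  exists l.
    move=> e e0; have e2 : 0 < e / 2 by rewrite divr_gt0.
    have [N NP] := ul _ e2; have [g Gg gP] := Gu_ N _ e2.
    exists g => //; apply: le_lt_trans (rnorm_tri (u_ N) _ _) _.
    by have := NP N (leqnn _); lra.
  move=> e e0; have e1 : 0 < Num.min e 1 by rewrite lt_min e0 ltr01.
  have [N NP] := ul _ e1; exists N => n Nn.
  rewrite -rnorm_inner rnormBC; have := NP n Nn; rewrite lt_min => /andP[h1 h2].
  have := rnorm_ge0 (l - u_ n); move: h1 h2; set r := rnorm _ => h1 h2 h3.
  by apply: le_lt_trans h1; rewrite expr2 ler_piMl// ltW.
- by rewrite sqr_ge0.
- by move=> c u v _ _; rewrite innerDl innerZl.
- move=> u _; rewrite -rnorm_inner -exprMn ler_sqr ?nnegrE ?mulr_ge0 ?rnorm_ge0//.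
  by rewrite mulrC; exact: rnorm_cs.
have : h - v = 0.
  by apply: Gt => u Gu; rewrite innerBr (vP u (GGc u Gu)) subrr.
by move/eqP; rewrite subr_eq0 => /eqP ->; exact: Gv.
Qed.

Definition lspan (S : set H) : set H :=
  [set h | exists n (c : 'I_n -> Cx R) (s : 'I_n -> H),
     (forall i, S (s i)) /\ h = \sum_i c i *: s i].

Lemma lspan_incl (S : set H) s : S s -> lspan S s.
Proof.
move=> Ss; exists 1%N, (fun=> 1), (fun=> s); split=> //.
by rewrite big_ord_recl big_ord0 scale1r addr0.
Qed.

Lemma lspan0 (S : set H) : lspan S 0.
Proof. by exists 0%N, (fun=> 0), (fun=> 0); split=> [[]|]//; rewrite big_ord0. Qed.

Lemma lspanP (S : set H) c u v : lspan S u -> lspan S v -> lspan S (c *: u + v).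
Proof.
move=> [n [a [s [sS ->]]]] [m [b [t [tS ->]]]].
exists (n + m)%N, (fun i : 'I_(n + m) => match fintype.split i with inl j => c * a j | inr j => b j end),
  (fun i : 'I_(n + m) => match fintype.split i with inl j => s j | inr j => t j end); split.
  by move=> i; case: (fintype.split i).
rewrite big_split_ord /= scaler_sumr; congr (_ + _); apply: eq_bigr => i _.
  by rewrite (unsplitK (inl i)) scalerA.
by rewrite (unsplitK (inr i)).
Qed.

Lemma lspan_dense (S : set H) :
  (forall v, (forall u, S u -> '[u, v] = 0) -> v = 0) -> norm_dense (lspan S).
Proof.
move=> St; apply: orth_norm_dense => [|c u v|v h]; first exact: lspan0.
  exact: lspanP.
by apply: St => u Su; apply: h; exact: lspan_incl.
Qed.

Lemma lspan_ind (S : set H) (P : H -> Prop) : P 0 ->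
  (forall c u v, S u -> P v -> P (c *: u + v)) -> forall h, lspan S h -> P h.
Proof.
move=> P0 PS h [n [c [s [sS ->]]]]; elim/big_rec: _ => // i v _; exact: PS.
Qed.

Lemma range_dense (x : bop H) : (forall v, adj x v = 0 -> v = 0) ->
  norm_dense (range x).
Proof.
move=> xi; apply: orth_norm_dense.
- by exists 0 => //; rewrite bop_lin0.
- move=> c _ _ [u _ <-] [v _ <-]; exists (c *: u + v) => //.
  by rewrite bop_linD bop_linZ.
- move=> v h; apply: xi; apply: inner_eq0l => u.
  by rewrite -adjPr innerC h ?conjC0//; exists u.
Qed.

Lemma dense_cvg (V : normedModType (Cx R)) (G : set V) (h : V) : norm_dense G ->
  exists2 g_ : nat -> V, (forall n, G (g_ n)) & g_ @ \oo --> h.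
Proof.
move=> Gd.
have /choice[g_ gP] (n : nat) : exists g, G g /\ rnorm (h - g) < n.+1%:R^-1.
  have n0 : 0 < n.+1%:R^-1 :> R by rewrite invr_gt0.
  by have [g Gg gh] := Gd h _ n0; exists g.
exists g_ => [n|]; first by have [] := gP n.
apply/cvg_rnormn => e e0.
have [N _ NP] := near_infty_natSinv_lt (PosNum e0).
exists N => n Nn; have [_] := gP n; move/lt_trans; apply; exact: (NP n Nn).
Qed.

Lemma bop_eq_dense (G : set H) (x y : bop H) : norm_dense G ->
  (forall g, G g -> x g = y g) -> x = y.
Proof.
move=> Gd xy; apply: bopP => h; have [g_ Gg gh] := dense_cvg h Gd.
apply: (rnorm_cvg_unique (cvg_bop x gh)).
under eq_fun do rewrite xy//; exact: cvg_bop.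
Qed.

(** The data are indexed by [T] and not by points of the range of [s]: the Lipschitz bound itself
    makes [f] factor through [s]. *)
Lemma lip_extension (T : Type) (K : hilbertType R) (s : T -> H) (f : T -> K) (C : R) :
  0 < C -> norm_dense (range s) ->
  (forall a b, rnorm (f a - f b) <= C * rnorm (s a - s b)) ->
  exists F : H -> K, (forall a, F (s a) = f a) /\
    forall v v', rnorm (F v - F v') <= C * rnorm (v - v').
Proof.
move=> C0 sd fs.
have hasl v : exists l : K, forall e : R, 0 < e ->
    exists2 d : R, 0 < d & forall a, rnorm (v - s a) < d -> rnorm (l - f a) < e.
  have /choice[a_ aP] (n : nat) : exists a, rnorm (v - s a) < n.+1%:R^-1.
    have n0 : 0 < n.+1%:R^-1 :> R by rewrite invr_gt0.
    by have [_ [a _ <-] ah] := sd v _ n0; exists a.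
  have asm (e : R) : 0 < e -> exists N, forall n, (N <= n)%N -> rnorm (v - s (a_ n)) < e.
    move=> e0; have [N _ NP] := near_infty_natSinv_lt (PosNum e0).
    by exists N => n Nn; apply: lt_trans (aP n) _; exact: (NP n Nn).
  have [l fl] : exists l : K, (f \o a_) @ \oo --> l.
    apply: complete_rnorm => e e0.
    have e2 : 0 < e / C / 2 by rewrite !divr_gt0.
    have [N NP] := asm _ e2; exists N => m n mN nN /=.
    apply: le_lt_trans (fs _ _) _; rewrite mulrC -ltr_pdivlMr//.
    apply: le_lt_trans (rnorm_tri v _ _) _; rewrite rnormBC.
    have := NP m mN; have := NP n nN; lra.
  exists l => e e0; exists (e / C / 4) => [|a va]; first by rewrite !divr_gt0.
  have e4 : 0 < e / C / 4 by rewrite !divr_gt0.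
  have e2 : 0 < e / 2 by rewrite divr_gt0.
  have [N1 N1P] := asm _ e4; have [N2 N2P] := (cvg_rnormn _ _).1 fl _ e2.
  pose n := maxn N1 N2; have h1 := N1P n (leq_maxl _ _).
  have h2 := N2P n (leq_maxr _ _).
  apply: le_lt_trans (rnorm_tri (f (a_ n)) _ _) _.
  have h3 : rnorm (f (a_ n) - f a) <= e / 2.
    apply: le_trans (fs _ _) _; rewrite mulrC -ler_pdivlMr//.
    apply: le_trans (rnorm_tri v _ _) _; rewrite rnormBC; lra.
  by move: h2 h3 => /=; lra.
have /choice[F FP] := hasl; exists F; split => [a|v v'].
  apply/eqP; rewrite -subr_eq0; apply/eqP; apply: rnorm_small_eq0 => e e0.
  have [d d0] := FP (s a) e e0; apply; by rewrite subrr rnorm0.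
apply/ler_addgt0Pr => e e0.
have e4 : 0 < e / 4 by rewrite divr_gt0.
have eC : 0 < e / C / 4 by rewrite !divr_gt0.
have [d d0 dP] := FP v _ e4; have [d' d'0 d'P] := FP v' _ e4.
have m0 : 0 < Num.min d (e / C / 4) by rewrite lt_min d0.
have m'0 : 0 < Num.min d' (e / C / 4) by rewrite lt_min d'0.
have [_ [a _ <-]] := sd v _ m0; rewrite lt_min => /andP[a1 a2].
have [_ [b _ <-]] := sd v' _ m'0; rewrite lt_min => /andP[b1 b2].
have h1 := dP a a1; have h2 := d'P b b1; rewrite rnormBC in h2.
apply: le_trans (rnorm_tri (f a) _ _) _.
have t1 := rnorm_tri (f b) (f a) (F v').
have t2 := fs a b.
have t3 : rnorm (s a - s b) <= rnorm (v - v') + e / C / 4 + e / C / 4.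
  apply: le_trans (rnorm_tri v _ _) _; have := rnorm_tri v' v (s b).
  by rewrite [rnorm (s a - v)]rnormBC; lra.
have t4 : C * rnorm (s a - s b) <= C * rnorm (v - v') + e / 4 + e / 4.
  have -> : C * rnorm (v - v') + e / 4 + e / 4 = C * (rnorm (v - v') + e / C / 4 + e / C / 4).
    by field; rewrite gt_eqF.
  by rewrite ler_pM2l.
lra.
Qed.

End Projection.

(** * Positive operators and square roots *)

Section Positive.
Variables (R : realType) (H : hilbertType R).
Implicit Types (x y z p : bop H) (u v w : H) (c : Cx R).

Lemma pos_cs p u v : pos_op p ->
  rnorm ('[p u, v] : Cx R) ^+ 2 <= complex.Re '[p u, u] * complex.Re '[p v, v].
Proof.
move=> pp; apply: (@form_cs R H setT (fun u v => '[p u, v])) => //.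
- by move=> c a b w _ _ _; rewrite bop_linD bop_linZ innerDl innerZl.
- by move=> a b _ _; rewrite -[in LHS](pos_op_adj pp) -adjPr; exact: innerC.
Qed.

Lemma pos_eq0 p u : pos_op p -> '[p u, u] = 0 -> p u = 0.
Proof.
move=> pp pu; apply: inner_eq0l => v.
have := pos_cs u v pp; rewrite pu /= mul0r => h.
have h2 : rnorm ('[p u, v] : Cx R) ^+ 2 == 0 by rewrite eq_le h sqr_ge0.
by apply: crnorm0_eq0; apply/eqP; rewrite -sqrf_eq0.
Qed.

(** Cauchy-Schwarz for the form of [x] at [u] and [x u]; since [x <= 1], the diagonal values are at
    most the squared norms. *)
Lemma pos_contraction x : pos_op x -> pos_op (1 - x) ->
  forall u, rnorm (x u) <= rnorm u.
Proof.
move=> xp x1 u; have := pos_cs u (x u) xp.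
have le1 v : complex.Re '[x v, v] <= rnorm v ^+ 2.
  have /ge0_Re := x1 v; rewrite bopBE bop1E innerBl ReD ReN -rnorm_inner; lra.
have ge0 v : 0 <= complex.Re '[x v, v] by apply: ge0_Re.
have -> : rnorm ('[x u, x u] : Cx R) = rnorm (x u) ^+ 2.
  by rewrite inner_rnorm rnormC_real ger0_norm ?sqr_ge0.
move=> h; have [->|xu0] := eqVneq (rnorm (x u)) 0; first exact: rnorm_ge0.
have xup : 0 < rnorm (x u) by rewrite lt_neqAle eq_sym xu0 rnorm_ge0.
rewrite -(ler_pXn2r (n := 2))// ?nnegrE ?rnorm_ge0//.
have x2p : 0 < rnorm (x u) ^+ 2 by rewrite exprn_gt0.
rewrite -(ler_pM2r x2p) -expr2; apply: le_trans h _.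
by apply: ler_pM.
Qed.

Lemma pos_scale_le p : pos_op p ->
  exists2 C : R, 0 < C & pos_op (1 - ((C^-1)%:C)%C *: p).
Proof.
move=> pp; have [C C0 pC] := bop_rbound p; exists C => // u.
have pu : '[p u, u] = ((complex.Re '[p u, u])%:C)%C by exact: ge0_ReE.
rewrite bopBE bop1E bopZE innerBl innerZl inner_rnorm pu -rmorphM -rmorphB /= ler0c.
rewrite subr_ge0 mulrC ler_pdivrMr//; apply: le_trans (ler_Re_rnorm _) _.
apply: le_trans (rnorm_cs _ _) _.
by rewrite expr2 mulrC -mulrA ler_wpM2l ?rnorm_ge0// mulrC pC.
Qed.

(* [z] is a polynomial in [x] with nonnegative coefficients of sum [a] *)
Inductive npoly x : bop H -> R -> Prop :=
| npoly0 : npoly x 0 0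
| npolyS (c : R) z a : 0 <= c -> npoly x z a ->
    npoly x ((c%:C)%C *: (1 : bop H) + x * z) (c + a).

Lemma npoly_ge0 x z a : npoly x z a -> 0 <= a.
Proof. by elim=> // c {}z {}a c0 _ a0; rewrite addr_ge0. Qed.

Lemma npolyD x z a (w : bop H) b : npoly x z a -> npoly x w b -> npoly x (z + w) (a + b).
Proof.
move=> zp; elim: zp w b => [|c {}z {}a c0 _ IH] w b wp; first by rewrite !add0r.
case: wp => [|d {}w {}b d0 wp]; first by rewrite !addr0; apply: npolyS => //; have := IH 0 0 (npoly0 x); rewrite !addr0.
have -> : (c%:C)%C *: (1 : bop H) + x * z + ((d%:C)%C *: (1 : bop H) + x * w) = ((c + d)%:C)%C *: (1 : bop H) + x * (z + w).
  by rewrite rmorphD /= scalerDl mulrDr addrACA.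
have -> : c + a + (d + b) = (c + d) + (a + b) by rewrite addrACA.
by apply: npolyS; [rewrite addr_ge0 | exact: IH].
Qed.

Lemma npolyZ x z a (c : R) : 0 <= c -> npoly x z a ->
  npoly x ((c%:C)%C *: z) (c * a).
Proof.
move=> c0; elim=> [|d {}z {}a d0 _ IH]; first by rewrite scaler0 mulr0; exact: npoly0.
rewrite scalerDr scalerA -rmorphM /= -bopZAr mulrDr.
by apply: npolyS => //; exact: mulr_ge0.
Qed.

Lemma npolyX x z a : npoly x z a -> npoly x (x * z) a.
Proof.
by move=> /(npolyS (lexx 0)); rewrite rmorph0 scale0r !add0r.
Qed.

Lemma npolyM x z a (w : bop H) b : npoly x z a -> npoly x w b -> npoly x (z * w) (a * b).
Proof.
move=> zp; elim: zp w b => [|c {}z {}a c0 _ IH] w b wp.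
  by rewrite !mul0r; exact: npoly0.
rewrite mulrDl bopZAl mul1r -mulrA mulrDl.
by apply: npolyD; [exact: npolyZ | apply: npolyX; exact: IH].
Qed.

Lemma npoly1 x : npoly x x 1.
Proof.
have := npolyX (npolyS ler01 (npoly0 x)).
by rewrite rmorph1 scale1r mulr0 !addr0 mulr1.
Qed.

Lemma npoly_pos x z a : pos_op x -> npoly x z a -> pos_op z.
Proof.
move=> xp zp; suff : pos_op z /\ pos_op (x * z) by case.
elim: zp => [|c {}z {}a c0 _ [zp xzp]].
  by rewrite mulr0; split; exact: pos_op0.
split; first by apply: pos_opD => //; apply: pos_opZ => //; exact: pos_op1.
rewrite mulrDr bopZAr mulr1; apply: pos_opD; first exact: pos_opZ.
(* x z = z x since both sides are self-adjoint *)
have zx : x * z = z * x.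
  by rewrite -(pos_op_adj xzp) adjM (pos_op_adj zp) (pos_op_adj xp).
rewrite zx mulrA -{1}(pos_op_adj xp); exact: pos_conj.
Qed.

Lemma npoly_bound x z a : (forall u, rnorm (x u) <= rnorm u) -> npoly x z a ->
  forall u, rnorm (z u) <= a * rnorm u.
Proof.
move=> xc; elim=> [|c {}z {}a c0 _ IH] u; first by rewrite rnorm0 mul0r.
apply: le_trans (rnormD _ _) _; rewrite mulrDl lerD//.
  by rewrite bopZE bop1E rnormZ rnormC_real ger0_norm.
by apply: le_trans (xc _) _; exact: IH.
Qed.

Lemma npoly_comm x z a y : x * y = y * x -> npoly x z a -> z * y = y * z.
Proof.
move=> xy; elim=> [|c {}z {}a c0 _ IH]; first by rewrite mul0r mulr0.
by rewrite mulrDl mulrDr bopZAl bopZAr mul1r mulr1 -mulrA IH mulrA xy mulrA.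
Qed.

Lemma bop_limit (f : nat -> bop H) (C : R) :
  (forall n u, rnorm (f n u) <= C * rnorm u) ->
  (forall u, exists l : H, (fun n => f n u) @ \oo --> l) ->
  exists y : bop H, forall u, (fun n => f n u) @ \oo --> y u.
Proof.
move=> fC /choice[g gP].
have gl : linear g.
  move=> c u v; apply: (rnorm_cvg_unique (gP _)).
  have -> : (fun n => f n (c *: u + v)) = (fun n => c *: f n u + f n v).
    by apply/funext => n; rewrite bop_linD bop_linZ.
  by apply: cvgD => //; apply: cvgZr.
have gb u : rnorm (g u) <= C * rnorm u.
  by apply: (cvg_rnorm_le (gP u)); near=> n; exact: fC.
have [y yP] := bop_of_rbound gl gb.
by exists y => u; rewrite yP.
Unshelve. all: by end_near. Qed.

Lemma cvg_ge0 {T} {F : set_system T} {FF : ProperFilter F} (f : T -> Cx R) (l : Cx R) :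
  f @ F --> l -> (forall t, 0 <= f t) -> 0 <= l.
Proof.
move=> fl f0; have -> : l = ((rnorm l)%:C)%C; last by rewrite ler0c rnorm_ge0.
apply: (rnorm_cvg_unique (V := Cx R) fl).
rewrite [f](_ : _ = (fun t => ((rnorm (f t))%:C)%C)); last first.
  by apply/funext => t; rewrite -rnormE ger0_norm.
apply/cvg_rnorm => e e0; have /cvgrPdist_lt /(_ e e0) : (fun t => rnorm (f t)) @ F --> rnorm l by exact: (cvg_rnormr (V := Cx R)).
by apply: filterS => t; rewrite -rmorphB rnormC_real.
Qed.

Lemma bop_cvgM (C : R) (f g : nat -> bop H) (f' g' : bop H) u :
  (forall n u, rnorm (f n u) <= C * rnorm u) ->
  (forall u, (fun n => f n u) @ \oo --> f' u) ->
  (fun n => g n u) @ \oo --> g' u ->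
  (fun n => f n (g n u)) @ \oo --> f' (g' u).
Proof.
move=> fC fl gl.
have -> : (fun n => f n (g n u)) = (fun n => f n (g n u - g' u) + f n (g' u)).
  by apply/funext => n; rewrite bop_linB subrK.
rewrite -[f' (g' u)]add0r; apply: cvgD => //.
have h : (fun n => C * rnorm (g n u - g' u)) @ \oo --> C * rnorm (g' u - g' u).
  apply: cvgMr; apply: cvg_rnormr; apply: cvgB => //; exact: cvg_cst.
rewrite subrr rnorm0 mulr0 in h; apply: cvg0_rnorm_le h; near=> n.
by rewrite sub0r rnormN.
Unshelve. all: by end_near. Qed.

(* The iteration y_{n+1} = (x + y_n^2)/2 converges to 1 - (1 - x)^(1/2). *)
Lemma sqrt1_exists x : pos_op x -> pos_op (1 - x) ->
  exists y, [/\ pos_op y, pos_op (1 - y), (1 - y) * (1 - y) = 1 - x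
    & forall z, x * z = z * x -> y * z = z * y].
Proof.
move=> xp x1; have xc := pos_contraction xp x1.
pose h := ((2^-1 : R)%:C)%C.
pose y_ := fix y_ n : bop H := if n is n'.+1 then h *: (x + y_ n' * y_ n') else 0.
(* The same iteration with [x] replaced by the number 1. It computes the coefficient sum of [y_ n],
   so the increments of [y_] are dominated by those of a bounded increasing real sequence. *)
pose t_ := fix t_ n : R := if n is n'.+1 then 2^-1 * (1 + t_ n' * t_ n') else 0.
have h0 : 0 <= 2^-1 :> R by rewrite invr_ge0.
have yt n : npoly x (y_ n) (t_ n).
  elim: n => [|n IH] /=; first exact: npoly0.
  by apply: npolyZ => //; apply: npolyD; [exact: npoly1 | exact: npolyM].
have dyt n : npoly x (y_ n.+1 - y_ n) (t_ n.+1 - t_ n).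
  elim: n => [|n IH].
    rewrite /= !subr0 mulr0 addr0 mulr0 addr0; apply: npolyZ => //; exact: npoly1.
  set d := y_ n.+1 - y_ n in IH *; set s := t_ n.+1 - t_ n in IH *.
  (* The difference of two squares, written without subtraction in [d] and [y_ n], so that the
     coefficients stay nonnegative. *)
  have -> : y_ n.+2 - y_ n.+1 = h *: (d * d + d * y_ n + y_ n * d).
    have e : y_ n.+1 = d + y_ n by rewrite /d subrK.
    have -> : y_ n.+2 = h *: (x + y_ n.+1 * y_ n.+1) by [].
    rewrite [X in _ - X]/= -scalerBr opprD addrACA subrr add0r {1 2}e.
    by rewrite mulrDl !mulrDr !addrA addrK.
  have -> : t_ n.+2 - t_ n.+1 = 2^-1 * (s * s + s * t_ n + t_ n * s).
    have e : t_ n.+1 = s + t_ n by rewrite /s subrK.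
    have -> : t_ n.+2 = 2^-1 * (1 + t_ n.+1 * t_ n.+1) by [].
    rewrite [X in _ - X]/= {1 2}e; ring.
  apply: npolyZ => //; apply: npolyD; first by apply: npolyD; exact: npolyM.
  exact: npolyM.
have mnt m n : (m <= n)%N -> npoly x (y_ n - y_ m) (t_ n - t_ m).
  elim: n => [|n IH]; first by rewrite leqn0 => /eqP ->; rewrite !subrr; exact: npoly0.
  rewrite leq_eqVlt => /orP[/eqP ->|mn]; first by rewrite !subrr; exact: npoly0.
  have := npolyD (dyt n) (IH mn); rewrite !addrA !subrK; exact.
have t1 n : t_ n <= 1.
  elim: n => [|n IH] //=; have := npoly_ge0 (yt n); nra.
have tc : forall e : R, 0 < e -> exists N, forall m n, (N <= m)%N -> (m <= n)%N -> t_ n - t_ m < e.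
  move=> e e0; have : cvgn t_.
    apply: nondecreasing_is_cvgn; last by exists 1 => _ [n _ <-]; exact: t1.
    by apply/nondecreasing_seqP => n; have := npoly_ge0 (dyt n); rewrite subr_ge0.
  move=> /cvgrPdist_lt /(_ (e / 2)); rewrite divr_gt0// => /(_ isT)[N _ NP].
  exists N => m n Nm mn; have := NP m Nm; have := NP n (leq_trans Nm mn) => /=.
  rewrite !ltr_norml; lra.
have [y yP] : exists y : bop H, forall u, (fun n => y_ n u) @ \oo --> y u.
  apply: (@bop_limit _ 1) => [n u|u].
    by apply: le_trans (npoly_bound xc (yt n) u) _; rewrite ler_wpM2r ?rnorm_ge0.
  apply: complete_rnorm => e e0.
  have u1 : 0 < rnorm u + 1 by rewrite ltr_wpDl ?rnorm_ge0.
  have [N NP] := tc (e / (rnorm u + 1)) (divr_gt0 e0 u1).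
  exists N; suff W m n : (N <= m)%N -> (m <= n)%N -> rnorm (y_ m u - y_ n u) < e.
    move=> m n Nm Nn; have [mn|nm] := leqP m n; first exact: W.
    by rewrite rnormBC; apply: W => //; exact: ltnW.
  move=> Nm mn; rewrite rnormBC; have := npoly_bound xc (mnt _ _ mn) u.
  rewrite bopBE => /le_lt_trans; apply.
  have := NP m n Nm mn; rewrite ltr_pdivlMr//; apply: le_lt_trans.
  by rewrite ler_wpM2l ?lerDl// (npoly_ge0 (mnt _ _ mn)).
have ypos : pos_op y.
  move=> u; apply: (cvg_ge0 (cvg_innerl (w := u) (yP u))) => n.
  exact: (npoly_pos xp (yt n)).
have yb u : rnorm (y u) <= rnorm u.
  apply: (cvg_rnorm_le (yP u)); near=> n.
  apply: le_trans (npoly_bound xc (yt n) u) _.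
  by rewrite ler_piMl ?rnorm_ge0.
have yE : y = h *: (x + y * y).
  apply: bopP => u; apply: (rnorm_cvg_unique (f := fun n => y_ n.+1 u) (F := \oo)).
    by have := yP u; rewrite -(cvg_shiftn 1) /=; under eq_fun do rewrite addn1.
  rewrite bopZE bopDE bopME; apply: cvgZr; apply: cvgD; first exact: cvg_cst.
  apply: (@bop_cvgM 1 y_ y_ y y u) => // n v.
  apply: le_trans (npoly_bound xc (yt n) v) _.
  by rewrite ler_wpM2r ?rnorm_ge0.
exists y; split => //.
- move=> u; rewrite bopBE bop1E innerBl inner_rnorm (ge0_ReE (ypos u)) -rmorphB /= ler0c.
  rewrite subr_ge0; apply: le_trans (ler_Re_rnorm _) _; apply: le_trans (rnorm_cs _ _) _.
  by rewrite expr2 ler_wpM2r ?rnorm_ge0.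
- have e2 : y + y = x + y * y.
    rewrite {1 2}yE -scalerDl -rmorphD /=.
    by have -> : 2^-1 + 2^-1 = 1 :> R by [field]; rewrite rmorph1 scale1r.
  have e3 : y * y = y + y - x by rewrite e2 addrAC subrr add0r.
  rewrite mulrBl !mulrBr !mul1r mulr1 opprB e3 [y + y - x - y]addrAC.
  by rewrite addrK addrA subrK.
- move=> z xz; apply: bopP => u; rewrite !bopME.
  apply: (rnorm_cvg_unique (yP (z u))).
  have -> : (fun n => y_ n (z u)) = (fun n => z (y_ n u)).
    by apply/funext => n; rewrite -!bopME (npoly_comm xz (yt n)).
  by apply: cvg_bop.
Unshelve. all: by end_near. Qed.

(** Scale [p] to some [p' <= 1] and apply [sqrt1_exists] to [1 - p']: the operator [1 - y] found
    there squares to [p']. *)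
Lemma sqrt_exists p : pos_op p -> exists s, [/\ pos_op s, s * s = p
  & forall z, p * z = z * p -> s * z = z * s].
Proof.
move=> pp; have [C C0 p1] := pos_scale_le pp.
pose p' := ((C^-1)%:C)%C *: p.
have [||y [y0 y1 yy yc]] := @sqrt1_exists (1 - p').
- exact: p1.
- by rewrite opprB addrC subrK; apply: pos_opZ => //; rewrite invr_ge0 ltW.
have sC : (Num.sqrt C) * (Num.sqrt C) = C by rewrite -expr2 sqr_sqrtr// ltW.
exists (((Num.sqrt C)%:C)%C *: (1 - y)); split.
- by apply: pos_opZ => //; exact: sqrtr_ge0.
- rewrite bopZAl bopZAr scalerA -rmorphM sC yy opprB addrC subrK scalerA -rmorphM /=.
  by rewrite mulfV ?gt_eqF// rmorph1 scale1r.
- move=> z pz; rewrite bopZAl bopZAr mulrBl mulrBr mul1r mulr1 yc//.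
  by rewrite mulrBl mulrBr mul1r mulr1 bopZAl bopZAr pz.
Qed.

(** A positive root [r] commutes with its square, hence with the root [t] from [sqrt_exists]. On
    [v = (t - r) u] the sum [t + r] vanishes, so positivity makes [t v] and [r v] both zero. *)
Lemma pos_sqrt_unique (q q' : bop H) : pos_op q -> pos_op q' -> q * q = q' * q' -> q = q'.
Proof.
move=> q0 q'0 qq.
have [t [t0 tt tc]] := sqrt_exists (pos_adjM q); rewrite pos_op_adj// in tt tc.
suff U (r : bop H) : pos_op r -> r * r = q * q -> r = t by rewrite (U q)// (U q').
move=> r0 rr; have tr : t * r = r * t by apply: tc; rewrite -rr mulrA.
apply: bopP => u; set v := (t - r) u.
have trv : (t + r) v = 0.
  have e : (t + r) * (t - r) = 0.
    by rewrite mulrBr !mulrDl tr rr tt [r * t + _]addrC subrr.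
  by rewrite /v -bopME e.
have e : '[t v, v] + '[r v, v] = 0 by rewrite -innerDl -bopDE trv inner0l.
have tv : '[t v, v] = 0.
  by apply/eqP; rewrite eq_le t0 andbT -e lerDl r0.
have rv : '[r v, v] = 0 by rewrite tv add0r in e.
have v0 : (t - r) v = 0 by rewrite bopBE (pos_eq0 t0 tv) (pos_eq0 r0 rv) subrr.
have : '[v, v] = 0.
  by rewrite {1}/v adjP adjB !pos_op_adj// v0 inner0r.
by move/eqP; rewrite inner_eq0 /v bopBE subr_eq0 => /eqP.
Qed.

End Positive.

(** * Amplifications and bases *)

Section PartialIsometries.
Variables (R : realType) (H : hilbertType R).
Implicit Types (x y X : bop H) (u v w : H).

(** Partial isometries with mutually orthogonal ranges that together span a dense subspace.
    Isometries would be too strict: the families produced by Gram-Schmidt may contain zeros. *)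
Record pfam (z : nat -> bop H) : Prop := {
  pfam_orth : forall i j, i != j -> adj (z i) * z j = 0;
  pfam_piso : forall i, z i * adj (z i) * z i = z i;
  pfam_total : forall w, (forall i, adj (z i) w = 0) -> w = 0 }.

Lemma cvg_series_bop (x : bop H) (f : nat -> H) l : series f @ \oo --> l ->
  series (fun n => x (f n)) @ \oo --> x l.
Proof.
move=> fl; have -> : series (fun n => x (f n)) = (fun n => x (series f n)).
  by apply/funext => n; rewrite /series /= bop_lin_sum.
exact: cvg_bop.
Qed.

Arguments cvg_series_bop x {f l}.

Lemma cvg_series_innerl (f : nat -> H) l w : series f @ \oo --> l ->
  series (fun n => '[f n, w] : Cx R) @ \oo --> ('[l, w] : Cx R).
Proof.
move=> fl; rewrite [series _](_ : _ = (fun n => '[series f n, w])); last first.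
  by apply/funext => n; rewrite /series /= inner_suml.
exact: cvg_innerl.
Qed.

Lemma cvg_series_innerr (f : nat -> H) l w : series f @ \oo --> l ->
  series (fun n => '[w, f n] : Cx R) @ \oo --> ('[w, l] : Cx R).
Proof.
move=> fl; rewrite [series _](_ : _ = (fun n => '[w, series f n])); last first.
  by apply/funext => n; rewrite /series /= inner_sumr.
exact: cvg_innerr.
Qed.

Section Family.
Variable z : nat -> bop H.
Hypothesis zF : pfam z.

Let zo i j u v : i != j -> '[z i u, z j v] = 0.
Proof. by move=> ij; rewrite adjP -bopME pfam_orth// bop0E inner0r. Qed.

Let zz i : adj (z i) * z i * adj (z i) = adj (z i).
Proof. by rewrite -[RHS](congr1 (@adj R H) (pfam_piso zF i)) !adjM adjK mulrA. Qed.

Lemma pfam_norm i w : rnorm (z i (adj (z i) w)) = rnorm (adj (z i) w).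
Proof.
apply/eqP; rewrite -(eqrXn2 (n := 2)) ?rnorm_ge0//; apply/eqP.
by rewrite !rnorm_inner adjP -!bopME zz.
Qed.

Lemma pfam_contr i w : rnorm (z i w) <= rnorm w.
Proof.
rewrite -(ler_pXn2r (n := 2))// ?nnegrE ?rnorm_ge0//.
have e : z i w = z i (adj (z i) (z i w)) by rewrite -!bopME pfam_piso.
have o : '[z i w, z i w] = '[w, adj (z i) (z i w)] by rewrite adjP.
rewrite {1}rnorm_inner o; apply: le_trans (ler_Re_rnorm _) _.
apply: le_trans (rnorm_cs _ _) _; rewrite expr2 ler_wpM2l ?rnorm_ge0//.
have : rnorm (adj (z i) (z i w)) ^+ 2 <= rnorm w * rnorm (adj (z i) (z i w)).
  rewrite rnorm_inner -adjP -[z i (adj (z i) (z i w))]bopME -[(z i * _) _]bopME pfam_piso// o.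
  by apply: le_trans (ler_Re_rnorm _) _; exact: rnorm_cs.
have [->|h] := eqVneq (rnorm (adj (z i) (z i w))) 0; first by rewrite rnorm_ge0.
have hp : 0 < rnorm (adj (z i) (z i w)) by rewrite lt_neqAle eq_sym h rnorm_ge0.
by rewrite expr2 ler_pM2r.
Qed.

Lemma pfam_bessel n w :
  \sum_(0 <= i < n) rnorm (adj (z i) w) ^+ 2 <= rnorm w ^+ 2.
Proof.
have orth i j : i != j -> '[z i (adj (z i) w), z j (adj (z j) w)] = 0 by exact: zo.
pose s := \sum_(0 <= i < n) z i (adj (z i) w).
have sE : rnorm s ^+ 2 = \sum_(0 <= i < n) rnorm (adj (z i) w) ^+ 2.
  by rewrite rnorm_sum_sqr//; apply: eq_bigr => i _; rewrite pfam_norm.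
have ws : '[w, s] = '[s, s].
  rewrite [in LHS]/s inner_sumr inner_rnorm sE rmorph_sum /=; apply: eq_bigr => i _.
  by rewrite adjPr inner_rnorm.
rewrite -sE; have := sqr_ge0 (rnorm (w - s)).
have e : '[w - s, s] = 0 by rewrite innerBl ws subrr.
have -> : rnorm w ^+ 2 = rnorm (w - s) ^+ 2 + rnorm s ^+ 2.
  by rewrite -rnormDsqr// subrK.
by rewrite lerDr.
Qed.

Lemma pfam_expand w : series (fun i => z i (adj (z i) w)) @ \oo --> w.
Proof.
have [||l lP] := @orth_series_cvg R H (fun i => z i (adj (z i) w)) (rnorm w ^+ 2).
- by move=> i j; exact: zo.
- by move=> n; under eq_bigr do rewrite pfam_norm; exact: pfam_bessel.
suff wl : w = l by rewrite [X in _ --> X]wl.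
apply/eqP; rewrite -subr_eq0; apply/eqP; apply: (pfam_total zF) => i.
rewrite bop_linB; apply/eqP; rewrite subr_eq0; apply/eqP.
apply: (rnorm_cvg_unique _ (cvg_series_bop (adj (z i)) lP)).
apply/cvg_rnormn => e e0; exists i.+1 => n ni.
rewrite /series /= (bigD1_seq i) ?mem_index_iota ?iota_uniq//= big1.
  by rewrite addr0 -!bopME zz subrr rnorm0.
by move=> j ji; rewrite -bopME pfam_orth// eq_sym.
Qed.

Lemma pfam_amp_exists X : exists y : bop H,
  forall w, series (fun i => z i (X (adj (z i) w))) @ \oo --> y w.
Proof.
have [C C0 XC] := bop_rbound X.
pose s n : bop H := \sum_(0 <= i < n) z i * X * adj (z i).
have sE n w : s n w = series (fun i => z i (X (adj (z i) w))) n.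
  by rewrite /s bop_sumE.
have bnd n w : \sum_(0 <= i < n) rnorm (z i (X (adj (z i) w))) ^+ 2 <= (C * rnorm w) ^+ 2.
  rewrite exprMn; apply: le_trans (_ : _ <= C ^+ 2 * \sum_(0 <= i < n) rnorm (adj (z i) w) ^+ 2) _.
    rewrite mulr_sumr; apply: ler_sum => i _.
    rewrite -exprMn ler_sqr ?nnegrE ?mulr_ge0 ?rnorm_ge0 ?(ltW C0)//.
    by apply: le_trans (pfam_contr _ _) _.
  by rewrite ler_pM2l ?exprn_gt0// pfam_bessel.
have orth w i j : i != j -> '[z i (X (adj (z i) w)), z j (X (adj (z j) w))] = 0.
  exact: zo.
have [|w|y yP] := @bop_limit R H s C.
- move=> n w; rewrite -(ler_pXn2r (n := 2))// ?nnegrE ?mulr_ge0 ?rnorm_ge0 ?(ltW C0)//.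
  by rewrite sE /series /= rnorm_sum_sqr//; exact: orth.
- have [|l lP] := @orth_series_cvg R H (fun i => z i (X (adj (z i) w))) ((C * rnorm w) ^+ 2) _ (fun n => bnd n w).
    exact: orth.
  by exists l; under eq_fun do rewrite sE.
exists y => w; have := yP w; under eq_fun do rewrite sE; exact.
Qed.

End Family.

Definition amp (z : nat -> bop H) X : bop H :=
  xget 0 [set y : bop H | forall w,
    series (fun i => z i (X (adj (z i) w))) @ \oo --> y w].

Lemma ampP z X w : pfam z ->
  series (fun i => z i (X (adj (z i) w))) @ \oo --> amp z X w.
Proof.
move=> zF.
pose S := [set y : bop H | forall w,
  series (fun i => z i (X (adj (z i) w))) @ \oo --> y w].
have /(@xgetPex _ 0 S) : exists y, S y by exact: pfam_amp_exists.
exact.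
Qed.

Section Amplification.
Variable z : nat -> bop H.
Hypothesis zF : pfam z.

(** The ranges of the [z i] are total, so the intertwining relation determines [y]. This
    characterization replaces manipulations of the series. *)
Lemma amp_unique X y : (forall i, y * z i = z i * X) -> y = amp z X.
Proof.
move=> yz; apply: bopP => w.
have := cvg_series_bop y (pfam_expand zF (w := w)).
under [X in series X]eq_fun do rewrite -bopME yz bopME.
by move=> h; exact: (rnorm_cvg_unique h (ampP (X := X) (w := w) zF)).
Qed.

Lemma amp1 : amp z 1 = 1.
Proof. by apply/esym; apply: amp_unique => i; rewrite mul1r mulr1. Qed.

Lemma amp_linear c (X Y : bop H) : amp z (c *: X + Y) = c *: amp z X + amp z Y.
Proof.
apply: bopP => w; apply: (rnorm_cvg_unique (ampP (X := c *: X + Y) (w := w) zF)).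
have -> : series (fun i => z i ((c *: X + Y) (adj (z i) w))) =
  (fun n => c *: series (fun i => z i (X (adj (z i) w))) n +
            series (fun i => z i (Y (adj (z i) w))) n).
  apply/funext => n; rewrite /series /= scaler_sumr -big_split /=.
  by apply: eq_bigr => i _; rewrite bop_linD bop_linZ.
by apply: cvgD; [apply: cvgZr|]; exact: ampP.
Qed.

Lemma amp_series X u v :
  series (fun i => '[X (adj (z i) u), adj (z i) v] : Cx R) @ \oo -->
  ('[amp z X u, v] : Cx R).
Proof.
have := cvg_series_innerl (w := v) (ampP (X := X) (w := u) zF).
by under [X in series X]eq_fun do rewrite adjP.
Qed.

Lemma amp_adj X : amp z (adj X) = adj (amp z X).
Proof.
apply/esym/adj_unique => u v.
apply: (rnorm_cvg_unique (V := Cx R) (amp_series (X := X) (u := u) (v := v))).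
have := cvg_series_innerr (w := u) (ampP (X := adj X) (w := v) zF).
rewrite [X in series X](_ : _ = (fun i => '[X (adj (z i) u), adj (z i) v])) //.
by apply/funext => i; rewrite [RHS]adjP adjPr.
Qed.

Lemma amp_bound X (C : R) : 0 <= C -> (forall u, rnorm (X u) <= C * rnorm u) ->
  forall u, rnorm (amp z X u) <= C * rnorm u.
Proof.
move=> C0 XC u; apply: (cvg_rnorm_le (ampP (X := X) (w := u) zF)); near=> n.
rewrite -(ler_pXn2r (n := 2))// ?nnegrE ?mulr_ge0 ?rnorm_ge0//.
rewrite /series /= rnorm_sum_sqr => [|i j ij]; last first.
  by rewrite adjP -[adj _ (z j _)]bopME pfam_orth// bop0E inner0r.
rewrite exprMn.
apply: le_trans (_ : _ <= C ^+ 2 * \sum_(0 <= i < n) rnorm (adj (z i) u) ^+ 2) _.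
  rewrite mulr_sumr; apply: ler_sum => i _.
  rewrite -exprMn ler_sqr ?nnegrE ?mulr_ge0 ?rnorm_ge0//.
  by apply: le_trans (pfam_contr zF _ _) _.
by rewrite ler_wpM2l ?sqr_ge0// pfam_bessel.
Unshelve. all: by end_near. Qed.

Lemma amp_at X i w : amp z X (z i w) = z i (X (adj (z i) (z i w))).
Proof.
apply: (rnorm_cvg_unique (ampP (X := X) (w := z i w) zF)).
apply/cvg_rnormn => e e0; exists i.+1 => n ni.
rewrite /series /= (bigD1_seq i) ?mem_index_iota ?iota_uniq//= big1.
  by rewrite addr0 subrr rnorm0.
by move=> j ji; rewrite -[adj _ (z i w)]bopME pfam_orth// !bop_lin0.
Qed.

Lemma amp_inter X i : X * (adj (z i) * z i) = (adj (z i) * z i) * X ->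
  amp z X * z i = z i * X.
Proof.
move=> XC; apply: bopP => w; rewrite bopME amp_at.
have -> : X (adj (z i) (z i w)) = (X * (adj (z i) * z i)) w by [].
by rewrite XC -mulrA -[LHS]bopME !mulrA pfam_piso.
Qed.

Lemma amp_mul X Y : (forall i, X * (adj (z i) * z i) = (adj (z i) * z i) * X) ->
  (forall i, Y * (adj (z i) * z i) = (adj (z i) * z i) * Y) ->
  amp z (X * Y) = amp z X * amp z Y.
Proof.
move=> XC YC; apply/esym/amp_unique => i.
by rewrite -mulrA amp_inter// mulrA amp_inter// mulrA.
Qed.

End Amplification.
End PartialIsometries.

(** * Gram-Schmidt and orthonormal bases *)

Section Bases.
Variables (R : realType) (H : hilbertType R).
Implicit Types (u v w : H).

Definition orthobasis (e : nat -> H) :=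
  (forall i j, '[e i, e j] = (i == j)%:R) /\
  (forall w, (forall i, '[w, e i] = 0) -> w = 0).

(** Zero vectors are allowed so that Gram-Schmidt keeps its indexing when the input vectors are
    dependent. *)
Definition ortho01 (g : nat -> H) :=
  (forall i j, i != j -> '[g i, g j] = 0) /\
  (forall i, '[g i, g i] = 0 \/ '[g i, g i] = 1).

Lemma ortho01_idem (g : nat -> H) i : ortho01 g -> '[g i, g i] *: g i = g i.
Proof.
by move=> [_ /(_ i)[] h]; rewrite h ?scale1r// scale0r; apply/esym/eqP; rewrite -inner_eq0 h.
Qed.

Lemma orthobasis01 e : orthobasis e -> ortho01 e.
Proof.
move=> [eo _]; split=> [i j ij|i]; rewrite eo ?(negbTE ij)// eqxx.
by right.
Qed.

Lemma ortho01_pfam g : ortho01 g -> (forall w, (forall i, '[w, g i] = 0) -> w = 0) ->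
  pfam (fun i => rk1 (g i) (g i)).
Proof.
move=> go gt; split=> [i j ij|i|w h].
- by rewrite adj_rk1 rk1M go.1 1?eq_sym// scale0r.
- rewrite adj_rk1 rk1M bopZAl rk1M -rk1Zl.
  by rewrite ortho01_idem// -rk1Zl ortho01_idem.
- apply: gt => i; have := h i; rewrite adj_rk1 rk1E => /eqP.
  rewrite scaler_eq0 => /orP[/eqP//|/eqP ->]; exact: inner0r.
Qed.

Lemma orthobasis_pfam e : orthobasis e -> pfam (fun i => rk1 (e i) (e i)).
Proof. by move=> eb; apply: ortho01_pfam; [exact: orthobasis01 | exact: eb.2]. Qed.

Lemma orthobasis_expand e w : orthobasis e ->
  series (fun i => '[w, e i] *: e i) @ \oo --> w.
Proof.
move=> eb; have := pfam_expand (orthobasis_pfam eb) (w := w).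
by under [X in series X]eq_fun do rewrite adj_rk1 -bopME rk1M eb.1 eqxx scale1r rk1E.
Qed.

Lemma orthobasis_bessel e n w : orthobasis e ->
  \sum_(0 <= i < n) rnorm ('[w, e i] : Cx R) ^+ 2 <= rnorm w ^+ 2.
Proof.
move=> eb; have := pfam_bessel (orthobasis_pfam eb) n w.
apply: le_trans; rewrite le_eqVlt; apply/orP; left; apply/eqP.
apply: eq_bigr => i _; rewrite adj_rk1 rk1E rnormZ.
suff -> : rnorm (e i) = 1 by rewrite mulr1.
by apply/eqP; rewrite -(eqrXn2 (n := 2)) ?rnorm_ge0// rnorm_inner eb.1 eqxx expr1n.
Qed.

Lemma orthobasis_rnorm e i : orthobasis e -> rnorm (e i) = 1.
Proof.
move=> eb; apply/eqP; rewrite -(eqrXn2 (n := 2)) ?rnorm_ge0// rnorm_inner eb.1.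
by rewrite eqxx expr1n.
Qed.

Lemma parseval e u v : orthobasis e ->
  series (fun i => '[u, e i] * '[e i, v] : Cx R) @ \oo --> ('[u, v] : Cx R).
Proof.
move=> eb; have := cvg_series_innerl (w := v) (orthobasis_expand (w := u) eb).
by under [X in series X]eq_fun do rewrite innerZl.
Qed.

(** At [u = 0] the value is [0], because [0^-1 = 0]; this is the source of the zeros in
    [ortho01]. *)
Definition normalize (V : normedModType (Cx R)) (u : V) : V := (((rnorm u)^-1)%:C)%C *: u.

Lemma normalize_inner (u : H) : '[normalize u, normalize u] = 0 \/
  '[normalize u, normalize u] = 1.
Proof.
have [->|u0] := eqVneq u 0; [left|right].
  by rewrite /normalize scaler0 inner0l.
rewrite inner_rnorm /normalize rnormZ rnormC_real ger0_norm ?invr_ge0 ?rnorm_ge0//.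
by rewrite mulVf ?rnorm_eq0// expr1n.
Qed.

(** Course-of-values recursion: [gsf d n] carries the first [n] vectors as a function, whose values
    from index [n] on are irrelevant. *)
Fixpoint gsf (d : nat -> H) (n : nat) : nat -> H :=
  if n is m.+1 then fun k => if (k < m)%N then gsf d m k else
    normalize (d m - \sum_(0 <= i < m) '[d m, gsf d m i] *: gsf d m i)
  else fun=> 0.

Definition gram_schmidt d n := gsf d n.+1 n.

Lemma gsfE d n k : (k < n)%N -> gsf d n k = gram_schmidt d k.
Proof.
rewrite /gram_schmidt; elim: n => // n IH; rewrite ltnS leq_eqVlt => /orP[/eqP ->//|kn].
by rewrite -IH//= kn.
Qed.

Lemma gram_schmidtE d n : gram_schmidt d n = normalize (d n -
  \sum_(0 <= i < n) '[d n, gram_schmidt d i] *: gram_schmidt d i).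
Proof.
rewrite {1}/gram_schmidt /= ltnn; congr (normalize (_ - _)).
by apply: eq_big_nat => i /andP[_ ni]; rewrite gsfE.
Qed.

Lemma gram_schmidt_ortho d : ortho01 (gram_schmidt d).
Proof.
set g := gram_schmidt d.
have n01 i : '[g i, g i] = 0 \/ '[g i, g i] = 1.
  by rewrite /g gram_schmidtE; exact: normalize_inner.
split=> //.
suff W n : forall i, (i < n)%N -> '[g n, g i] = 0.
  move=> i j; rewrite neq_ltn => /orP[|]; last exact: W.
  by move=> /W h; rewrite innerC h conjC0.
have [k kn] := ubnP n; elim: k n kn => // k IH n nk i ni.
have o j : (j < n)%N -> j != i -> '[g j, g i] = 0.
  move=> jn; rewrite neq_ltn => /orP[ji|ij].
    by rewrite innerC IH ?conjC0// -ltnS (leq_trans _ nk)// ltnS.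
  by apply: IH => //; rewrite -ltnS (leq_trans _ nk)// ltnS.
rewrite {1}/g gram_schmidtE -/g /normalize; set c := (X in X *: _).
rewrite innerZl innerBl inner_suml.
rewrite (bigD1_seq i) ?mem_index_iota ?iota_uniq//=.
rewrite big_nat_cond big1 => [|j /andP[/andP[_ jn] ji]]; last first.
  by rewrite innerZl o ?mulr0.
rewrite addr0 innerZl; have [h|->] := n01 i; last by rewrite mulr1 subrr mulr0.
have -> : g i = 0 by apply/eqP; rewrite -inner_eq0 h.
by rewrite !inner0r !mulr0 subrr mulr0.
Qed.

Lemma gram_schmidt_total d w : (forall i, '[w, gram_schmidt d i] = 0) ->
  forall n, '[w, d n] = 0.
Proof.
move=> h n; set g := gram_schmidt d in h.
pose r := d n - \sum_(0 <= i < n) '[d n, g i] *: g i.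
have -> : d n = r + \sum_(0 <= i < n) '[d n, g i] *: g i by rewrite subrK.
rewrite innerDr inner_sumr big1 ?addr0 => [|i _]; last by rewrite innerZr h mulr0.
have [->|r0] := eqVneq r 0; first by rewrite inner0r.
have := h n; rewrite /g gram_schmidtE -/g -/r innerZr => /eqP; rewrite mulf_eq0.
move=> /orP[|/eqP//]; rewrite conjC_eq0 => /eqP q.
have /complexI/eqP : (((rnorm r)^-1)%:C)%C = ((0 : R)%:C)%C by rewrite q.
by rewrite invr_eq0 rnorm_eq0 (negbTE r0).
Qed.

Lemma gram_schmidt_closed d (G : set H) : G 0 ->
  (forall c u v, G u -> G v -> G (c *: u + v)) -> (forall n, G (d n)) ->
  forall n, G (gram_schmidt d n).
Proof.
move=> G0 GP Gd n; have [k kn] := ubnP n; elim: k n kn => // k IH n nk.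
rewrite gram_schmidtE /normalize -[_ *: _]addr0; apply: (GP) => //.
rewrite -scaleN1r addrC; apply: (GP) => //.
rewrite big_nat_cond; elim/big_rec: _ => // i v /andP[/andP[_ ni] _] Gv.
by apply: GP => //; apply: IH; rewrite -ltnS (leq_trans _ nk)// ltnS.
Qed.

Lemma separable_seq : separable_space H -> exists d : nat -> H, norm_dense (range d).
Proof.
move=> [D /pcard_injP[f fi] Dd].
have nd : norm_dense D.
  move=> h e e0; have eC : 0 < (e%:C)%C by rewrite ltcR.
  have [||g [gb Dg]] := Dd (ball h (e%:C)%C).
  - by exists h; exact: ballxx.
  - exact: ball_open.
  exists g => //; move: gb; rewrite -ball_normE /= rnormE.
  by rewrite ltcR.
exists (fun n => xget 0 [set x | D x /\ f x = n]) => h e e0.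
have [g Dg gh] := nd h e e0; exists g => //; exists (f g) => //.
case: xgetP => [x _ [Dx xg]|/(_ g) []//].
by apply: fi; rewrite ?inE.
Qed.

(** Meant for a projection [p]: the family is then an orthonormal basis of its range, with zero
    vectors interspersed. *)
Lemma ortho01_exists : separable_space H -> forall (p : bop H),
  exists g : nat -> H, [/\ ortho01 g, forall n, exists u, g n = p u
    & forall w, (forall n, '[w, g n] = 0) -> adj p w = 0].
Proof.
move=> /separable_seq[d dd] p; exists (gram_schmidt (fun n => p (d n))); split.
- exact: gram_schmidt_ortho.
- apply: (@gram_schmidt_closed _ (fun v => exists u, v = p u)).
  + by exists 0; rewrite bop_lin0.
  + by move=> c _ _ [u ->] [v ->]; exists (c *: u + v); rewrite bop_linD bop_linZ.
  + by move=> n; exists (d n).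
- move=> w /gram_schmidt_total h; apply: inner_eq0l => v.
  have [d_ dr dv] := dense_cvg v dd.
  apply: (rnorm_cvg_unique (V := Cx R) (cvg_innerr (w := adj p w) dv)).
  rewrite [X in X @ _](_ : _ = fun=> 0); first exact: cvg_cst.
  by apply/funext => n; have [m _ <-] := dr n; rewrite adjP adjK h.
Qed.

End Bases.

Section BasisExistence.
Variables (R : realType) (H : hilbertType R).
Implicit Types (u v w : H).

(** Used to delete the zeros of a Gram-Schmidt family: in infinite dimension its nonzero indices are
    unbounded, since finitely many vectors would otherwise span the space. *)
Lemma strict_enum (P : nat -> Prop) : (forall N, exists2 i, (N <= i)%N & P i) ->
  exists h : nat -> nat, [/\ injective h, forall n, P (h n) &
    forall i, P i -> exists n, h n = i].
Proof.
move=> Pinf; pose p i := `[< P i >].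
have ex N : exists i, (N <= i)%N && p i.
  by have [i Ni Pi] := Pinf N; exists i; rewrite Ni; apply/asboolP.
pose nxt N := ex_minn (ex N).
have nxtP N : [/\ (N <= nxt N)%N, P (nxt N) & forall i, (N <= i)%N -> P i -> (nxt N <= i)%N].
  rewrite /nxt; case: ex_minnP => m /andP[Nm /asboolP Pm] h; split=> // i Ni Pi.
  by apply: h; rewrite Ni; apply/asboolP.
pose h := fix h n := if n is m.+1 then nxt (h m).+1 else nxt 0%N.
have hP n : P (h n) by case: n => [|n] /=; [have [] := nxtP 0%N | have [] := nxtP (h n).+1].
have hlt n : (h n < h n.+1)%N by have [] := nxtP (h n).+1.
have hmono m n : (m < n)%N -> (h m < h n)%N.
  elim: n => // n IH; rewrite ltnS leq_eqVlt => /orP[/eqP -> //|/IH mn].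
  exact: ltn_trans mn (hlt n).
exists h; split=> // [m n mn|i Pi].
  have [mn'|nm|//] := ltngtP m n.
    by have := hmono _ _ mn'; rewrite mn ltnn.
  by have := hmono _ _ nm; rewrite mn ltnn.
have hge n : (n <= h n)%N.
  by elim: n => // n IH; exact: leq_ltn_trans IH (hlt n).
have : exists n, (i <= h n)%N by exists i.
move=> /ex_minnP[] [|n] ih hmin; first exists 0%N.
  by apply/eqP; rewrite eqn_leq ih andbT; have [_ _] := nxtP 0%N; apply.
exists n.+1; apply/eqP; rewrite eqn_leq ih andbT.
have [_ _] := nxtP (h n).+1; apply => //.
by rewrite ltnNge; apply/negP => /hmin; rewrite ltnn.
Qed.

Lemma orthobasis_exists : infinite_dimensional H -> separable_space H ->
  exists e : nat -> H, orthobasis e.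
Proof.
move=> Hinf Hsep; have [g [go _ gt]] := ortho01_exists Hsep (1 : bop H).
have {}gt w : (forall i, '[w, g i] = 0) -> w = 0.
  by move/gt; rewrite adj1.
have [|h [hi hP hs]] := @strict_enum (fun i => g i != 0).
  move=> N; apply: contrapT => hN.
  have g0 i : (N <= i)%N -> g i = 0.
    by move=> Ni; apply/eqP; apply: contrapT => /negP gi; apply: hN; exists i.
  have [v vN] := Hinf N (fun i : 'I_N => g i).
  apply: (vN (fun i => '[v, g i])); apply/eqP; rewrite -subr_eq0; apply/eqP.
  apply: gt => i; rewrite innerBl inner_suml.
  have [iN|Ni] := ltnP i N; last by rewrite g0// inner0r big1 ?subrr// => j _; rewrite inner0r.
  rewrite (bigD1 (Ordinal iN))//= big1 => [|j jN]; last first.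
    rewrite innerZl go.1 ?mulr0//; apply: contra jN => /eqP ji; apply/eqP; exact: val_inj.
  rewrite addr0 innerZl; have [gi|->] := go.2 i; last by rewrite mulr1 subrr.
  have -> : g i = 0 by apply/eqP; rewrite -inner_eq0 gi.
  by rewrite !inner0r mul0r subrr.
exists (g \o h); split => [i j|w wh] /=.
  have [<-|ij] := eqVneq i j; last by rewrite go.1//; apply: contra ij => /eqP/hi ->.
  by have [gi|//] := go.2 (h i); have := hP i; rewrite -inner_eq0 gi eqxx.
apply: gt => i; have [->|gi] := eqVneq (g i) 0; first by rewrite inner0r.
by have [n <-] := hs i gi; exact: wh.
Qed.

End BasisExistence.

Section PairSequences.
Variables (R : realType) (H : hilbertType R).
Implicit Types (u v w : H).

Lemma nat_pairing : exists2 pr : nat * nat -> nat, injective pr &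
  forall m, exists ij, pr ij = m.
Proof.
have /card_set_bijP[f [_ fi fs]] := card_nat2.
exists f => [x y xy|m]; first by apply: fi; rewrite ?inE.
by have [x _ xm] := fs m I; exists x.
Qed.

End PairSequences.

Section SplitFamily.
Variables (R : realType) (H : hilbertType R).
Implicit Types (x y X : bop H) (u v w : H).
Variable e : nat -> H.
Hypothesis eb : orthobasis e.

Lemma orthobasis_bop_eq x y : (forall i, x (e i) = y (e i)) -> x = y.
Proof.
move=> xy; apply: bopP => w; have we := orthobasis_expand (w := w) eb.
have h : series (fun n => x ('[w, e n] *: e n)) @ \oo --> x w.
  exact: cvg_series_bop.
apply: (rnorm_cvg_unique h).
rewrite [X in series X](_ : _ = (fun n => y ('[w, e n] *: e n))).
  exact: cvg_series_bop.
by apply/funext => n; rewrite !bop_linZ xy.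
Qed.

Lemma orthobasis_eq u v : (forall i, '[u, e i] = '[v, e i]) -> u = v.
Proof.
move=> uv; apply/eqP; rewrite -subr_eq0; apply/eqP; apply: eb.2 => i.
by rewrite innerBl uv subrr.
Qed.

Lemma basis_map (f : nat -> nat) : injective f ->
  exists x : bop H, (forall i, x (e i) = e (f i)) /\ adj x * x = 1.
Proof.
move=> fi; pose s n : bop H := \sum_(0 <= i < n) rk1 (e (f i)) (e i).
have sE w n : s n w = series (fun i => '[w, e i] *: e (f i)) n by rewrite /s bop_sumE.
have orth w i j : i != j -> '['[w, e i] *: e (f i), '[w, e j] *: e (f j)] = 0.
  move=> ij; rewrite innerZl innerZr eb.1 (_ : f i == f j = false) ?mulr0//.
  by apply/negbTE; apply: contra ij => /eqP/fi ->.
have bnd w n : \sum_(0 <= i < n) rnorm ('[w, e i] *: e (f i)) ^+ 2 <= rnorm w ^+ 2.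
  apply: le_trans (orthobasis_bessel n w eb); rewrite le_eqVlt; apply/orP; left; apply/eqP.
  by apply: eq_bigr => i _; rewrite rnormZ orthobasis_rnorm// mulr1.
have [|w|x xP] := @bop_limit R H s 1.
- move=> n w; rewrite mul1r -(ler_pXn2r (n := 2)) ?nnegrE ?rnorm_ge0//.
  by rewrite sE /series /= rnorm_sum_sqr//; exact: orth.
- have [||l lP] := @orth_series_cvg R H (fun i => '[w, e i] *: e (f i)) (rnorm w ^+ 2).
  + exact: orth.
  + exact: bnd.
  by exists l; under eq_fun do rewrite sE.
have xe i : x (e i) = e (f i).
  apply: (rnorm_cvg_unique (xP (e i))); apply/cvg_rnormn => d d0; exists i.+1 => n ni.
  rewrite sE /series /= (bigD1_seq i) ?mem_index_iota ?iota_uniq//= big1.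
    by rewrite eb.1 eqxx scale1r addr0 subrr rnorm0.
  by move=> j ji; rewrite eb.1 eq_sym (negbTE ji) scale0r.
exists x; split=> //; apply: orthobasis_bop_eq => i; apply: orthobasis_eq => j.
rewrite bopME adjP adjK bop1E !xe !eb.1; congr (_%:R); congr (nat_of_bool _).
by apply/eqP/eqP => [/fi|->].
Qed.

(** Isometries with orthogonal ranges filling [H], that is an identification of [H] with a countable
    direct sum of copies of itself. *)
Definition split_family (w : nat -> bop H) :=
  pfam w /\ forall n, adj (w n) * w n = 1.

Lemma split_family_exists (pr : nat * nat -> nat) : injective pr ->
  (forall m, exists ij, pr ij = m) ->
  exists w : nat -> bop H, split_family w /\ forall i j, w j (e i) = e (pr (i, j)).
Proof.
move=> pi ps.
have /choice[w wP] j : exists x : bop H, (forall i, x (e i) = e (pr (i, j))) /\ adj x * x = 1.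
  by apply: (@basis_map (fun i => pr (i, j))) => i i' /pi[].
exists w; split; last by move=> i j; exact: (wP j).1.
split; last by move=> n; exact: (wP n).2.
split=> [i j ij|i|v h].
- apply: orthobasis_bop_eq => k; apply: orthobasis_eq => l.
  rewrite bopME adjP adjK (wP j).1 (wP i).1 eb.1 bop0E inner0l.
  rewrite (_ : pr (k, j) == pr (l, i) = false)//; apply/negbTE; apply: contra ij.
  by move=> /eqP/pi[_ ->].
- by rewrite -mulrA (wP i).2 mulr1.
- apply: eb.2 => m; have [[i j] <-] := ps m.
  by rewrite -(wP j).1 adjPr h inner0l.
Qed.

Lemma pfam_compose (w z : nat -> bop H) (pr : nat * nat -> nat) (un : nat -> nat * nat) :
  cancel pr un -> cancel un pr -> split_family w -> pfam z ->
  pfam (fun m => w (un m).2 * z (un m).1).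
Proof.
move=> pk uk [wF w1] zF; split => [m n mn|m|v h].
- rewrite adjM mulrA -[adj (z _) * _ * _]mulrA; have [e2|ne2] := eqVneq (un m).2 (un n).2.
    rewrite e2 w1 mulr1 (pfam_orth zF)//; apply: contra mn => /eqP e1.
    by apply/eqP; rewrite -[m]uk -[n]uk [un m]surjective_pairing e1 e2 -surjective_pairing.
  by rewrite (pfam_orth wF)// mulr0 mul0r.
- rewrite adjM !mulrA -[_ * adj (w _) * w _]mulrA w1 mulr1.
  by rewrite -[_ * adj (z _)]mulrA -mulrA (pfam_piso zF).
- apply: (pfam_total wF) => n; apply: (pfam_total zF) => i.
  by have := h (pr (i, n)); rewrite pk /= adjM.
Qed.

End SplitFamily.

(** * The predual of B(H) *)

Section Predual.
Variables (R : realType) (H : hilbertType R).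
Implicit Types (x y X : bop H) (u v w : H).

Lemma cvgn_normsq_bounded (u : nat -> H) :
  cvgn (series (fun n => `|u n| ^+ 2 : Cx R)) ->
  exists B : R, forall n, \sum_(0 <= i < n) rnorm (u i) ^+ 2 <= B.
Proof.
move=> /cvg_ex[l /cvg_rnormn/(_ _ ltr01)[N NP]].
pose s n := \sum_(0 <= i < n) rnorm (u i) ^+ 2.
have sE n : series (fun n => `|u n| ^+ 2 : Cx R) n = ((s n)%:C)%C.
  rewrite /series /= rmorph_sum /=; apply: eq_bigr => i _.
  by rewrite rnormE rmorphXn.
have smono m n : (m <= n)%N -> s m <= s n.
  move=> mn; rewrite /s (big_cat_nat (n := m) (p := n))//= lerDl sumr_ge0// => i _.
  exact: sqr_ge0.
exists (rnorm l + 1) => n.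
apply: le_trans (smono _ _ (leq_maxl n N)) _; set m := maxn n N.
have := NP m (leq_maxr _ _); rewrite sE => h.
have s0 : 0 <= s m by rewrite sumr_ge0// => i _; exact: sqr_ge0.
have : rnorm (((s m)%:C)%C : Cx R) <= rnorm l + rnorm (l - ((s m)%:C)%C).
  by rewrite rnormBC; have := rnormD l (((s m)%:C)%C - l); rewrite addrC subrK.
by rewrite rnormC_real ger0_norm//; lra.
Qed.

Lemma cvgn_normsq (u : nat -> H) (B : R) :
  (forall n, \sum_(0 <= i < n) rnorm (u i) ^+ 2 <= B) ->
  cvgn (series (fun n => `|u n| ^+ 2 : Cx R)).
Proof.
move=> uB; pose s n := \sum_(0 <= i < n) rnorm (u i) ^+ 2.
have sE : series (fun n => `|u n| ^+ 2 : Cx R) = (fun n => ((s n)%:C)%C).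
  apply/funext => n; rewrite /series /= rmorph_sum /=; apply: eq_bigr => i _.
  by rewrite rnormE rmorphXn.
have : cvgn s.
  apply: nondecreasing_is_cvgn; last by exists B => _ [n _ <-]; exact: uB.
  by apply/nondecreasing_seqP => n; rewrite /s big_nat_recr//= lerDl sqr_ge0.
move=> /cvg_ex[l /cvgrPdist_lt sl]; apply/cvg_ex; exists ((l%:C)%C); rewrite sE.
apply/cvg_rnorm => e /sl; apply: filterS => n.
by rewrite -rmorphB rnormC_real.
Qed.

Lemma predual_amp_vec z u v : pfam z -> predual setT (fun X => '[amp z X u, v]).
Proof.
move=> zF; exists (fun n => adj (z n) u), (fun n => adj (z n) v); split.
- by apply: (@cvgn_normsq _ (rnorm u ^+ 2)) => n; exact: pfam_bessel.
- by apply: (@cvgn_normsq _ (rnorm v ^+ 2)) => n; exact: pfam_bessel.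
- by move=> X _; exact: amp_series.
Qed.

Lemma predual_vec u v : predual setT (fun X : bop H => '[X u, v]).
Proof.
have b (a : H) n : \sum_(0 <= i < n) rnorm (if i == 0%N then a else 0) ^+ 2 <= rnorm a ^+ 2.
  case: n => [|n]; first by rewrite big_geq// sqr_ge0.
  rewrite big_ltn//= big_nat big1 ?addr0// => -[|i] //= _.
  by rewrite rnorm0 expr0n.
exists (fun n => if n == 0%N then u else 0), (fun n => if n == 0%N then v else 0); split.
- exact: (cvgn_normsq (b u)).
- exact: (cvgn_normsq (b v)).
- move=> X _; apply/cvg_rnormn => e e0; exists 1%N => -[|n] //= _.
  rewrite /series /= big_ltn//= big_nat big1 ?addr0 ?subrr ?rnorm0// => -[|i] //= _.
  by rewrite bop_lin0 inner0l.
Qed.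

Section WithBasis.
Variable e : nat -> H.
Hypothesis eb : orthobasis e.

Lemma split_family_sum (w : nat -> bop H) (a : nat -> H) (B : R) : split_family w ->
  (forall n, \sum_(0 <= i < n) rnorm (a i) ^+ 2 <= B) ->
  exists s : H, forall n, adj (w n) s = a n.
Proof.
move=> [wF w1] aB.
have wn n u : rnorm (w n u) = rnorm u.
  apply/eqP; rewrite -(eqrXn2 (n := 2)) ?rnorm_ge0// !rnorm_inner.
  by rewrite adjP -[adj _ _]bopME w1.
have wo i j u v : i != j -> '[w i u, w j v] = 0.
  by move=> ij; rewrite adjP -bopME (pfam_orth wF)// inner0r.
have [||l lP] := @orth_series_cvg R H (fun i => w i (a i)) B.
- by move=> i j; exact: wo.
- by move=> n; under eq_bigr do rewrite wn.
exists l => n.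
have h : series (fun i => adj (w n) (w i (a i))) @ \oo --> adj (w n) l.
  exact: cvg_series_bop.
apply: (rnorm_cvg_unique h).
apply/cvg_rnormn => d d0; exists n.+1 => m nm.
rewrite /series /= (bigD1_seq n) ?mem_index_iota ?iota_uniq//= big1.
  by rewrite addr0 -bopME w1 subrr rnorm0.
by move=> j jn; rewrite -bopME (pfam_orth wF) 1?eq_sym.
Qed.

(** The two square summable sequences defining [rho] are packed by [w] into two single vectors, so
    [rho] becomes a vector functional of an infinite amplification. *)
Lemma predual_split (w : nat -> bop H) rho : split_family w -> predual setT rho ->
  exists u v, forall X, rho X = '[amp w X u, v].
Proof.
move=> wF [a [b [/cvgn_normsq_bounded[A aA] /cvgn_normsq_bounded[B bB] abP]]].
have [u uP] := split_family_sum wF aA; have [v vP] := split_family_sum wF bB.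
exists u, v => X; apply: (rnorm_cvg_unique (V := Cx R) (abP X I)).
have := amp_series wF.1 (X := X) (u := u) (v := v).
by under [X in series X]eq_fun do rewrite uP vP.
Qed.

(** Replacing [u] by its component [un N] in the first [N] ranges costs an error that the common
    bound [C] makes uniform along the filter; on [un N] only finitely many weak limits are
    involved. *)
Lemma amp_weak_cvg {T} {F : set_system T} {FF : Filter F} (w : nat -> bop H) (f : T -> bop H)
    (x : bop H) (C : R) u v : pfam w -> 0 <= C ->
  (forall u, rnorm (x u) <= C * rnorm u) ->
  (\forall t \near F, forall u, rnorm (f t u) <= C * rnorm u) ->
  (forall u v, (fun t => '[f t u, v] : Cx R) @ F --> ('[x u, v] : Cx R)) ->
  (fun t => '[amp w (f t) u, v] : Cx R) @ F --> ('[amp w x u, v] : Cx R).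
Proof.
move=> wF C0 xC fC fx; apply/cvg_rnorm => d d0.
pose un n := \sum_(0 <= i < n) w i (adj (w i) u).
have /cvg_rnormn ul := pfam_expand wF (w := u).
have K0 : 0 < C * rnorm v + 1 by rewrite ltr_wpDl// mulr_ge0 ?rnorm_ge0.
have d3 : 0 < d / 3 / (C * rnorm v + 1) by rewrite !divr_gt0.
have [N /(_ N (leqnn N)) NP] := ul _ d3.
have ampN (y : bop H) : '[amp w y (un N), v] = \sum_(0 <= i < N) '[y (adj (w i) u), adj (w i) v].
  rewrite /un bop_lin_sum inner_suml; apply: eq_bigr => i _.
  rewrite amp_at// adjP; congr ('[_ , _]).
  have -> : adj (w i) (w i (adj (w i) u)) = adj (w i) u.
    by rewrite -!bopME -[RHS](congr1 (fun z => adj z u) (pfam_piso wF i)) !adjM adjK mulrA.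
  by [].
have tail (y : bop H) : (forall u, rnorm (y u) <= C * rnorm u) ->
    rnorm ('[amp w y u, v] - '[amp w y (un N), v] : Cx R) <= d / 3.
  move=> yC; rewrite -innerBl -bop_linB; apply: le_trans (rnorm_cs _ _) _.
  apply: le_trans (_ : _ <= C * rnorm (u - un N) * rnorm v) _.
    by rewrite ler_wpM2r ?rnorm_ge0// amp_bound.
  have : rnorm (u - un N) * (C * rnorm v + 1) <= d / 3 by rewrite -ler_pdivlMr// ltW.
  have := rnorm_ge0 (u - un N); have := rnorm_ge0 v; nra.
have mid : (fun t => '[amp w (f t) (un N), v] : Cx R) @ F --> ('[amp w x (un N), v] : Cx R).
  rewrite ampN; under eq_fun do rewrite ampN.
  by apply: cvg_sum => i _; exact: fx.
have d30 : 0 < d / 3 by rewrite divr_gt0.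
have := (@cvg_rnorm _ _ _ F FF _ _).1 mid _ d30; apply: filterS2 fC => t ft tm.
have h1 := tail _ xC; have h2 := tail _ ft.
rewrite (_ : '[amp w x u, v] - '[amp w (f t) u, v] = ('[amp w x u, v] - '[amp w x (un N), v])
  + ('[amp w x (un N), v] - '[amp w (f t) (un N), v])
  - ('[amp w (f t) u, v] - '[amp w (f t) (un N), v])); last by ring.
apply: le_lt_trans (rnormB _ _) _; have := rnormD ('[amp w x u, v] - '[amp w x (un N), v])
  ('[amp w x (un N), v] - '[amp w (f t) (un N), v]); lra.
Qed.

(** On bounded sets the weak operator topology and the sigma-weak topology agree. *)
Lemma predual_cvg {T} {F : set_system T} {FF : Filter F} (f : T -> bop H)
    (x : bop H) (C : R) rho : predual setT rho -> 0 <= C ->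
  (forall u, rnorm (x u) <= C * rnorm u) ->
  (\forall t \near F, forall u, rnorm (f t u) <= C * rnorm u) ->
  (forall u v, (fun t => '[f t u, v] : Cx R) @ F --> ('[x u, v] : Cx R)) ->
  (fun t => rho (f t)) @ F --> rho x.
Proof.
move=> rP C0 xC fC fx.
have [pr pi ps] := nat_pairing.
have [w [wF _]] := split_family_exists eb pi ps.
have [u [v uv]] := predual_split wF rP.
rewrite uv; under eq_fun do rewrite uv.
exact: (amp_weak_cvg wF.1 C0 xC fC fx).
Qed.

(** Multiplicativity comes from the centrality of the initial projections, which on B(H) makes each
    [z i] either an isometry or zero. *)
Lemma amp_endo (z : nat -> bop H) : pfam z ->
  (forall i X, X * (adj (z i) * z i) = (adj (z i) * z i) * X) ->
  normal_unital_endo setT (amp z).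
Proof.
move=> zF zc; split.
- by [].
- by move=> c x y _ _; exact: amp_linear.
- by move=> x y _ _; exact: amp_mul.
- by move=> x _; exact: amp_adj.
- exact: amp1.
- move=> rho rP.
  have [pr pi ps] := nat_pairing; have [un uk] := choice ps.
  have pk : cancel pr un by move=> ij; apply: pi; rewrite uk.
  have [w [wF _]] := split_family_exists eb pi ps.
  have yF := pfam_compose pk uk wF zF.
  have [u [v uv]] := predual_split wF rP.
  (* Normality: [rho] is a vector functional of [amp w], and [amp w \o amp z] is again an
     amplification, along the products of the two families. *)
  suff -> : rho \o amp z = (fun X => '[amp (fun m => w (un m).2 * z (un m).1) X u, v]).
    exact: predual_amp_vec.
  apply/funext => X /=; rewrite uv.
  suff -> : amp w (amp z X) = amp (fun m => w (un m).2 * z (un m).1) X by [].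
  apply: amp_unique => // m.
  rewrite mulrA (amp_inter wF.1); last by rewrite wF.2 mulr1 mul1r.
  by rewrite -mulrA (amp_inter zF)// mulrA.
Qed.

End WithBasis.
End Predual.

(** * Normal endomorphisms and intertwiners *)

Section Endomorphisms.
Variables (R : realType) (H : hilbertType R).
Implicit Types (x y X A B : bop H) (u v w g : H) (c : Cx R).

(** For [theta = alpha t] this is the fibre at [t] of Arveson's product system. *)
Definition intw (theta : bop H -> bop H) : set (bop H) :=
  [set T | forall x, theta x * T = T * x].

Section OneEndo.
Variable theta : bop H -> bop H.
Hypothesis tE : normal_unital_endo setT theta.

Lemma endo0 : theta 0 = 0.
Proof.
have := endo_linear tE (-1) (x := 0) (y := 0) I I.
by rewrite scaler0 addr0 scaleN1r addNr.
Qed.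

Lemma endoD x y : theta (x + y) = theta x + theta y.
Proof. by have := endo_linear tE 1 (x := x) (y := y) I I; rewrite !scale1r. Qed.

Lemma endoZ c x : theta (c *: x) = c *: theta x.
Proof. by have := endo_linear tE c (x := x) (y := 0) I I; rewrite endo0 !addr0. Qed.

Lemma endoN x : theta (- x) = - theta x.
Proof. by rewrite -scaleN1r endoZ scaleN1r. Qed.

Lemma endoB x y : theta (x - y) = theta x - theta y.
Proof. by rewrite endoD endoN. Qed.

Lemma endo_sum I (r : seq I) (P : pred I) (F : I -> bop H) :
  theta (\sum_(i <- r | P i) F i) = \sum_(i <- r | P i) theta (F i).
Proof. by elim/big_rec2: _ => [|i y1 y2 _ <-]; rewrite ?endo0 ?endoD. Qed.

Lemma endoM x y : theta (x * y) = theta x * theta y.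
Proof. exact: (endo_mul tE). Qed.

Lemma endoJ x : theta (adj x) = adj (theta x).
Proof. exact: (endo_adj tE). Qed.

(** [C^2 - x^* x] has a positive square root, and [theta] sends the square of that root to a
    positive operator. *)
Lemma endo_bound x (C : R) : 0 <= C -> (forall u, rnorm (x u) <= C * rnorm u) ->
  forall u, rnorm (theta x u) <= C * rnorm u.
Proof.
move=> C0 xC u.
have p : pos_op (((C ^+ 2)%:C)%C *: (1 : bop H) - adj x * x).
  move=> v; rewrite bopBE bopZE bop1E innerBl innerZl bopME -adjPr !inner_rnorm.
  rewrite -rmorphM -rmorphB /= ler0c subr_ge0 -exprMn ler_sqr ?nnegrE ?rnorm_ge0//.
  by rewrite mulr_ge0 ?rnorm_ge0.
have [s [s0 ss _]] := sqrt_exists p.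
have := inner_ge0 (theta s u).
rewrite adjP -endoJ (pos_op_adj s0) -bopME -endoM ss.
rewrite endoB endoZ (endo_one tE) endoM endoJ bopBE bopZE bop1E bopME innerBr.
rewrite innerZr -adjP !inner_rnorm conj_Creal ?realX ?realE ?ler0c ?sqr_ge0//.
rewrite -rmorphM -rmorphB /= ler0c subr_ge0 -exprMn ler_sqr ?nnegrE ?rnorm_ge0//.
by rewrite mulr_ge0 ?rnorm_ge0.
Qed.

Lemma endo_pos_eq0 x u : theta (adj x * x) u = 0 -> theta x u = 0.
Proof.
rewrite endoM endoJ bopME => h; apply/eqP; rewrite -inner_eq0 adjP h inner0r.
by [].
Qed.

Lemma itw_exists e0 g : exists V : bop H, forall u, V u = theta (rk1 u e0) g.
Proof.
have b u : rnorm (theta (rk1 u e0) g) <= (rnorm e0 * rnorm g) * rnorm u.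
  rewrite mulrC mulrA; apply: endo_bound.
    by rewrite mulr_ge0 ?rnorm_ge0.
  by move=> v; exact: rk1_bound.
have [|V VP] := bop_of_rbound _ b; last by exists V.
by move=> c u v; rewrite rk1Dl rk1Zl endoD endoZ.
Qed.

(** An intertwiner [A] satisfies [A u = theta |u><e0| (A e0)] for a unit vector [e0], so this
    construction reaches all of them: evaluation at [e0] identifies the intertwiners with the range
    of [theta |e0><e0|]. *)
Definition itw e0 g : bop H := projT1 (cid (itw_exists e0 g)).

Lemma itwE e0 g u : itw e0 g u = theta (rk1 u e0) g.
Proof. by rewrite /itw; case: cid. Qed.

Lemma itw_intw e0 g : intw theta (itw e0 g).
Proof. by move=> x; apply: bopP => u; rewrite !bopME !itwE -mul_rk1 endoM. Qed.

Lemma itw_unit e0 g : theta (rk1 e0 e0) g = g -> itw e0 g e0 = g.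
Proof. by move=> h; rewrite itwE h. Qed.

Lemma intwP c A B : intw theta A -> intw theta B -> intw theta (c *: A + B).
Proof. by move=> AE BE x; rewrite mulrDr mulrDl bopZAl bopZAr AE BE. Qed.

Lemma intw0 : intw theta 0.
Proof. by move=> x; rewrite mulr0 mul0r. Qed.

Lemma intwZ c A : intw theta A -> intw theta (c *: A).
Proof. by move=> AE; rewrite -[c *: A]addr0; apply: intwP => //; exact: intw0. Qed.

Lemma intwE x A u : intw theta A -> theta x (A u) = A (x u).
Proof. by move=> AE; rewrite -!bopME AE. Qed.

Section UnitVector.
Variable e0 : H.
Hypothesis e1 : '[e0, e0] = 1.

Lemma intw_fix A : intw theta A -> theta (rk1 e0 e0) (A e0) = A e0.
Proof. by move=> AE; rewrite intwE// rk1E e1 scale1r. Qed.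

Lemma intw_at A u : intw theta A -> A u = theta (rk1 u e0) (A e0).
Proof. by move=> AE; rewrite intwE// rk1E e1 scale1r. Qed.

(** Moving [theta |v><e0|] to the other side leaves [theta] of the product of |e0><v| and |u><e0|,
    which is ['[u, v]] times |e0><e0|. This is Arveson's inner product on intertwiners. *)
Lemma intw_inner A B u v : intw theta A -> intw theta B ->
  '[A u, B v] = '[u, v] * '[A e0, B e0].
Proof.
move=> AE BE; rewrite (intw_at u AE) (intw_at v BE) adjPr -bopME -endoJ -endoM adj_rk1 rk1M.
by rewrite endoZ bopZE innerZl intw_fix.
Qed.

Lemma intw_adjM A B : intw theta A -> intw theta B ->
  adj B * A = '[A e0, B e0] *: (1 : bop H).
Proof.
move=> AE BE; apply: bopP => u; apply: inner_eql => v.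
by rewrite bopME -adjPr intw_inner// bopZE innerZl bop1E mulrC.
Qed.

Lemma intw_rnorm A u : intw theta A -> rnorm (A u) = rnorm u * rnorm (A e0).
Proof.
move=> AE; apply/eqP; rewrite -(eqrXn2 (n := 2)) ?mulr_ge0 ?rnorm_ge0//; apply/eqP.
by apply: (@complexI R); rewrite -inner_rnorm intw_inner// exprMn rmorphM /= -!inner_rnorm.
Qed.

Lemma intw_eq A B : intw theta A -> intw theta B -> A e0 = B e0 -> A = B.
Proof. by move=> AE BE AB; apply: bopP => u; rewrite (intw_at u AE) AB -intw_at. Qed.

Lemma intw_neq0 A : intw theta A -> A e0 = 0 -> A = 0.
Proof. by move=> AE A0; apply: intw_eq => //; exact: intw0. Qed.

End UnitVector.

Section WithBasis.
Variable e : nat -> H.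
Hypothesis eb : orthobasis e.

Lemma endo_weak_cvg {T} {F : set_system T} {FF : Filter F} (f : T -> bop H)
    (x : bop H) (C : R) u v : 0 <= C ->
  (forall u, rnorm (x u) <= C * rnorm u) ->
  (\forall t \near F, forall u, rnorm (f t u) <= C * rnorm u) ->
  (forall u v, (fun t => '[f t u, v] : Cx R) @ F --> ('[x u, v] : Cx R)) ->
  (fun t => '[theta (f t) u, v] : Cx R) @ F --> ('[theta x u, v] : Cx R).
Proof.
move=> C0 xC fC fx.
exact: (predual_cvg eb (endo_normal tE (predual_vec u v)) C0 xC fC fx).
Qed.

Definition fproj n : bop H := \sum_(0 <= i < n) rk1 (e i) (e i).

Lemma fprojE n w : fproj n w = series (fun i => '[w, e i] *: e i) n.
Proof. by rewrite /fproj bop_sumE. Qed.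

Lemma fproj_cvg w : (fun n => fproj n w) @ \oo --> w.
Proof. under eq_fun do rewrite fprojE; exact: orthobasis_expand. Qed.

Lemma fproj_bound n w : rnorm (fproj n w) <= rnorm w.
Proof.
rewrite -(ler_pXn2r (n := 2)) ?nnegrE ?rnorm_ge0// fprojE /series /= rnorm_sum_sqr.
  apply: le_trans (orthobasis_bessel n w eb); apply: ler_sum => i _.
  by rewrite rnormZ orthobasis_rnorm// mulr1.
by move=> i j ij; rewrite innerZl innerZr eb.1 (negbTE ij) !mulr0.
Qed.

(** Normality enters here: [theta] of the finite rank projections [fproj n] converges weakly to
    [theta 1 = 1]. *)
Lemma endo_total w : (forall i, theta (rk1 (e i) (e i)) w = 0) -> w = 0.
Proof.
move=> h; apply/eqP; rewrite -inner_eq0; apply/eqP.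
have c : (fun n => '[theta (fproj n) w, w] : Cx R) @ \oo --> ('[theta 1 w, w] : Cx R).
  apply: (@endo_weak_cvg nat \oo _ fproj 1 1) => //.
  - by move=> u; rewrite mul1r.
  - by near=> n => u; rewrite mul1r fproj_bound.
  - by move=> u v; apply: cvg_innerl; exact: fproj_cvg.
rewrite (endo_one tE) bop1E in c.
apply: (rnorm_cvg_unique (V := Cx R) c).
rewrite [X in X @ _](_ : _ = fun=> 0); first exact: cvg_cst.
apply/funext => n; rewrite endo_sum bop_sumE inner_suml big1// => i _.
by rewrite h inner0l.
Unshelve. all: by end_near. Qed.

(** The [g i] form an orthonormal basis of the range of [theta |e0><e0|], up to zeros. The
    intertwiners they generate have orthogonal ranges, and these are total by [endo_total]. *)
Lemma endo_amp : separable_space H -> exists g : nat -> H,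
  [/\ ortho01 g, pfam (fun i => itw (e 0%N) (g i)),
     forall i, theta (rk1 (e 0%N) (e 0%N)) (g i) = g i
   & forall x, theta x = amp (fun i => itw (e 0%N) (g i)) x].
Proof.
move=> Hsep; set p := theta (rk1 (e 0%N) (e 0%N)).
have e1 : '[e 0%N, e 0%N] = 1 by rewrite eb.1.
have pp : p * p = p by rewrite -endoM rk1M e1 scale1r.
have pa : adj p = p by rewrite -endoJ adj_rk1.
have [g [go gp gt]] := ortho01_exists Hsep p.
have pg i : p (g i) = g i by have [u ->] := gp i; rewrite -bopME pp.
have VE i := itw_intw (e 0%N) (g i).
have V0 i : itw (e 0%N) (g i) (e 0%N) = g i by exact: itw_unit.
have VF : pfam (fun i => itw (e 0%N) (g i)).
  split.
  - move=> i j ij; rewrite (intw_adjM e1)// !V0 go.1 1?eq_sym// scale0r.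
    by [].
  - move=> i; rewrite -mulrA (intw_adjM e1)// V0 bopZAr mulr1.
    apply: (intw_eq e1) => //; first exact: intwZ.
    by rewrite bopZE V0 ortho01_idem.
  - move=> w h; apply: endo_total => i; apply: endo_pos_eq0.
    have -> : adj (rk1 (e i) (e i)) * rk1 (e i) (e i) =
        adj (rk1 (e 0%N) (e i)) * rk1 (e 0%N) (e i).
      by rewrite !adj_rk1 !rk1M !eb.1 !eqxx.
    rewrite endoM endoJ bopME.
    suff -> : theta (rk1 (e 0%N) (e i)) w = 0 by rewrite bop_lin0.
    have q : p (theta (rk1 (e 0%N) (e i)) w) = theta (rk1 (e 0%N) (e i)) w.
      by rewrite -bopME -endoM rk1M e1 scale1r.
    rewrite -q -pa; apply: gt => j.
    rewrite adjP -endoJ adj_rk1 -itwE innerC adjP h.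
    by rewrite inner0r conjC0.
exists g; split=> // x; apply: amp_unique => // i.
exact: VE.
Qed.

(** Since [x |k><k0|] is again of the form |k'><k0|, the difference [theta x - theta' x] kills the
    range of every [theta |k><k0|], and these ranges are total. *)
Lemma endo_eq (k0 : H) (theta' : bop H -> bop H) : '[k0, k0] = 1 ->
  normal_unital_endo setT theta' ->
  (forall k, theta (rk1 k k0) = theta' (rk1 k k0)) -> forall x, theta x = theta' x.
Proof.
move=> k1 tE' h x; apply/eqP; rewrite -subr_eq0; apply/eqP.
set d := theta x - theta' x.
have dk k : d * theta (rk1 k k0) = 0.
  have M' := (endo_mul tE' (x := x) (y := rk1 k k0) I I).
  by rewrite /d mulrBl -endoM mul_rk1 [in X in _ - X]h -M' mul_rk1 h subrr.
apply: bopP => w; apply: inner_eql => v; rewrite bop0E inner0l adjP.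
suff -> : adj d v = 0 by rewrite inner0r.
apply: endo_total => i; apply: inner_eql => u; rewrite inner0l adjP -endoJ adj_rk1 adjP adjK.
rewrite -bopME.
have -> : rk1 (e i) (e i) = rk1 (e i) k0 * adj (rk1 (e i) k0).
  by rewrite adj_rk1 rk1M k1 scale1r.
by rewrite endoM mulrA dk mul0r bop0E inner0r.
Qed.

End WithBasis.
End OneEndo.

Lemma intwM (theta theta' : bop H -> bop H) A B : intw theta A -> intw theta' B ->
  intw (theta \o theta') (A * B).
Proof. by move=> AE BE x /=; rewrite mulrA AE -mulrA BE mulrA. Qed.

End Endomorphisms.

(** * The tensor product with the conjugate space *)

Section Tensor.
Variables (R : realType) (H K : hilbertType R).
Implicit Types (x y z : bop H) (u v w : H) (k : K) (c : Cx R).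

(* [K] is the tensor product of [H] with its conjugate space, [tau u v] being
   |u><v|; [tau] is therefore conjugate-linear in its second argument. *)
Record tensor (tau : H -> H -> K) : Prop := {
  tau_linl : forall c u u' v, tau (c *: u + u') v = c *: tau u v + tau u' v;
  tau_linr : forall c u v v', tau u (c *: v + v') = c^* *: tau u v + tau u v';
  tau_inner : forall u v u' v', '[tau u v, tau u' v'] = '[u, u'] * '[v', v];
  tau_total : forall k, (forall u v, '[k, tau u v] = 0) -> k = 0 }.

Section Tau.
Variable tau : H -> H -> K.
Hypothesis tT : tensor tau.

Lemma tau0l v : tau 0 v = 0.
Proof. by have := tau_linl tT (-1) 0 0 v; rewrite scaler0 addr0 scaleN1r addNr. Qed.
Lemma tau0r u : tau u 0 = 0.
Proof.
by have := tau_linr tT (-1) u 0 0; rewrite scaler0 addr0 rmorphN rmorph1 scaleN1r addNr.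
Qed.
Lemma tauDl u u' v : tau (u + u') v = tau u v + tau u' v.
Proof. by have := tau_linl tT 1 u u' v; rewrite !scale1r. Qed.
Lemma tauDr u v v' : tau u (v + v') = tau u v + tau u v'.
Proof. by have := tau_linr tT 1 u v v'; rewrite rmorph1 !scale1r. Qed.
Lemma tauZl c u v : tau (c *: u) v = c *: tau u v.
Proof. by have := tau_linl tT c u 0 v; rewrite tau0l !addr0. Qed.
Lemma tauZr c u v : tau u (c *: v) = c^* *: tau u v.
Proof. by have := tau_linr tT c u v 0; rewrite tau0r !addr0. Qed.
Lemma tauNl u v : tau (- u) v = - tau u v.
Proof. by rewrite -scaleN1r tauZl scaleN1r. Qed.
Lemma tauNr u v : tau u (- v) = - tau u v.
Proof. by rewrite -scaleN1r tauZr rmorphN rmorph1 scaleN1r. Qed.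
Lemma tauBl u u' v : tau (u - u') v = tau u v - tau u' v.
Proof. by rewrite tauDl tauNl. Qed.
Lemma tauBr u v v' : tau u (v - v') = tau u v - tau u v'.
Proof. by rewrite tauDr tauNr. Qed.

Lemma tau_rnorm u v : rnorm (tau u v) = rnorm u * rnorm v.
Proof.
apply/eqP; rewrite -(eqrXn2 (n := 2)) ?mulr_ge0 ?rnorm_ge0//; apply/eqP.
by apply: (@complexI R); rewrite -inner_rnorm (tau_inner tT) exprMn rmorphM /= -!inner_rnorm.
Qed.

Lemma tau_cvg {T} {F : set_system T} {FF : ProperFilter F} (f g : T -> H) u v :
  f @ F --> u -> g @ F --> v -> (fun t => tau (f t) (g t)) @ F --> tau u v.
Proof.
move=> fu gv; pose h t := rnorm (u - f t) * rnorm (g t) + rnorm u * rnorm (v - g t).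
have hc : h @ F --> rnorm (u - u) * rnorm v + rnorm u * rnorm (v - v).
  apply: cvgD; apply: cvgM.
  - by apply: cvg_rnormr; apply: cvgB => //; exact: cvg_cst.
  - exact: cvg_rnormr.
  - exact: cvg_cst.
  - by apply: cvg_rnormr; apply: cvgB => //; exact: cvg_cst.
rewrite !subrr !rnorm0 mul0r mulr0 addr0 in hc.
apply: cvg0_rnorm_le hc; near=> t.
have -> : tau u v - tau (f t) (g t) = tau (u - f t) (g t) + tau u (v - g t).
  by rewrite tauBl tauBr [RHS]addrC addrA subrK.
by apply: le_trans (rnormD _ _) _; rewrite !tau_rnorm.
Unshelve. all: by end_near. Qed.

Lemma op_exists k : exists y : bop H, forall u v, '[y v, u] = '[k, tau u v].
Proof.
have /choice[s sP] v : exists s : H, forall u, '[tau u v, k] = '[u, s].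
  apply: (@riesz R H (fun u => '[tau u v, k]) (`|v| * `|k|)).
  - by move=> c u u'; rewrite (tau_linl tT) innerDl innerZl.
  - by rewrite mulr_ge0.
  - move=> u; apply: le_trans (cauchy_schwarz _ _) _.
    by rewrite (rnormE (tau _ _)) tau_rnorm rmorphM /= -!rnormE [X in X * _]mulrC mulrAC.
have [|u|y yP] := @bop_of_rbound R H s (rnorm k).
- move=> c v v'; apply: inner_eqr => u.
  by rewrite -sP (tau_linr tT) innerDl innerZl innerDr innerZr -!sP.
- have [->|su] := eqVneq (s u) 0; first by rewrite rnorm0 mulr_ge0 ?rnorm_ge0.
  rewrite -rnorm_gt0 in su; rewrite -(ler_pM2l su) -expr2 rnorm_inner -sP.
  apply: le_trans (ler_Re_rnorm _) _; apply: le_trans (rnorm_cs _ _) _.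
  by rewrite tau_rnorm -mulrA ler_wpM2l ?rnorm_ge0// mulrC.
by exists y => u v; rewrite yP innerC -sP -innerC.
Qed.

(** The Hilbert-Schmidt operator corresponding to the vector [k]. It is recovered from the abstract
    tensor structure, where [K] is not itself a space of operators. *)
Definition op k : bop H := projT1 (cid (op_exists k)).

Lemma opP k u v : '[op k v, u] = '[k, tau u v].
Proof. by rewrite /op; case: cid. Qed.

Lemma op_eqP k (y : bop H) : (forall u v, '[y v, u] = '[k, tau u v]) -> op k = y.
Proof. by move=> h; apply: bopP => v; apply: inner_eql => u; rewrite opP h. Qed.

Lemma op_linear c k k' : op (c *: k + k') = c *: op k + op k'.
Proof. by apply: op_eqP => u v; rewrite /= !innerDl !innerZl !opP. Qed.

Lemma op0 : op 0 = 0.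
Proof. by apply: op_eqP => u v; rewrite !inner0l. Qed.

Lemma opD k k' : op (k + k') = op k + op k'.
Proof. by have := op_linear 1 k k'; rewrite !scale1r. Qed.

Lemma opZ c k : op (c *: k) = c *: op k.
Proof. by have := op_linear c k 0; rewrite op0 !addr0. Qed.

Lemma opB k k' : op (k - k') = op k - op k'.
Proof. by rewrite opD -scaleN1r opZ scaleN1r. Qed.

Lemma op_inj k k' : op k = op k' -> k = k'.
Proof.
move=> kk; apply/eqP; rewrite -subr_eq0; apply/eqP; apply: (tau_total tT) => u v.
by rewrite -opP opB kk subrr inner0l.
Qed.

Lemma op_tau u v : op (tau u v) = rk1 u v.
Proof. by apply: op_eqP => u' v'; rewrite rk1E innerZl (tau_inner tT) mulrC. Qed.

Lemma op_bound k v : rnorm (op k v) <= rnorm k * rnorm v.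
Proof.
have [->|h] := eqVneq (op k v) 0; first by rewrite rnorm0 mulr_ge0 ?rnorm_ge0.
rewrite -rnorm_gt0 in h; rewrite -(ler_pM2l h) -expr2 rnorm_inner opP.
apply: le_trans (ler_Re_rnorm _) _; apply: le_trans (rnorm_cs _ _) _.
by rewrite tau_rnorm mulrCA.
Qed.

Lemma tau_bop_eq (X Y : bop K) : (forall u v, X (tau u v) = Y (tau u v)) -> X = Y.
Proof.
move=> h; apply/eqP; rewrite -subr_eq0 -[X - Y]adjK; apply/eqP.
rewrite -[RHS]adj0; congr adj; apply: bopP => k; rewrite bop0E; apply: (tau_total tT) => u v.
by rewrite adjP adjK bopBE h subrr inner0r.
Qed.

Lemma tau_lspan_dense : norm_dense (lspan [set tau p.1 p.2 | p in [set: H * H]]).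
Proof.
apply: lspan_dense => k h; apply: (tau_total tT) => u v.
by rewrite innerC h ?conjC0//; exists (u, v).
Qed.

Section TauBasis.
Variable e : nat -> H.
Hypothesis eb : orthobasis e.

Let tau_orth (a : nat -> H) i j : i != j -> '[tau (a i) (e i), tau (a j) (e j)] = 0.
Proof. by move=> ij; rewrite (tau_inner tT) eb.1 eq_sym (negbTE ij) mulr0. Qed.

Lemma op_bessel k n : \sum_(0 <= j < n) rnorm (op k (e j)) ^+ 2 <= rnorm k ^+ 2.
Proof.
pose s := \sum_(0 <= j < n) tau (op k (e j)) (e j).
have sE : rnorm s ^+ 2 = \sum_(0 <= j < n) rnorm (op k (e j)) ^+ 2.
  rewrite rnorm_sum_sqr; last exact: (tau_orth (fun j => op k (e j))).
  by apply: eq_bigr => j _; rewrite tau_rnorm orthobasis_rnorm// mulr1.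
have ks : '[k, s] = '[s, s].
  rewrite inner_rnorm sE rmorph_sum [in LHS]/s inner_sumr; apply: eq_bigr => j _.
  by rewrite -opP inner_rnorm.
rewrite -sE; have -> : rnorm k ^+ 2 = rnorm (k - s) ^+ 2 + rnorm s ^+ 2.
  by rewrite -rnormDsqr ?subrK// innerBl ks subrr.
by rewrite lerDr sqr_ge0.
Qed.

(** Converse of [op_bessel]: an operator with finite Hilbert-Schmidt norm comes from a vector, the
    orthogonal sum of the |x e_j><e_j|. *)
Lemma vec_exists x (B : R) :
  (forall n, \sum_(0 <= j < n) rnorm (x (e j)) ^+ 2 <= B) ->
  exists k, [/\ op k = x, rnorm k ^+ 2 <= B &
    series (fun j => tau (x (e j)) (e j)) @ \oo --> k].
Proof.
move=> xB; have [||l lP] := @orth_series_cvg R K (fun j => tau (x (e j)) (e j)) B.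
- exact: (tau_orth (fun j => x (e j))).
- by move=> n; under eq_bigr do rewrite tau_rnorm orthobasis_rnorm// mulr1.
exists l; split=> //.
  apply: (orthobasis_bop_eq eb) => i; apply: inner_eql => u; rewrite opP.
  apply: (rnorm_cvg_unique (V := Cx R) (cvg_series_innerl (w := tau u (e i)) lP)).
  apply/cvg_rnormn => d d0; exists i.+1 => n ni.
  rewrite /series /= (bigD1_seq i) ?mem_index_iota ?iota_uniq//= big1.
    by rewrite (tau_inner tT) eb.1 eqxx mulr1 addr0 subrr rnorm0.
  by move=> j ji; rewrite (tau_inner tT) eb.1 eq_sym (negbTE ji) mulr0.
have B0 : 0 <= B by have := xB 0%N; rewrite big_geq.
have : rnorm l <= Num.sqrt B.
  apply: (cvg_rnorm_le lP); near=> n.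
  rewrite -(ler_pXn2r (n := 2)) ?nnegrE ?rnorm_ge0 ?sqrtr_ge0// sqr_sqrtr//.
  rewrite /series /= rnorm_sum_sqr; last exact: (tau_orth (fun j => x (e j))).
  by under eq_bigr do rewrite tau_rnorm orthobasis_rnorm// mulr1.
by rewrite -(ler_pXn2r (n := 2)) ?nnegrE ?rnorm_ge0 ?sqrtr_ge0// sqr_sqrtr.
Unshelve. all: by end_near. Qed.

Lemma op_expand k : series (fun j => tau (op k (e j)) (e j)) @ \oo --> k.
Proof. by have [l [/op_inj -> _]] := vec_exists (op_bessel k). Qed.

Lemma op_rnorm_cvg k : series (fun j => rnorm (op k (e j)) ^+ 2) @ \oo --> rnorm k ^+ 2.
Proof.
have h : (fun n => rnorm (series (fun j => tau (op k (e j)) (e j)) n)) @ \oo --> rnorm k.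
  by apply: cvg_rnormr; exact: op_expand.
rewrite [series _](_ : _ =
    (fun n => rnorm (series (fun j => tau (op k (e j)) (e j)) n) ^+ 2)).
  by rewrite expr2; under eq_fun do rewrite expr2; exact: cvgM.
apply/funext => n; rewrite /series /= rnorm_sum_sqr.
  by apply: eq_bigr => j _; rewrite tau_rnorm orthobasis_rnorm// mulr1.
exact: (tau_orth (fun j => op k (e j))).
Qed.

Lemma lmul_exists x : exists X : bop K, forall u v, X (tau u v) = tau (x u) v.
Proof.
have [C C0 xC] := bop_rbound x.
have /choice[f fP] k : exists l, op l = x * op k /\ rnorm l <= C * rnorm k.
  have [n|l [lx lC _]] := @vec_exists (x * op k) ((C * rnorm k) ^+ 2).
    rewrite exprMn; apply: le_trans (_ : _ <= C ^+ 2 * \sum_(0 <= j < n) rnorm (op k (e j)) ^+ 2) _.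
      rewrite mulr_sumr; apply: ler_sum => j _; rewrite -exprMn.
      by rewrite ler_sqr ?nnegrE ?mulr_ge0 ?rnorm_ge0 ?(ltW C0)//; exact: xC.
    by rewrite ler_pM2l ?exprn_gt0// op_bessel.
  exists l; split=> //.
  by move: lC; rewrite ler_sqr ?nnegrE ?mulr_ge0 ?rnorm_ge0 ?(ltW C0).
have [||X XP] := @bop_of_rbound R K f C.
- move=> c k k'; apply: op_inj; rewrite op_linear !(fP _).1 op_linear.
  by rewrite mulrDr bopZAr.
- by move=> k; exact: (fP k).2.
exists X => u v; apply: op_inj; rewrite XP (fP _).1 !op_tau mul_rk1.
by [].
Qed.

(** On Hilbert-Schmidt operators the flip is the adjoint; the terms |e_j><op k e_j| of its series
    are orthogonal with square summable norms. *)
Lemma flip_exists : exists J : K -> K, antiunitary J /\ forall u v, J (tau u v) = tau v u.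
Proof.
have /choice[f fP] k : exists l, op l = adj (op k) /\
    series (fun j => tau (e j) (op k (e j))) @ \oo --> l.
  have orth i j : i != j -> '[tau (e i) (op k (e i)), tau (e j) (op k (e j))] = 0.
    by move=> ij; rewrite (tau_inner tT) eb.1 (negbTE ij) mul0r.
  have [|n|l lP] := @orth_series_cvg R K (fun j => tau (e j) (op k (e j))) (rnorm k ^+ 2).
  - exact: orth.
  - by under eq_bigr do rewrite tau_rnorm orthobasis_rnorm// mul1r; exact: op_bessel.
  exists l; split=> //; apply: op_eqP => u v.
  apply: (rnorm_cvg_unique (V := Cx R) (parseval (u := adj (op k) v) (v := u) eb)).
  have := cvg_series_innerl (w := tau u v) lP.
  rewrite [X in series X](_ : _ = (fun i => '[adj (op k) v, e i] * '[e i, u])) //.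
  by apply/funext => i; rewrite (tau_inner tT) mulrC [in RHS]adjP adjK.
have ff k : f (f k) = k by apply: op_inj; rewrite !(fP _).1 adjK.
have ftau u v : f (tau u v) = tau v u.
  by apply: op_inj; rewrite (fP _).1 !op_tau adj_rk1.
exists f; split=> //; split.
- move=> c k k'; apply: op_inj; rewrite op_linear !(fP _).1 op_linear adjD adjZ.
  by [].
- move=> k k'.
  apply: (rnorm_cvg_unique (V := Cx R) (cvg_series_innerr (w := f k) (fP k').2)).
  have := cvg_series_innerl (w := k) (op_expand (k := k')).
  rewrite [X in series X](_ : _ = (fun j => '[f k, tau (e j) (op k' (e j))])) //.
  by apply/funext => j; rewrite innerC -!opP (fP k).1 -innerC [RHS]adjP adjK.
- by move=> k; exists (f k).
Qed.

Lemma antiunitary_rnorm (J : K -> K) k : antiunitary J -> rnorm (J k) = rnorm k.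
Proof.
move=> Ja; apply/eqP; rewrite -(eqrXn2 (n := 2)) ?rnorm_ge0//.
by rewrite !rnorm_inner (antiunitary_inner Ja).
Qed.

(** The flip exchanges the two legs, so the action of [y] on the second leg is a conjugate of left
    multiplication. *)
Lemma tens_exists x y : exists Z : bop K, forall u v, Z (tau u v) = tau (x u) (y v).
Proof.
have [J [Ja Jt]] := flip_exists.
have [X XP] := lmul_exists x; have [Y YP] := lmul_exists y.
have [C C0 YC] := bop_rbound Y.
have [||Z ZP] := @bop_of_rbound R K (fun k => J (Y (J k))) C.
- move=> c k k'; rewrite (antiunitary_linear Ja) bop_linD bop_linZ (antiunitary_linear Ja).
  by rewrite conjCK.
- by move=> k; rewrite (antiunitary_rnorm _ Ja) -(antiunitary_rnorm k Ja) YC.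
by exists (X * Z) => u v; rewrite bopME ZP Jt YP Jt XP.
Qed.

End TauBasis.

End Tau.

(** On Hilbert-Schmidt operators this is [k |-> x k y^*]; it is therefore conjugate-linear in
    [y]. *)
Definition tens (tau : H -> H -> K) x y : bop K :=
  xget 0 [set Z : bop K | forall u v, Z (tau u v) = tau (x u) (y v)].

Section Tens.
Variables (tau : H -> H -> K) (e : nat -> H).
Hypotheses (tT : tensor tau) (eb : orthobasis e).

Lemma tensE x y u v : tens tau x y (tau u v) = tau (x u) (y v).
Proof.
pose S := [set Z : bop K | forall u v, Z (tau u v) = tau (x u) (y v)].
have /(@xgetPex _ 0 S) : exists Z, S Z by exact: (tens_exists tT eb).
exact.
Qed.

Lemma tens_eq x y (Z : bop K) : (forall u v, Z (tau u v) = tau (x u) (y v)) ->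
  tens tau x y = Z.
Proof. by move=> h; apply: (tau_bop_eq tT) => u v; rewrite tensE h. Qed.

Lemma tensM x y x' y' : tens tau x y * tens tau x' y' = tens tau (x * x') (y * y').
Proof. by apply/esym/tens_eq => u v; rewrite bopME !tensE. Qed.

Lemma tens11 : tens tau 1 1 = 1.
Proof. exact: tens_eq. Qed.

Lemma tensJ x y : adj (tens tau x y) = tens tau (adj x) (adj y).
Proof.
apply/esym/tens_eq => u v; apply: inner_eqr => k.
have : adj (tens tau x y) (tau u v) = tau (adj x u) (adj y v); last by move=> ->.
apply/eqP; rewrite -subr_eq0; apply/eqP; apply: (tau_total tT) => u' v'.
by rewrite innerBl -adjPr tensE !(tau_inner tT) -adjPr -adjP subrr.
Qed.

Lemma tensDl x x' y : tens tau (x + x') y = tens tau x y + tens tau x' y.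
Proof. by apply: tens_eq => u v; rewrite bopDE !tensE bopDE (tauDl tT). Qed.
Lemma tensDr x y y' : tens tau x (y + y') = tens tau x y + tens tau x y'.
Proof. by apply: tens_eq => u v; rewrite bopDE !tensE bopDE (tauDr tT). Qed.
Lemma tensZl c x y : tens tau (c *: x) y = c *: tens tau x y.
Proof. by apply: tens_eq => u v; rewrite bopZE tensE bopZE (tauZl tT). Qed.
Lemma tensZr c x y : tens tau x (c *: y) = c^* *: tens tau x y.
Proof. by apply: tens_eq => u v; rewrite bopZE tensE bopZE (tauZr tT). Qed.
Lemma tens0l y : tens tau 0 y = 0.
Proof. by apply: tens_eq => u v; rewrite !bop0E (tau0l tT). Qed.
Lemma tens0r x : tens tau x 0 = 0.
Proof. by apply: tens_eq => u v; rewrite !bop0E (tau0r tT). Qed.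

Lemma op_tens x y k : op tT (tens tau x y k) = x * op tT k * adj y.
Proof.
apply: op_eqP => u v; rewrite !bopME adjP (opP tT) adjP tensJ tensE.
by [].
Qed.

Lemma rk1_tau u v u' v' : rk1 (tau u v) (tau u' v') = tens tau (rk1 u u') (rk1 v v').
Proof.
apply/esym/tens_eq => a b; rewrite !rk1E (tau_inner tT) (tauZl tT) (tauZr tT) scalerA -innerC.
by [].
Qed.

Lemma tens_bound x y (C D : R) : 0 <= C -> 0 <= D ->
  (forall u, rnorm (x u) <= C * rnorm u) -> (forall u, rnorm (y u) <= D * rnorm u) ->
  forall k, rnorm (tens tau x y k) <= C * D * rnorm k.
Proof.
move=> C0 D0 xC yD k.
have l x' (C' : R) : 0 <= C' -> (forall u, rnorm (x' u) <= C' * rnorm u) ->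
    forall k, rnorm (tens tau x' 1 k) <= C' * rnorm k.
  move=> C'0 xC' k'.
  have [n|l [lx lC _]] := vec_exists tT eb (x := x' * op tT k') (B := (C' * rnorm k') ^+ 2).
    rewrite exprMn; apply: le_trans (_ : _ <= C' ^+ 2 * \sum_(0 <= j < n) rnorm (op tT k' (e j)) ^+ 2) _.
      rewrite mulr_sumr; apply: ler_sum => j _; rewrite -exprMn.
      by rewrite ler_sqr ?nnegrE ?mulr_ge0 ?rnorm_ge0//; exact: xC'.
    by rewrite ler_wpM2l ?exprn_ge0// op_bessel.
  have -> : tens tau x' 1 k' = l.
    by apply: (op_inj (tT := tT)); rewrite op_tens adj1 mulr1 lx.
  by move: lC; rewrite ler_sqr ?nnegrE ?mulr_ge0 ?rnorm_ge0.
have [J [Ja Jt]] := flip_exists tT eb.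
have JJ k' : J (tens tau 1 y (J k')) = tens tau y 1 k'.
  have [||Z ZP] := @bop_of_rbound R K (fun k => J (tens tau 1 y (J k))) (projT1 (cid2 (bop_rbound (tens tau 1 y)))).
  - move=> c a b; rewrite (antiunitary_linear Ja) bop_linD bop_linZ (antiunitary_linear Ja).
    by rewrite conjCK.
  - case: cid2 => C' C'0 h /= a; rewrite (antiunitary_rnorm _ Ja) -(antiunitary_rnorm a Ja).
    exact: h.
  rewrite -ZP; congr (bop_fun _ k'); apply/esym/tens_eq => u v.
  by rewrite ZP Jt tensE Jt.
have r k' : rnorm (tens tau 1 y k') <= D * rnorm k'.
  have [k2 <-] := antiunitary_surj Ja k'.
  rewrite (antiunitary_rnorm _ Ja) -(antiunitary_rnorm (tens _ _ _ _) Ja) JJ.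
  exact: l.
have -> : tens tau x y = tens tau x 1 * tens tau 1 y by rewrite tensM mulr1 mul1r.
by rewrite bopME; apply: le_trans (l _ _ C0 xC _) _; rewrite -mulrA ler_wpM2l.
Qed.

End Tens.
End Tensor.

(** * Hilbert-Schmidt norms of second compound matrices *)

Section Minors.
Variables (R : realType) (n : nat).
Implicit Types (x y : 'I_n -> 'I_n -> Cx R).

Definition hsq x : R := \sum_i \sum_j rnorm (x i j) ^+ 2.
Definition gram x : 'I_n -> 'I_n -> Cx R := fun i l => \sum_j x i j * (x l j)^*.
Definition minor2 x i j k l : Cx R := x i k * x j l - x i l * x j k.
(** Ordered pairs of rows and of columns are summed, which counts each minor four times in the
    squared norm of the second compound. *)
Definition minors_sq x : R :=
  \sum_i \sum_j \sum_k \sum_l rnorm (minor2 x i j k l) ^+ 2.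

Lemma rnorm_sqE (a : Cx R) : ((rnorm a ^+ 2)%:C)%C = a * a^*.
Proof. by rewrite -normCK rnormE rmorphXn. Qed.

Lemma gram_conj x i l : (gram x i l)^* = gram x l i.
Proof.
rewrite /gram rmorph_sum; apply: eq_bigr => j _.
by rewrite rmorphM /= conjCK mulrC.
Qed.

Lemma sum_pair_prod (a b : 'I_n -> Cx R) :
  \sum_k \sum_l a k * b l = (\sum_k a k) * (\sum_l b l).
Proof. by rewrite mulr_suml; apply: eq_bigr => k _; rewrite mulr_sumr. Qed.

(** In terms of the eigenvalues of [x x^*], [hsq x] is their sum and [hsq (gram x)] the sum of their
    squares, so the right side is four times their second elementary symmetric function. It vanishes
    exactly in rank at most one. *)
Lemma minors_sqE x : minors_sq x = 2 * (hsq x ^+ 2 - hsq (gram x)).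
Proof.
apply: (@complexI R).
rewrite rmorphM rmorphB rmorphXn /= rmorph_nat.
pose S1 := \sum_i \sum_j x i j * (x i j)^*.
have h1 : ((hsq x)%:C)%C = S1.
  rewrite /hsq rmorph_sum; apply: eq_bigr => i _; rewrite rmorph_sum.
  by apply: eq_bigr => j _; rewrite -rnorm_sqE.
pose S2 := \sum_i \sum_j gram x i j * gram x j i.
have h2 : ((hsq (gram x))%:C)%C = S2.
  rewrite /hsq rmorph_sum; apply: eq_bigr => i _; rewrite rmorph_sum.
  by apply: eq_bigr => j _; rewrite -[gram x j i]gram_conj -rnorm_sqE.
have -> : ((minors_sq x)%:C)%C = \sum_i \sum_j \sum_k \sum_l
    minor2 x i j k l * (minor2 x i j k l)^*.
  rewrite /minors_sq; do 4!(rewrite rmorph_sum; apply: eq_bigr => ? _).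
  by rewrite -rnorm_sqE.
rewrite h1 h2.
have e i j : \sum_k \sum_l minor2 x i j k l * (minor2 x i j k l)^* =
    (\sum_k x i k * (x i k)^*) * (\sum_l x j l * (x j l)^*) *+ 2
    - (gram x i j * gram x j i) *+ 2.
  transitivity (\sum_k \sum_l (x i k * (x i k)^* * (x j l * (x j l)^*)
      + (x j k * (x j k)^*) * (x i l * (x i l)^*)
      - (x i k * (x j k)^* * (x j l * (x i l)^*) + x j k * (x i k)^* * (x i l * (x j l)^*)))).
    apply: eq_bigr => k _; apply: eq_bigr => l _.
    rewrite /minor2 rmorphB !rmorphM /=; ring.
  under eq_bigr do rewrite sumrB !big_split /=.
  by rewrite sumrB !big_split /= !sum_pair_prod /gram; ring.
under eq_bigr do under eq_bigr do rewrite e.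
under eq_bigr do rewrite sumrB !sumrMnl.
rewrite sumrB !sumrMnl sum_pair_prod -/S1 -/S2 -mulrnBl -expr2.
by rewrite mulr_natl.
Qed.

(** The Cauchy-Binet formula for [x x^*], with a factor 2 because the column pairs are ordered. *)
Lemma minor2_gram x i j k l :
  \sum_p \sum_q minor2 x i j p q * (minor2 x k l p q)^* = 2 * minor2 (gram x) i j k l.
Proof.
transitivity (\sum_p \sum_q (x i p * (x k p)^* * (x j q * (x l q)^*)
   + x j p * (x l p)^* * (x i q * (x k q)^*)
   - (x i p * (x l p)^* * (x j q * (x k q)^*) + x j p * (x k p)^* * (x i q * (x l q)^*)))).
  apply: eq_bigr => p _; apply: eq_bigr => q _.
  rewrite /minor2 rmorphB !rmorphM /=; ring.
under eq_bigr do rewrite sumrB !big_split /=.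
by rewrite sumrB !big_split /= !sum_pair_prod /minor2 /gram; ring.
Qed.

Lemma sum_cs (a b : 'I_n -> 'I_n -> Cx R) :
  rnorm (\sum_p \sum_q a p q * (b p q)^*) ^+ 2 <= hsq a * hsq b.
Proof.
pose B (u v : 'M[Cx R]_n) : Cx R := \sum_p \sum_q u p q * (v p q)^*.
have BE (c : 'I_n -> 'I_n -> Cx R) : complex.Re (B (\matrix_(i, j) c i j) (\matrix_(i, j) c i j)) = hsq c.
  rewrite /B Re_sum; apply: eq_bigr => p _; rewrite Re_sum; apply: eq_bigr => q _.
  by rewrite !mxE -rnorm_sqE.
rewrite -!BE.
have -> : \sum_p \sum_q a p q * (b p q)^* = B (\matrix_(i, j) a i j) (\matrix_(i, j) b i j).
  by apply: eq_bigr => p _; apply: eq_bigr => q _; rewrite !mxE.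
apply: (@form_cs R 'M[Cx R]_n setT B) => //.
- move=> c u v w _ _ _; rewrite /B mulr_sumr -big_split /=; apply: eq_bigr => p _.
  rewrite mulr_sumr -big_split /=; apply: eq_bigr => q _.
  by rewrite !mxE mulrDl mulrA.
- move=> u v _ _; rewrite /B rmorph_sum; apply: eq_bigr => p _.
  rewrite rmorph_sum; apply: eq_bigr => q _; by rewrite rmorphM /= conjCK mulrC.
- move=> u _; apply: sumr_ge0 => p _; apply: sumr_ge0 => q _.
  exact: mul_conjC_ge0.
Qed.

(* The Hilbert-Schmidt norm of the second compound of [x x^*] is at most the
   squared Hilbert-Schmidt norm of the second compound of [x]. *)
Lemma hsq_gram_ineq x :
  hsq (gram x) ^+ 2 - hsq (gram (gram x)) <= 2^-1 * (hsq x ^+ 2 - hsq (gram x)) ^+ 2.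
Proof.
(* Cauchy-Schwarz on [minor2_gram], whose factor 2 appears squared. Through [minors_sqE] this
   becomes the constant [1 / 2] of the statement. *)
have h : 4 * minors_sq (gram x) <= minors_sq x ^+ 2.
  pose M i j := hsq (minor2 x i j).
  have -> : minors_sq x ^+ 2 = \sum_i \sum_j \sum_k \sum_l M i j * M k l.
    rewrite expr2 {1}/minors_sq mulr_suml; apply: eq_bigr => i _.
    rewrite mulr_suml; apply: eq_bigr => j _; rewrite -/(M i j) mulr_sumr.
    by apply: eq_bigr => k _; rewrite mulr_sumr.
  rewrite /minors_sq; do 4!(rewrite mulr_sumr; apply: ler_sum => ? _).
  apply: le_trans (sum_cs _ _); rewrite minor2_gram rnormM exprMn.
  have -> : rnorm (2 : Cx R) ^+ 2 = 4.
    have -> : (2 : Cx R) = ((2 : R)%:C)%C by rewrite rmorph_nat.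
    by rewrite rnormC_real ger0_norm// expr2 -natrM.
  by [].
move: h; rewrite !minors_sqE exprMn; lra.
Qed.

Lemma minor2_le x i j k l :
  rnorm (minor2 x i j k l) ^+ 2 <= 2 * (hsq x ^+ 2 - hsq (gram x)).
Proof.
rewrite -minors_sqE /minors_sq (bigD1 i)//= (bigD1 j)//= (bigD1 k)//= (bigD1 l)//=.
rewrite -!addrA lerDl !addr_ge0//; do ?[apply: sumr_ge0 => ? _]; exact: sqr_ge0.
Qed.

End Minors.

(** * Inequalities between functions multiplicative in time *)

Section MultiplicativeFunctions.
Variable R : realType.

Lemma subr_exp_le (a b : R) n : 0 <= b -> b <= a -> a <= 1 ->
  a ^+ n - b ^+ n <= n%:R * (a - b).
Proof.
move=> b0 ba a1; elim: n => [|n IH]; first by rewrite !expr0 subrr mul0r.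
rewrite !exprS -natr1 mulrDl mul1r.
have bn : b ^+ n <= 1 by rewrite exprn_ile1// (le_trans ba).
have bn0 : 0 <= b ^+ n by rewrite exprn_ge0.
have an : b ^+ n <= a ^+ n by rewrite lerXn2r ?nnegrE// (le_trans b0).
have -> : a * a ^+ n - b * b ^+ n = a * (a ^+ n - b ^+ n) + (a - b) * b ^+ n by ring.
apply: lerD.
  by apply: le_trans IH; rewrite ler_piMl// subr_ge0.
by rewrite ler_piMr// subr_ge0.
Qed.

(** Bernoulli's inequality applied to [1 / u >= 1 + (1 - u)]; it bounds [n (1 - u)] in terms of
    [u ^+ n] alone. *)
Lemma bernoulli_le (u : R) n : 0 <= u -> u <= 1 -> (1 + n%:R * (1 - u)) * u ^+ n <= 1.
Proof.
move=> u0 u1; elim: n => [|n IH]; first by rewrite mul0r addr0 expr0 mulr1.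
apply: le_trans IH; rewrite exprS -natr1 mulrA ler_wpM2r ?exprn_ge0//.
have n0 : 0 <= n%:R :> R by [].
have : 0 <= n%:R * (1 - u) ^+ 2 by rewrite mulr_ge0// sqr_ge0.
have : 0 <= (1 - u) ^+ 2 by rewrite sqr_ge0.
nra.
Qed.

(** The ratios [b = c2 / c1^2] and [g = c4 / c1^4] are multiplicative with [g <= b^2 <= 1]. At time
    [t / N], [1 - b] is of order [1 / N] because its [N]-th power [b t] is fixed. The last
    inequality makes [b^2 - g] of order [1 / N^2] there, and [N] steps accumulate this to order
    [1 / N] at time [t]. *)
Lemma multiplicative_equality (c1 c2 c4 : R -> R) :
  (forall t, 0 <= t -> [/\ 0 < c1 t, 0 < c2 t & 0 < c4 t]) ->
  (forall s t, 0 <= s -> 0 <= t -> [/\ c1 (s + t) = c1 s * c1 t,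
     c2 (s + t) = c2 s * c2 t & c4 (s + t) = c4 s * c4 t]) ->
  (forall t, 0 <= t -> [/\ c2 t <= c1 t ^+ 2, c4 t <= c2 t ^+ 2 &
     c2 t ^+ 2 - c4 t <= 2^-1 * (c1 t ^+ 2 - c2 t) ^+ 2]) ->
  forall t, 0 <= t -> c4 t = c2 t ^+ 2.
Proof.
move=> cp cM cle t t0.
pose b s := c2 s / c1 s ^+ 2; pose g s := c4 s / c1 s ^+ 4.
have p1 s : 0 <= s -> 0 < c1 s by move=> /cp[].
have bM s s' : 0 <= s -> 0 <= s' -> b (s + s') = b s * b s'.
  move=> s0 s'0; rewrite /b; have [-> -> _] := cM _ _ s0 s'0; have := p1 _ s0; have := p1 _ s'0.
  by move=> h h'; field; rewrite !gt_eqF.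
have gM s s' : 0 <= s -> 0 <= s' -> g (s + s') = g s * g s'.
  move=> s0 s'0; rewrite /g; have [-> _ ->] := cM _ _ s0 s'0; have := p1 _ s0; have := p1 _ s'0.
  by move=> h h'; field; rewrite !gt_eqF.
have b0 s : 0 <= s -> 0 < b s.
  by move=> s0; have [h1 h2 _] := cp _ s0; rewrite /b divr_gt0// exprn_gt0.
have g0 s : 0 <= s -> 0 < g s.
  by move=> s0; have [h1 _ h2] := cp _ s0; rewrite /g divr_gt0// exprn_gt0.
have b1 s : 0 <= s -> b s <= 1.
  move=> s0; have [h1 _ _] := cle _ s0; rewrite /b ler_pdivrMr ?mul1r// exprn_gt0//.
  exact: p1.
have gb s : 0 <= s -> g s <= b s ^+ 2.
  move=> s0; have [_ h1 _] := cle _ s0; have h := p1 _ s0.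
  rewrite /g /b expr_div_n -exprM ler_pM2r ?invr_gt0 ?exprn_gt0//.
have ineq s : 0 <= s -> b s ^+ 2 - g s <= 2^-1 * (1 - b s) ^+ 2.
  move=> s0; have [_ _ h] := cle _ s0; have h1 := p1 _ s0.
  have h4 : 0 < c1 s ^+ 4 by rewrite exprn_gt0.
  rewrite -(ler_pM2r h4) /b /g.
  have -> : ((c2 s / c1 s ^+ 2) ^+ 2 - c4 s / c1 s ^+ 4) * c1 s ^+ 4 = c2 s ^+ 2 - c4 s.
    by field; rewrite gt_eqF.
  have -> : 2^-1 * (1 - c2 s / c1 s ^+ 2) ^+ 2 * c1 s ^+ 4 = 2^-1 * (c1 s ^+ 2 - c2 s) ^+ 2.
    by field; rewrite gt_eqF.
  by [].
suff gbt : g t = b t ^+ 2.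
  have h := p1 _ t0; move: gbt; rewrite /g /b expr_div_n -exprM => /(mulIf _) -> //.
  by rewrite invr_neq0// expf_neq0// gt_eqF.
have pow (f : R -> R) s n : (forall s s', 0 <= s -> 0 <= s' -> f (s + s') = f s * f s') ->
    0 <= s -> 0 < f 0 -> f (n%:R * s) = f s ^+ n.
  move=> fM s0 f0; elim: n => [|n IH].
    rewrite mul0r expr0; have := fM 0 0 (lexx 0) (lexx 0); rewrite addr0.
    by move=> h; apply: (mulfI (lt0r_neq0 f0)); rewrite mulr1 -h.
  by rewrite -natr1 mulrDl mul1r addrC fM ?mulr_ge0// IH exprS.
apply/eqP; rewrite eq_le gb//=; apply/ler_addgt0Pr => eps eps0.
pose C := (b t)^-1.
have C0 : 0 < C by rewrite invr_gt0 b0.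
have [n _ nP] : exists2 n, True & C ^+ 2 / n.+1%:R <= eps.
  have e0 : 0 < eps / C ^+ 2 by rewrite divr_gt0// exprn_gt0.
  have [n _ nP] := near_infty_natSinv_lt (PosNum e0); exists n => //.
  have := nP n (leqnn n) => /= /ltW; rewrite ler_pdivlMr ?exprn_gt0// mulrC.
  by [].
pose s := t / n.+1%:R.
have s0 : 0 <= s by rewrite divr_ge0.
have ts : t = n.+1%:R * s by rewrite /s mulrC divfK// pnatr_eq0.
have bt : b t = b s ^+ n.+1 by rewrite {1}ts pow// b0.
have gt : g t = g s ^+ n.+1 by rewrite {1}ts pow// g0.
have h1 := subr_exp_le n.+1 (ltW (g0 _ s0)) (gb _ s0) (exprn_ile1 2 (ltW (b0 _ s0)) (b1 _ s0)).
have h2 := bernoulli_le n.+1 (ltW (b0 _ s0)) (b1 _ s0).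
have h3 := ineq _ s0.
rewrite -bt in h2; set N := n.+1%:R in h1 h2 nP.
have N0 : 0 < N by rewrite ltr0n.
have h4 : N * (1 - b s) <= C.
  rewrite -(ler_pM2r (b0 _ t0)) /C mulVf ?gt_eqF ?b0//.
  have := ltW (b0 _ t0); nra.
have h5 : 0 <= 1 - b s by rewrite subr_ge0 b1.
have h6 : N * (b s ^+ 2 - g s) <= C ^+ 2 / N.
  rewrite ler_pdivlMr//.
  have h7 : (N * (1 - b s)) ^+ 2 <= C ^+ 2.
    by rewrite ler_sqr ?nnegrE ?(ltW C0)// mulr_ge0// ltW.
  have h8 : N ^+ 2 * (b s ^+ 2 - g s) <= N ^+ 2 * (2^-1 * (1 - b s) ^+ 2).
    by rewrite ler_pM2l// exprn_gt0.
  have e1 : N * (b s ^+ 2 - g s) * N = N ^+ 2 * (b s ^+ 2 - g s) by ring.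
  have e2 : N ^+ 2 * (2^-1 * (1 - b s) ^+ 2) = 2^-1 * (N * (1 - b s)) ^+ 2 by ring.
  rewrite e1; rewrite e2 in h8; apply: le_trans h8 _.
  have := sqr_ge0 (N * (1 - b s)); move: h7; set X := _ ^+ 2; lra.
rewrite bt gt -exprM mulnC exprM -lerBlDl.
exact: le_trans h1 (le_trans h6 nP).
Qed.

End MultiplicativeFunctions.

(** * Intertwiners of tensor product endomorphisms, elementary tensors *)

Section TensorProducts.
Variables (R : realType) (H K : hilbertType R).
Variables (tau : H -> H -> K) (e : nat -> H).
Hypotheses (tT : tensor tau) (eb : orthobasis e).
Implicit Types (x y A B : bop H) (u v w : H) (k : K) (c : Cx R).

Let e1 : '[e 0%N, e 0%N] = 1. Proof. by rewrite eb.1. Qed.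
Let k0 : K := tau (e 0%N) (e 0%N).
Let k1 : '[k0, k0] = 1. Proof. by rewrite (tau_inner tT) e1 mulr1. Qed.

Section Intertwiners.
Variables (theta : bop H -> bop H) (Theta : bop K -> bop K).
Hypotheses (tE : normal_unital_endo setT theta) (TE : normal_unital_endo setT Theta).
Hypothesis Tt : forall x y, Theta (tens tau x y) = tens tau (theta x) (theta y).

(** For |k><k0| both sides are bounded linear in [k], so elementary tensors [k] suffice. These rank
    one operators already give [U l = Theta |l><k0| (U k0)], from which the relation follows for
    every operator. *)
Lemma tens_intw_crit (U : bop K) :
  (forall x y, Theta (tens tau x y) * U = U * tens tau x y) -> intw Theta U.
Proof.
move=> h.
have rk k : Theta (rk1 k k0) * U = U * rk1 k k0.
  apply: bopP => w; rewrite !bopME.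
  suff -> : Theta (rk1 k k0) (U w) = ('[w, k0] *: U) k by rewrite rk1E bop_linZ.
  rewrite -(itwE TE).
  suff -> : itw TE k0 (U w) = '[w, k0] *: U by [].
  apply: (tau_bop_eq tT) => u v; rewrite itwE bopZE (rk1_tau tT eb) -bopME h.
  by rewrite -(rk1_tau tT eb) bopME rk1E bop_linZ.
move=> X; apply: bopP => k; rewrite !bopME.
have Uk l : U l = Theta (rk1 l k0) (U k0) by rewrite -bopME rk bopME rk1E k1 scale1r.
by rewrite (Uk k) -bopME -(endoM TE) mul_rk1 -Uk.
Qed.

Lemma tens_intw A B : intw theta A -> intw theta B -> intw Theta (tens tau A B).
Proof.
move=> AE BE; apply: tens_intw_crit => x y.
by rewrite Tt !(tensM tT eb) AE BE.
Qed.

Let p := theta (rk1 (e 0%N) (e 0%N)).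

Lemma intw_tens_fix U : intw Theta U -> tens tau p p (U k0) = U k0.
Proof. by move=> UE; rewrite -Tt -(rk1_tau tT eb) (intw_fix k1). Qed.

Lemma intw_tens_at U u v : intw Theta U ->
  U (tau u v) = tens tau (theta (rk1 u (e 0%N))) (theta (rk1 v (e 0%N))) (U k0).
Proof. by move=> UE; rewrite (intw_at k1 (tau u v) UE) (rk1_tau tT eb) Tt. Qed.

Lemma linear_span0 (S : set (bop K)) : linear_span S 0.
Proof. by exists 0%N, (fun=> 0), (fun=> 0); split=> [[]|]//; rewrite big_ord0. Qed.

Lemma linear_spanP (S : set (bop K)) c (X Y : bop K) : S X -> linear_span S Y ->
  linear_span S (c *: X + Y).
Proof.
move=> SX [n [a [B [SB ->]]]].
exists n.+1, (fun i => if unlift ord0 i is Some j then a j else c),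
  (fun i => if unlift ord0 i is Some j then B j else X); split.
  by move=> i; case: unliftP.
rewrite big_ord_recl unlift_none; congr (_ + _); apply: eq_bigr => i _.
by rewrite liftK.
Qed.

(** The norm of an intertwiner is the norm of its value at [k0]. The vector [U k0] is fixed by
    [p (x) p], so compressing by [p (x) p] a finite sum of elementary tensors close to it yields
    values at [k0] of tensor products of intertwiners. *)
Lemma intw_tens_approx U (d : R) : intw Theta U -> 0 < d ->
  exists2 Z, linear_span [set tens tau A.1 A.2 | A in
      [set A : bop H * bop H | intw theta A.1 /\ intw theta A.2]] Z
    & forall k, rnorm ((U - Z) k) <= d * rnorm k.
Proof.
move=> UE d0; set S := (X in linear_span X).
have pp : p * p = p by rewrite -(endoM tE) rk1M e1 scale1r.
have pb u : rnorm (p u) <= 1 * rnorm u.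
  apply: (endo_bound tE) => // v; rewrite mul1r.
  by apply: le_trans (rk1_bound _ _ _) _; rewrite orthobasis_rnorm// !mul1r.
have [k' k'S k'd] := tau_lspan_dense tT (U k0) d0.
have [Z [ZS ZE Zk]] : exists Z, [/\ linear_span S Z, intw Theta Z & Z k0 = tens tau p p k'].
  elim/lspan_ind: k'S => [|c _ v [[a b] _ <-] [Z [ZS ZE Zk]]].
    exists 0; split; [exact: linear_span0 | exact: intw0 |].
    by rewrite bop_lin0.
  have pf w : theta (rk1 (e 0%N) (e 0%N)) (p w) = p w by rewrite -bopME pp.
  have AE := itw_intw tE (e 0%N) (p a); have BE := itw_intw tE (e 0%N) (p b).
  exists (c *: tens tau (itw tE (e 0%N) (p a)) (itw tE (e 0%N) (p b)) + Z); split.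
  - apply: linear_spanP => //.
    by exists (itw tE (e 0%N) (p a), itw tE (e 0%N) (p b)).
  - by apply: intwP => //; exact: tens_intw.
  - rewrite bopDE bopZE (tensE tT eb) !(itw_unit _ (pf _)) Zk.
    by rewrite bop_linD bop_linZ (tensE tT eb).
exists Z => // k.
have UZE : intw Theta (U - Z) by rewrite addrC -scaleN1r; exact: intwP.
rewrite (intw_rnorm TE k1)// mulrC ler_wpM2r ?rnorm_ge0// ltW//.
apply: le_lt_trans k'd; rewrite bopBE.
have -> : U k0 - Z k0 = tens tau p p (U k0 - k').
  by rewrite bop_linB (intw_tens_fix UE) Zk.
by apply: le_trans (tens_bound tT eb ler01 ler01 pb pb _) _; rewrite !mul1r.
Qed.

End Intertwiners.

(** The product [k k'^*] of Hilbert-Schmidt operators. The norm of [kmul k k] is the square of the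
    Schatten 4-norm of [k]; iterating once more gives the fourth power of its 8-norm. *)
Definition kmul k k' : K := tens tau 1 (op tT k') k.

Lemma op_kmul k k' : op tT (kmul k k') = op tT k * adj (op tT k').
Proof. by rewrite /kmul (op_tens tT eb) mul1r. Qed.

Lemma kmul_rnorm k k' : rnorm (kmul k k') <= rnorm k * rnorm k'.
Proof.
rewrite mulrC -[rnorm k' as X in X * _]mul1r.
apply: (tens_bound tT eb) => //; first exact: rnorm_ge0.
  by move=> u; rewrite mul1r.
exact: op_bound.
Qed.

Lemma kmulBl k k' l : kmul (k - k') l = kmul k l - kmul k' l.
Proof. by rewrite /kmul bop_linB. Qed.

Lemma kmulBr k l l' : kmul k (l - l') = kmul k l - kmul k l'.
Proof. by apply: (op_inj (tT := tT)); rewrite opB !op_kmul opB adjB mulrBr. Qed.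

Lemma kmul_linr k c l l' : kmul k (c *: l + l') = c^* *: kmul k l + kmul k l'.
Proof.
by apply: (op_inj (tT := tT)); rewrite op_linear !op_kmul op_linear adjD adjZ mulrDr bopZAr.
Qed.

Lemma kmul_cvg {T} {F : set_system T} {FF : ProperFilter F} (f g : T -> K) k l :
  f @ F --> k -> g @ F --> l -> (fun t => kmul (f t) (g t)) @ F --> kmul k l.
Proof.
move=> fk gl; pose h t := rnorm (k - f t) * rnorm (g t) + rnorm k * rnorm (l - g t).
have hc : h @ F --> rnorm (k - k) * rnorm l + rnorm k * rnorm (l - l).
  apply: cvgD; apply: cvgM.
  - by apply: cvg_rnormr; apply: cvgB => //; exact: cvg_cst.
  - exact: cvg_rnormr.
  - exact: cvg_cst.
  - by apply: cvg_rnormr; apply: cvgB => //; exact: cvg_cst.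
rewrite !subrr !rnorm0 mul0r mulr0 addr0 in hc.
apply: cvg0_rnorm_le hc; near=> t.
have -> : kmul k l - kmul (f t) (g t) = kmul (k - f t) (g t) + kmul k (l - g t).
  by rewrite kmulBl kmulBr [RHS]addrC addrA subrK.
by apply: le_trans (rnormD _ _) _; rewrite lerD ?kmul_rnorm.
Unshelve. all: by end_near. Qed.

Lemma conj_linear_tau_eq (f g : K -> K) (C D : R) :
  (forall c k l, f (c *: k + l) = c^* *: f k + f l) ->
  (forall c k l, g (c *: k + l) = c^* *: g k + g l) ->
  (forall k, rnorm (f k) <= C * rnorm k) -> (forall k, rnorm (g k) <= D * rnorm k) ->
  (forall u v, f (tau u v) = g (tau u v)) -> forall k, f k = g k.
Proof.
move=> fl gl fC gD fg k; have [J [Ja Jt]] := flip_exists tT eb.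
have [||X XP] := @bop_of_rbound R K (f \o J) C.
- by move=> c a b /=; rewrite (antiunitary_linear Ja) fl conjCK.
- by move=> a; rewrite /= -(antiunitary_rnorm a Ja).
have [||Y YP] := @bop_of_rbound R K (g \o J) D.
- by move=> c a b /=; rewrite (antiunitary_linear Ja) gl conjCK.
- by move=> a; rewrite /= -(antiunitary_rnorm a Ja).
have XY : X = Y by apply: (tau_bop_eq tT) => u v; rewrite XP YP /= Jt fg.
have [k' <-] := antiunitary_surj Ja k.
by rewrite -[LHS]/((f \o J) k') -[RHS]/((g \o J) k') -XP -YP XY.
Qed.

(** With [q u = theta |u><e0|], [A] sends [tau u v] to [q u a (q v)^*]. Since [(q v)^* q v' =
    '[v', v] q e0] and [a (q e0)^* = a], the product of two such operators has the same shape with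
    [a a^*] in place of [a]. *)
Lemma intw_square (theta : bop H -> bop H) (Theta : bop K -> bop K)
    (tE : normal_unital_endo setT theta) (TE : normal_unital_endo setT Theta)
    (Tt : forall x y, Theta (tens tau x y) = tens tau (theta x) (theta y)) (A : bop K) :
  intw Theta A ->
  exists2 A2, intw Theta A2 & forall k k', kmul (A k) (A k') = A2 (kmul k k').
Proof.
move=> AE; pose a := A k0; pose A2 := itw TE k0 (kmul a a).
pose q u := theta (rk1 u (e 0%N)).
have A2E : intw Theta A2 by exact: itw_intw.
exists A2 => // k k'.
have Atau u v : op tT (A (tau u v)) = q u * op tT a * adj (q v).
  by rewrite (intw_tens_at Tt)// (op_tens tT eb).
have A2tau u v : op tT (A2 (tau u v)) = q u * (op tT a * adj (op tT a)) * adj (q v).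
  by rewrite /A2 itwE (rk1_tau tT eb) Tt (op_tens tT eb) op_kmul.
have qq u v : adj (q u) * q v = '[v, u] *: q (e 0%N).
  by rewrite /q -(endoJ tE) -(endoM tE) adj_rk1 rk1M (endoZ tE).
have aq : op tT a * adj (q (e 0%N)) = op tT a.
  have := intw_tens_fix Tt AE; rewrite -/a => /(congr1 (op tT)).
  rewrite (op_tens tT eb) => h; rewrite -{1}h -mulrA -adjM; suff -> : q (e 0%N) * theta (rk1 (e 0%N) (e 0%N)) = theta (rk1 (e 0%N) (e 0%N)) by [].
  by rewrite /q -(endoM tE) rk1M e1 scale1r.
have qa : adj (q (e 0%N)) = q (e 0%N) by rewrite /q -(endoJ tE) adj_rk1.
have [C C0 AC] := bop_rbound A; have [D D0 A2D] := bop_rbound A2.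
have step1 u v k2 : kmul (A (tau u v)) (A k2) = A2 (kmul (tau u v) k2).
  apply: (@conj_linear_tau_eq (fun k2 => kmul (A (tau u v)) (A k2)) (fun k2 => A2 (kmul (tau u v) k2))
    (rnorm (A (tau u v)) * C) (D * rnorm (tau u v))) => [c l l'|c l l'|l|l|u' v'].
  - by rewrite bop_linD bop_linZ kmul_linr.
  - by rewrite kmul_linr bop_linD bop_linZ.
  - by apply: le_trans (kmul_rnorm _ _) _; rewrite -mulrA ler_wpM2l ?rnorm_ge0.
  - by apply: le_trans (A2D _) _; rewrite -mulrA ler_wpM2l ?(ltW D0)// kmul_rnorm.
  - apply: (op_inj (tT := tT)); rewrite (op_kmul (A (tau u v)) (A (tau u' v'))) (Atau u v) (Atau u' v').
    have -> : kmul (tau u v) (tau u' v') = '[v', v] *: tau u u'.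
      apply: (op_inj (tT := tT)); rewrite op_kmul opZ !op_tau adj_rk1 rk1M.
      by [].
    rewrite bop_linZ opZ A2tau !adjM adjK !mulrA -[_ * adj (q v) * q v']mulrA qq.
    by rewrite bopZAr !bopZAl -qa -[q u * _ * _]mulrA aq.
have XY : tens tau 1 (op tT (A k')) * A = A2 * tens tau 1 (op tT k').
  by apply: (tau_bop_eq tT) => u v; rewrite !bopME -!/(kmul _ _) step1.
exact: (congr1 (fun Z : bop K => Z k) XY).
Qed.

Definition tproj n : bop K := tens tau (fproj e n) (fproj e n).
Definition tmat n k : 'I_n -> 'I_n -> Cx R := fun i j => '[k, tau (e i) (e j)].
Arguments tmat : clear implicits.

Lemma fprojJ n : adj (fproj e n) = fproj e n.
Proof.
by apply: adj_unique => u v; rewrite /fproj !bop_sumE inner_suml inner_sumr;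
  apply: eq_bigr => i _; rewrite adjP adj_rk1.
Qed.

Lemma fproj_basis n i : (i < n)%N -> fproj e n (e i) = e i.
Proof.
move=> ni; rewrite /fproj bop_sumE (bigD1_seq i) ?mem_index_iota ?iota_uniq//= big1.
  by rewrite eb.1 eqxx scale1r addr0.
by move=> j ji; rewrite eb.1 eq_sym (negbTE ji) scale0r.
Qed.

Lemma fprojM n : fproj e n * fproj e n = fproj e n.
Proof.
apply: bopP => u; rewrite bopME ![fproj e n u]fprojE /series /= bop_lin_sum.
by rewrite !big_nat; apply: eq_bigr => i /andP[_ ni]; rewrite bop_linZ fproj_basis.
Qed.

Lemma tprojM n : tproj n * tproj n = tproj n.
Proof. by rewrite /tproj (tensM tT eb) fprojM. Qed.

Lemma tprojJ n : adj (tproj n) = tproj n.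
Proof. by rewrite /tproj (tensJ tT eb) fprojJ. Qed.

Lemma tens_suml n (F : nat -> bop H) y :
  tens tau (\sum_(0 <= i < n) F i) y = \sum_(0 <= i < n) tens tau (F i) y.
Proof.
elim: n => [|n IH]; first by rewrite !big_geq// (tens0l tT eb).
by rewrite !big_nat_recr//= (tensDl tT eb) IH.
Qed.

Lemma tens_sumr n (F : nat -> bop H) x :
  tens tau x (\sum_(0 <= i < n) F i) = \sum_(0 <= i < n) tens tau x (F i).
Proof.
elim: n => [|n IH]; first by rewrite !big_geq// (tens0r tT eb).
by rewrite !big_nat_recr//= (tensDr tT eb) IH.
Qed.

Lemma tproj_rnorm n k : rnorm (tproj n k) ^+ 2 = hsq (tmat n k).
Proof.
rewrite rnorm_inner adjP tprojJ -bopME tprojM {1}/tproj {1}/fproj.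
rewrite {1}/fproj tens_suml bop_sumE inner_sumr Re_sum /hsq big_mkord.
apply: eq_bigr => i _; rewrite /fproj tens_sumr bop_sumE inner_sumr Re_sum big_mkord.
apply: eq_bigr => j _; rewrite -(rk1_tau tT eb) rk1E innerZr /tmat mulrC.
by rewrite -rnorm_sqE.
Qed.

Lemma tproj_cvg k : (fun n => tproj n k) @ \oo --> k.
Proof.
have b n l : rnorm (tproj n l) <= rnorm l.
  have fb u : rnorm (fproj e n u) <= 1 * rnorm u by rewrite mul1r fproj_bound.
  by apply: le_trans (tens_bound tT eb ler01 ler01 fb fb l) _; rewrite !mul1r.
have h l : lspan [set tau p.1 p.2 | p in [set: H * H]] l -> (fun n => tproj n l) @ \oo --> l.
  elim/lspan_ind => {l} [|c _ l [[u v] _ <-] IH].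
    by under eq_fun do rewrite bop_lin0; exact: cvg_cst.
  under eq_fun do rewrite bop_linD bop_linZ; apply: cvgD => //; apply: cvgZr.
  under eq_fun do rewrite (tensE tT eb).
  by apply: (tau_cvg tT); exact: fproj_cvg.
apply/cvg_rnormn => d d0; have d3 : 0 < d / 3 by rewrite divr_gt0.
have [l lS ld] := tau_lspan_dense tT k d3.
have [N NP] := (cvg_rnormn _ _).1 (h l lS) _ d3.
exists N => n Nn; apply: le_lt_trans (rnorm_tri l _ _) _.
have := rnorm_tri (tproj n l) l (tproj n k).
have := b n (l - k); rewrite bop_linB rnormBC => h1.
have := NP n Nn; move: ld; rewrite rnormBC in h1.
rewrite [rnorm (l - k)]rnormBC in h1; rewrite [rnorm (tproj n l - tproj n k)]rnormBC in h1 *.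
lra.
Qed.

Lemma kmul_tproj n k : tproj n (kmul (tproj n k) (tproj n k)) = kmul (tproj n k) (tproj n k).
Proof.
apply: (op_inj (tT := tT)).
rewrite /tproj !(op_tens tT eb, op_kmul) !adjM !adjK !fprojJ !mulrA.
by rewrite fprojM -!mulrA fprojM.
Qed.

Lemma tmat_kmul n k : tmat n (kmul (tproj n k) (tproj n k)) = gram (tmat n k).
Proof.
apply/funext => i; apply/funext => l.
rewrite /tmat /gram -(opP tT) op_kmul /tproj !(op_tens tT eb) !adjM !adjK !fprojJ.
set X := op tT k; set P := fproj e n.
have PP : P * P = P by exact: fprojM.
have -> : P * X * P * (P * (adj X * P)) = P * (X * (P * (adj X * P))).
  by rewrite !mulrA -[_ * P * P]mulrA PP.
rewrite !bopME -[X in '[_, X]](fproj_basis (ltn_ord i)).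
rewrite fproj_basis ?ltn_ord// {1}/P adjP fprojJ fproj_basis ?ltn_ord//.
rewrite adjP {1}/P /fproj bop_sumE inner_suml big_mkord; apply: eq_bigr => j _.
rewrite rk1E innerZl mulrC; congr (_ * _).
  by rewrite -adjP /X (opP tT).
by rewrite /P fproj_basis ?ltn_ord// adjP adjK innerC /X (opP tT).
Qed.

Lemma kmul_tproj_rnorm n k :
  rnorm (kmul (tproj n k) (tproj n k)) ^+ 2 = hsq (gram (tmat n k)).
Proof. by rewrite -kmul_tproj tproj_rnorm tmat_kmul. Qed.

Lemma kmul2_tproj_rnorm n k : let y := kmul (tproj n k) (tproj n k) in
  rnorm (kmul y y) ^+ 2 = hsq (gram (gram (tmat n k))).
Proof. by move=> y; rewrite /y -kmul_tproj kmul_tproj_rnorm tmat_kmul. Qed.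

Lemma le_cvgn (f g : nat -> R) a b : f @ \oo --> a -> g @ \oo --> b ->
  (forall n, f n <= g n) -> a <= b.
Proof.
move=> fa gb fg; rewrite -(cvg_lim _ fa)// -(cvg_lim _ gb)//.
by apply: ler_lim; [apply/cvg_ex; exists a | apply/cvg_ex; exists b | near=> n].
Unshelve. all: by end_near. Qed.

Lemma cvg_rnorm_sq (f : nat -> K) k : f @ \oo --> k ->
  (fun n => rnorm (f n) ^+ 2) @ \oo --> rnorm k ^+ 2.
Proof.
move=> fk; rewrite expr2; under eq_fun do rewrite expr2.
by apply: cvgM; exact: cvg_rnormr.
Qed.

(** [hsq_gram_ineq] for the matrices of the truncations [tproj n k], passed to the limit by
    continuity of [kmul]. *)
Lemma kmul_ineq k :
  (rnorm (kmul k k) ^+ 2) ^+ 2 - rnorm (kmul (kmul k k) (kmul k k)) ^+ 2 <=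
  2^-1 * ((rnorm k ^+ 2) ^+ 2 - rnorm (kmul k k) ^+ 2) ^+ 2.
Proof.
set y := kmul k k; pose y_ n := kmul (tproj n k) (tproj n k).
have kc := tproj_cvg (k := k).
have yc : y_ @ \oo --> y by exact: kmul_cvg.
have zc : (fun n => kmul (y_ n) (y_ n)) @ \oo --> kmul y y by exact: kmul_cvg.
have kn := cvg_rnorm_sq kc; have yn := cvg_rnorm_sq yc; have zn := cvg_rnorm_sq zc.
apply: (@le_cvgn (fun n => (rnorm (y_ n) ^+ 2) ^+ 2 - rnorm (kmul (y_ n) (y_ n)) ^+ 2)
  (fun n => 2^-1 * ((rnorm (tproj n k) ^+ 2) ^+ 2 - rnorm (y_ n) ^+ 2) ^+ 2)).
- apply: cvgB => //; rewrite [(rnorm y ^+ 2) ^+ 2]expr2.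
  by under eq_fun do rewrite [(rnorm _ ^+ 2) ^+ 2]expr2; exact: cvgM.
- apply: cvgMr; rewrite [_ ^+ 2 in X in _ --> X]expr2.
  under eq_fun do rewrite expr2.
  have h : (fun n => (rnorm (tproj n k) ^+ 2) ^+ 2 - rnorm (y_ n) ^+ 2) @ \oo -->
     (rnorm k ^+ 2) ^+ 2 - rnorm y ^+ 2.
    apply: cvgB => //; rewrite [(rnorm k ^+ 2) ^+ 2]expr2.
    by under eq_fun do rewrite [(rnorm _ ^+ 2) ^+ 2]expr2; exact: cvgM.
  exact: cvgM.
- by move=> n; rewrite tproj_rnorm kmul_tproj_rnorm kmul2_tproj_rnorm; exact: hsq_gram_ineq.
Qed.

Lemma kmul_le k : rnorm (kmul k k) ^+ 2 <= (rnorm k ^+ 2) ^+ 2.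
Proof.
by rewrite ler_sqr ?nnegrE ?rnorm_ge0 ?sqr_ge0// expr2 kmul_rnorm.
Qed.

(** A fixed minor of [k] occurs in all large truncations, where [minor2_le] bounds it by a quantity
    that tends to the deficit in the hypothesis, which is zero. *)
Lemma kmul_minors k : rnorm (kmul k k) ^+ 2 = (rnorm k ^+ 2) ^+ 2 ->
  forall i j m l : nat, '[k, tau (e i) (e m)] * '[k, tau (e j) (e l)] =
    '[k, tau (e i) (e l)] * '[k, tau (e j) (e m)].
Proof.
move=> kk i j m l; apply/eqP; rewrite -subr_eq0; apply/eqP; apply: crnorm0_eq0.
apply/eqP; rewrite -sqrf_eq0 eq_le sqr_ge0 andbT.
have kc := tproj_cvg (k := k).
have yc : (fun n => kmul (tproj n k) (tproj n k)) @ \oo --> kmul k k by exact: kmul_cvg.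
have kn := cvg_rnorm_sq kc; have yn := cvg_rnorm_sq yc.
pose N := (maxn (maxn i j) (maxn m l)).+1.
have h : (fun n => 2 * ((rnorm (tproj (n + N)%N k) ^+ 2) ^+ 2 -
    rnorm (kmul (tproj (n + N)%N k) (tproj (n + N)%N k)) ^+ 2)) @ \oo --> (0 : R).
  rewrite -[0](mulr0 2) -(subrr ((rnorm k ^+ 2) ^+ 2)) -{2}kk.
  apply: cvgMr; apply: cvgB; last first.
    by rewrite (cvg_shiftn N (fun n => rnorm (kmul (tproj n k) (tproj n k)) ^+ 2)).
  rewrite (cvg_shiftn N (fun n => (rnorm (tproj n k) ^+ 2) ^+ 2)).
  rewrite [(rnorm k ^+ 2) ^+ 2]expr2.
  by under eq_fun do rewrite [(rnorm _ ^+ 2) ^+ 2]expr2; exact: cvgM.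
apply: (le_cvgn _ h); first exact: cvg_cst.
move=> n; rewrite tproj_rnorm kmul_tproj_rnorm.
have iN : (i < n + N)%N by rewrite /N addnS ltnS (leq_trans _ (leq_addl _ _))// !leq_max leqnn.
have jN : (j < n + N)%N by rewrite /N addnS ltnS (leq_trans _ (leq_addl _ _))// !leq_max leqnn orbT.
have mN : (m < n + N)%N by rewrite /N addnS ltnS (leq_trans _ (leq_addl _ _))// !leq_max leqnn !orbT.
have lN : (l < n + N)%N by rewrite /N addnS ltnS (leq_trans _ (leq_addl _ _))// !leq_max leqnn !orbT.
exact: (minor2_le (tmat (n + N)%N k) (Ordinal iN) (Ordinal jN) (Ordinal mN) (Ordinal lN)).
Qed.

(** The operator [Y = X X^*] of [y] has vanishing minors, so its range is spanned by a single vector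
    [g]. What is orthogonal to [g] is killed by the quadratic form of [Y], hence by [X^*], and [X]
    has rank one. *)
Lemma kmul_elementary k : k != 0 -> let y := kmul k k in
  rnorm (kmul y y) ^+ 2 = (rnorm y ^+ 2) ^+ 2 -> exists u v, k = tau u v.
Proof.
move=> k_neq0 y yy; pose X := op tT k; pose Y := op tT y.
have YX : Y = X * adj X by rewrite /Y op_kmul.
have ymin i j m l : '[Y (e m), e i] * '[Y (e l), e j] = '[Y (e l), e i] * '[Y (e m), e j].
  by rewrite /Y !(opP tT) kmul_minors.
have [j0 Xj0] : exists j0, adj X (e j0) != 0.
  apply: contrapT => h; move/eqP: k_neq0; apply; apply: (op_inj (tT := tT)).
  rewrite op0 -[LHS]adjK -[RHS]adjK adj0; congr adj; apply: (orthobasis_bop_eq eb) => j.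
  by rewrite bop0E; apply/eqP; apply: contrapT => /negP hj; apply: h; exists j.
have Yj0 : '[Y (e j0), e j0] != 0.
  by rewrite YX bopME adjP inner_eq0.
pose g := Y (e j0).
have Ye j : Y (e j) = ('[Y (e j), e j0] / '[Y (e j0), e j0]) *: g.
  apply: (orthobasis_eq eb) => i; rewrite innerZl /g.
  by rewrite mulrAC [X in X / _]mulrC -ymin mulfK.
have Yorth u : '[u, g] = 0 -> adj X u = 0.
  move=> ug; apply/eqP; rewrite -inner_eq0 adjP adjK -[X (adj X u)]bopME -YX; apply/eqP.
  have gu : '[g, u] = 0 by rewrite innerC ug conjC0.
  suff : '[Y u, u] = 0 by move=> h; rewrite innerC h conjC0.
  have ue := orthobasis_expand (w := u) eb.
  have h := cvg_series_innerl (w := u) (cvg_series_bop (x := Y) ue).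
  apply: (rnorm_cvg_unique (V := Cx R) h).
  rewrite (_ : series _ = fun=> 0); first exact: cvg_cst.
  apply/funext => n; rewrite /series /= big1// => i _.
  by rewrite bop_linZ Ye !innerZl gu !mulr0.
have g0 : '[g, g] != 0.
  rewrite inner_eq0; apply: contra Yj0 => /eqP; rewrite /g => ->.
  by rewrite inner0l.
exists (('[g, g])^-1 *: g), (adj X g); apply: (op_inj (tT := tT)); rewrite op_tau.
rewrite -/X -[LHS]adjK -[RHS]adjK; congr adj; apply: bopP => u.
have -> : u = ('[u, g] / '[g, g]) *: g + (u - ('[u, g] / '[g, g]) *: g).
  by rewrite addrC subrK.
set u' := u - _.
have u'g : '[u', g] = 0 by rewrite innerBl innerZl divfK// subrr.
clearbody u'.
rewrite !bop_linD !bop_linZ (Yorth _ u'g) addr0 adj_rk1 !rk1E !innerZr u'g mulr0 scale0r addr0.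
rewrite conj_Creal ?realV ?ger0_real ?inner_ge0// mulVf// scale1r.
by [].
Qed.

End TensorProducts.

(** * Units: from projective to genuine semigroups *)

Section DyadicSemigroup.
Variables (R : realType) (H : hilbertType R).
Implicit Types (u v : H).
Variables (X : nat -> bop H) (x : nat -> R) (tau : R).
Hypothesis tau0 : 0 < tau.
Hypothesis x0 : forall n, 0 <= x n.
Hypothesis xS : forall n, x n.+1 ^+ 2 = x n.
Hypothesis XS : forall n, X n.+1 ^+ 2 = X n.
Hypothesis Xx : forall n u, rnorm (X n u) = x n * rnorm u.
Hypothesis X1 : forall u (eps : R), 0 < eps -> exists N, forall n j,
  (N <= n)%N -> (j <= 2 ^ (n - N))%N -> rnorm ((X n ^+ j) u - u) <= eps.

Definition dyadic_step n : R := tau / 2 ^+ n.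
Definition dyadic_index n (t : R) := Num.truncn (t / dyadic_step n).
Local Notation h := dyadic_step.
Local Notation k := dyadic_index.

Lemma dyadic_step_gt0 n : 0 < h n.
Proof. by rewrite /dyadic_step divr_gt0// exprn_gt0. Qed.

Lemma dyadic_stepM n m : (n <= m)%N -> (2 ^ (m - n))%:R * h m = h n.
Proof.
move=> nm; rewrite /dyadic_step -{2}(subnK nm) exprD natrX.
by field; rewrite !expf_neq0.
Qed.

Lemma dyadic_indexP n (t : R) : 0 <= t -> (k n t)%:R * h n <= t < (k n t).+1%:R * h n.
Proof.
move=> t0; have hn := dyadic_step_gt0 n.
by rewrite -ler_pdivlMr// -ltr_pdivrMr// truncn_itv// divr_ge0// ltW.
Qed.

Lemma dyadic_index_refine n m (t : R) : 0 <= t -> (n <= m)%N ->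
  (k n t * 2 ^ (m - n) <= k m t <= k n t * 2 ^ (m - n) + 2 ^ (m - n))%N.
Proof.
move=> t0 nm; have hm := dyadic_step_gt0 m; have e := dyadic_stepM nm.
have /andP[a1 a2] := dyadic_indexP n t0; have /andP[b1 b2] := dyadic_indexP m t0.
apply/andP; split; rewrite -ltnS -(ltr_nat R) -(ltr_pM2r hm).
  apply: le_lt_trans b2; rewrite natrM -mulrA e; exact: a1.
apply: le_lt_trans b1 _; apply: lt_trans a2 _.
by rewrite -mulSnr -[(_ * _).+1]addn1 natrD natrM mulrDl -mulrA e mul1r ltrDl.
Qed.

Lemma dyadic_expX n m : (n <= m)%N -> X m ^+ (2 ^ (m - n)) = X n.
Proof.
move=> nm; rewrite -{1}(subnK nm); elim: (m - n)%N => [|d IH]; first by rewrite expn0 expr1.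
by rewrite addSn expnS exprM XS.
Qed.

Lemma dyadic_expx n m : (n <= m)%N -> x m ^+ (2 ^ (m - n)) = x n.
Proof.
move=> nm; rewrite -{1}(subnK nm); elim: (m - n)%N => [|d IH]; first by rewrite expn0 expr1.
by rewrite addSn expnS exprM xS.
Qed.

Lemma dyadic_rnorm n j u : rnorm ((X n ^+ j) u) = x n ^+ j * rnorm u.
Proof.
elim: j u => [|j IH] u; first by rewrite !expr0 mul1r.
by rewrite exprS bopME Xx IH exprS mulrA.
Qed.

(** Whole blocks of [2 ^ n] steps contribute powers of [x 0], at most [Q] of them; the remaining
    steps are fewer than one block and contribute at most [b = 1 + x 0]. *)
Lemma dyadic_bound T : exists2 B : R, 0 < B &
  forall n j, j%:R * h n <= T -> x n ^+ j <= B.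
Proof.
pose b := 1 + x 0%N; have b1 : 1 <= b by rewrite lerDl.
have b0 : 0 < b by rewrite (lt_le_trans ltr01).
pose Q := Num.truncn (T / tau); exists (b ^+ Q * b).
  by rewrite mulr_gt0// exprn_gt0.
move=> n j jT; have p2 : (0 < 2 ^ n)%N by rewrite expn_gt0.
rewrite (divn_eq j (2 ^ n)) exprD mulnC exprM.
have -> : x n ^+ (2 ^ n) = x 0%N by rewrite -[in RHS](dyadic_expx (leq0n n)) subn0.
have xb : x 0%N <= b by rewrite lerDr.
apply: ler_pM; rewrite ?exprn_ge0//.
  apply: (@le_trans _ _ (b ^+ (j %/ 2 ^ n))).
    by apply: lerXn2r => //; rewrite nnegrE// ltW.
  apply: ler_weXn2l => //; rewrite /Q truncn_ge_nat; last first.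
    rewrite divr_ge0 ?(ltW tau0)//; apply: le_trans jT.
    by rewrite mulr_ge0// ltW// dyadic_step_gt0.
  rewrite ler_pdivlMr//; apply: le_trans jT.
  have e : (2 ^ n)%:R * h n = tau.
    by have := dyadic_stepM (leq0n n); rewrite subn0 => ->; rewrite /dyadic_step expr0 divr1.
  rewrite -[leLHS]/(_%:R * tau) -[X in _ * X]e mulrA -natrM; apply: ler_wpM2r; first exact/ltW/dyadic_step_gt0.
  by rewrite ler_nat leq_divM.
have [x1|/ltW x1] := leP (x n) 1; first by rewrite (le_trans (exprn_ile1 _ _ x1)).
apply: le_trans xb; rewrite -(dyadic_expx (leq0n n)) subn0.
by apply: ler_weXn2l => //; rewrite ltnW// ltn_mod.
Qed.

Lemma dyadic_diff B n i j u : (i <= j)%N -> x n ^+ i <= B ->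
  rnorm ((X n ^+ j) u - (X n ^+ i) u) <= B * rnorm ((X n ^+ (j - i)) u - u).
Proof.
move=> ij iB; rewrite -{1}(subnKC ij) exprD bopME -bop_linB dyadic_rnorm.
by rewrite ler_wpM2r// rnorm_ge0.
Qed.

Lemma dyadic_cauchy (t : R) u : 0 <= t -> exists l : H, (fun n => (X n ^+ k n t) u) @ \oo --> l.
Proof.
move=> t0; have [B B0 BP] := dyadic_bound t; apply: complete_rnorm => eps e0.
have e' : 0 < eps / (B *+ 4) by rewrite divr_gt0// pmulrn_lgt0.
have [N NP] := X1 u e'; exists N.
suff W m n : (N <= n)%N -> (n <= m)%N ->
    rnorm ((X m ^+ k m t) u - (X n ^+ k n t) u) < eps.
  move=> m n hm hn; have [mn|/ltnW nm] := leqP n m; first exact: W.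
  by rewrite rnormBC; exact: W.
move=> Nn nm; have /andP[a1 a2] := dyadic_index_refine t0 nm.
have hm := dyadic_step_gt0 m.
rewrite -[in X n ^+ _](dyadic_expX nm) -exprM mulnC.
have jB : x m ^+ (k n t * 2 ^ (m - n)) <= B.
  apply: BP; have /andP[b1 _] := dyadic_indexP m t0; apply: le_trans b1.
  by rewrite ler_wpM2r ?(ltW hm)// ler_nat.
apply: le_lt_trans (dyadic_diff u a1 jB) _.
have : rnorm ((X m ^+ (k m t - k n t * 2 ^ (m - n))) u - u) <= eps / (B *+ 4).
  apply: NP; first exact: leq_trans nm.
  rewrite leq_subLR; apply: leq_trans a2 _; rewrite leq_add2l leq_exp2l//.
  by rewrite leq_sub2l.
move=> le1; apply: le_lt_trans (ler_wpM2l (ltW B0) le1) _.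
have -> : B * (eps / (B *+ 4)) = eps / 4 by rewrite -mulr_natr; field; rewrite gt_eqF.
lra.
Qed.

(** [X n] plays the value at time [tau / 2 ^ n], and [k n t] rounds [t] down to that grid. [X1] is
    strong continuity at 0 uniform in the grid level; it yields both the convergence and the
    continuity of the limit. *)
Lemma dyadic_semigroup : exists S : R -> bop H,
  [/\ forall t u, 0 <= t -> (fun n => (X n ^+ k n t) u) @ \oo --> S t u,
      S 0 = 1,
      forall s t, 0 <= s -> 0 <= t -> S (s + t) = S s * S t
    & forall u, {within [set t : R | 0 <= t], continuous (fun t => S t u)}].
Proof.
have bnd T t : 0 <= t -> t <= T -> forall B, (forall n j, j%:R * h n <= T -> x n ^+ j <= B) ->
    forall n u, rnorm ((X n ^+ k n t) u) <= B * rnorm u.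
  move=> t0 tT B BP n u; rewrite dyadic_rnorm ler_wpM2r ?rnorm_ge0//; apply: BP.
  by apply: le_trans tT; case/andP: (dyadic_indexP n t0).
have /choice[S SP] t : exists y : bop H, 0 <= t ->
    forall u, (fun n => (X n ^+ k n t) u) @ \oo --> y u.
  have [t0|t0] := pselect (0 <= t); last by exists 0 => /t0.
  have [B B0 BP] := dyadic_bound t.
  have [y yP] := bop_limit (bnd t t t0 (lexx t) B BP) (fun u => dyadic_cauchy u t0).
  by exists y.
have X0 u d : (d <= 1)%N -> (fun n => (X n ^+ d) u) @ \oo --> u.
  move=> d1; apply/cvg_rnormn => eps e0.
  have e2 : 0 < eps / 2 by rewrite divr_gt0.
  have [N NP] := X1 u e2; exists N => n Nn.
  rewrite rnormBC; apply: le_lt_trans (NP n d Nn _) _; last lra.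
  by apply: leq_trans d1 _; rewrite expn_gt0.
exists S; split=> //.
- by move=> t u t0; exact: SP.
- apply: bopP => u; apply: (rnorm_cvg_unique (SP 0 (lexx 0) u)).
  rewrite bop1E [X in X @ _](_ : _ = fun=> u); first exact: cvg_cst.
  by apply/funext => n; rewrite /dyadic_index mul0r truncn0 expr0.
- move=> s t s0 t0; have st0 : 0 <= s + t by rewrite addr_ge0.
  apply: bopP => u; apply: (rnorm_cvg_unique (SP _ st0 u)).
  have [B B0 BP] := dyadic_bound (s + t).
  have sB := bnd (s + t) s s0 _ B BP; rewrite lerDl t0 in sB; have {}sB := sB isT.
  have tB := bnd (s + t) t t0 _ B BP; rewrite lerDr s0 in tB; have {}tB := tB isT.
  (* Rounding down is additive up to one grid step, and a single step tends strongly to the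
     identity. *)
  pose d n := (k n (s + t) - (k n s + k n t))%N.
  have dP n : k n (s + t) = (k n s + k n t + d n)%N /\ (d n <= 1)%N.
    have hn := dyadic_step_gt0 n.
    have /andP[a1 a2] := dyadic_indexP n s0; have /andP[b1 b2] := dyadic_indexP n t0.
    have /andP[c1 c2] := dyadic_indexP n st0.
    have le1 : (k n s + k n t <= k n (s + t))%N.
      rewrite -ltnS -(ltr_nat R) -(ltr_pM2r hn) natrD mulrDl.
      by apply: le_lt_trans c2; exact: lerD.
    split; first by rewrite /d subnKC.
    rewrite /d leq_subLR -ltnS -(ltr_nat R) -(ltr_pM2r hn).
    apply: le_lt_trans c1 _; rewrite -addn1 !natrD !mulrDl.
    move: a2 b2; rewrite -!natr1 !mulrDl; lra.
  rewrite bopME; have -> : (fun n => (X n ^+ k n (s + t)) u) =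
      (fun n => (X n ^+ k n s) ((X n ^+ k n t) ((X n ^+ d n) u))).
    by apply/funext => n; have [-> _] := dP n; rewrite !exprD !bopME.
  apply: (bop_cvgM (g := fun n => X n ^+ k n t * X n ^+ d n) sB); first exact: SP.
  have -> : (fun n => (X n ^+ k n t * X n ^+ d n) u) =
    (fun n => (X n ^+ k n t) ((X n ^+ d n) u)) by [].
  apply: (bop_cvgM (g := fun n => X n ^+ d n) (g' := 1) tB); first exact: SP.
  apply/cvg_rnormn => eps e0.
  have /cvg_rnormn/(_ eps e0)[N0 N0P] := X0 u 0%N isT.
  have /cvg_rnormn/(_ eps e0)[N1 N1P] := X0 u 1%N isT.
  exists (maxn N0 N1) => n; rewrite geq_max => /andP[n0 n1].
  have [_] := dP n; case: (d n) => [|[|//]] _; [exact: N0P|exact: N1P].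
- move=> u; apply/subspace_continuousP => t /= t0; apply/cvg_rnorm => eps e0.
  have [B B0 BP] := dyadic_bound (t + 1).
  have e' : 0 < eps / (B *+ 4) by rewrite divr_gt0// pmulrn_lgt0.
  have [N NP] := X1 u e'.
  (* Rounding adds at most one step of size at most [h N.+1], so a time difference below [h N.+1]
     stays within the range [h N] covered by [X1]. *)
  pose dl := Num.min 1 (h N.+1).
  have dl0 : 0 < dl by rewrite lt_min ltr01 dyadic_step_gt0.
  have main s s' : 0 <= s -> s <= s' -> s' <= t + 1 -> s' - s < dl ->
      rnorm (S s' u - S s u) < eps.
    move=> s0 ss' s'T sd; have s'0 := le_trans s0 ss'.
    apply: (@le_lt_trans _ _ (eps / 4)); last lra.
    have cv : (fun n => (X n ^+ k n s') u - (X n ^+ k n s) u) @ \oo --> S s' u - S s u.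
      by apply: cvgB; exact: SP.
    apply: (cvg_rnorm_le cv); exists N.+1 => // n /= Nn.
    have hn := dyadic_step_gt0 n.
    have /andP[a1 a2] := dyadic_indexP n s0; have /andP[b1 b2] := dyadic_indexP n s'0.
    have le1 : (k n s <= k n s')%N.
      by rewrite -ltnS -(ltr_nat R) -(ltr_pM2r hn); lra.
    have sB : x n ^+ k n s <= B by apply: BP; lra.
    apply: le_trans (dyadic_diff u le1 sB) _.
    have : rnorm ((X n ^+ (k n s' - k n s)) u - u) <= eps / (B *+ 4).
      apply: NP; first exact: ltnW.
      rewrite -(ler_nat R) -(ler_pM2r hn) dyadic_stepM 1?ltnW// natrB// mulrBl.
      have e1 := dyadic_stepM (leqnSn N); rewrite subSnn expn1 in e1.
      have e2 := dyadic_stepM Nn.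
      have : h n <= h N.+1.
        rewrite -e2 -[leLHS]mul1r ler_pM2r// ler1n expn_gt0//.
      have : s' - s < h N.+1 by apply: lt_le_trans sd _; rewrite ge_min lexx orbT.
      move: a2 b1; rewrite -natr1 mulrDl -e1; lra.
    move=> le2; apply: le_trans (ler_wpM2l (ltW B0) le2) _.
    have -> : B * (eps / (B *+ 4)) = eps / 4 by rewrite -mulr_natr; field; rewrite gt_eqF.
    exact: lexx.
  near=> s.
  have s0 : 0 <= s by near: s; exact: withinT.
  have : `|t - s| < dl.
    near: s; apply: cvg_within; apply: (@cvgr_dist_lt _ R _ (nbhs t) _ id) => //.
  rewrite ltr_norml => /andP[d1 d2].
  have dl1 : dl <= 1 by rewrite ge_min lexx.
  have [ts|/ltW st] := leP t s; last by apply: main => //; lra.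
  by rewrite rnormBC; apply: main => //; lra.
Unshelve. all: by end_near. Qed.

End DyadicSemigroup.

(** * Square roots and phases near 1 *)

Section ScalarPhases.
Variable R : realType.
Implicit Types (z w : Cx R).

(** Choose the root [w] nearer to [1] than to [-1]. The product of [|w - 1|] and [|w + 1|] is
    [|z - 1|], and for [z] within [1 / 2] of [1] the second factor is at least [3 / 2]. *)
Lemma sqrt_near1 z : exists w, w ^+ 2 = z /\
  (rnorm (z - 1) <= 2^-1 -> 3 * rnorm (w - 1) <= 2 * rnorm (z - 1)).
Proof.
have [w [wz ab]] : exists w, w ^+ 2 = z /\ rnorm (w - 1) <= rnorm (w + 1).
  have [h|/ltW h] := leP (rnorm (sqrtC z - 1)) (rnorm (sqrtC z + 1)).
    by exists (sqrtC z); rewrite sqrtCK.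
  exists (- sqrtC z); rewrite sqrrN sqrtCK; split=> //.
  by rewrite -opprD rnormN [- _ + _]addrC rnormBC.
exists w; split=> // d12.
have d : rnorm (w - 1) * rnorm (w + 1) = rnorm (z - 1).
  by rewrite -rnormM -wz -subr_sqr expr1n.
have t : 2 <= rnorm (w - 1) + rnorm (w + 1).
  have := rnormB (w + 1) (w - 1); have -> : w + 1 - (w - 1) = ((2 : R)%:C)%C.
    by rewrite opprB addrC addrA subrK rmorph_nat.
  by rewrite rnormC_real ger0_norm ?ler0n// addrC.
have := rnorm_ge0 (w - 1); have := rnorm_ge0 (w + 1).
move: ab d t d12; set a := rnorm (w - 1); set b := rnorm (w + 1); set c := rnorm (z - 1).
move=> ab d t d12 b0 a0.
have [a2|a2] := leP a 2^-1; first by nra.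
suff : 2^-1 < a * b by rewrite d; lra.
by nra.
Qed.

Lemma contraction_small (x d : nat -> R) : (forall n, 0 <= x n) ->
  (forall n, 4 * x n.+1 <= 3 * (x n + d n)) ->
  (forall eps : R, 0 < eps -> exists N, forall n, (N <= n)%N -> d n <= eps) ->
  forall eps : R, 0 < eps -> exists N, forall n, (N <= n)%N -> x n <= eps.
Proof.
move=> x0 xd dP eps e0.
have [N NP] : exists N, forall n, (N <= n)%N -> d n <= eps / 8 by apply: dP; lra.
pose y : R := 3 / 4.
have cv : (fun n => y ^+ n) @ \oo --> (0 : R).
  by apply: cvg_expr; rewrite ger0_norm /y; lra.
have e' : 0 < eps / (2 * (x N + 1)).
  by rewrite divr_gt0// mulr_gt0// ltr_wpDl.
have /cvgrPdist_lt/(_ _ e')[M _ MP] := cv.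
(* The factor 3 is [y / (1 - y)], the total effect of a constant perturbation damped by [y = 3 / 4]
   at each step. *)
have main k : x (N + k)%N <= y ^+ k * x N + 3 * (eps / 8).
  elim: k => [|k IH]; first by rewrite addn0 expr0 mul1r lerDl; lra.
  have h1 := xd (N + k)%N; have h2 := NP (N + k)%N (leq_addr _ _).
  rewrite addnS exprS -mulrA.
  move: IH h1 h2; rewrite {2}/y; set A := _ * x N; lra.
exists (N + M)%N => n NM.
have Nn : (N <= n)%N by apply: leq_trans NM; rewrite leq_addr.
have := main (n - N)%N; rewrite subnKC// => /le_trans; apply.
have /MP /= : (M <= n - N)%N by rewrite leq_subRL.
have y0 : 0 <= y ^+ (n - N) by apply: exprn_ge0; rewrite /y; lra.
rewrite sub0r normrN ger0_norm// ltr_pdivlMr ?mulr_gt0 ?ltr_wpDl//.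
move: y0; have := x0 N.
set A := y ^+ _; set B := x N; nra.
Qed.

(** Each [a n.+1] is the root of [a n / c n] near [1]. The threshold [1 / 20] keeps this quotient
    within [1 / 2] of [1] and [a n] within [1 / 4], where the root contracts distances to [1]. *)
Lemma root_sequence (c : nat -> Cx R) : (forall n, 20 * rnorm (c n - 1) <= 1) ->
  (forall eps : R, 0 < eps -> exists N, forall n, (N <= n)%N -> rnorm (c n - 1) <= eps) ->
  exists a : nat -> Cx R, [/\ forall n, a n.+1 ^+ 2 * c n = a n,
    forall n, 4 * rnorm (a n - 1) <= 1 &
    forall eps : R, 0 < eps -> exists N, forall n, (N <= n)%N -> rnorm (a n - 1) <= eps].
Proof.
move=> c20 c1; have /choice[r rP] := sqrt_near1.
pose a := fix a n := if n is m.+1 then r (a m / c m) else 1.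
have cn n : 19 <= 20 * rnorm (c n).
  have := c20 n.
  have := rnormD (c n) (1 - c n : Cx R); rewrite addrC subrK rnorm1 (rnormBC (1 : Cx R)); lra.
have c0 n : c n != 0.
  by apply/eqP => h; have := cn n; rewrite h rnorm0; lra.
have aS n : a n.+1 ^+ 2 * c n = a n by rewrite /= (rP _).1 divfK.
have zP n : 19 * rnorm (a n / c n - 1) <= 20 * (rnorm (a n - 1) + rnorm (c n - 1)).
  have h : rnorm (a n / c n - 1) * rnorm (c n) <= rnorm (a n - 1) + rnorm (c n - 1).
    rewrite -rnormM mulrBl divfK// mul1r.
    have -> : a n - c n = (a n - 1) - (c n - 1) by rewrite opprB addrA subrK.
    exact: rnormB.
  have := cn n; have := rnorm_ge0 (a n / c n - 1); nra.
have a4 n : 4 * rnorm (a n - 1) <= 1.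
  elim: n => [|n IH]; first by rewrite subrr rnorm0 mulr0.
  have h := zP n; have h2 := c20 n.
  have := (rP (a n / c n)).2; rewrite -/(a n.+1) => h3.
  have : rnorm (a n / c n - 1) <= 2^-1 by lra.
  move=> /h3; lra.
exists a; split=> //.
apply: (contraction_small (d := fun n => rnorm (c n - 1))) => [n|n|//]; first exact: rnorm_ge0.
have h := zP n; have h2 := c20 n; have h4 := a4 n.
have := (rP (a n / c n)).2; rewrite -/(a n.+1) => h3.
have : rnorm (a n / c n - 1) <= 2^-1 by lra.
have := rnorm_ge0 (a n - 1); have := rnorm_ge0 (c n - 1).
move=> ? ? /h3; lra.
Qed.

Lemma rnorm_mul_sub1 z w :
  rnorm (z * w - 1) <= rnorm (z - 1) + rnorm (w - 1) + rnorm (z - 1) * rnorm (w - 1).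
Proof.
have -> : z * w - 1 = (z - 1) + (w - 1) + (z - 1) * (w - 1) by ring.
apply: le_trans (rnormD _ _) _; rewrite rnormM lerD2r; exact: rnormD.
Qed.

(* The value at [j] is controlled by that at [2 j - 2 ^ k.+1 < j], since
   [p j ^+ 2 ~ p (2 j) ~ p (2 ^ k.+1) * p (2 j - 2 ^ k.+1)]; comparison with
   [p j.-1] selects the square root near [1]. *)
Lemma dyadic_near1 (p : nat -> Cx R) (c : nat -> nat -> Cx R) M (kap : R) :
  0 <= kap -> 100 * kap <= 1 -> p 0%N = 1 ->
  (forall i j, (i + j <= 2 ^ M.+1)%N ->
     p i * p j * c i j = p (i + j)%N /\ rnorm (c i j - 1) <= kap) ->
  (forall k, (k <= M.+1)%N -> rnorm (p (2 ^ k)%N - 1) <= kap) ->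
  forall j, (j <= 2 ^ M)%N -> rnorm (p j - 1) <= 20 * kap.
Proof.
move=> k0 k1 p0 pc p2.
have three z w (t : Cx R) : rnorm (z - 1) <= kap -> rnorm (w - 1) <= 20 * kap ->
    rnorm (t - 1) <= kap -> rnorm (z * w * t - 1) <= 20 * kap + 3 * kap.
  move=> hz hw ht.
  have h1 := rnorm_mul_sub1 (z * w) t; have h2 := rnorm_mul_sub1 z w.
  apply: le_trans h1 _; move: h2 hz hw ht.
  have := rnorm_ge0 (z - 1); have := rnorm_ge0 (w - 1); have := rnorm_ge0 (t - 1).
  have := rnorm_ge0 (z * w - 1).
  set A := rnorm (z - 1); set B := rnorm (w - 1); set C := rnorm (t - 1).
  set D := rnorm (z * w - 1) => D0 C0 B0 A0 h hz hw ht.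
  have h3 : A * B <= kap * (20 * kap) by apply: ler_pM.
  have h4 : kap * (20 * kap) <= kap / 5 by nra.
  have D1 : D <= 22 * kap by lra.
  have h5 : D * C <= (22 * kap) * kap by apply: ler_pM.
  have h6 : 22 * kap * kap <= kap * (22 / 100) by nra.
  lra.
elim/ltn_ind => -[_ _|j IH jM]; first by rewrite p0 subrr rnorm0 mulr_ge0.
pose k := trunc_log 2 j.+1.
have /andP[kj jk] : (2 ^ k <= j.+1 < 2 ^ k.+1)%N by exact: trunc_log_bounds.
have kM : (k <= M)%N by rewrite -(leq_exp2l k M (ltnSn 1)) (leq_trans kj).
have [jk2|jk2] := eqVneq j.+1 (2 ^ k)%N.
  by rewrite jk2; apply: le_trans (p2 _ _) _; [rewrite leqW|lra].
have {}kj : (2 ^ k < j.+1)%N by rewrite ltn_neqAle eq_sym jk2.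
have {}kM : (k < M)%N by rewrite -(ltn_exp2l k M (ltnSn 1)) (leq_trans kj).
have jM2 : (j.+1 + j.+1 <= 2 ^ M.+1)%N by rewrite addnn expnS mul2n leq_double.
pose q := (j.+1 + j.+1 - 2 ^ k.+1)%N.
have qj : (q < j.+1)%N by rewrite /q ltn_subLR ?ltn_add2r// addnn expnS mul2n leq_double ltnW.
have qE : (2 ^ k.+1 + q = j.+1 + j.+1)%N.
  by rewrite subnKC// addnn expnS mul2n leq_double ltnW.
have [e1 c1] : p 1%N * p j * c 1%N j = p j.+1 /\ rnorm (c 1%N j - 1) <= kap.
  by apply: pc; rewrite add1n (leq_trans jM)// leq_exp2l.
have [e2 c2] := pc _ _ jM2.
have [e3 c3] : p (2 ^ k.+1)%N * p q * c (2 ^ k.+1)%N q = p (j.+1 + j.+1)%N /\ rnorm (c (2 ^ k.+1)%N q - 1) <= kap.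
  by rewrite -qE; apply: pc; rewrite qE.
have pj : rnorm (p j - 1) <= 20 * kap by apply: IH => //; exact: ltnW.
have pq : rnorm (p q - 1) <= 20 * kap.
  by apply: IH => //; apply: leq_trans (ltnW qj) jM.
have h1 : rnorm (p j.+1 - 1) <= 20 * kap + 3 * kap.
  by rewrite -e1; apply: three => //; exact: (p2 0%N).
have h2 : rnorm (p j.+1 * p j.+1 * c j.+1 j.+1 - 1) <= 20 * kap + 3 * kap.
  by rewrite e2 -e3; apply: three => //; apply: p2; rewrite leqW.
have h3 : rnorm (p j.+1 ^+ 2 - 1) <= 24 * kap + rnorm (p j.+1 ^+ 2 - 1) * kap.
  have -> : rnorm (p j.+1 ^+ 2 - 1) * kap = rnorm (p j.+1 ^+ 2 - 1) * kap + 0 by rewrite addr0.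
  have e : p j.+1 ^+ 2 - 1 = (p j.+1 * p j.+1 * c j.+1 j.+1 - 1) - (c j.+1 j.+1 - 1)
     - (p j.+1 ^+ 2 - 1) * (c j.+1 j.+1 - 1) by ring.
  rewrite {1}e; apply: le_trans (rnormB _ _) _; rewrite rnormM addr0.
  apply: lerD; last by rewrite ler_wpM2l// rnorm_ge0.
  apply: le_trans (rnormB _ _) _; lra.
have h4 : rnorm (p j.+1 ^+ 2 - 1) = rnorm (p j.+1 - 1) * rnorm (p j.+1 + 1).
  by rewrite -rnormM -subr_sqr expr1n.
have h5 : 2 <= rnorm (p j.+1 - 1) + rnorm (p j.+1 + 1).
  have := rnormB (p j.+1 + 1) (p j.+1 - 1).
  have -> : p j.+1 + 1 - (p j.+1 - 1) = ((2 : R)%:C)%C.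
    by rewrite opprB addrC addrA subrK rmorph_nat.
  by rewrite rnormC_real ger0_norm ?ler0n// addrC.
move: h3 h1 h5; rewrite h4; have := rnorm_ge0 (p j.+1 - 1).
set A := rnorm (p j.+1 - 1); set B := rnorm (p j.+1 + 1) => A0 h3 h1 h5.
have hB : 3 / 2 <= B by lra.
have hAB : A * (3 / 2) <= A * B by apply: ler_wpM2l.
have hk : A * B * kap <= A * B / 100.
  by apply: ler_wpM2l; [apply: mulr_ge0 => //; lra|lra].
lra.
Qed.

End ScalarPhases.

Lemma within_cvg_dist (R : realType) (V : normedModType (Cx R)) (f : R -> V) :
  {within [set t : R | 0 <= t], continuous f} <->
  forall t eps, 0 <= t -> 0 < eps -> exists2 d : R, 0 < d &
    forall s, 0 <= s -> `|t - s| < d -> rnorm (f t - f s) < eps.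
Proof.
rewrite subspace_continuousP; split=> h t => [eps t0 e0|/= t0].
  have /cvg_rnorm/(_ eps e0) := h t t0.
  rewrite near_withinE => /nbhs_ballP[d d0 dP]; exists d => // s s0 sd.
  by apply: dP => //; rewrite -ball_normE.
apply/cvg_rnorm => eps e0; have [d d0 dP] := h t eps t0 e0.
rewrite near_withinE; apply/nbhs_ballP; exists d => // s.
by rewrite -ball_normE /= => sd s0; exact: dP.
Qed.

Lemma dyadic_step_small (R : realType) (tau d : R) : 0 < tau -> 0 < d -> exists N, forall n, (N <= n)%N ->
  dyadic_step tau n <= d.
Proof.
move=> tau0 d0; have dt : 0 < d / tau by rewrite divr_gt0.
have [N _ NP] := near_infty_natSinv_lt (PosNum dt); exists N => n Nn.
have := NP n Nn => /= /ltW; rewrite ler_pdivlMr// => h; apply: le_trans h.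
rewrite mulrC ler_pM2l// lef_pV2 ?posrE ?exprn_gt0//.
by rewrite -natrX ler_nat ltn_expl.
Qed.

(** * Semigroups of intertwiners up to scalars *)

Section ProjectiveUnits.
Variables (R : realType) (H : hilbertType R).
Implicit Types (u v w : H) (s t tau kap eps : R).
Variables (alpha : R -> bop H -> bop H) (e0 : H).
Hypothesis aE : e0_semigroup setT alpha.
Hypothesis e1 : '[e0, e0] = 1.

Lemma e0_dist x u v t eps : 0 <= t -> 0 < eps -> exists2 d : R, 0 < d &
  forall s, 0 <= s -> `|t - s| < d ->
    rnorm ('[alpha t x u, v] - '[alpha s x u, v] : Cx R) < eps.
Proof.
have := e0_cont aE (x := x) (predual_vec u v) I.
by move/(within_cvg_dist (V := Cx R) (fun t => '[alpha t x u, v])) => h; exact: h.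
Qed.

Section Phases.
Variables (V Sl : R -> bop H) (lam : R -> Cx R).
Hypothesis VE : forall t, 0 <= t -> intw (alpha t) (V t).
Hypothesis V0 : forall t, 0 <= t -> V t e0 != 0.
Hypothesis VM : forall s t, 0 <= s -> 0 <= t -> exists c, V s * V t = c *: V (s + t).
Hypothesis SlV : forall t, 0 <= t -> Sl t = lam t *: V t.
Hypothesis Sl0 : Sl 0 = 1.
Hypothesis Slc : forall u, {within [set t : R | 0 <= t], continuous (fun t => Sl t u)}.

(** [Sl] is continuous but not multiplicative, and its scalar [lam] may vanish at some times. Where
    this component along [e0] is nonzero, every multiple of [V t] is a multiple of [Sl t] with
    coefficient read off at [e0]. *)
Definition phase t : Cx R := '[Sl t e0, e0].
Local Notation m := phase.
(** The scalar in [Sl s * Sl t = c s t *: Sl (s + t)]; it has this meaning only when [m (s + t)] is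
    nonzero, in particular for small times. *)
Definition cocycle s t : Cx R := '[Sl s (Sl t e0), e0] / m (s + t).
Local Notation c := cocycle.

Let re0 : rnorm e0 = 1.
Proof. by apply/eqP; rewrite -(eqrXn2 (n := 2)) ?rnorm_ge0// rnorm_inner e1 expr1n. Qed.

Let endo t (t0 : 0 <= t) : normal_unital_endo setT (alpha t).
Proof. exact: (e0_endo aE). Qed.

Let SlE t : 0 <= t -> intw (alpha t) (Sl t).
Proof. by move=> t0; rewrite SlV//; apply: intwZ; exact: VE. Qed.

Lemma phase_near u eps : 0 < eps -> exists2 d : R, 0 < d &
  forall t, 0 <= t -> t <= d -> rnorm (Sl t u - u) <= eps.
Proof.
move=> eps0; have /within_cvg_dist h := Slc (u := u).
have [d d0 dP] := h 0 eps (lexx 0) eps0.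
exists (d / 2) => [|t t0 td]; first by rewrite divr_gt0.
rewrite rnormBC; have := dP t t0; rewrite Sl0 bop1E sub0r normrN ger0_norm// => ht.
by apply/ltW/ht; lra.
Qed.

Lemma phase_sub1 t : rnorm (m t - 1) <= rnorm (Sl t e0 - e0).
Proof.
by rewrite /phase -e1 -innerBl; apply: le_trans (rnorm_cs _ _) _; rewrite re0 mulr1.
Qed.

Lemma phase_neq0 t : rnorm (Sl t e0 - e0) < 1 -> m t != 0.
Proof.
apply: contraTN => /eqP m0; rewrite -leNgt; have := phase_sub1 t.
by rewrite m0 sub0r rnormN rnorm1.
Qed.

Lemma phase_prop t a A : 0 <= t -> A = a *: V t -> m t != 0 ->
  A = ('[A e0, e0] / m t) *: Sl t.
Proof.
move=> t0 -> mt; have l0 : lam t != 0.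
  by apply: contraNneq mt => l0; rewrite /phase SlV// l0 scale0r bop0E inner0l.
have -> : a *: V t = (a / lam t) *: Sl t by rewrite SlV// scalerA divfK.
by rewrite bopZE innerZl mulfK.
Qed.

Lemma cocycleP s t : 0 <= s -> 0 <= t -> m (s + t) != 0 ->
  Sl s * Sl t = c s t *: Sl (s + t).
Proof.
move=> s0 t0 mst; have [d dP] := VM s0 t0.
rewrite [LHS](@phase_prop (s + t) (lam s * lam t * d))// ?addr_ge0//.
by rewrite (SlV s0) (SlV t0) bopZAl bopZAr dP !scalerA.
Qed.

Lemma cocycle_near kap : 0 < kap -> exists2 d : R, 0 < d &
  forall s t, 0 <= s -> 0 <= t -> s + t <= d ->
    m (s + t) != 0 /\ rnorm (c s t - 1) <= kap.
Proof.
(* The numerator of [c s t - 1] is at most [4 k'] and the denominator [m (s + t)] at least [1 / 2],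
   whence the [8]. *)
move=> k0; pose k' := Num.min (1 / 2) (kap / 8).
have k'0 : 0 < k' by rewrite lt_min; apply/andP; split; lra.
have k1 : k' <= 1 / 2 by rewrite ge_min lexx.
have k2 : k' <= kap / 8 by rewrite ge_min lexx orbT.
have [d d0 dP] := phase_near e0 k'0; exists d => // s t s0 t0 std.
have Ds : rnorm (Sl s e0 - e0) <= k' by apply: dP => //; lra.
have Dt : rnorm (Sl t e0 - e0) <= k' by apply: dP => //; lra.
have Dst : rnorm (Sl (s + t) e0 - e0) <= k' by apply: dP => //; lra.
have mst : m (s + t) != 0 by apply: phase_neq0; lra.
split=> //.
have h1 : rnorm (m (s + t) - 1) <= k' := le_trans (phase_sub1 _) Dst.
have Ss : rnorm (Sl s e0) <= 3 / 2.
  by have := rnormD (Sl s e0 - e0) e0; rewrite subrK re0; lra.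
have h2 : rnorm ('[Sl s (Sl t e0), e0] - 1 : Cx R) <= 3 / 2 * k' + k'.
  rewrite -e1 -innerBl; apply: le_trans (rnorm_cs _ _) _; rewrite re0 mulr1.
  have -> : Sl s (Sl t e0) - e0 = Sl s (Sl t e0 - e0) + (Sl s e0 - e0).
    by rewrite bop_linB addrA subrK.
  apply: le_trans (rnormD _ _) _; rewrite (intw_rnorm (endo s0) e1 _ (SlE s0)).
  by apply: lerD => //; rewrite mulrC; apply: ler_pM => //; exact: rnorm_ge0.
have h3 : rnorm (c s t - 1) * rnorm (m (s + t)) <= 4 * k'.
  rewrite -rnormM mulrBl divfK// mul1r.
  have -> : '[Sl s (Sl t e0), e0] - m (s + t) = ('[Sl s (Sl t e0), e0] - 1) - (m (s + t) - 1).
    by rewrite opprB addrA subrK.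
  by apply: le_trans (rnormB _ _) _; lra.
have h4 : 1 / 2 <= rnorm (m (s + t)).
  by have := rnormD (m (s + t)) (1 - m (s + t)); rewrite addrC subrK rnorm1 (rnormBC (1 : Cx R)); lra.
have := rnorm_ge0 (c s t - 1); nra.
Qed.

(* [Sl t] is rescaled along [t = tau / 2 ^ n] by iterated square roots close to
   [1], which gives an honest semigroup over the dyadic multiples of [tau]. *)
Lemma dyadic_phases : exists tau (X : nat -> bop H) (x : nat -> R),
  [/\ 0 < tau, forall t, 0 <= t -> t <= tau -> m t != 0,
      forall n, 0 <= x n, forall n, x n.+1 ^+ 2 = x n &
  [/\ forall n, X n.+1 ^+ 2 = X n,
      forall n u, rnorm (X n u) = x n * rnorm u,
      forall n j, exists q, X n ^+ j = q *: V (j%:R * dyadic_step tau n) &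
      forall u (eps : R), 0 < eps -> exists N, forall n j,
        (N <= n)%N -> (j <= 2 ^ (n - N))%N -> rnorm ((X n ^+ j) u - u) <= eps]].
Proof.
have k20 : 0 < 1 / 20 :> R by lra.
have [tau tau0 tauP] := cocycle_near k20.
pose h := dyadic_step tau.
have h0 n : 0 < h n by exact: dyadic_step_gt0.
have hM : forall n k, (n <= k)%N -> (2 ^ (k - n))%:R * h k = h n by exact: dyadic_stepM.
have hS n : h n.+1 + h n.+1 = h n.
  by rewrite -(hM n n.+1)// subSnn expn1 mulr_natl mulr2n.
have hle n k : (n <= k)%N -> h k <= h n.
  by move=> nk; rewrite -(hM _ _ nk) -[leLHS]mul1r ler_pM2r// ler1n expn_gt0.
have htau n : h n <= tau.
  have -> : tau = h 0%N by rewrite /h /dyadic_step expr0 divr1.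
  exact: hle.
have [a [aS a4 a1]] : exists a : nat -> Cx R, [/\ forall n, a n.+1 ^+ 2 * c (h n.+1) (h n.+1) = a n,
    forall n, 4 * rnorm (a n - 1) <= 1 &
    forall eps : R, 0 < eps -> exists N, forall n, (N <= n)%N -> rnorm (a n - 1) <= eps].
  apply: (root_sequence (c := fun n => c (h n.+1) (h n.+1))) => [n|eps ep].
    have [] := tauP (h n.+1) (h n.+1) (ltW (h0 _)) (ltW (h0 _)).
      by rewrite hS.
    move=> _; lra.
  have [d d0 dP] := cocycle_near ep; have [N NP] := dyadic_step_small tau0 d0.
  exists N => n Nn; have [] := dP (h n.+1) (h n.+1) (ltW (h0 _)) (ltW (h0 _)) => //.
  by rewrite hS NP.
have mtau t : 0 <= t -> t <= tau -> m t != 0.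
  by move=> t0 tt; have [] := tauP t 0 t0 (lexx 0); rewrite addr0.
pose X n : bop H := a n *: Sl (h n).
have XE n : intw (alpha (h n)) (X n).
  by apply: intwZ; apply: SlE; exact: ltW.
have XS n : X n.+1 ^+ 2 = X n.
  rewrite expr2 /X bopZAl bopZAr scalerA cocycleP ?ltW//; last first.
    by rewrite hS; apply: mtau; [exact: ltW|].
  by rewrite hS scalerA -expr2 aS.
pose x n := rnorm (X n e0).
have Xx n u : rnorm (X n u) = x n * rnorm u by rewrite (intw_rnorm (endo (ltW (h0 n))) e1 _ (XE n)) mulrC.
have Xq n j : exists q, X n ^+ j = q *: V (j%:R * h n).
  elim: j => [|j [q qE]].
    by exists (lam 0); rewrite expr0 mul0r -Sl0 SlV.
  have j0 : 0 <= j%:R * h n by rewrite mulr_ge0// ltW.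
  have [d dP] := VM (ltW (h0 n)) j0.
  exists (a n * lam (h n) * q * d).
  rewrite exprS qE /X SlV ?ltW// scalerA bopZAl bopZAr dP !scalerA.
  by rewrite -[j.+1]add1n natrD mulrDl mul1r.
pose p n j : Cx R := '[(X n ^+ j) e0, e0] / m (j%:R * h n).
have pP n j : j%:R * h n <= tau -> X n ^+ j = p n j *: Sl (j%:R * h n).
  move=> jt; have [q qE] := Xq n j; have j0 : 0 <= j%:R * h n by rewrite mulr_ge0// ltW.
  exact: (phase_prop j0 qE (mtau _ j0 jt)).
exists tau, X, x; split=> // [n|n|]; first exact: rnorm_ge0.
  by rewrite expr2 /x -Xx -bopME -expr2 XS.
split=> // u eps eps0.
(* The first bound is the hypothesis of [dyadic_near1]; the second makes the phase error
   [20 kap |u|] a fraction of [eps]. *)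
pose kap := Num.min (1 / 100) (eps / (100 * (rnorm u + 1))).
have ru := rnorm_ge0 u.
have kap0 : 0 < kap.
  by rewrite lt_min; apply/andP; split; [lra|rewrite divr_gt0// mulr_gt0//; lra].
have kap1 : 100 * kap <= 1 by have : kap <= 1 / 100; [rewrite ge_min lexx|lra].
have kap2 : 100 * kap * (rnorm u + 1) <= eps.
  have : kap <= eps / (100 * (rnorm u + 1)) by rewrite ge_min lexx orbT.
  by rewrite ler_pdivlMr ?mulr_gt0//; lra.
have [d1 d10 d1P] := cocycle_near kap0.
have e4 : 0 < eps / 4 by lra.
have [d2 d20 d2P] := phase_near u e4.
have [N1 N1P] := dyadic_step_small tau0 d10.
have [N2 N2P] := dyadic_step_small tau0 d20.
have [N3 N3P] := a1 _ kap0.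
pose N := maxn N1 (maxn N2 N3).
have NN : [/\ N1 <= N, N2 <= N & N3 <= N]%N by rewrite /N; split; rewrite !leq_max leqnn ?orbT.
have [NN1 NN2 NN3] := NN.
(* One extra level, because [dyadic_near1] compares index [j] with index [2 j]. *)
exists N.+1 => n j Nn jn.
have Nn' := ltnW Nn.
have jh i : (i <= 2 ^ (n - N))%N -> i%:R * h n <= h N.
  by move=> iN; rewrite -(hM _ _ Nn') ler_pM2r// ler_nat.
have nN : (n - N = (n - N.+1).+1)%N by rewrite -subSn// subSS.
have near := @dyadic_near1 R (p n) (fun i k => c (i%:R * h n) (k%:R * h n)) (n - N.+1) kap (ltW kap0) kap1.
have pj : rnorm (p n j - 1) <= 20 * kap.
  apply: near jn.
  - rewrite /p expr0 mul0r /phase Sl0 bop1E e1 divr1//.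
  - move=> i k ik; rewrite -nN in ik.
    have ikh : i%:R * h n + k%:R * h n <= h N by rewrite -mulrDl -natrD jh.
    have i0 : 0 <= i%:R * h n by rewrite mulr_ge0// ltW.
    have k0' : 0 <= k%:R * h n by rewrite mulr_ge0// ltW.
    have [mik cik] : m (i%:R * h n + k%:R * h n) != 0 /\ rnorm (c (i%:R * h n) (k%:R * h n) - 1) <= kap.
      by apply: d1P => //; apply: le_trans ikh _; apply: N1P.
    split=> //; rewrite {3}/p natrD mulrDl exprD.
    have it : i%:R * h n <= tau by have := htau N; lra.
    have kt : k%:R * h n <= tau by have := htau N; lra.
    rewrite [X n ^+ i](pP _ _ it) [X n ^+ k](pP _ _ kt) bopZAl bopZAr scalerA cocycleP//.
    by rewrite scalerA bopZE innerZl mulfK.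
  - move=> k kn; rewrite -nN in kn.
    have kn' : (k <= n)%N by apply: leq_trans kn _; exact: leq_subr.
    have nk : (n - (n - k) = k)%N by rewrite subKn.
    (* [2 ^ k] steps at level [n] make one step at level [n - k], where [X] is by construction
       [a (n - k)] times [Sl]. *)
    have -> : p n (2 ^ k)%N = a (n - k)%N.
      have eX := dyadic_expX XS (leq_subr k n); have eh := hM _ _ (leq_subr k n).
      rewrite nk in eX eh; rewrite /p eX eh /X.
      by rewrite bopZE innerZl -/(m _) mulfK// mtau// ltW.
    apply: N3P; apply: leq_trans NN3 _.
    by rewrite leq_subRL// addnC -leq_subRL.
have jhN : j%:R * h n <= h N.
  by apply: jh; apply: leq_trans jn _; rewrite leq_exp2l// nN.
rewrite pP; last exact: le_trans jhN (htau _).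
rewrite bopZE; set y := Sl _ u.
have -> : p n j *: y - u = p n j *: (y - u) + (p n j - 1) *: u.
  by rewrite scalerBr scalerBl scale1r addrA subrK.
apply: le_trans (rnormD _ _) _; rewrite (rnormZ (p n j)) (rnormZ (p n j - 1)).
have yu : rnorm (y - u) <= eps / 4.
  apply: d2P; first by rewrite mulr_ge0// ltW.
  by apply: le_trans jhN _; apply: N2P.
have p2 : rnorm (p n j) <= 2.
  by have := rnormD (p n j - 1) (1 : Cx R); rewrite subrK rnorm1; lra.
have h1 : rnorm (p n j) * rnorm (y - u) <= 2 * (eps / 4) by apply: ler_pM => //; exact: rnorm_ge0.
have h2 : rnorm (p n j - 1) * rnorm u <= 20 * kap * rnorm u by apply: ler_wpM2r.
have := mulr_ge0 (ltW kap0) ru; lra.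
Qed.

(** The semigroup [S] is the limit of the dyadic powers, and weak continuity of [alpha] carries the
    intertwining relation to the limit. For small [t] comparison with [Sl] shows that [S t] is a
    nonzero multiple of [V t]; multiplicativity extends this to all times. *)
Lemma projective_unit : exists S, is_unit alpha S /\
  forall t, 0 <= t -> exists2 d : Cx R, d != 0 & S t = d *: V t.
Proof.
have [tau [X [x [tau0 mtau x0 xS [XS Xx Xq X1]]]]] := dyadic_phases.
have [S [Sl' S0 SM Sc]] := dyadic_semigroup tau0 x0 xS XS Xx X1.
pose h := dyadic_step tau; pose k := dyadic_index tau.
have h0 n : 0 < h n by exact: dyadic_step_gt0.
pose s n t := (k n t)%:R * h n.
have s0 n t : 0 <= s n t by rewrite mulr_ge0// ltW.
have st t d : 0 <= t -> 0 < d -> exists N, forall n, (N <= n)%N -> `|t - s n t| < d.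
  move=> t0 d0; have d2 : 0 < d / 2 by lra.
  have [N NP] := dyadic_step_small tau0 d2; exists N => n /NP hn.
  have /andP[b1 b2] := dyadic_indexP tau0 n t0.
  move: b1 b2; rewrite -natr1 mulrDl mul1r -/(h n) -/(k n t) -/(s n t) => b1 b2.
  have hd : h n <= d / 2 := hn.
  by rewrite ger0_norm ?subr_ge0//; lra.
have intwX n j : intw (alpha (j%:R * h n)) (X n ^+ j).
  have [q ->] := Xq n j; have j0 : 0 <= j%:R * h n by rewrite mulr_ge0// ltW.
  by apply: intwZ; exact: VE.
have SE t : 0 <= t -> intw (alpha t) (S t).
  move=> t0 y; apply: bopP => u; rewrite !bopME; apply: inner_eql => w.
  have [C C0 yC] := bop_rbound y.
  have cv1 : (fun n => '[(X n ^+ k n t) (y u), w] : Cx R) @ \oo --> ('[S t (y u), w] : Cx R).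
    by apply: cvg_innerl; exact: Sl'.
  apply: esym; apply: (rnorm_cvg_unique (V := Cx R) cv1).
  apply/cvg_rnormn => eps eps0.
  have e2 : 0 < eps / 2 by lra.
  have [d d0 dP] := e0_dist y (S t u) w t0 e2.
  have [N1 N1P] := st _ _ t0 d0.
  have rw := rnorm_ge0 w.
  have e' : 0 < eps / (2 * C * (rnorm w + 1)) by rewrite divr_gt0// !mulr_gt0//; lra.
  have /cvg_rnormn/(_ _ e')[N2 N2P] : (fun n => (X n ^+ k n t) u) @ \oo --> S t u by exact: Sl'.
  exists (maxn N1 N2) => n; rewrite geq_max => /andP[n1 n2].
  rewrite -(intwE y u (intwX n (k n t))) -/(s n t).
  set E := (X n ^+ k n t) u.
  have -> : '[alpha t y (S t u), w] - '[alpha (s n t) y E, w] =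
    ('[alpha t y (S t u), w] - '[alpha (s n t) y (S t u), w]) + '[alpha (s n t) y (S t u - E), w].
    by rewrite bop_linB innerBl addrA subrK.
  apply: le_lt_trans (rnormD _ _) _.
  have h1 := dP _ (s0 n t) (N1P n n1).
  have h2 : rnorm ('[alpha (s n t) y (S t u - E), w] : Cx R) <= eps / 2.
    apply: le_trans (rnorm_cs _ _) _.
    have := endo_bound (endo (s0 n t)) (ltW C0) yC (S t u - E).
    have := N2P n n2; rewrite -/E ltr_pdivlMr; last by rewrite !mulr_gt0//; lra.
    have := rnorm_ge0 (S t u - E); have := rnorm_ge0 (alpha (s n t) y (S t u - E)).
    set A := rnorm (alpha _ _ _); set B := rnorm (S t u - E) => A0 B0 h3 h4.
    have h5 : A * rnorm w <= C * B * rnorm w by apply: ler_wpM2r.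
    have : 0 <= C * B by rewrite mulr_ge0// ltW.
    lra.
  lra.
exists S; split; first by split=> //; exact: SE.
have re t : 0 <= t -> forall u, rnorm (S t u) = rnorm u * rnorm (S t e0).
  by move=> t0 u; exact: (intw_rnorm (endo t0) e1 _ (SE t t0)).
have [d d0 dP] : exists2 d : R, 0 < d & forall t, 0 <= t -> t <= d ->
    exists2 q : Cx R, q != 0 & S t = q *: V t.
  have /within_cvg_dist Sc' := Sc e0.
  have [d1 d10 d1P] := Sc' 0 1 (lexx 0) ltr01.
  pose d := Num.min tau (d1 / 2); exists d => [|t t0 td].
    by rewrite lt_min tau0 divr_gt0.
  have ttau : t <= tau by apply: le_trans td _; rewrite ge_min lexx.
  have td1 : t < d1.
    have : t <= d1 / 2 by apply: le_trans td _; rewrite ge_min lexx orbT.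
    lra.
  have cvS u : (fun n => Sl (s n t) u) @ \oo --> Sl t u.
    apply/cvg_rnormn => eps eps0.
    have /within_cvg_dist Slc' := Slc (u := u).
    have [d2 d20 d2P] := Slc' t eps t0 eps0.
    by have [N NP] := st t d2 t0 d20; exists N => n /NP; exact: d2P.
  have E n u : m (s n t) *: (X n ^+ k n t) u = '[(X n ^+ k n t) e0, e0] *: Sl (s n t) u.
    have [q qE] := Xq n (k n t).
    have stt : s n t <= tau.
      by apply: le_trans ttau; case/andP: (dyadic_indexP tau0 n t0).
    have ms := mtau _ (s0 n t) stt.
    have h1 := phase_prop (s0 n t) qE ms.
    by rewrite {1}h1 bopZE scalerA mulrC divfK.
  have ES u : m t *: S t u = '[S t e0, e0] *: Sl t u.
    have c1 : (fun n => m (s n t) *: (X n ^+ k n t) u) @ \oo --> m t *: S t u.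
      apply: cvgZ; last exact: Sl'.
      by apply: cvg_innerl; exact: cvS.
    apply: (rnorm_cvg_unique c1); under eq_fun do rewrite E.
    apply: cvgZ; last exact: cvS.
    by apply: cvg_innerl; exact: Sl'.
  have mt := mtau t t0 ttau.
  have SV : S t = ('[S t e0, e0] / m t * lam t) *: V t.
    apply: bopP => u; rewrite -scalerA -SlV// bopZE mulrC -scalerA -ES scalerA mulVf//.
    by rewrite scale1r.
  exists ('[S t e0, e0] / m t * lam t) => //; apply/eqP => q0.
  have := d1P t t0; rewrite sub0r normrN ger0_norm// => /(_ td1).
  by rewrite S0 bop1E SV q0 scale0r bop0E subr0 re0 ltxx.
have add s' t : 0 <= s' -> 0 <= t -> (exists2 q : Cx R, q != 0 & S s' = q *: V s') ->
    (exists2 q : Cx R, q != 0 & S t = q *: V t) -> exists2 q : Cx R, q != 0 & S (s' + t) = q *: V (s' + t).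
  move=> s'0 t0 [q q0 qE] [r r0 rE]; have [b bE] := VM s'0 t0.
  exists (q * r * b); last by rewrite SM// qE rE bopZAl bopZAr bE !scalerA.
  rewrite !mulf_neq0//; apply/eqP => b0.
  have S00 : V s' * V t = 0 by rewrite bE b0 scale0r.
  have /(congr1 (fun y : bop H => rnorm (y e0))) := S00.
  rewrite bopME bop0E rnorm0 (intw_rnorm (endo s'0) e1 _ (VE s'0)) => /eqP.
  by rewrite mulf_eq0 !rnorm_eq0 (negbTE (V0 t0)) (negbTE (V0 s'0)).
move=> t t0; pose n := Num.truncn (t / d).
pose t' := t / n.+1%:R.
have t'0 : 0 <= t' by rewrite divr_ge0.
have t'd : t' <= d.
  rewrite ler_pdivrMr ?ltr0n// mulrC -ler_pdivrMr//; apply: ltW.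
  by have /andP[] := truncn_itv (divr_ge0 t0 (ltW d0)).
have -> : t = n.+1%:R * t' by rewrite mulrC divfK// pnatr_eq0.
elim: n.+1 => [|j IH]; first by rewrite mul0r; apply: dP => //; exact: ltW.
rewrite -natr1 mulrDl mul1r; apply: add => //; first by rewrite mulr_ge0.
exact: dP.
Qed.

End Phases.
End ProjectiveUnits.

Lemma nonneg_additive_ind (R : realType) (P : R -> Prop) (d : R) : 0 < d ->
  (forall t, 0 <= t -> t <= d -> P t) ->
  (forall s t, 0 <= s -> 0 <= t -> P s -> P t -> P (s + t)) ->
  forall t, 0 <= t -> P t.
Proof.
move=> d0 Pd PD t t0; pose n := Num.truncn (t / d).
pose t' := t / n.+1%:R.
have t'0 : 0 <= t' by rewrite divr_ge0.
have t'd : t' <= d.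
  rewrite ler_pdivrMr ?ltr0n// mulrC -ler_pdivrMr//; apply: ltW.
  by have /andP[] := truncn_itv (divr_ge0 t0 (ltW d0)).
have -> : t = n.+1%:R * t' by rewrite mulrC divfK// pnatr_eq0.
elim: n.+1 => [|j IH]; first by rewrite mul0r; apply: Pd => //; exact: ltW.
rewrite -natr1 mulrDl mul1r; apply: PD => //; first by rewrite mulr_ge0.
exact: Pd.
Qed.

(** * Units of a tensor product semigroup *)

Section UnitNorms.
Variables (R : realType) (H : hilbertType R) (alpha : R -> bop H -> bop H) (e0 : H).
Hypothesis aE : e0_semigroup setT alpha.
Hypothesis e1 : '[e0, e0] = 1.
Implicit Types (s t : R).

Lemma unit_vector_rnorm : rnorm e0 = 1.
Proof. by apply/eqP; rewrite -(eqrXn2 (n := 2)) ?rnorm_ge0// rnorm_inner e1 expr1n. Qed.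

Lemma unit_near U u eps : is_unit alpha U -> 0 < eps -> exists2 d : R, 0 < d &
  forall t, 0 <= t -> t <= d -> rnorm (U t u - u) <= eps.
Proof.
move=> Uu eps0; have /within_cvg_dist h := unit_cont Uu (u := u).
have [d d0 dP] := h 0 eps (lexx 0) eps0.
exists (d / 2) => [|t t0 td]; first by rewrite divr_gt0.
rewrite rnormBC; have := dP t t0; rewrite (unit_zero Uu) bop1E sub0r normrN ger0_norm// => ht.
by apply/ltW/ht; lra.
Qed.

Lemma unit_rnormM U s t : is_unit alpha U -> 0 <= s -> 0 <= t ->
  rnorm (U (s + t) e0) = rnorm (U s e0) * rnorm (U t e0).
Proof.
move=> Uu s0 t0; rewrite (unit_add Uu)// bopME.
by rewrite (intw_rnorm (e0_endo aE s0) e1 _ (unit_intertw Uu s0)) mulrC.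
Qed.

Lemma unit_neq0 U t : is_unit alpha U -> 0 <= t -> U t e0 != 0.
Proof.
move=> Uu; rewrite -rnorm_gt0; have e2 : 0 < 1 / 2 :> R by lra.
have [d d0 dP] := unit_near e0 Uu e2.
move: t; apply: (nonneg_additive_ind d0) => [t t0 td|s t s0 t0 hs ht].
  have := dP t t0 td; have := rnormB (U t e0) (U t e0 - e0).
  by rewrite opprB addrC subrK unit_vector_rnorm; lra.
by rewrite unit_rnormM// mulr_gt0.
Qed.

End UnitNorms.

Section UnitDecomposition.
Variables (R : realType) (H K : hilbertType R).
Variables (tau : H -> H -> K) (e : nat -> H).
Hypotheses (tT : tensor tau) (eb : orthobasis e).
Variables (alpha : R -> bop H -> bop H) (sigma : R -> bop K -> bop K).
Hypotheses (aE : e0_semigroup setT alpha) (sE : e0_semigroup setT sigma).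
Hypothesis st : forall t, 0 <= t -> forall x y,
  sigma t (tens tau x y) = tens tau (alpha t x) (alpha t y).
Implicit Types (s t : R) (u v : H) (k : K).

Local Notation e0 := (e 0%N).
Local Notation k0 := (tau e0 e0).
Local Notation sq k := (kmul tT k k).
Let e1 : '[e0, e0] = 1. Proof. by rewrite eb.1. Qed.
Let k1 : '[k0, k0] = 1. Proof. by rewrite (tau_inner tT) e1 mulr1. Qed.
Let tE t (t0 : 0 <= t) : normal_unital_endo setT (alpha t). Proof. exact: (e0_endo aE). Qed.
Let TE t (t0 : 0 <= t) : normal_unital_endo setT (sigma t). Proof. exact: (e0_endo sE). Qed.

Lemma kmul_unit_vector : sq k0 = k0.
Proof.
apply: (op_inj (tT := tT)); rewrite (op_kmul tT eb) op_tau adj_rk1 rk1M e1.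
by rewrite scale1r.
Qed.

Lemma kmul_near k d : rnorm (k - k0) <= d -> rnorm (sq k - k0) <= d * (2 + d).
Proof.
move=> kd; have d0 := le_trans (rnorm_ge0 _) kd.
have -> : sq k - k0 = kmul tT (k - k0) k + kmul tT k0 (k - k0).
  by rewrite kmulBl (kmulBr tT eb) kmul_unit_vector addrA subrK.
have rk : rnorm k <= 1 + d.
  have := rnormD (k - k0) k0; rewrite subrK (unit_vector_rnorm k1); lra.
apply: le_trans (rnormD _ _) _.
have h1 := kmul_rnorm tT eb (k - k0) k; have h2 := kmul_rnorm tT eb k0 (k - k0).
rewrite (unit_vector_rnorm k1) mul1r in h2.
have h3 : rnorm (k - k0) * rnorm k <= d * (1 + d) by apply: ler_pM => //; exact: rnorm_ge0.
lra.
Qed.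

Section OneUnit.
Variable U : R -> bop K.
Hypothesis Uu : is_unit sigma U.

(* The squared norms of [U t k0] and of its first two squares for [kmul] are
   multiplicative in [t], so the matrix inequality between them, applied at
   time [t / n], becomes an equality. *)
Lemma unit_elementary t : 0 <= t -> exists u v, U t k0 = tau u v.
Proof.
move=> t0.
have UE s : 0 <= s -> intw (sigma s) (U s) by move=> s0; exact: (unit_intertw Uu).
pose y1 s := U s k0; pose y2 s := sq (y1 s); pose y4 s := sq (y2 s).
have A2P s : 0 <= s -> exists A2, intw (sigma s) A2 /\
    forall k k', kmul tT (U s k) (U s k') = A2 (kmul tT k k').
  move=> s0; have [A2] := intw_square tT eb (tE s0) (TE s0) (st s0) (UE s s0).
  by exists A2.
have yM s s' : 0 <= s -> 0 <= s' ->
    [/\ rnorm (y1 (s + s')) = rnorm (y1 s) * rnorm (y1 s'),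
        rnorm (y2 (s + s')) = rnorm (y2 s) * rnorm (y2 s')
      & rnorm (y4 (s + s')) = rnorm (y4 s) * rnorm (y4 s')].
  move=> s0 s'0; have eU : y1 (s + s') = U s (y1 s') by rewrite /y1 (unit_add Uu).
  have [A2 [A2E A2Q]] := A2P s s0.
  have [A4 A4E A4Q] := intw_square tT eb (tE s0) (TE s0) (st s0) A2E.
  have e2 : y2 (s + s') = A2 (y2 s') by rewrite /y2 eU A2Q.
  have e4 : y4 (s + s') = A4 (y4 s') by rewrite /y4 e2 A4Q.
  have f2 : A2 k0 = y2 s by rewrite -kmul_unit_vector -A2Q.
  have f4 : A4 k0 = y4 s by rewrite -kmul_unit_vector -A4Q f2.
  split; first exact: (unit_rnormM sE k1).
    by rewrite e2 (intw_rnorm (TE s0) k1 _ A2E) f2 mulrC.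
  by rewrite e4 (intw_rnorm (TE s0) k1 _ A4E) f4 mulrC.
have [d d0 dP] : exists2 d : R, 0 < d & forall s, 0 <= s -> s <= d ->
    [/\ 0 < rnorm (y1 s), 0 < rnorm (y2 s) & 0 < rnorm (y4 s)].
  (* Starting from [1 / 8], two applications of [d |-> d (2 + d)] from [kmul_near] stay below
     [1]. *)
  have e8 : 0 < 1 / 8 :> R by lra.
  have [d d0 dP] := unit_near k0 Uu e8; exists d => // s s0 sd.
  have h1 := dP s s0 sd; have h2 := kmul_near h1; have h4 := kmul_near h2.
  have pos k b : rnorm (k - k0) <= b -> b < 1 -> 0 < rnorm k.
    move=> kb b1; have := rnormB k (k - k0).
    by rewrite opprB addrC subrK (unit_vector_rnorm k1); lra.
  by split; [apply: (pos _ _ h1)|apply: (pos _ _ h2)|apply: (pos _ _ h4)]; lra.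
have yp s : 0 <= s -> [/\ 0 < rnorm (y1 s), 0 < rnorm (y2 s) & 0 < rnorm (y4 s)].
  move: s; apply: (nonneg_additive_ind d0 dP) => s s' s0 s'0 [a1 a2 a4] [b1 b2 b4].
  by have [-> -> ->] := yM s s' s0 s'0; rewrite !mulr_gt0.
have := @multiplicative_equality R (fun s => rnorm (y1 s) ^+ 2)
  (fun s => rnorm (y2 s) ^+ 2) (fun s => rnorm (y4 s) ^+ 2) _ _ _ t t0.
move=> h; apply: (kmul_elementary (tT := tT) eb).
  by rewrite -rnorm_gt0; have [] := yp t t0.
apply: h => [s s0|s s' s0 s'0|s s0].
- by have [a b c] := yp s s0; rewrite !exprn_gt0.
- by have [-> -> ->] := yM s s' s0 s'0; rewrite !exprMn.
- by split; [exact: (kmul_le tT eb)|exact: (kmul_le tT eb)|exact: (kmul_ineq tT eb)].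
Qed.

(** [U t k0 = tau u v] is fixed by [p (x) p] with [p = alpha t |e0><e0|], and the intertwiners built
    from [u] and [v] send [e0] to [p u] and [p v]. Intertwiners that agree at [k0] are equal. *)
Lemma unit_tens t : 0 <= t -> exists V W,
  [/\ intw (alpha t) V, intw (alpha t) W & U t = tens tau V W].
Proof.
move=> t0; have [u [v uv]] := unit_elementary t0.
have UE := unit_intertw Uu t0.
exists (itw (tE t0) e0 u), (itw (tE t0) e0 v); split; try exact: itw_intw.
apply: (intw_eq k1 UE).
  by apply: (tens_intw tT eb (TE t0) (st t0)); exact: itw_intw.
rewrite (tensE tT eb) !itwE -(intw_tens_fix tT eb (st t0) UE) uv.
by rewrite (tensE tT eb).
Qed.

End OneUnit.

Lemma tens_proportional (A B C D : bop H) u : B u != 0 -> tens tau A B = tens tau C D ->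
  exists c : Cx R, A = c *: C.
Proof.
move=> Bu AC; have BB : '[B u, B u] != 0 by rewrite inner_eq0.
exists ('[B u, D u] / '[B u, B u]); apply: bopP => v; apply: inner_eql => a.
have /(congr1 (fun X : bop K => '[X (tau v u), tau a (B u)])) := AC.
rewrite !(tensE tT eb) !(tau_inner tT) bopZE innerZl => h.
by apply: (mulIf BB); rewrite h mulrAC divfK// mulrC.
Qed.

Lemma tens_cancel (A B B' : bop H) u : A u != 0 -> tens tau A B = tens tau A B' -> B = B'.
Proof.
move=> Au BB; apply: bopP => v.
have /(congr1 (fun X : bop K => X (tau u v))) := BB.
rewrite !(tensE tT eb) => /eqP; rewrite -subr_eq0 -(tauBr tT) -rnorm_eq0 (tau_rnorm tT).
by rewrite mulf_eq0 !rnorm_eq0 (negbTE Au) subr_eq0 => /eqP.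
Qed.

(** Once the first factor has been made a unit by [projective_unit], the second is determined by [U]
    and inherits the semigroup law by cancellation and continuity by division. *)
Lemma unit_decomposition U : is_unit sigma U -> exists S T,
  [/\ is_unit alpha S, is_unit alpha T & forall t, 0 <= t -> U t = tens tau (S t) (T t)].
Proof.
move=> Uu.
have /choice[V VP] t : exists V, 0 <= t -> exists W,
    [/\ intw (alpha t) V, intw (alpha t) W & U t = tens tau V W].
  have [t0|nt0] := pselect (0 <= t); last by exists 0 => /nt0.
  by have [V [W VW]] := unit_tens Uu t0; exists V => _; exists W.
have /choice[W WP] t : exists W, 0 <= t ->
    [/\ intw (alpha t) (V t), intw (alpha t) W & U t = tens tau (V t) W].
  have [t0|nt0] := pselect (0 <= t); last by exists 0 => /nt0.
  by have [W VW] := VP t t0; exists W.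
have VW0 t : 0 <= t -> V t e0 != 0 /\ W t e0 != 0.
  move=> t0; have := unit_neq0 sE k1 Uu t0; have [_ _ ->] := WP t t0.
  rewrite (tensE tT eb) -rnorm_eq0 (tau_rnorm tT) mulf_eq0 negb_or !rnorm_eq0.
  by move/andP.
pose lam t : Cx R := '[e0, W t e0].
have opU t u : 0 <= t -> op tT (U t (tau u e0)) e0 = lam t *: V t u.
  by move=> t0; have [_ _ ->] := WP t t0; rewrite (tensE tT eb) op_tau rk1E.
(* This is the slice of [U t] at [e0] in the second leg, hence continuous in [t], although [V] and
   [W] are chosen independently at each time. *)
pose Sl t := lam t *: V t.
have Sl0 : Sl 0 = 1.
  apply: bopP => u; rewrite bopZE -opU// (unit_zero Uu) bop1E op_tau rk1E e1 scale1r.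
  by [].
have Slc u : {within [set t : R | 0 <= t], continuous (fun t => Sl t u)}.
  apply/within_cvg_dist => t eps t0 eps0.
  have /within_cvg_dist h := unit_cont Uu (u := tau u e0).
  have [d d0 dP] := h t eps t0 eps0; exists d => // s s0 sd.
  rewrite /Sl !bopZE -!opU// -bopBE -opB.
  apply: le_lt_trans (op_bound _ _ _) _; rewrite (unit_vector_rnorm e1) mulr1.
  exact: dP.
have VM s t : 0 <= s -> 0 <= t -> exists c : Cx R, V s * V t = c *: V (s + t).
  move=> s0 t0; have st0 := addr_ge0 s0 t0.
  have [_ Ws Us] := WP s s0; have [_ Wt Ut] := WP t t0; have [_ _ Ust] := WP _ st0.
  apply: (@tens_proportional _ (W s * W t) _ (W (s + t)) e0).
    rewrite bopME -rnorm_eq0 (intw_rnorm (tE s0) e1 _ Ws) mulf_eq0 !rnorm_eq0.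
    by rewrite (negbTE (VW0 t t0).2) (negbTE (VW0 s s0).2).
  by rewrite -(tensM tT eb) -Us -Ut -Ust (unit_add Uu).
have VE t : 0 <= t -> intw (alpha t) (V t) by move=> t0; have [] := WP t t0.
have V0 t : 0 <= t -> V t e0 != 0 by move=> t0; have [] := VW0 t t0.
have SlV t : 0 <= t -> Sl t = lam t *: V t by [].
have [S [Su SV]] := projective_unit aE e1 VE V0 VM SlV Sl0 Slc.
have /choice[T TP] t : exists T, 0 <= t -> intw (alpha t) T /\ U t = tens tau (S t) T.
  have [t0|nt0] := pselect (0 <= t); last by exists 0 => /nt0.
  have [_ Wt Ut] := WP t t0; have [d d0 SVd] := SV t t0.
  (* The scalar is conjugated because [tens] is conjugate-linear in its second argument. *)
  exists ((d^-1)^* *: W t) => _; split; first exact: intwZ.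
  rewrite Ut SVd (tensZl tT eb) (tensZr tT eb) conjCK scalerA mulfV// scale1r.
  by [].
have TE' t (t0 : 0 <= t) := (TP t t0).1; have UT t (t0 : 0 <= t) := (TP t t0).2.
exists S, T; split=> //; split=> [|s t s0 t0|v|t t0]; last exact: TE'.
- apply: (@tens_cancel 1 _ _ e0); first by rewrite bop1E -rnorm_gt0 (unit_vector_rnorm e1).
  by rewrite -{1}(unit_zero Su) -UT// (unit_zero Uu) (tens11 tT eb).
- have st0 := addr_ge0 s0 t0.
  apply: (@tens_cancel (S (s + t)) _ _ e0); first exact: (unit_neq0 aE e1 Su).
  by rewrite -UT// (unit_add Uu)// (unit_add Su)// -(tensM tT eb) -!UT.
- apply/within_cvg_dist => t eps t0 eps0.
  (* The tensor of [S t e0] with [T t v - T s v] is the increment of [U] at [k] minus the increment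
     of [S] at [e0] tensored with [T s v]. Near [t] the norm of [S s e0] stays above [a / 2], which
     bounds [T s v] by [M]. *)
  pose k := tau e0 v; pose a := rnorm (S t e0).
  have a0 : 0 < a by rewrite rnorm_gt0 (unit_neq0 aE e1 Su).
  pose M := (rnorm (U t k) + 1) * (2 / a).
  have M0 : 0 <= M by rewrite mulr_ge0 ?divr_ge0 ?ltW// ltr_wpDl ?rnorm_ge0.
  have M1 : 0 < 1 + M by lra.
  pose eta := eps * a / (2 * (1 + M)).
  have eta0 : 0 < eta by rewrite divr_gt0// ?mulr_gt0.
  have /within_cvg_dist hU := unit_cont Uu (u := k).
  have /within_cvg_dist hS := unit_cont Su (u := e0).
  have m1 : 0 < Num.min eta 1 by rewrite lt_min eta0 ltr01.
  have m2 : 0 < Num.min eta (a / 2) by rewrite lt_min eta0 divr_gt0.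
  have [d1 d10 d1P] := hU t _ t0 m1; have [d2 d20 d2P] := hS t _ t0 m2.
  exists (Num.min d1 d2) => [|s s0]; first by rewrite lt_min d10 d20.
  rewrite lt_min => /andP[/(d1P s s0) + /(d2P s s0)].
  rewrite !lt_min => /andP[h1 h2] /andP[h3 h4].
  have Uk r : 0 <= r -> U r k = tau (S r e0) (T r v).
    by move=> r0; rewrite UT// (tensE tT eb).
  have Ss : a / 2 <= rnorm (S s e0).
    by have := rnormD (S t e0 - S s e0) (S s e0); rewrite subrK -/a; lra.
  have Ts : rnorm (T s v) <= M.
    have := rnormB (U t k) (U t k - U s k); rewrite opprB addrC subrK => h5.
    have h6 : rnorm (S s e0) * rnorm (T s v) <= rnorm (U t k) + 1.
      by rewrite -(tau_rnorm tT) -Uk//; lra.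
    have h7 : a / 2 * rnorm (T s v) <= rnorm (U t k) + 1.
      by apply: le_trans h6; apply: ler_wpM2r => //; exact: rnorm_ge0.
    rewrite /M [leRHS]mulrC.
    have -> : rnorm (T s v) = 2 / a * (a / 2 * rnorm (T s v)).
      by field; rewrite gt_eqF.
    by apply: ler_wpM2l => //; rewrite divr_ge0// ltW.
  have key : a * rnorm (T t v - T s v) <= eta + eta * M.
    rewrite /a -(tau_rnorm tT).
    have -> : tau (S t e0) (T t v - T s v) = (U t k - U s k) - tau (S t e0 - S s e0) (T s v).
      by rewrite !Uk// (tauBr tT) (tauBl tT) opprB addrA subrK.
    apply: le_trans (rnormB _ _) _; apply: lerD; first exact: ltW.
    by rewrite (tau_rnorm tT); apply: ler_pM => //; [exact: rnorm_ge0|exact: rnorm_ge0|exact: ltW].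
  rewrite -(ltr_pM2l a0); apply: le_lt_trans key _.
  have -> : eta + eta * M = eps * a / 2 by rewrite /eta; field; rewrite gt_eqF.
  by rewrite mulrC; have := mulr_gt0 a0 eps0; lra.
Qed.

Lemma tens_unit S T : is_unit alpha S -> is_unit alpha T ->
  is_unit sigma (fun t => tens tau (S t) (T t)).
Proof.
move=> Su Tu; split=> [|s t s0 t0|k|t t0].
- by rewrite (unit_zero Su) (unit_zero Tu) (tens11 tT eb).
- by rewrite (unit_add Su)// (unit_add Tu)// (tensM tT eb).
- apply/within_cvg_dist => t eps t0 eps0.
  pose B := (rnorm (S t e0) + 1) * (rnorm (T t e0) + 1).
  have B0 : 0 < B by rewrite mulr_gt0// ltr_wpDl ?rnorm_ge0.
  have UB (s : R) : 0 <= s -> rnorm (S s e0) <= rnorm (S t e0) + 1 ->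
      rnorm (T s e0) <= rnorm (T t e0) + 1 -> forall l, rnorm (tens tau (S s) (T s) l) <= B * rnorm l.
    move=> s0 hS hT; apply: (tens_bound tT eb) => [||u|u].
    - by rewrite addr_ge0 ?rnorm_ge0.
    - by rewrite addr_ge0 ?rnorm_ge0.
    - rewrite (intw_rnorm (tE s0) e1 _ (unit_intertw Su s0)) mulrC.
      by apply: ler_wpM2r => //; exact: rnorm_ge0.
    - rewrite (intw_rnorm (tE s0) e1 _ (unit_intertw Tu s0)) mulrC.
      by apply: ler_wpM2r => //; exact: rnorm_ge0.
  have lc (g : K) : lspan [set tau p.1 p.2 | p in [set: H * H]] g ->
      {within [set t : R | 0 <= t], continuous (fun t => tens tau (S t) (T t) g)}.
    apply: (@lspan_ind R K [set tau p.1 p.2 | p in [set: H * H]]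
      (fun g => {within [set t : R | 0 <= t], continuous (fun t => tens tau (S t) (T t) g)})).
    + by apply/within_cvg_dist => s d _ d0; exists 1 => // r _ _; rewrite !bop_lin0 subrr rnorm0.
    + move=> c g1 g2 [[u v] _ <-] /= /subspace_continuousP g2c.
      have -> : (fun r => tens tau (S r) (T r) (c *: tau u v + g2)) =
          (fun r => c *: tau (S r u) (T r v) + tens tau (S r) (T r) g2).
        by apply/funext => r; rewrite bop_linD bop_linZ (tensE tT eb).
      apply/subspace_continuousP => s s0; apply: cvgD; last exact: g2c.
      have FF : ProperFilter (within [set t : R | 0 <= t] (nbhs s)).
        exact: within_nbhs_proper (subset_closure s0).
      apply: cvgZr; apply: (tau_cvg tT).
      * by have /subspace_continuousP := unit_cont Su (u := u); apply.
      * by have /subspace_continuousP := unit_cont Tu (u := v); apply.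
  have e4 : 0 < eps / (4 * B) by rewrite divr_gt0// mulr_gt0.
  have [g gl kg] := tau_lspan_dense tT k e4.
  have e2 : 0 < eps / 4 by rewrite divr_gt0.
  have /within_cvg_dist/(_ t _ t0 e2)[d1 d10 d1P] := lc g gl.
  have /within_cvg_dist/(_ t 1 t0 ltr01)[d2 d20 d2P] := unit_cont Su (u := e0).
  have /within_cvg_dist/(_ t 1 t0 ltr01)[d3 d30 d3P] := unit_cont Tu (u := e0).
  exists (Num.min d1 (Num.min d2 d3)) => [|s s0]; first by rewrite !lt_min d10 d20 d30.
  rewrite !lt_min => /and3P[/(d1P s s0) h1 /(d2P s s0) h2 /(d3P s s0) h3].
  set X := tens tau (S t) (T t) in h1 *; set Y := tens tau (S s) (T s) in h1 *.
  have -> : X k - Y k = X (k - g) + (X g - Y g) - Y (k - g).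
    by rewrite !bop_linB subrKA opprB subrKA.
  have near1 (a b : H) : rnorm (a - b) < 1 -> rnorm b <= rnorm a + 1.
    by move=> ab; have := rnormB a (a - b); rewrite opprB addrC subrK; lra.
  have hX : rnorm (X (k - g)) <= B * rnorm (k - g) by apply: UB => //; lra.
  have hY : rnorm (Y (k - g)) <= B * rnorm (k - g) by apply: UB => //; exact: near1.
  have hk : B * rnorm (k - g) < eps / 4.
    have -> : eps / 4 = B * (eps / (4 * B)) by field; rewrite gt_eqF.
    by rewrite ltr_pM2l.
  apply: le_lt_trans (rnormB _ _) _.
  apply: (@le_lt_trans _ _ (rnorm (X (k - g)) + rnorm (X g - Y g) + rnorm (Y (k - g)))).
    by rewrite lerD2r; exact: rnormD.
  lra.
- apply: (tens_intw tT eb (TE t0) (st t0)); first exact: (unit_intertw Su).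
  exact: (unit_intertw Tu).
Qed.

Lemma has_units_tens : has_units sigma <-> has_units alpha.
Proof.
split=> [[U /unit_decomposition[S [T [Su _ _]]]]|[S Su]]; first by exists S.
by exists (fun t => tens tau (S t) (S t)); exact: tens_unit.
Qed.

End UnitDecomposition.

(** * Types of a tensor product semigroup *)

Section UnitWords.
Variables (R : realType) (K : hilbertType R) (sigma : R -> bop K -> bop K).

(** Recursive form of [unit_products]: the argument [t] is the time still to be covered. This makes
    induction and refinement of time partitions possible. *)
Fixpoint unit_word n (t : R) (X : bop K) : Prop :=
  if n is m.+1 then exists T s Y, [/\ is_unit sigma T, 0 <= s, unit_word m (t - s) Y & X = T s * Y]
  else t = 0 /\ X = 1.

Lemma unit_word_ge0 n t X : unit_word n t X -> 0 <= t.
Proof.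
elim: n t X => [t X [-> _]//|n IH t X [T [s [Y [_ s0 /IH ts _]]]]].
by rewrite -[t](subrK s) addr_ge0.
Qed.

Lemma unit_word0 n X : unit_word n 0 X -> X = 1.
Proof.
elim: n X => [X [_ ->]//|n IH X [T [s [Y [Tu s0 Yw ->]]]]].
have s00 : s = 0.
  by apply/eqP; rewrite eq_le s0 andbT; have := unit_word_ge0 Yw; rewrite sub0r oppr_ge0.
by move: Yw; rewrite s00 subr0 => /IH ->; rewrite (unit_zero Tu) mulr1.
Qed.

Lemma unit_productsE t X : unit_products sigma t X <-> exists n, unit_word n t X.
Proof.
split=> [[n [T [s [Tu s0 <- ->]]]]|[n]].
  exists n; elim: n T s Tu s0 => [|n IH] T s Tu s0 /=; first by rewrite !big_ord0.
  rewrite !big_ord_recl /=; exists (T ord0), (s ord0), (\prod_(i < n) T (lift ord0 i) (s (lift ord0 i))).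
  split=> //; rewrite addrC addrA addNr add0r.
  by apply: (IH (fun i => T (lift ord0 i)) (fun i => s (lift ord0 i))).
elim: n t X => [t X [-> ->]|n IH t X [T [s [Y [Tu s0 /IH[m [T' [s' [Tu' s0' st ->]]]] ->]]]]].
  exists 0%N, (fun=> (fun=> 0)), (fun=> 0); split; rewrite ?big_ord0//; by case.
exists m.+1, (fun i => if unlift ord0 i is Some j then T' j else T),
  (fun i => if unlift ord0 i is Some j then s' j else s); split.
- by move=> i; case: unliftP => [j|] _.
- by move=> i; case: unliftP => [j|] _.
- by rewrite big_ord_recl unlift_none; under eq_bigr do rewrite liftK; rewrite st addrC subrK.
- rewrite big_ord_recl unlift_none; congr (_ * _).
  by apply: eq_bigr => i _; rewrite liftK.
Qed.

End UnitWords.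

Section NormClosure.
Variables (R : realType) (K : hilbertType R).
Implicit Types (S : set (bop K)) (X Y : bop K).

Lemma norm_closureE S X : norm_closure S X <-> forall d : R, 0 < d ->
  exists2 Y, S Y & forall u, rnorm (X u - Y u) <= d * rnorm u.
Proof.
split=> h d /h [Y SY XY]; exists Y => // u.
  by have := XY u; rewrite !rnormE -rmorphM lecR.
by rewrite !rnormE -rmorphM lecR XY.
Qed.

Lemma linear_span_ind S (P : bop K -> Prop) : P 0 ->
  (forall c X Y, S X -> P Y -> P (c *: X + Y)) -> forall X, linear_span S X -> P X.
Proof.
move=> P0 PS X [n [c [B [SB ->]]]].
elim: n c B SB => [|n IH] c B SB; first by rewrite big_ord0.
by rewrite big_ord_recl; apply: PS => //; apply: IH.
Qed.

Lemma linear_spanD S c X Y : linear_span S X -> linear_span S Y -> linear_span S (c *: X + Y).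
Proof.
move=> SX SY; move: X SX; apply: linear_span_ind => [|d X Z SX SZ].
  by rewrite scaler0 add0r.
by rewrite scalerDr scalerA -addrA; exact: linear_spanP.
Qed.

Lemma norm_closure_sub S X : S X -> norm_closure S X.
Proof.
move=> SX; apply/norm_closureE => d d0; exists X => // u.
by rewrite subrr rnorm0 mulr_ge0 ?rnorm_ge0// ltW.
Qed.

Lemma norm_closure_spanP S c X Y : norm_closure (linear_span S) X ->
  norm_closure (linear_span S) Y -> norm_closure (linear_span S) (c *: X + Y).
Proof.
move=> /norm_closureE SX /norm_closureE SY; apply/norm_closureE => d d0.
have c1 : 0 < rnorm c + 1 by rewrite ltr_wpDl ?rnorm_ge0.
have d1 : 0 < d / 2 / (rnorm c + 1) by rewrite !divr_gt0.
have d2 : 0 < d / 2 by rewrite divr_gt0.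
have [X' SX' XX'] := SX _ d1; have [Y' SY' YY'] := SY _ d2.
exists (c *: X' + Y') => [|u]; first exact: linear_spanD.
rewrite !bopDE !bopZE opprD addrACA -scalerBr; apply: le_trans (rnormD _ _) _.
rewrite rnormZ; have h1 := XX' u; have h2 := YY' u; have ru := rnorm_ge0 u.
have h3 : rnorm c * rnorm (X u - X' u) <= d / 2 * rnorm u.
  apply: (@le_trans _ _ ((rnorm c + 1) * (d / 2 / (rnorm c + 1) * rnorm u))).
    by apply: ler_pM => //; rewrite ?rnorm_ge0// lerDl.
  by rewrite mulrA [_ * (_ / _)]mulrC divfK// gt_eqF.
lra.
Qed.

Lemma norm_closure_idem S X : norm_closure (norm_closure S) X -> norm_closure S X.
Proof.
move=> /norm_closureE h; apply/norm_closureE => d d0; have d2 : 0 < d / 2 by rewrite divr_gt0.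
have [Y /norm_closureE/(_ _ d2)[Z SZ YZ] XY] := h _ d2; exists Z => // u.
have h1 := XY u; have h2 := YZ u; have := rnorm_tri (Y u) (X u) (Z u); lra.
Qed.

Lemma intw_norm_closed (theta : bop K -> bop K) S X : S `<=` intw theta ->
  norm_closure S X -> intw theta X.
Proof.
move=> SE /norm_closureE h x; apply: bopP => u; rewrite !bopME.
apply/eqP; rewrite -subr_eq0; apply/eqP; apply: rnorm_small_eq0 => d d0.
have [C C0 CP] := bop_rbound (theta x).
pose M := C * rnorm u + rnorm (x u) + 1.
have M0 : 0 < M by rewrite ltr_wpDl// addr_ge0 ?rnorm_ge0// mulr_ge0 ?rnorm_ge0// ltW.
have dM : 0 < d / M by rewrite divr_gt0.
have [Y /SE YE XY] := h _ dM.
have -> : theta x (X u) - X (x u) = theta x (X u - Y u) - (X (x u) - Y (x u)).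
  by rewrite bop_linB (intwE x u YE) opprB addrA subrK.
apply: le_lt_trans (rnormB _ _) _.
have h1 := CP (X u - Y u); have h2 := XY u; have h3 := XY (x u).
have h4 : C * rnorm (X u - Y u) <= C * (d / M * rnorm u) by apply: ler_wpM2l => //; exact: ltW.
apply: (@le_lt_trans _ _ (d / M * (C * rnorm u + rnorm (x u)))).
  have -> : d / M * (C * rnorm u + rnorm (x u)) = C * (d / M * rnorm u) + d / M * rnorm (x u) by ring.
  by apply: lerD; [exact: le_trans h4|].
by rewrite -[ltRHS](divfK (lt0r_neq0 M0)) ltr_pM2l// /M ltrDl.
Qed.

Lemma unit_word_intw (sigma : R -> bop K -> bop K) n t X : e0_semigroup setT sigma ->
  unit_word sigma n t X -> intw (sigma t) X.
Proof.
move=> sE; elim: n t X => [t X [-> ->] x|n IH t X [T [s [Y [Tu s0 Yw ->]]]]].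
  by rewrite (e0_zero sE)// mulr1 mul1r.
have ts0 := unit_word_ge0 Yw.
have h := intwM (unit_intertw Tu s0) (IH _ _ Yw).
by move=> x; have := h x; rewrite /= (e0_add sE)// addrC subrK.
Qed.

Lemma unit_closure_intw (sigma : R -> bop K -> bop K) t : e0_semigroup setT sigma ->
  norm_closure (linear_span (unit_products sigma t)) `<=` intertwiners sigma t.
Proof.
move=> sE X; apply: intw_norm_closed => Y.
apply: linear_span_ind => [|c Z W /unit_productsE[n Zw] WE]; first exact: intw0.
by apply: intwP => //; exact: unit_word_intw Zw.
Qed.

Lemma type_I_alt (sigma : R -> bop K -> bop K) : e0_semigroup setT sigma ->
  type_I sigma <-> has_units sigma /\ forall t, 0 < t ->
    intertwiners sigma t `<=` norm_closure (linear_span (unit_products sigma t)).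
Proof.
move=> sE; split=> [[hu h]|[hu h]]; split=> // t t0; first by rewrite h.
by apply/seteqP; split; [exact: h|exact: unit_closure_intw].
Qed.

End NormClosure.

Section TypeTensor.
Variables (R : realType) (H K : hilbertType R).
Variables (tau : H -> H -> K) (e : nat -> H).
Hypotheses (tT : tensor tau) (eb : orthobasis e).
Variables (alpha : R -> bop H -> bop H) (sigma : R -> bop K -> bop K).
Hypotheses (aE : e0_semigroup setT alpha) (sE : e0_semigroup setT sigma).
Hypothesis st : forall t, 0 <= t -> forall x y,
  sigma t (tens tau x y) = tens tau (alpha t x) (alpha t y).
Implicit Types (s t : R) (u v : H) (k : K).

Local Notation e0 := (e 0%N).
Let e1 : '[e0, e0] = 1. Proof. by rewrite eb.1. Qed.
Let tE t (t0 : 0 <= t) : normal_unital_endo setT (alpha t). Proof. exact: (e0_endo aE). Qed.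
Let TE t (t0 : 0 <= t) : normal_unital_endo setT (sigma t). Proof. exact: (e0_endo sE). Qed.

Lemma unit_word_tens n t Z : unit_word sigma n t Z -> exists X Y,
  [/\ unit_word alpha n t X, unit_word alpha n t Y & Z = tens tau X Y].
Proof.
elim: n t Z => [t Z [-> ->]|n IH t Z [U [s [Z' [Uu s0 Zw ->]]]]].
  by exists 1, 1; rewrite (tens11 tT eb).
have [X [Y [Xw Yw ->]]] := IH _ _ Zw.
have [S [T [Su Tu UST]]] := unit_decomposition tT eb aE sE st Uu.
exists (S s * X), (T s * Y); split.
- by exists S, s, X.
- by exists T, s, Y.
- by rewrite UST// (tensM tT eb).
Qed.

(* By common refinement of the two time partitions. *)
Lemma tens_unit_word m n t X Y : unit_word alpha m t X -> unit_word alpha n t Y ->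
  exists l, unit_word sigma l t (tens tau X Y).
Proof.
move: {2}(m + n)%N (leqnn (m + n)) => N; elim: N m n t X Y => [|N IH] [|m] [|n] t X Y //=.
- by move=> _ [-> ->] [_ ->]; exists 0%N; rewrite (tens11 tT eb).
- by move=> _ [-> ->] [_ ->]; exists 0%N; rewrite (tens11 tT eb).
- move=> _ [-> ->] Yw; rewrite (@unit_word0 _ _ alpha n.+1 Y)//.
  by exists 0%N; rewrite (tens11 tT eb).
- move=> _ Xw [t0 ->]; rewrite t0 in Xw *; rewrite (@unit_word0 _ _ alpha m.+1 X)//.
  by exists 0%N; rewrite (tens11 tT eb).
rewrite addSn addnS !ltnS => mn [S [a [X' [Su a0 Xw ->]]]] [T [b [Y' [Tu b0 Yw ->]]]].
have [ab|/ltW ba] := leP a b.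
  have ba0 : 0 <= b - a by rewrite subr_ge0.
  have [||l lw] := IH m n.+1 (t - a) X' (T (b - a) * Y') _ Xw.
    by rewrite addnS.
    by exists T, (b - a), Y'; split=> //; rewrite opprB addrA subrK.
  exists l.+1, (fun t => tens tau (S t) (T t)), a, (tens tau X' (T (b - a) * Y')).
  split=> //; first exact: (tens_unit tT eb aE sE st).
  by rewrite (tensM tT eb) mulrA -(unit_add Tu)// addrC subrK.
have ba0 : 0 <= a - b by rewrite subr_ge0.
have [||l lw] := IH m.+1 n (t - b) (S (a - b) * X') Y' _ _ Yw.
- by rewrite addSn.
- by exists S, (a - b), X'; split=> //; rewrite opprB addrA subrK.
exists l.+1, (fun t => tens tau (S t) (T t)), b, (tens tau (S (a - b) * X') Y').
split=> //; first exact: (tens_unit tT eb aE sE st).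
by rewrite (tensM tT eb) mulrA -(unit_add Su)// addrC subrK.
Qed.

Lemma closure_tens t X Y : norm_closure (linear_span (unit_products alpha t)) X ->
  norm_closure (linear_span (unit_products alpha t)) Y ->
  norm_closure (linear_span (unit_products sigma t)) (tens tau X Y).
Proof.
move=> Xc Yc.
have s1 X' Y' : linear_span (unit_products alpha t) X' -> unit_products alpha t Y' ->
    linear_span (unit_products sigma t) (tens tau X' Y').
  move=> X's /unit_productsE[n Yw]; move: X' X's; apply: linear_span_ind => [|c P Q].
    by rewrite (tens0l tT eb); exact: linear_span0.
  move=> /unit_productsE[m Pw] Qs; rewrite (tensDl tT eb) (tensZl tT eb).
  by apply: linear_spanP => //; apply/unit_productsE; exact: tens_unit_word Pw Yw.
have s2 X' Y' : linear_span (unit_products alpha t) X' -> linear_span (unit_products alpha t) Y' ->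
    linear_span (unit_products sigma t) (tens tau X' Y').
  move=> X's; move: Y'; apply: linear_span_ind => [|c P Q Pu Qs].
    by rewrite (tens0r tT eb); exact: linear_span0.
  rewrite (tensDr tT eb) (tensZr tT eb); apply: linear_spanD => //; exact: s1.
apply/norm_closureE => d d0.
have [B B0 YB] := bop_rbound Y.
have d1 : 0 < d / 2 / B by rewrite !divr_gt0.
have [X' X's XX'] := (norm_closureE _ _).1 Xc _ d1.
have [A A0 X'A] := bop_rbound X'.
have d2 : 0 < d / 2 / A by rewrite !divr_gt0.
have [Y' Y's YY'] := (norm_closureE _ _).1 Yc _ d2.
exists (tens tau X' Y') => [|k]; first exact: s2.
have -> : tens tau X Y k - tens tau X' Y' k = tens tau (X - X') Y k + tens tau X' (Y - Y') k.
  have E1 : tens tau (X - X') Y + tens tau X' Y = tens tau X Y.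
    by rewrite -(tensDl tT eb) subrK.
  have E2 : tens tau X' (Y - Y') + tens tau X' Y' = tens tau X' Y.
    by rewrite -(tensDr tT eb) subrK.
  by rewrite -E1 -E2 !bopDE addrA addrK.
apply: le_trans (rnormD _ _) _.
have h1 : rnorm (tens tau (X - X') Y k) <= d / 2 / B * B * rnorm k.
  by apply: (tens_bound tT eb) => [||u|//]; [exact: ltW|exact: ltW|rewrite bopBE].
have h2 : rnorm (tens tau X' (Y - Y') k) <= A * (d / 2 / A) * rnorm k.
  by apply: (tens_bound tT eb) => [||//|u]; [exact: ltW|exact: ltW|rewrite bopBE].
rewrite divfK ?gt_eqF// in h1; rewrite mulrC [A * _]mulrC divfK ?gt_eqF// in h2.
by move: h1 h2; rewrite ![_ * rnorm k]mulrC; set r := rnorm k; lra.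
Qed.

(** From [alpha] to [sigma], intertwiners are approximated by sums of tensor products. Conversely,
    an intertwiner [A] of [alpha] is recovered from an approximation of [A (x) A] by slicing the
    second leg with [A^*]. *)
Lemma type_I_tens : type_I sigma <-> type_I alpha.
Proof.
rewrite !type_I_alt// (has_units_tens tT eb aE sE st).
split=> -[hu h]; split=> // t t0; have t0' := ltW t0; last first.
  move=> U UE; apply: norm_closure_idem; apply/norm_closureE => d d0.
  have [Z Zs UZ] := intw_tens_approx tT eb (tE t0') (TE t0') (st t0') UE d0.
  exists Z => [|k]; last by have := UZ k; rewrite bopBE.
  move: Z Zs {UZ}; apply: linear_span_ind => [|c X Y [[A B] /= [AE BE] <-] Yc].
    by apply: norm_closure_sub; exact: linear_span0.
  by apply: norm_closure_spanP => //; apply: closure_tens; exact: h.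
move=> A AE; have [A0|A0] := eqVneq (A e0) 0.
  rewrite (intw_neq0 e1 AE A0); apply: norm_closure_sub; exact: linear_span0.
pose a := rnorm (A e0) ^+ 2.
have a0 : 0 < a by rewrite exprn_gt0// rnorm_gt0.
have [C C0 AC] := bop_rbound (adj A).
apply/norm_closureE => d d0.
(* Slicing with [adj A] costs a factor [C], and dividing by the scalar [adj A * A = a] a factor
   [1 / a]. *)
have dl : 0 < d * a / C by rewrite divr_gt0// mulr_gt0.
have TA : intertwiners sigma t (tens tau A A) by apply: (tens_intw tT eb (TE t0') (st t0')).
have [Z Zs ZA] := (norm_closureE _ _).1 (h t t0 _ TA) _ dl.
(* A word of [sigma] is [X (x) Y] with words [X] and [Y] of [alpha], and [adj A * Y] is a scalar;
   slicing therefore leaves a combination of words of [alpha] in the first leg. *)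
have [P Ps PZ] : exists2 P, linear_span (unit_products alpha t) P &
    tens tau 1 (adj A) * Z = tens tau P 1.
  move: Z Zs {ZA}; apply: linear_span_ind => [|c Q Z' /unit_productsE[n Qw] [P Ps PZ]].
    by exists 0; [exact: linear_span0|rewrite mulr0 (tens0l tT eb)].
  have [X [Y [Xw Yw ->]]] := unit_word_tens Qw.
  have YE := unit_word_intw aE Yw.
  exists ((c * ('[Y e0, A e0])^*) *: X + P).
    by apply: linear_spanP => //; apply/unit_productsE; exists n.
  rewrite mulrDr bopZAr (tensM tT eb) mul1r (intw_adjM (tE t0') e1 YE AE) PZ.
  by rewrite (tensZr tT eb) scalerA (tensDl tT eb) (tensZl tT eb).
exists ((((a^-1)%:C)%C : Cx R) *: P).
  rewrite -[_ *: P]addr0; apply: linear_spanD => //; exact: linear_span0.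
move=> u; have := ZA (tau u e0); set k := tau u e0.
rewrite (tau_rnorm tT) (unit_vector_rnorm e1) mulr1 => h1.
have h2 : rnorm (tens tau 1 (adj A) (tens tau A A k - Z k)) <= C * (d * a / C * rnorm u).
  apply: le_trans (_ : _ <= 1 * C * rnorm (tens tau A A k - Z k)) _.
    by apply: (tens_bound tT eb) => // [|v]; [exact: ltW|rewrite bop1E mul1r].
  by rewrite mul1r; apply: ler_wpM2l => //; exact: ltW.
have e2 : tens tau 1 (adj A) (tens tau A A k - Z k) = tau (((a%:C)%C : Cx R) *: A u - P u) e0.
  rewrite bop_linB -!bopME PZ (tensM tT eb) mul1r (intw_adjM (tE t0') e1 AE AE).
  rewrite !(tensE tT eb) inner_rnorm -/a bopZE !bop1E (tauBl tT) (tauZr tT) (tauZl tT).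
  by rewrite conj_Creal// complex_real.
rewrite e2 (tau_rnorm tT) (unit_vector_rnorm e1) mulr1 in h2.
have h3 : C * (d * a / C * rnorm u) = a * (d * rnorm u) by field; rewrite gt_eqF.
rewrite h3 in h2; rewrite -(ler_pM2l a0); apply: le_trans h2.
rewrite -{1}[a]ger0_norm ?(ltW a0)// -rnormC_real -rnormZ scalerBr bopZE scalerA -rmorphM /=.
by rewrite mulfV ?gt_eqF// scale1r.
Qed.

Lemma type_II_tens : type_II sigma <-> type_II alpha.
Proof. by rewrite /type_II (has_units_tens tT eb aE sE st) type_I_tens. Qed.

Lemma type_III_tens : type_III sigma <-> type_III alpha.
Proof. by rewrite /type_III (has_units_tens tT eb aE sE st). Qed.

End TypeTensor.

Section Polarization.
Variables (R : realType) (K : hilbertType R).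
Implicit Types (a b : K).

Lemma Re_inner_polar a b :
  complex.Re '[a, b] = (rnorm (a + b) ^+ 2 - rnorm a ^+ 2 - rnorm b ^+ 2) / 2.
Proof.
rewrite !rnorm_inner innerDl !innerDr !ReD (innerC b a).
by case: ('[a, b]) => x y /=; field.
Qed.

Lemma inner_polar (K' : hilbertType R) a b (a' b' : K') :
  rnorm a = rnorm a' -> rnorm b = rnorm b' ->
  (forall c : Cx R, rnorm (a + c *: b) = rnorm (a' + c *: b')) -> '[a, b] = '[a', b'].
Proof.
move=> aa bb h; have h1 := h 1; rewrite !scale1r in h1.
have hi := h ('i : Cx R).
have re : complex.Re '[a, b] = complex.Re '[a', b'].
  rewrite Re_inner_polar h1 aa bb.
  by rewrite !rnorm_inner innerDl !innerDr !ReD (innerC b' a'); case: ('[a', b']) => x y /=; field.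
have ri (L : hilbertType R) (u v : L) : complex.Re '[u, 'i *: v] = complex.Im '[u, v].
  rewrite innerZr conjCi; case: ('[u, v]) => x y.
  by rewrite -[X in - X * _]/('i%C : R[i]) /=; ring.
have ni (L : hilbertType R) (u : L) : rnorm (('i : Cx R) *: u) = rnorm u.
  by rewrite rnormZ /rnorm normCi mul1r.
have im : complex.Im '[a, b] = complex.Im '[a', b'].
  rewrite -!ri Re_inner_polar hi ni aa bb.
  rewrite -[in LHS](ni _ b') !rnorm_inner innerDl !innerDr !ReD (innerC ('i *: b') a').
  by case: ('[a', 'i *: b']) => x y /=; field.
by move: re im; case: ('[a, b]) => x y; case: ('[a', b']) => x' y' /= -> ->.
Qed.

Lemma inner_polar0 a b :
  (forall c : Cx R, rnorm (a + c *: b) ^+ 2 = rnorm a ^+ 2 + rnorm (c *: b) ^+ 2) -> '[a, b] = 0.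
Proof.
move=> h; have e (c : Cx R) : complex.Re '[a, c *: b] = 0.
  by rewrite Re_inner_polar h; field.
have := e '[a, b]; rewrite innerZr => h2; apply: crnorm0_eq0; apply/eqP.
rewrite -sqrf_eq0 -[X in X == _]/(complex.Re ((rnorm ('[a, b] : Cx R) ^+ 2)%:C)%C).
have -> : ((rnorm ('[a, b] : Cx R) ^+ 2)%:C)%C = ('[a, b])^* * '[a, b] :> Cx R.
  by rewrite mulrC -normCK rnormE rmorphXn.
by rewrite h2.
Qed.

End Polarization.

(** * Arbitrary weights on B(H) *)

Section Weights.
Variables (R : realType) (H : hilbertType R) (phi : bop H -> \bar R).
Hypothesis wP : fns_weight setT phi.
Implicit Types (x y : bop H) (u v w : H).
Local Notation N := (left_ideal setT phi).

Lemma le_op_trans y x (z : bop H) : le_op x y -> le_op y z -> le_op x z.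
Proof. by move=> h1 h2 u; have := addr_ge0 (h1 u) (h2 u); rewrite -innerDl -bopDE addrC addrA subrK. Qed.

Lemma weight_le x y : pos_op x -> le_op x y -> (phi x <= phi y)%E.
Proof.
move=> xp xy; rewrite -[y](subrK x) (weight_add wP)//.
by rewrite leeDr// (weight_ge0 wP).
Qed.

Lemma weight_adjM_fin x : N x -> phi (adj x * x) = (fine (phi (adj x * x)))%:E.
Proof.
move=> [_ xN]; rewrite fineK// ge0_fin_numE//.
by apply: (weight_ge0 wP); split=> //; exact: pos_adjM.
Qed.

Lemma left_ideal_le x (c : R) y : 0 <= c -> N x ->
  le_op (adj y * y) ((c%:C)%C *: (adj x * x)) -> N y.
Proof.
move=> c0 xN h; split=> //; apply: (le_lt_trans (weight_le (pos_adjM _) h)).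
by rewrite (weight_scale wP)//; [rewrite (weight_adjM_fin xN) ltry|split=> //; exact: pos_adjM].
Qed.

Lemma left_idealM y x : N x -> N (y * x).
Proof.
move=> xN; have [C C0 yC] := bop_rbound y; apply: (@left_ideal_le x (C ^+ 2)) => // [|u].
  by rewrite sqr_ge0.
rewrite bopBE bopZE !bopME innerBl innerZl -!adjPr !inner_rnorm -rmorphM -rmorphB ler0c subr_ge0.
by rewrite -exprMn ler_sqr ?nnegrE ?rnorm_ge0// mulr_ge0 ?rnorm_ge0// ltW.
Qed.

Lemma left_idealD x y : N x -> N y -> N (x + y).
Proof.
move=> xN yN; split=> //.
have h : le_op (adj (x + y) * (x + y)) (((2 : R)%:C)%C *: (adj x * x + adj y * y)).
  move=> u; rewrite bopBE bopZE bopDE !bopME innerBl innerZl innerDl -!adjPr !inner_rnorm.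
  rewrite -rmorphD -rmorphM -rmorphB ler0c subr_ge0 bopDE.
  have := rnormD (x u) (y u); have := rnorm_ge0 (x u + y u).
  have := sqr_ge0 (rnorm (x u) - rnorm (y u)).
  set p := rnorm _; set q := rnorm (y u); set r := rnorm (_ + _) => h r0 rpq.
  have : r ^+ 2 <= (p + q) ^+ 2 by rewrite ler_sqr// nnegrE// (le_trans r0).
  nra.
apply: (le_lt_trans (weight_le (pos_adjM _) h)).
have pD : pos_op (adj x * x + adj y * y) by apply: pos_opD; exact: pos_adjM.
have xp : pos_part setT (adj x * x) by split=> //; exact: pos_adjM.
have yp : pos_part setT (adj y * y) by split=> //; exact: pos_adjM.
rewrite (weight_scale wP)// (weight_add wP xp yp).
by rewrite (weight_adjM_fin xN) (weight_adjM_fin yN) ltry.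
Qed.

Lemma left_ideal0 : N 0.
Proof.
split=> //; have -> : adj 0 * 0 = (0%:C)%C *: (0 : bop H) by rewrite scaler0 mulr0.
by rewrite (weight_scale wP)// ?mul0e ?ltry//; split=> // u; rewrite bop0E inner0l.
Qed.

Lemma left_idealZ c x : N x -> N (c *: x).
Proof. by move=> xN; rewrite -[x]mul1r -bopZAl; exact: left_idealM. Qed.

(** A weak limit of an increasing sequence is its supremum, so normality applies to the range of the
    sequence. *)
Lemma weight_seq_le (T : nat -> bop H) x (B : R) : (forall n, pos_op (T n)) ->
  (forall n, le_op (T n) (T n.+1)) ->
  (forall u, (fun n => '[T n u, u] : Cx R) @ \oo --> ('[x u, u] : Cx R)) ->
  (forall n, (phi (T n) <= B%:E)%E) -> (phi x <= B%:E)%E.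
Proof.
move=> Tp TS Tx TB.
have mono n m : (n <= m)%N -> le_op (T n) (T m).
  move=> nm; rewrite -(subnK nm); elim: (m - n)%N => [|k IH].
    by move=> u; rewrite subrr bop0E inner0l.
  exact: le_op_trans (TS _).
have cT y u : (fun n => '[(y - T n) u, u] : Cx R) @ \oo --> ('[(y - x) u, u] : Cx R).
  under eq_fun do rewrite bopBE innerBl.
  by rewrite bopBE innerBl; apply: cvgB; [exact: cvg_cst|exact: Tx].
have xp : pos_op x by move=> u; apply: (cvg_ge0 (Tx u)) => n; exact: Tp.
have := weight_normal wP (D := range T) (x := x).
move=> ->//.
- by apply: ub_ereal_sup => _ [_ [n _ <-] <-].
- by move=> _ [n _ <-].
- by exists (T 0%N); exists 0%N.
- move=> _ _ [n _ <-] [m _ <-]; exists (T (maxn n m)); split; first by exists (maxn n m).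
    by apply: mono; exact: leq_maxl.
  by apply: mono; exact: leq_maxr.
- move=> _ [n _ <-] u.
  have h : (fun m => '[(T (m + n)%N - T n) u, u] : Cx R) @ \oo --> ('[(x - T n) u, u] : Cx R).
    under eq_fun do rewrite bopBE innerBl.
    rewrite bopBE innerBl; apply: cvgB; last exact: cvg_cst.
    by have := Tx u; rewrite -(cvg_shiftn n).
  by apply: (cvg_ge0 h) => m; apply: mono; exact: leq_addl.
- move=> y _ yT u; apply: (cvg_ge0 (cT y u)) => n; apply: yT.
  by exists n.
Qed.

Section Gns.
Variables (K : hilbertType R) (pi : bop H -> bop K) (Lam : bop H -> K).
Hypothesis gP : gns setT phi pi Lam.

Lemma gns_rnorm x : N x -> rnorm (Lam x) ^+ 2 = fine (phi (adj x * x)).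
Proof.
by move=> xN; have := gns_norm gP xN; rewrite rnormE -rmorphXn; apply: complexI.
Qed.

Lemma gnsP c x y : N x -> N y -> Lam (c *: x + y) = c *: Lam x + Lam y.
Proof. exact: (gns_linear gP). Qed.

Lemma gnsD x y : N x -> N y -> Lam (x + y) = Lam x + Lam y.
Proof. by move=> xN yN; have := gnsP 1 xN yN; rewrite !scale1r. Qed.

Lemma gnsB x y : N x -> N y -> Lam (x - y) = Lam x - Lam y.
Proof. by move=> xN yN; rewrite addrC -scaleN1r gnsP// scaleN1r addrC. Qed.

Lemma gnsZ c x : N x -> Lam (c *: x) = c *: Lam x.
Proof.
move=> xN; have xN' := left_idealZ (c - 1) xN.
have := gnsP (c - 1) xN xN; rewrite scalerBl scale1r subrK => ->.
by rewrite scalerBl scale1r subrK.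
Qed.

Lemma gns0 : Lam 0 = 0.
Proof. by have := gnsD left_ideal0 left_ideal0; rewrite addr0 => /esym/eqP; rewrite -subr_eq0 addrK => /eqP. Qed.

(** Inner products of GNS vectors are accessible only through norms. With [x^* y = 0], additivity of
    the weight gives Pythagoras for [Lam x + c Lam y] with every scalar [c], which forces
    orthogonality. *)
Lemma gns_orth x y : N x -> N y -> adj x * y = 0 -> '[Lam x, Lam y] = 0.
Proof.
move=> xN yN xy; have yx : adj y * x = 0 by rewrite -[x]adjK -adjM xy adj0.
apply: inner_polar0 => c; rewrite -gnsZ// -gnsD//; last exact: left_idealZ.
have cyN := left_idealZ c yN; have sN := left_idealD xN cyN.
rewrite !gns_rnorm// adjD adjZ mulrDl !mulrDr bopZAr xy scaler0 addr0 bopZAl yx scaler0 add0r.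
have xp : pos_part setT (adj x * x) by split=> //; exact: pos_adjM.
have yp : pos_part setT (adj (c *: y) * (c *: y)) by split=> //; exact: pos_adjM.
by rewrite -adjZ (weight_add wP xp yp) (weight_adjM_fin xN) (weight_adjM_fin cyN).
Qed.

Section Brackets.
Variable e0 : H.
Hypothesis e1 : '[e0, e0] = 1.

(** The domain of [h^(1/2)] for the density [h] of the weight: when [e0] is a unit vector, the
    condition says that |v><v| has finite weight. *)
Definition weight_dom : set H := [set v | N (rk1 e0 v)].
Local Notation dom := weight_dom.
(** In terms of the density this is the Hilbert-Schmidt operator |u><h^(1/2) v|. *)
Definition bracket u v := Lam (rk1 u v).
Local Notation iota := (bracket e0).

Lemma weight_dom_rk1 u v : dom v -> N (rk1 u v).
Proof.
move=> vD; have -> : rk1 u v = rk1 u e0 * rk1 e0 v by rewrite rk1M e1 scale1r.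
exact: left_idealM.
Qed.

Lemma weight_domP c v w : dom v -> dom w -> dom (c *: v + w).
Proof.
move=> vD wD; rewrite /weight_dom /= rk1Dr rk1Zr; apply: left_idealD => //.
exact: left_idealZ.
Qed.

Lemma rk10r u : rk1 u 0 = 0.
Proof. by apply: bopP => z; rewrite rk1E inner0r scale0r bop0E. Qed.

Lemma weight_dom0 : dom 0.
Proof. by rewrite /weight_dom /= rk10r; exact: left_ideal0. Qed.

Lemma weight_domB v w : dom v -> dom w -> dom (v - w).
Proof. by move=> vD wD; rewrite addrC -scaleN1r; exact: weight_domP. Qed.

Lemma weight_dom_adj x u : N x -> dom (adj x u).
Proof. by move=> xN; rewrite /weight_dom /= -rk1_mul; exact: left_idealM. Qed.

Lemma bracketPl c u u' v : dom v -> bracket (c *: u + u') v = c *: bracket u v + bracket u' v.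
Proof.
move=> vD; rewrite /bracket rk1Dl rk1Zl gnsP//; exact: weight_dom_rk1.
Qed.

Lemma bracketPr c u v v' : dom v -> dom v' ->
  bracket u (c *: v + v') = c^* *: bracket u v + bracket u v'.
Proof. by move=> vD vD'; rewrite /bracket rk1Dr rk1Zr gnsP//; exact: weight_dom_rk1. Qed.

Lemma bracketBr u v v' : dom v -> dom v' -> bracket u (v - v') = bracket u v - bracket u v'.
Proof.
by move=> vD vD'; rewrite addrC -scaleN1r bracketPr// rmorphN rmorph1 scaleN1r addrC.
Qed.

Lemma iota_rnorm v : dom v -> (rnorm (iota v) ^+ 2)%:E = phi (rk1 v v).
Proof.
move=> vD; rewrite gns_rnorm// -weight_adjM_fin// adj_rk1 rk1M e1 scale1r.
by [].
Qed.

Lemma bracket_rnorm u v : dom v -> rnorm (bracket u v) = rnorm u * rnorm (iota v).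
Proof.
move=> vD; apply/eqP; rewrite -(eqrXn2 (n := 2)) ?mulr_ge0 ?rnorm_ge0//; apply/eqP.
have uN := weight_dom_rk1 u vD.
have : ((rnorm (bracket u v) ^+ 2)%:E = ((rnorm u * rnorm (iota v)) ^+ 2)%:E)%E; last by case.
rewrite gns_rnorm// -weight_adjM_fin// adj_rk1 rk1M inner_rnorm (weight_scale wP) ?sqr_ge0//.
  by rewrite -iota_rnorm// -EFinM exprMn.
by split=> //; exact: pos_rk1.
Qed.

(** For equal first arguments this is the polarization of [bracket_rnorm]. In general the part of
    [u] orthogonal to [u'] does not contribute, by [gns_orth]. *)
Lemma bracket_inner u v u' v' : dom v -> dom v' ->
  '[bracket u v, bracket u' v'] = '[u, u'] * '[iota v, iota v'].
Proof.
move=> vD vD'.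
have diag : '[bracket u' v, bracket u' v'] = '[u', u'] * '[iota v, iota v'].
  pose r : Cx R := ((rnorm u')%:C)%C.
  have -> : '[u', u'] * '[iota v, iota v'] = '[r *: iota v, r *: iota v'].
    rewrite innerZl innerZr mulrA inner_rnorm /r conj_Creal ?complex_real// -rmorphM expr2.
    by [].
  have rr : rnorm (r : Cx R) = rnorm u' by rewrite /r rnormC_real ger0_norm// rnorm_ge0.
  apply: inner_polar => [||c].
  - by rewrite rnormZ rr bracket_rnorm.
  - by rewrite rnormZ rr bracket_rnorm.
  have cc : c = (c^*)^* by rewrite conjCK.
  rewrite {1}cc addrC -bracketPr// scalerA mulrC -scalerA -scalerDr rnormZ rr.
  rewrite bracket_rnorm; last exact: weight_domP.
  by rewrite bracketPr// conjCK [in RHS]addrC.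
have [u0|u0] := eqVneq u' 0.
  rewrite u0 /bracket inner0r mul0r.
  have -> : rk1 0 v' = 0 *: rk1 e0 v' by rewrite -rk1Zl scale0r.
  by rewrite gnsZ// scale0r inner0r.
have uu : '[u', u'] != 0 by rewrite inner_eq0.
set c := '[u, u'] / '[u', u'].
have -> : u = c *: u' + (u - c *: u') by rewrite addrC subrK.
have wu : '[u - c *: u', u'] = 0 by rewrite innerBl innerZl divfK// subrr.
set w := u - _ in wu *; rewrite bracketPl// innerDl innerZl diag (@gns_orth (rk1 w v)).
- by rewrite addr0 innerDl innerZl wu addr0 mulrA.
- exact: weight_dom_rk1.
- exact: weight_dom_rk1.
- rewrite adj_rk1 rk1M (innerC u' w) wu conjC0 scale0r.
  by [].
Qed.

(** Only the compression of [x] to the line of [u] on the left pairs with the bracket; up to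
    normalization it is |u><x^* u|. *)
Lemma gns_bracket x u v : N x -> dom v -> '[Lam x, bracket u v] = '[iota (adj x u), iota v].
Proof.
move=> xN vD; have [->|u0] := eqVneq u 0.
  have z0 w : bracket 0 w = 0.
    by rewrite /bracket (_ : rk1 0 w = 0) ?gns0//; apply: bopP => z; rewrite rk1E scaler0 bop0E.
  have -> : iota (adj x 0) = 0.
    by rewrite bop_lin0 /bracket rk10r gns0.
  by rewrite z0 inner0l inner0r.
have uu : '[u, u] != 0 by rewrite inner_eq0.
pose p := '[u, u]^-1 *: rk1 u u.
have pxE : p * x = '[u, u]^-1 *: rk1 u (adj x u) by rewrite bopZAl rk1_mul.
have xD : dom (adj x u) by exact: weight_dom_adj.
have E : Lam x = Lam (p * x) + Lam ((1 - p) * x).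
  rewrite -gnsD; [|exact: left_idealM|exact: left_idealM].
  by rewrite -mulrDl addrC subrK mul1r.
have uD := weight_dom_rk1 u xD.
rewrite E innerDl (@gns_orth ((1 - p) * x)) ?addr0.
- rewrite pxE gnsZ// innerZl (bracket_inner u u xD vD) mulrA mulVf// mul1r.
  by [].
- exact: left_idealM.
- exact: weight_dom_rk1.
rewrite adjM -mulrA mul_rk1; set y := adj (1 - p) u.
have -> : y = 0.
  rewrite /y adjB adj1 adjZ adj_rk1 bopBE bop1E bopZE rk1E scalerA conj_Creal ?mulVf ?scale1r ?subrr//.
  by rewrite realV ger0_real// inner_ge0.
by rewrite mul_rk1 bop_lin0; apply: bopP => w; rewrite rk1E scaler0 bop0E.
Qed.

(** The domain contains the range of [y^*] for [y] in the left ideal, and semifiniteness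
    approximates [1] by such a [y] against the single functional [X |-> '[X v, v]]. *)
Lemma weight_dom_dense v : (forall w, dom w -> '[w, v] = 0) -> v = 0.
Proof.
move=> h; have [/crnorm0_eq0/eqP|nz] := eqVneq (rnorm ('[v, v] : Cx R)) 0.
  by rewrite inner_eq0 => /eqP.
have pz : 0 < rnorm ('[v, v] : Cx R) by rewrite lt_neqAle rnorm_ge0 andbT eq_sym.
have [y yN yP] := weight_semifinite wP (x := 1) I (n := 1) (rho := fun=> fun X => '[X v, v])
  (fun=> predual_vec v v) pz.
have := yP ord0; rewrite bop1E; have -> : '[y v, v] = 0.
  by rewrite -[y]adjK -adjPr innerC (h _ (weight_dom_adj v yN)) conjC0.
by rewrite subr0 rnormE ltcR ltxx.
Qed.

Lemma iota_eq0 v : dom v -> iota v = 0 -> v = 0.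
Proof.
move=> vD v0; have := iota_rnorm vD; rewrite v0 rnorm0 expr0n => /esym h.
have /(congr1 (fun x : bop H => '[x v, v])) := weight_faithful wP (conj I (pos_rk1 v)) h.
rewrite rk1E innerZl bop0E inner0l => /eqP; rewrite mulf_eq0 orbb inner_eq0.
by move/eqP.
Qed.

End Brackets.
End Gns.
End Weights.

(** * Series in the form domain of a weight *)

Section WeightForm.
Variables (R : realType) (H : hilbertType R) (phi : bop H -> \bar R).
Hypothesis wP : fns_weight setT phi.
Variables (K : hilbertType R) (pi : bop H -> bop K) (Lam : bop H -> K).
Hypothesis gP : gns setT phi pi Lam.
Variable e0 : H.
Hypothesis e1 : '[e0, e0] = 1.
Implicit Types (x y : bop H) (u v w z : H) (c : Cx R).
Local Notation dom := (weight_dom phi e0).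
Local Notation iota := (bracket Lam e0).

Lemma geometric_sum_le n : \sum_(0 <= i < n) (2^-1 : R) ^+ i.+1 <= 1.
Proof.
suff -> : \sum_(0 <= i < n) (2^-1 : R) ^+ i.+1 = 1 - 2^-1 ^+ n.
  by rewrite lerBlDr lerDl exprn_ge0.
elim: n => [|n IH]; first by rewrite big_geq// expr0 subrr.
by rewrite big_nat_recr//= IH exprS; set y := _ ^+ n; field.
Qed.

(** Cauchy-Schwarz with weights [2 ^- (i + 1)], whose sum is at most 1, obtained from the positivity
    of a sum of squares. *)
Lemma weighted_cs (a : nat -> R) n : (forall i, 0 <= a i) ->
  (\sum_(0 <= i < n) a i) ^+ 2 <= \sum_(0 <= i < n) 2 ^+ i.+1 * a i ^+ 2.
Proof.
move=> a0; pose g : R := \sum_(0 <= i < n) 2^-1 ^+ i.+1.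
pose A := \sum_(0 <= i < n) a i; pose B := \sum_(0 <= i < n) 2 ^+ i.+1 * a i ^+ 2.
have B0 : 0 <= B by apply: sumr_ge0 => i _; rewrite mulr_ge0 ?sqr_ge0 ?exprn_ge0.
have h : 0 <= \sum_(0 <= i < n) 2 ^+ i.+1 * (a i - A * 2^-1 ^+ i.+1) ^+ 2.
  by apply: sumr_ge0 => i _; rewrite mulr_ge0 ?sqr_ge0 ?exprn_ge0.
have e : \sum_(0 <= i < n) 2 ^+ i.+1 * (a i - A * 2^-1 ^+ i.+1) ^+ 2 = B - 2 * A * A + A ^+ 2 * g.
  have -> : 2 * A * A = \sum_(0 <= i < n) 2 * A * a i by rewrite -mulr_sumr.
  rewrite /B /g [A ^+ 2 * _]mulr_sumr -sumrB -big_split /=; apply: eq_bigr => i _.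
  have : (2 : R) ^+ i.+1 * 2^-1 ^+ i.+1 = 1 by rewrite -exprMn divff// expr1n.
  set p := 2 ^+ _; set q := 2^-1 ^+ _ => pq.
  have -> : p * (a i - A * q) ^+ 2 = p * a i ^+ 2 - 2 * A * a i * (p * q) + A ^+ 2 * q * (p * q) by ring.
  by rewrite pq !mulr1.
rewrite e in h; have g1 : g <= 1 by exact: geometric_sum_le.
have : A ^+ 2 * g <= A ^+ 2 by rewrite ler_piMr// sqr_ge0.
rewrite -/A -/B; move: h; rewrite -mulrA -expr2; lra.
Qed.

(* [|sum_i d_i><sum_i d_i| <= sum_i 2^(i+1) |d_i><d_i|], and the right side has
   weight at most [sum_i 2^(i+1) * |iota d_i|^2] by normality *)
Lemma weight_dom_series (d : nat -> H) v (C : R) : 0 <= C ->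
  (forall i, dom (d i)) -> (forall i, rnorm (d i) ^+ 2 <= C * 8^-1 ^+ i) ->
  (forall i, rnorm (iota (d i)) ^+ 2 <= C * 8^-1 ^+ i) ->
  series d @ \oo --> v -> dom v /\ rnorm (iota v) ^+ 2 <= 4 * C.
Proof.
move=> C0 dD dC iC dv.
pose T n : bop H := \sum_(0 <= i < n) (((2 ^+ i.+1 : R)%:C)%C : Cx R) *: rk1 (d i) (d i).
have TE n u w : '[T n u, w] = \sum_(0 <= i < n) ((2 ^+ i.+1 : R)%:C)%C * ('[u, d i] * '[d i, w]).
  rewrite /T bop_sumE inner_suml; apply: eq_bigr => i _.
  by rewrite bopZE rk1E !innerZl.
have TEu n u : '[T n u, u] = ((\sum_(0 <= i < n) 2 ^+ i.+1 * rnorm ('[u, d i] : Cx R) ^+ 2)%:C)%C.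
  rewrite TE rmorph_sum; apply: eq_bigr => i _; rewrite rmorphM; congr (_ * _).
  by rewrite (innerC (d i)) -normCK rnormE rmorphXn.
have Tp n : pos_op (T n).
  move=> u; rewrite TEu ler0c; apply: sumr_ge0 => i _.
  by rewrite mulr_ge0 ?sqr_ge0 ?exprn_ge0.
have TS n : le_op (T n) (T n.+1).
  move=> u; rewrite bopBE innerBl !TEu -rmorphB ler0c subr_ge0 big_nat_recr//= lerDl.
  by rewrite mulr_ge0 ?sqr_ge0 ?exprn_ge0.
(* The rate [8 ^- i] beats the weights [2 ^ (i + 1)] and leaves a geometric series of sum
   [8 / 3 * C], below [4 * C]. *)
have quarter i : 2 ^+ i.+1 * (C * 8^-1 ^+ i) = 2 * C * 4^-1 ^+ i :> R.
  have -> : (4^-1 : R) = 2 * 8^-1 by field.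
  by rewrite exprMn exprS; ring.
have q1 n : \sum_(0 <= i < n) 2 * C * (4^-1 : R) ^+ i <= 4 * C.
  suff -> : \sum_(0 <= i < n) 2 * C * (4^-1 : R) ^+ i = 8 / 3 * C * (1 - 4^-1 ^+ n).
    have : 0 <= (4^-1 : R) ^+ n by rewrite exprn_ge0.
    set y := _ ^+ n => y0; have : 0 <= C * y by rewrite mulr_ge0.
    lra.
  elim: n => [|n IH]; first by rewrite big_geq// expr0 subrr mulr0.
  by rewrite big_nat_recr//= IH exprS; set y := _ ^+ n; field.
have tail m n : (m <= n)%N -> \sum_(m <= i < n) (4^-1 : R) ^+ i <= 2 * 4^-1 ^+ m.
  move=> mn; rewrite -(subnKC mn).
  suff -> : \sum_(m <= i < m + (n - m)) (4^-1 : R) ^+ i = 4 / 3 * (4^-1 ^+ m - 4^-1 ^+ (m + (n - m))).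
    have : 0 <= (4^-1 : R) ^+ (m + (n - m)) by rewrite exprn_ge0.
    have : 0 <= (4^-1 : R) ^+ m by rewrite exprn_ge0.
    lra.
  elim: (n - m)%N => [|k IH]; first by rewrite addn0 big_geq// subrr mulr0.
  by rewrite addnS big_nat_recr ?leq_addr//= IH exprS; set y := _ ^+ (m + k); field.
have Tbd m n u : (m <= n)%N -> rnorm (T n u - T m u) <= 2 * C * (\sum_(m <= i < n) 4^-1 ^+ i) * rnorm u.
  move=> mn; rewrite -bopBE /T (big_cat_nat (n := m))//= addrC addrA [- _ + _]addrC subrr add0r.
  rewrite bop_sumE; apply: le_trans (_ : _ <= \sum_(m <= i < n) rnorm (((2 ^+ i.+1)%:C%C : Cx R) *: rk1 (d i) (d i) u)) _.
    by elim/big_rec2: _ => [|i y1 y2 _ h]; [rewrite rnorm0|apply: le_trans (rnormD _ _) _; rewrite lerD2l].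
  rewrite mulr_sumr mulr_suml; apply: ler_sum => i _.
  rewrite rnormZ rnormC_real ger0_norm ?exprn_ge0// rk1E rnormZ -quarter -mulrA.
  apply: ler_wpM2l; first by rewrite exprn_ge0.
  apply: (@le_trans _ _ (rnorm u * rnorm (d i) * rnorm (d i))).
    by apply: ler_wpM2r; [exact: rnorm_ge0|exact: rnorm_cs].
  by rewrite -mulrA -expr2 mulrC; apply: ler_wpM2r; [exact: rnorm_ge0|exact: dC].
have [X XP] : exists X : bop H, forall u, (fun n => T n u) @ \oo --> X u.
  apply: (@bop_limit _ _ _ (4 * C)) => [n u|u].
    have := Tbd 0%N n u (leq0n n); rewrite {2}/T big_geq// bop0E subr0 => /le_trans; apply.
    by apply: ler_wpM2r; [exact: rnorm_ge0|rewrite mulr_sumr].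
  apply: complete_rnorm => eps eps0.
  have ru := rnorm_ge0 u; pose D := 4 * C * rnorm u + 1.
  have D0 : 0 < D by rewrite ltr_wpDl// !mulr_ge0.
  have e' : 0 < eps / D by rewrite divr_gt0.
  have [M _ MP] := near_infty_natSinv_lt (PosNum e'); exists M.
  have small m : (M <= m)%N -> D * 4^-1 ^+ m < eps.
    move=> /(MP m) /= h; rewrite mulrC -ltr_pdivlMr//; apply: le_lt_trans h.
    rewrite exprVn lef_pV2 ?posrE ?exprn_gt0 ?ltr0n//.
    by rewrite -natrX ler_nat; apply: ltn_expl.
  suff W m n : (M <= m)%N -> (m <= n)%N -> rnorm (T n u - T m u) < eps.
    move=> m n hm hn; have [nm|/ltnW mn] := leqP n m; first exact: W.
    by rewrite rnormBC; exact: W.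
  move=> Mm mn; apply: le_lt_trans (Tbd m n u mn) _; apply: le_lt_trans (small m Mm).
  have h := tail m n mn; have z : 0 <= (4^-1 : R) ^+ m by rewrite exprn_ge0.
  have Cu : 0 <= C * rnorm u by rewrite mulr_ge0.
  move: h z; set y := _ ^+ m; set S := \sum_(m <= i < n) _ => h z.
  have : C * rnorm u * S <= C * rnorm u * (2 * y) by apply: ler_wpM2l.
  rewrite /D; lra.
have Xu u : (fun n => '[T n u, u] : Cx R) @ \oo --> ('[X u, u] : Cx R) by exact: cvg_innerl.
have phT n : (phi (T n) <= (4 * C)%:E)%E.
  have h m : phi (T m) = (\sum_(0 <= i < m) 2 ^+ i.+1 * rnorm (iota (d i)) ^+ 2)%:E.
    elim: m => [|m IH].
      rewrite /T !big_geq//; have -> : (0 : bop H) = (0%:C)%C *: (0 : bop H) by rewrite scaler0.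
      by rewrite (weight_scale wP)// ?mul0e//; split=> // u; rewrite bop0E inner0l.
    rewrite /T !big_nat_recr//= (weight_add wP) -/(T m).
    - rewrite IH (weight_scale wP) ?exprn_ge0//; last by split=> //; exact: pos_rk1.
      by rewrite -(iota_rnorm wP gP e1)// -EFinM -EFinD.
    - by split.
    - by split=> //; apply: pos_opZ; [exact: exprn_ge0|exact: pos_rk1].
  rewrite h lee_fin; apply: le_trans (q1 n); apply: ler_sum => i _.
  by rewrite -quarter; apply: ler_wpM2l; [rewrite exprn_ge0|exact: iC].
have phX := weight_seq_le wP Tp TS Xu phT.
have vX : le_op (rk1 v v) X.
  move=> u; rewrite bopBE innerBl rk1E innerZl.
  have h1 : (fun n => '[T n u, u] - '[u, series d n] * '[series d n, u] : Cx R) @ \oo -->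
      ('[X u, u] - '[u, v] * '[v, u] : Cx R).
    by apply: cvgB; [exact: Xu|apply: cvgM; [exact: cvg_innerr|exact: cvg_innerl]].
  apply: (cvg_ge0 h1) => n; rewrite (innerC (series d n)) -normCK rnormE -rmorphXn TEu -rmorphB.
  rewrite ler0c subr_ge0 /series /= inner_sumr.
  apply: le_trans (weighted_cs _ _); last by move=> i; exact: rnorm_ge0.
  rewrite ler_sqr ?nnegrE ?rnorm_ge0//; last by apply: sumr_ge0 => i _; exact: rnorm_ge0.
  by elim/big_rec2: _ => [|i y1 y2 _ h]; [rewrite rnorm0|apply: le_trans (rnormD _ _) _; rewrite lerD2l].
have phv := le_trans (weight_le wP (pos_rk1 v) vX) phX.
have vD : dom v.
  by split=> //; rewrite adj_rk1 rk1M e1 scale1r; apply: le_lt_trans phv _; rewrite ltry.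
by split=> //; rewrite -lee_fin (iota_rnorm wP gP e1).
Qed.

End WeightForm.

(** * The closed form of a weight and its resolvent *)

Section WeightTensor.
Variables (R : realType) (H : hilbertType R) (phi : bop H -> \bar R).
Hypothesis wP : fns_weight setT phi.
Variables (K : hilbertType R) (pi : bop H -> bop K) (Lam : bop H -> K).
Hypothesis gP : gns setT phi pi Lam.
Variable e : nat -> H.
Hypothesis eb : orthobasis e.
Implicit Types (x y : bop H) (u v w z : H) (c : Cx R).
Local Notation e0 := (e 0%N).
Local Notation N := (left_ideal setT phi).
Local Notation dom := (weight_dom phi e0).
Local Notation br := (bracket Lam).
Local Notation iota := (bracket Lam e0).
Let e1 : '[e0, e0] = 1. Proof. by rewrite eb.1. Qed.

(** The form of [1 + h] for the density [h]. The arguments of the second term are swapped because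
    [iota] is conjugate-linear. *)
Definition graph_form u v : Cx R := '[u, v] + '[iota v, iota u].
Local Notation Q := graph_form.

Lemma graph_formP c u v w : dom u -> dom v -> dom w -> Q (c *: u + v) w = c * Q u w + Q v w.
Proof.
move=> uD vD wD; rewrite /graph_form (bracketPr wP gP e1)// innerDl innerDr innerZl innerZr conjCK.
by ring.
Qed.

Lemma graph_formC u v : dom u -> dom v -> Q v u = (Q u v)^*.
Proof. by move=> uD vD; rewrite /graph_form rmorphD /= -!innerC. Qed.

Lemma graph_form_diag u : Q u u = ((rnorm u ^+ 2 + rnorm (iota u) ^+ 2)%:C)%C.
Proof. by rewrite /graph_form !inner_rnorm rmorphD. Qed.

Lemma graph_form_ge0 u : 0 <= Q u u.
Proof. by rewrite graph_form_diag ler0c addr_ge0 ?sqr_ge0. Qed.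

(** The constant is [2 + 2 (1 + 4)]: the parallelogram estimate in [graph_form_complete] splits
    [u_ n - l] at a term of the fast subsequence. *)
Lemma exp8_small (eps : R) : 0 < eps -> exists k, forall j, (k <= j)%N -> 12 * 8^-1 ^+ j < eps.
Proof.
move=> eps0; have e' : 0 < eps / 12 by rewrite divr_gt0.
have [M _ MP] := near_infty_natSinv_lt (PosNum e'); exists M => j /(MP j) /= h.
rewrite mulrC -ltr_pdivlMr//; apply: le_lt_trans h.
rewrite exprVn lef_pV2 ?posrE ?exprn_gt0 ?ltr0n//.
by rewrite -natrX ler_nat; apply: ltn_expl.
Qed.

(** Closedness of the form. A subsequence whose increments have form value below [8 ^- k] satisfies
    the hypotheses of [weight_dom_series], which puts the limit in the domain and bounds [iota] on
    the tails. *)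
Lemma graph_form_complete (u_ : nat -> H) : (forall n, dom (u_ n)) ->
  (forall eps : R, 0 < eps -> exists M, forall m n, (M <= m)%N -> (M <= n)%N ->
     complex.Re (Q (u_ m - u_ n) (u_ m - u_ n)) < eps) ->
  exists2 l, dom l & forall eps : R, 0 < eps -> exists M, forall n, (M <= n)%N ->
     complex.Re (Q (u_ n - l) (u_ n - l)) < eps.
Proof.
move=> uD uC; have QE w : complex.Re (Q w w) = rnorm w ^+ 2 + rnorm (iota w) ^+ 2.
  by rewrite graph_form_diag.
have [l ul] : exists l : H, u_ @ \oo --> l.
  apply: complete_rnorm => eps eps0; have e2 : 0 < eps ^+ 2 by rewrite exprn_gt0.
  have [M MP] := uC _ e2; exists M => m n hm hn; have := MP m n hm hn; rewrite QE => h.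
  rewrite -(ltr_pXn2r (n := 2))// ?nnegrE ?rnorm_ge0 ?(ltW eps0)//.
  by have := sqr_ge0 (rnorm (iota (u_ m - u_ n))); lra.
have /choice[M_ MP] k : exists M, forall m n, (M <= m)%N -> (M <= n)%N ->
    complex.Re (Q (u_ m - u_ n) (u_ m - u_ n)) < 8^-1 ^+ k.
  by apply: uC; rewrite exprn_gt0.
pose M k := (\max_(i < k.+1) M_ i)%N.
have MM k j : (k <= j)%N -> (M_ k <= M j)%N.
  rewrite -ltnS => kj.
  exact: (leq_bigmax (F := fun i : 'I_j.+1 => M_ i) (Ordinal kj)).
pose z k := u_ (M k).
have zD k : dom (z k) by exact: uD.
have zl : z @ \oo --> l.
  apply/cvg_rnormn => eps eps0; have eps2 : 0 < eps / 2 by rewrite divr_gt0.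
  have /cvg_rnormn/(_ _ eps2)[n1 n1P] := ul.
  have e2 : 0 < (eps / 2) ^+ 2 by rewrite exprn_gt0.
  have [k kP] := exp8_small e2; exists k => j kj.
  pose n2 := maxn n1 (M j).
  have := MP j n2 (M j) (leq_trans (MM j j (leqnn j)) (leq_maxr _ _)) (MM j j (leqnn j)).
  rewrite QE => h2; have h3 := n1P n2 (leq_maxl _ _); have h4 := kP j kj.
  have h5 : rnorm (u_ n2 - z j) < eps / 2.
    rewrite -(ltr_pXn2r (n := 2))// ?nnegrE ?rnorm_ge0 ?(ltW eps2)//.
    have := sqr_ge0 (rnorm (iota (u_ n2 - u_ (M j)))).
    have : 0 <= (8^-1 : R) ^+ j by rewrite exprn_ge0.
    move: h2 h4; rewrite -/(z j); set y := (eps / 2) ^+ 2; lra.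
  by have := rnorm_tri (u_ n2) l (z j); lra.
have key k : dom (l - z k) /\ rnorm (iota (l - z k)) ^+ 2 <= 4 * 8^-1 ^+ k.
  pose d i := z (k + i).+1 - z (k + i)%N.
  have Qd i : complex.Re (Q (d i) (d i)) < 8^-1 ^+ k * 8^-1 ^+ i.
    by rewrite -exprD; apply: MP; apply: MM; rewrite ?leqW.
  apply: (weight_dom_series wP gP e1 (d := d)) => [|i|i|i|].
  - by rewrite exprn_ge0.
  - exact: (weight_domB wP).
  - by have := Qd i; rewrite QE; have := sqr_ge0 (rnorm (iota (d i))); lra.
  - by have := Qd i; rewrite QE; have := sqr_ge0 (rnorm (d i)); lra.
  have -> : series d = (fun n => z (n + k)%N - z k).
    apply/funext => n; rewrite /series /=; elim: n => [|n IH].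
      by rewrite big_geq// add0n subrr.
    by rewrite big_nat_recr//= IH /d addnC -[(k + n)%N]addnC addrC addrA subrK addSn.
  by apply: cvgB; [rewrite (cvg_shiftn k)|exact: cvg_cst].
have lD : dom l.
  by have [h _] := key 0%N; rewrite -[l](subrK (z 0%N)) -[_ - _]scale1r; exact: (weight_domP wP).
exists l => // eps eps0; have [k kP] := exp8_small eps0.
exists (M_ k) => n kn; have h1 := MP k n (M k) kn (MM k k (leqnn k)).
have [h2 h3] := key k; have h4 := kP k (leqnn k).
have h5 : rnorm (l - z k) ^+ 2 <= 8^-1 ^+ k.
  have cz : (fun n => u_ n - z k) @ \oo --> l - z k by apply: cvgB => //; exact: cvg_cst.
  have p8 : 0 <= (8^-1 : R) ^+ k by rewrite exprn_ge0.
  rewrite -[8^-1 ^+ k]sqr_sqrtr// ler_sqr ?nnegrE ?rnorm_ge0 ?sqrtr_ge0//.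
  apply: (cvg_rnorm_le cz); exists (M_ k) => // j /= kj.
  rewrite -ler_sqr ?nnegrE ?rnorm_ge0 ?sqrtr_ge0// sqr_sqrtr//.
  have := MP k j (M k) kj (MM k k (leqnn k)); rewrite QE -/(z k).
  have := sqr_ge0 (rnorm (iota (u_ j - z k))); lra.
have -> : u_ n - l = (u_ n - z k) - (l - z k) by rewrite opprB addrA subrK.
have par (L : hilbertType R) (p q : L) : rnorm (p - q) ^+ 2 <= 2 * rnorm p ^+ 2 + 2 * rnorm q ^+ 2.
  have := rnormB p q; have := rnorm_ge0 (p - q); have := sqr_ge0 (rnorm p - rnorm q).
  set r := rnorm (p - q) => h r0 rpq.
  have : r ^+ 2 <= (rnorm p + rnorm q) ^+ 2 by rewrite ler_sqr// nnegrE// (le_trans r0).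
  nra.
rewrite QE (bracketBr wP gP e1)//; last exact: (weight_domB wP).
have := par H (u_ n - z k) (l - z k); have := par K (iota (u_ n - z k)) (iota (l - z k)).
move: h1; rewrite QE -/(z k); lra.
Qed.

Lemma graph_form_riesz (f : H -> Cx R) (C : R) : 0 <= C ->
  (forall c u v, dom u -> dom v -> f (c *: u + v) = c * f u + f v) ->
  (forall u, dom u -> rnorm (f u) ^+ 2 <= C * complex.Re (Q u u)) ->
  exists2 v, dom v & forall u, dom u -> f u = Q u v.
Proof.
move=> C0 fl fC; apply: (form_riesz (weight_dom0 wP e0) _ graph_formP graph_formC _ _ C0 fl fC).
- exact: (weight_domP wP).
- by move=> u _; exact: graph_form_ge0.
- exact: graph_form_complete.
Qed.

Lemma graph_form_eq u v : dom u -> dom v -> (forall w, dom w -> Q w u = Q w v) -> u = v.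
Proof.
move=> uD vD h; have uvD := weight_domB wP uD vD.
have E w : dom w -> Q w (u - v) = 0.
  move=> wD; rewrite (graph_formC uvD wD) addrC -scaleN1r graph_formP// mulN1r.
  by rewrite (graph_formC wD vD) (graph_formC wD uD) h// addNr conjC0.
have := E _ uvD.
rewrite graph_form_diag => /complexI h0; apply/eqP; rewrite -subr_eq0 -rnorm_eq0 -sqrf_eq0.
apply/eqP; have := sqr_ge0 (rnorm (u - v)); have := sqr_ge0 (rnorm (iota (u - v))); lra.
Qed.

(* [a] is [(1 + h)^-1] for the density [h] of the weight *)
Lemma resolvent_exists : exists a : bop H, forall u, dom (a u) /\
  forall v, dom v -> '[v, u] = Q v (a u).
Proof.
have /choice[a aP] u : exists v, dom v /\ forall w, dom w -> '[w, u] = Q w v.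
  have [||v vD vP] := @graph_form_riesz (fun w => '[w, u]) (rnorm u ^+ 2) (sqr_ge0 _).
  - by move=> c w w' _ _; rewrite innerDl innerZl.
  - move=> w wD; rewrite graph_form_diag ReC.
    apply: (@le_trans _ _ ((rnorm w * rnorm u) ^+ 2)).
      by rewrite ler_sqr ?nnegrE ?mulr_ge0 ?rnorm_ge0// rnorm_cs.
    rewrite exprMn mulrC; apply: ler_wpM2l; first exact: sqr_ge0.
    by rewrite lerDl sqr_ge0.
  by exists v.
have aD u := (aP u).1; have aE u v (vD : dom v) := (aP u).2 v vD.
have al : linear a.
  move=> c u v; have D : dom (c *: a u + a v) by exact: (weight_domP wP).
  apply: graph_form_eq => // w wD; rewrite -aE// graph_formC// graph_formP// rmorphD rmorphM /=.
  by rewrite -!graph_formC// -!aE// innerDr innerZr.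
have [|x xE] := @bop_of_rbound R H a 1 al.
  move=> u; rewrite mul1r; have [->|au] := eqVneq (a u) 0; first by rewrite rnorm0 rnorm_ge0.
  have a0 : 0 < rnorm (a u) by rewrite rnorm_gt0.
  rewrite -(ler_pM2l a0) -expr2; apply: le_trans (rnorm_cs (a u) u).
  apply: le_trans (ler_Re_rnorm _); rewrite aE// graph_form_diag ReC lerDl.
  exact: sqr_ge0.
by exists x => u; rewrite xE; exact: aP.
Qed.

Section Resolvent.
Variable a : bop H.
Hypothesis aP : forall u, dom (a u) /\ forall v, dom v -> '[v, u] = Q v (a u).

Let aD u : dom (a u). Proof. exact: (aP u).1. Qed.
Let aE u v : dom v -> '[v, u] = Q v (a u). Proof. exact: (aP u).2. Qed.

Lemma resolvent_diag u : '[a u, u] = ((rnorm (a u) ^+ 2 + rnorm (iota (a u)) ^+ 2)%:C)%C.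
Proof. by rewrite aE// graph_form_diag. Qed.

Lemma resolvent_pos : pos_op a.
Proof. by move=> u; rewrite resolvent_diag ler0c addr_ge0 ?sqr_ge0. Qed.

Lemma resolvent_inj u : a u = 0 -> u = 0.
Proof.
move=> au; apply: (weight_dom_dense (e0 := e0) wP) => v vD; rewrite aE// au.
rewrite -[Q v 0]conjCK -graph_formC//; last exact: (weight_dom0 wP).
by rewrite /graph_form inner0l /bracket (rk10r e0) (gns0 wP gP) inner0r addr0 conjC0.
Qed.

Lemma resolvent_sub1_inj u : a u = u -> u = 0.
Proof.
move=> au; have uD : dom u by rewrite -au.
have := resolvent_diag u; rewrite au inner_rnorm => /complexI h.
apply: (iota_eq0 wP gP e1 uD); apply/eqP; rewrite -rnorm_eq0 -sqrf_eq0; apply/eqP; lra.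
Qed.

(** With [a = (1 + h)^-1] both sides express [a h a = a - a^2]. *)
Lemma resolvent_iota u u' : '[iota (a u'), iota (a u)] = '[(a - a * a) u, u'].
Proof.
have := aE u' (aD u); rewrite /graph_form => h.
have h1 : '[a (a u), u'] = '[a u, a u'].
  by rewrite -{1}(pos_op_adj resolvent_pos) -adjPr.
by rewrite bopBE bopME innerBl h1 h addrAC subrr add0r.
Qed.

(** [s] stands for [h^(1/2) (1 + h)^-1]. It is injective because [a] and [1 - a] are, the latter by
    faithfulness of the weight. *)
Lemma resolvent_sqrt : exists s : bop H, [/\ pos_op s, s * s = a - a * a, s * a = a * s &
  forall u, s u = 0 -> u = 0].
Proof.
have bp : pos_op (a - a * a).
  by move=> u; rewrite -resolvent_iota inner_ge0.
have [s [sp ss sc]] := sqrt_exists bp; exists s; split=> //.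
  by apply: sc; rewrite mulrBl mulrBr mulrA.
move=> u su; apply: resolvent_sub1_inj; apply/eqP; rewrite eq_sym -subr_eq0; apply/eqP.
apply: resolvent_inj; have : (s * s) u = 0 by rewrite bopME su bop_lin0.
by rewrite ss bopBE bopME bop_linB.
Qed.

End Resolvent.
End WeightTensor.

Section DenseRanges.
Variables (R : realType) (H : hilbertType R).
Implicit Types (x y : bop H).

Lemma dense_norm_dense (G : set H) : dense G -> norm_dense G.
Proof.
move=> Gd h eps eps0; have e0 : 0 < ((eps%:C)%C : Cx R) by rewrite ltcR.
have hb : ball h ((eps%:C)%C : Cx R) !=set0 by exists h; exact: ballxx.
have [g [hg Gg]] := Gd _ hb (ball_open h _).
by exists g => //; move: hg; rewrite -ball_normE /= rnormE ltcR.
Qed.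

Lemma pos_op_dense x y : norm_dense (range y) -> (forall u, 0 <= '[x (y u), y u]) -> pos_op x.
Proof.
move=> yd h v; have [g_ gy gv] := dense_cvg v yd.
have xg : (fun n => x (g_ n)) @ \oo --> x v by exact: (cvg_bop x gv).
have cv : (fun n => '[x (g_ n), g_ n] : Cx R) @ \oo --> ('[x v, v] : Cx R) by exact: cvg_inner.
by apply: (cvg_ge0 cv) => n; have [u _ <-] := gy n.
Qed.

Lemma bop_factor x y : norm_dense (range y) -> (forall u, rnorm (x u) <= rnorm (y u)) ->
  exists q : bop H, q * y = x.
Proof.
move=> yd xy.
have [F [Fy FL]] : exists F : H -> H, (forall a, F (y a) = x a) /\
    (forall v v', rnorm (F v - F v') <= 1 * rnorm (v - v')).
  apply: (lip_extension (f := x) ltr01 yd) => u v.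
  by rewrite mul1r -!bop_linB.
have Fc (g : nat -> H) v : g @ \oo --> v -> (fun n => F (g n)) @ \oo --> F v.
  move=> /cvg_rnormn gv; apply/cvg_rnormn => eps /gv[N NP]; exists N => n /NP.
  by apply: le_lt_trans; have := FL v (g n); rewrite mul1r.
have Fl : linear F.
  move=> c u v; have [gu gud guv] := dense_cvg u yd; have [gv gvd gvv] := dense_cvg v yd.
  have h1 : (fun n => c *: gu n + gv n) @ \oo --> c *: u + v.
    by apply: cvgD => //; exact: cvgZr.
  apply: (rnorm_cvg_unique (Fc _ _ h1)).
  have -> : (fun n => F (c *: gu n + gv n)) = (fun n => c *: F (gu n) + F (gv n)).
    apply/funext => n; have [a _ <-] := gud n; have [b _ <-] := gvd n.
    by rewrite -bop_linZ -bop_linD !Fy bop_linD bop_linZ.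
  by apply: cvgD; [apply: cvgZr; exact: Fc|exact: Fc].
have [|q qF] := @bop_of_rbound R H F 1 Fl.
  move=> u; have := FL u 0; rewrite subr0.
  have -> : F 0 = 0 by have := Fy 0; rewrite !bop_lin0.
  by rewrite subr0.
by exists q; apply: bopP => u; rewrite bopME qF Fy.
Qed.

Lemma pos_mul_comm x y : pos_op x -> pos_op y -> x * y = y * x -> pos_op (x * y).
Proof.
move=> xp yp xy; have [r [rp rx rc]] := sqrt_exists xp.
have ry : r * y = y * r by apply: rc.
rewrite -rx.
rewrite -mulrA ry mulrA -{1}(pos_op_adj rp); exact: pos_conj.
Qed.

End DenseRanges.

Section TensInjective.
Variables (R : realType) (H K : hilbertType R) (tau : H -> H -> K) (e : nat -> H).
Hypotheses (tT : tensor tau) (eb : orthobasis e).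
Implicit Types (x y : bop H).

Lemma tens_inj x y k : (forall u, x u = 0 -> u = 0) -> (forall u, y u = 0 -> u = 0) ->
  tens tau x y k = 0 -> k = 0.
Proof.
move=> xi yi h; apply: (op_inj (tT := tT)); rewrite op0.
have := op_tens tT eb x y k; rewrite h op0 => h0.
have h1 : op tT k * adj y = 0.
  by apply: bopP => u; rewrite bop0E; apply: xi; rewrite -bopME mulrA -h0 bop0E.
have h2 : y * adj (op tT k) = 0 by rewrite -[y]adjK -adjM h1 adj0.
rewrite -[LHS]adjK -[RHS]adjK adj0; congr adj; apply: bopP => u.
by rewrite bop0E; apply: yi; rewrite -bopME h2 bop0E.
Qed.

Lemma tens_sqr_pos x : pos_op x -> pos_op (tens tau x x).
Proof.
move=> xp; have [r [rp <- _]] := sqrt_exists xp.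
have h : adj (tens tau r r) = tens tau r r by rewrite (tensJ tT eb) pos_op_adj.
by rewrite -(tensM tT eb) -{1}h; exact: pos_adjM.
Qed.

Lemma tens_self_adj x y : pos_op x -> pos_op y -> adj (tens tau x y) = tens tau x y.
Proof. by move=> xp yp; rewrite (tensJ tT eb) !pos_op_adj. Qed.

Lemma flip_involutive J0 : antiunitary J0 -> (forall u v, J0 (tau u v) = tau v u) ->
  forall k, J0 (J0 k) = k.
Proof.
move=> Ja Jt k; apply/eqP; rewrite -subr_eq0; apply/eqP; apply: (tau_total tT) => u v.
rewrite innerBl -{1}[tau u v]Jt (antiunitary_inner Ja) -[tau v u]Jt (antiunitary_inner Ja).
by rewrite subrr.
Qed.

Lemma flip_tens J0 x y k : antiunitary J0 -> (forall u v, J0 (tau u v) = tau v u) ->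
  J0 (tens tau x y (J0 k)) = tens tau y x k.
Proof.
move=> Ja Jt; have [X XP] : exists X : bop K, forall k, X k = J0 (tens tau x y (J0 k)).
  have [C C0 CP] := bop_rbound (tens tau x y).
  apply: (@bop_of_rbound _ _ _ C) => [c k1 k2|k1].
    by rewrite (antiunitary_linear Ja) bop_linD bop_linZ (antiunitary_linear Ja) conjCK.
  by rewrite (antiunitary_rnorm _ Ja); apply: le_trans (CP _) _; rewrite (antiunitary_rnorm _ Ja).
rewrite -XP; suff -> : X = tens tau y x by [].
by apply: (tau_bop_eq tT) => u v; rewrite XP Jt !(tensE tT eb) Jt.
Qed.

Lemma flip_adj J0 k : antiunitary J0 -> (forall u v, J0 (tau u v) = tau v u) ->
  op tT (J0 k) = adj (op tT k).
Proof.
move=> Ja Jt; apply: op_eqP => u v.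
by rewrite -adjPr -[tau u v]Jt (antiunitary_inner Ja) (innerC (tau v u)) -(opP tT) -innerC.
Qed.

End TensInjective.

(** * Tensor structure on the GNS space of a weight *)

Section WeightTensorStructure.
Variables (R : realType) (H : hilbertType R) (phi : bop H -> \bar R).
Hypothesis wP : fns_weight setT phi.
Variables (K : hilbertType R) (pi : bop H -> bop K) (Lam : bop H -> K).
Hypothesis gP : gns setT phi pi Lam.
Variable e : nat -> H.
Hypothesis eb : orthobasis e.
Implicit Types (x y : bop H) (u v w z : H) (c : Cx R).
Local Notation e0 := (e 0%N).
Local Notation N := (left_ideal setT phi).
Local Notation dom := (weight_dom phi e0).
Local Notation br := (bracket Lam).
Local Notation iota := (bracket Lam e0).
Local Notation Q := (graph_form Lam e).
Let e1 : '[e0, e0] = 1. Proof. by rewrite eb.1. Qed.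

(** If every truncation lost at least [eps], normality along the increasing [y^* fproj_n y] would
    bound the weight of [y^* y] by its own value minus [eps]. *)
Lemma gns_fproj_small y (eps : R) : N y -> 0 < eps ->
  exists n, rnorm (Lam y - Lam (fproj e n * y)) ^+ 2 < eps.
Proof.
move=> yN eps0; apply: contrapT => h.
have hn n : eps <= rnorm (Lam y - Lam (fproj e n * y)) ^+ 2.
  by rewrite leNgt; apply/negP => hlt; apply: h; exists n.
pose T n := adj y * fproj e n * y.
have TN n : N (fproj e n * y) by exact: (left_idealM wP).
have TE n : T n = adj (fproj e n * y) * (fproj e n * y).
  by rewrite adjM fprojJ -!mulrA [fproj e n * (fproj e n * y)]mulrA (fprojM eb) !mulrA.
have phT n : (phi (T n) <= (rnorm (Lam y) ^+ 2 - eps)%:E)%E.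
  rewrite TE (weight_adjM_fin wP (TN n)) lee_fin -(gns_rnorm gP (TN n)) lerBrDr.
  have orth : '[Lam (fproj e n * y), Lam y - Lam (fproj e n * y)] = 0.
    rewrite -(gnsB gP)//; apply: (gns_orth wP gP) => //.
      by rewrite -[y]mul1r mulrA -mulrBl mulr1 ; exact: (left_idealM wP).
    by rewrite mulrBr -TE adjM fprojJ /T subrr.
  have := rnormDsqr orth; rewrite addrC subrK => ->.
  by rewrite lerD2l.
have phy : (phi (adj y * y)%R <= (rnorm (Lam y) ^+ 2 - eps)%:E)%E.
  apply: (weight_seq_le wP (T := T)) => // [n|n|u].
  - by rewrite TE; exact: pos_adjM.
  - rewrite /T => u; rewrite -mulrBl -mulrBr /fproj big_nat_recr//= addrAC subrr add0r.
    by rewrite -adjPr innerZl (innerC (e n)) -normCK exprn_ge0.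
  - have py : (fun n => fproj e n (y u)) @ \oo --> y u by exact: fproj_cvg.
    under eq_fun do rewrite TE !bopME -adjPr.
    by rewrite bopME -adjPr; exact: cvg_inner.
move: phy; rewrite (weight_adjM_fin wP yN) lee_fin -(gns_rnorm gP yN); lra.
Qed.

Section ResolventTensor.
Variables (a s : bop H).
Hypothesis aP : forall u, dom (a u) /\ forall v, dom v -> '[v, u] = Q v (a u).
Hypothesis sp : pos_op s.
Hypothesis ss : s * s = a - a * a.
Hypothesis sa : s * a = a * s.
Hypothesis si : forall u, s u = 0 -> u = 0.

Let aD u : dom (a u). Proof. exact: (aP u).1. Qed.
Let aE u v : dom v -> '[v, u] = Q v (a u). Proof. exact: (aP u).2. Qed.
Let ap : pos_op a. Proof. exact: (resolvent_pos aP). Qed.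
Let ai u : a u = 0 -> u = 0. Proof. exact: (resolvent_inj wP gP aP). Qed.

Lemma iota_resolvent_rnorm u : rnorm (iota (a u)) = rnorm (s u).
Proof.
apply/eqP; rewrite -(eqrXn2 (n := 2)) ?rnorm_ge0//; apply/eqP.
apply: (@complexI R); rewrite -!inner_rnorm (resolvent_iota aP) -ss bopME.
by rewrite -{1}(pos_op_adj sp) -adjPr.
Qed.

Let sd : norm_dense (range s).
Proof. by apply: range_dense => v; rewrite (pos_op_adj sp); exact: si. Qed.

(** The bracket of [u] and [a v] should be |u><h^(1/2) a v| = |u><s v|. The norm of [iota (a v)] is
    that of [s v], so this prescription is Lipschitz on the dense range of [s] and extends. *)
Lemma weight_tensor : exists tau : H -> H -> K,
  [/\ tensor tau, forall u v, tau u (s v) = br u (a v) &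
      forall x u v, pi x (tau u v) = tau (x u) v].
Proof.
have /choice[tau tP] u : exists F : H -> K, (forall v, F (s v) = br u (a v)) /\
    (forall v v', rnorm (F v - F v') <= (rnorm u + 1) * rnorm (v - v')).
  apply: (lip_extension (s := s) (f := fun v => br u (a v))) sd _.
    by rewrite ltr_wpDl// rnorm_ge0.
  move=> v v'; rewrite -(bracketBr wP gP e1)// -bop_linB (bracket_rnorm wP gP e1)//.
  rewrite iota_resolvent_rnorm -bop_linB; apply: ler_wpM2r; first exact: rnorm_ge0.
  by rewrite lerDl.
have ts u v : tau u (s v) = br u (a v) by rewrite (tP u).1.
have tc (g : nat -> H) u v : g @ \oo --> v -> (fun n => tau u (g n)) @ \oo --> tau u v.
  move=> /cvg_rnormn gv; apply/cvg_rnormn => eps eps0.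
  have C0 : 0 < rnorm u + 1 by rewrite ltr_wpDl// rnorm_ge0.
  have [M MP] := gv _ (divr_gt0 eps0 C0); exists M => n /MP.
  rewrite ltr_pdivlMr// mulrC; apply: le_lt_trans; exact: (tP u).2.
have sq v : exists g_ : nat -> H, (fun n => s (g_ n)) @ \oo --> v.
  have [h hd hv] := dense_cvg v sd.
  have /choice[g gP'] n : exists g, s g = h n by have [g _ gE] := hd n; exists g.
  by exists g; rewrite (_ : (fun n => s (g n)) = h)//; apply/funext => n; rewrite gP'.
have tT : tensor tau.
  split.
  - move=> c u u' v; have [g gv] := sq v.
    apply: (rnorm_cvg_unique (tc _ _ _ gv)).
    have -> : (fun n => tau (c *: u + u') (s (g n))) = (fun n => c *: tau u (s (g n)) + tau u' (s (g n))).
      by apply/funext => n; rewrite !ts (bracketPl wP gP e1).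
    by apply: cvgD; [apply: cvgZr; exact: tc|exact: tc].
  - move=> c u v v'; have [g gv] := sq v; have [g' gv'] := sq v'.
    have h1 : (fun n => c *: s (g n) + s (g' n)) @ \oo --> c *: v + v'.
      by apply: cvgD => //; exact: cvgZr.
    apply: (rnorm_cvg_unique (tc _ u _ h1)).
    have -> : (fun n => tau u (c *: s (g n) + s (g' n))) =
        (fun n => c^* *: tau u (s (g n)) + tau u (s (g' n))).
      apply/funext => n; rewrite -bop_linZ -bop_linD !ts bop_linD bop_linZ.
      by rewrite (bracketPr wP gP e1).
    by apply: cvgD; [apply: cvgZr; exact: tc|exact: tc].
  - move=> u v u' v'; have [g gv] := sq v; have [g' gv'] := sq v'.
    have h1 : (fun n => '[tau u (s (g n)), tau u' (s (g' n))] : Cx R) @ \oo --> ('[tau u v, tau u' v'] : Cx R).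
      by apply: cvg_inner; exact: tc.
    apply: (rnorm_cvg_unique (V := Cx R) h1).
    have -> : (fun n => '[tau u (s (g n)), tau u' (s (g' n))]) = (fun n => '[u, u'] * '[s (g' n), s (g n)]).
      apply/funext => n; rewrite !ts (bracket_inner wP gP e1)// (resolvent_iota aP).
      by rewrite -ss bopME -{1}(pos_op_adj sp) -adjPr.
    by apply: cvgM; [exact: cvg_cst|exact: cvg_inner].
  - move=> k kt.
    have kb u v : dom v -> '[k, br u v] = 0.
      move=> vD.
      (* [k] is orthogonal to brackets with second argument in the range of [a] only. The form
         vector [v0] representing [v |-> '[k, br u v]] then satisfies ['[v0, w] = Q v0 (a w) = 0]
         for all [w], so [k] is orthogonal to all brackets. *)
      have [||v0 v0D v0P] := @graph_form_riesz _ _ _ wP _ _ _ gP _ eb (fun v => '[k, br u v])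
        ((rnorm k * rnorm u) ^+ 2) (sqr_ge0 _).
      + move=> c w w' wD wD'; rewrite (bracketPr wP gP e1)// innerDr innerZr conjCK.
        by [].
      + move=> w wD; rewrite graph_form_diag ReC.
        apply: (@le_trans _ _ ((rnorm k * (rnorm u * rnorm (iota w))) ^+ 2)).
          rewrite ler_sqr ?nnegrE ?mulr_ge0 ?rnorm_ge0// -(bracket_rnorm wP gP e1 u wD).
          exact: rnorm_cs.
        rewrite mulrA exprMn; apply: ler_wpM2l; first exact: sqr_ge0.
        by rewrite lerDr sqr_ge0.
      have v00 : v0 = 0.
        apply: inner_eq0l => w; rewrite aE// (graph_formC Lam (aD w) v0D) -v0P//.
        by rewrite -ts kt conjC0.
      rewrite v0P// v00 /graph_form inner0r /bracket (rk10r e0) (gns0 wP gP) inner0l addr0.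
      by [].
    have kL y : N y -> '[k, Lam y] = 0.
      move=> yN; apply: crnorm0_eq0; apply/eqP; rewrite eq_le rnorm_ge0 andbT.
      apply/ler_addgt0Pr => eps eps0; rewrite add0r.
      have k1 : 0 < rnorm k + 1 by rewrite ltr_wpDl// rnorm_ge0.
      have d0 : 0 < eps / (rnorm k + 1) by rewrite divr_gt0.
      have [n nP] := gns_fproj_small yN (exprn_gt0 2 d0).
      have z m : '[k, Lam (fproj e m * y)] = 0.
        elim: m => [|m IH].
          by rewrite /fproj big_geq// mul0r (gns0 wP gP) inner0r.
        rewrite /fproj big_nat_recr//= mulrDl (gnsD gP); first last.
        + exact: (left_idealM wP).
        + exact: (left_idealM wP).
        rewrite -/(fproj e m) innerDr IH add0r rk1_mul; apply: kb; exact: (weight_dom_adj wP).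
      rewrite -[Lam y](subrK (Lam (fproj e n * y))) innerDr z addr0.
      apply: le_trans (rnorm_cs _ _) _.
      rewrite ltr_pXn2r ?nnegrE ?rnorm_ge0 ?(ltW d0)// in nP.
      rewrite -[leRHS](divfK (lt0r_neq0 k1)) mulrC; apply: ler_pM; rewrite ?rnorm_ge0 ?(ltW nP)//.
      by rewrite lerDl.
    have [g_ gN gk] := dense_cvg k (dense_norm_dense (gns_dense gP)).
    have h1 : (fun n => '[k, g_ n] : Cx R) @ \oo --> ('[k, k] : Cx R) by exact: cvg_innerr.
    apply/eqP; rewrite -inner_eq0; apply/eqP; apply: (rnorm_cvg_unique (V := Cx R) h1).
    rewrite (_ : (fun n => _) = fun=> 0); first exact: cvg_cst.
    by apply/funext => n; have [y yN <-] := gN n; exact: kL.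
exists tau; split=> // x u v; have [g gv] := sq v.
have h1 : (fun n => pi x (tau u (s (g n)))) @ \oo --> pi x (tau u v).
  by apply: cvg_bop; exact: tc.
apply: (rnorm_cvg_unique h1); rewrite (_ : (fun n => _) = fun n => tau (x u) (s (g n))); first exact: tc.
apply/funext => n; rewrite !ts /bracket (gns_rep gP)//; last exact: (weight_dom_rk1 wP e1).
by rewrite mul_rk1.
Qed.

End ResolventTensor.
End WeightTensorStructure.

Section ClosureSequences.
Variables (R : realType) (K : hilbertType R).

Lemma closure_pair_seq (S : set (K * K)) (f g : nat -> K) (u v : K) :
  (forall n, S (f n, g n)) -> f @ \oo --> u -> g @ \oo --> v -> closure S (u, v).
Proof.
move=> SP fu gv B /= [[B1 B2] /= [B1u B2v] BB].
have h1 : \forall n \near \oo, B1 (f n) by exact: fu.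
have h2 : \forall n \near \oo, B2 (g n) by exact: gv.
have [n [n1 n2]] := filter_ex (filterI h1 h2).
by exists (f n, g n); split=> //; apply: BB.
Qed.

Lemma closure_pair_approx (S : set (K * K)) (u v : K) (d : R) : 0 < d -> closure S (u, v) ->
  exists p, [/\ S p, rnorm (u - p.1) < d & rnorm (v - p.2) < d].
Proof.
move=> d0 cS; have d0' : 0 < ((d%:C)%C : Cx R) by rewrite ltcR.
have [|[p1 p2] [Sp [/= h1 h2]]] := cS (ball u ((d%:C)%C : Cx R) `*` ball v ((d%:C)%C : Cx R)).
  exists (ball u ((d%:C)%C : Cx R), ball v ((d%:C)%C : Cx R)) => //=.
  by split; exact: nbhsx_ballx.
exists (p1, p2); split=> //=.
  by move: h1; rewrite -ball_normE /= rnormE ltcR.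
by move: h2; rewrite -ball_normE /= rnormE ltcR.
Qed.

End ClosureSequences.

(** * The modular conjugation of a weight is the flip *)

Section ModularFlip.
Variables (R : realType) (H : hilbertType R) (phi : bop H -> \bar R).
Hypothesis wP : fns_weight setT phi.
Variables (K : hilbertType R) (pi : bop H -> bop K) (Lam : bop H -> K) (J : K -> K).
Hypothesis gP : gns setT phi pi Lam.
Hypothesis mJ : modular_conjugation setT phi Lam J.
Variable e : nat -> H.
Hypothesis eb : orthobasis e.
Implicit Types (x y : bop H) (u v w z : H) (c : Cx R) (k : K).
Local Notation e0 := (e 0%N).
Local Notation N := (left_ideal setT phi).
Local Notation dom := (weight_dom phi e0).
Local Notation br := (bracket Lam).
Local Notation iota := (bracket Lam e0).
Local Notation Q := (graph_form Lam e).
Let e1 : '[e0, e0] = 1. Proof. by rewrite eb.1. Qed.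

Variables (a s : bop H).
Hypothesis aP : forall u, dom (a u) /\ forall v, dom v -> '[v, u] = Q v (a u).
Hypothesis sp : pos_op s.
Hypothesis ss : s * s = a - a * a.
Hypothesis sa : s * a = a * s.
Hypothesis si : forall u, s u = 0 -> u = 0.
Variable tau : H -> H -> K.
Hypothesis tT : tensor tau.
Hypothesis ts : forall u v, tau u (s v) = br u (a v).
Variable J0 : K -> K.
Hypothesis Ja0 : antiunitary J0.
Hypothesis Jt : forall u v, J0 (tau u v) = tau v u.

Let aD u : dom (a u). Proof. exact: (aP u).1. Qed.
Let aE u v : dom v -> '[v, u] = Q v (a u). Proof. exact: (aP u).2. Qed.
Let ap : pos_op a. Proof. exact: (resolvent_pos aP). Qed.
Let ai u : a u = 0 -> u = 0. Proof. exact: (resolvent_inj wP gP aP). Qed.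
Let J0K k : J0 (J0 k) = k. Proof. exact: (flip_involutive tT Ja0 Jt). Qed.

(** Formally [Lam x] is [x h^(1/2)], so the pairing is that of [x h a v] with [u], and [h a = 1 - a]
    is bounded. *)
Lemma gns_tau x u v : N x -> '[Lam x, tau u (s v)] = '[x (v - a v), u].
Proof.
move=> xN; have xD := weight_dom_adj wP e0 u xN.
rewrite ts (gns_bracket wP gP e1)//.
have h := aE v xD; rewrite /graph_form in h.
have : ('[adj x u, v])^* = ('[adj x u, a v])^* + ('[iota (a v), iota (adj x u)])^*.
  by rewrite h rmorphD.
rewrite -!innerC => h2; rewrite bop_linB innerBl (adjP x v) (adjP x (a v)) h2.
by rewrite addrAC subrr add0r.
Qed.

Lemma tau_total_sqrt k : (forall u v, '[k, tau u (s v)] = 0) -> k = 0.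
Proof.
move=> h; apply: (op_inj (tT := tT)); rewrite op0.
have os : op tT k * s = 0.
  by apply: bopP => v; rewrite bop0E bopME; apply: inner_eq0l => u; rewrite (opP tT) h.
have so : s * adj (op tT k) = 0.
  by rewrite -{1}(pos_op_adj sp) -adjM os adj0.
rewrite -[LHS]adjK -[RHS]adjK adj0; congr adj; apply: bopP => u.
by rewrite bop0E; apply: si; rewrite -bopME so bop0E.
Qed.

(** Formally the modular operator satisfies [Delta^(1/2) = h^(1/2) (x) h^(-1/2) = B A^-1], with [A]
    and [B] bounded, injective and commuting. *)
Let A := tens tau a s.
Let B := tens tau s a.

(** [A (tau u v)] is the GNS vector of |a u><a v|, whose adjoint |a v><a u| has GNS vector
    [J0 (B (tau u v))]; sums and limits give all [k]. *)
Lemma tomita_graph_tens k : closure (tomita_graph setT phi Lam) (A k, J0 (B k)).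
Proof.
have gl c p q p' q' : tomita_graph setT phi Lam (p, q) -> tomita_graph setT phi Lam (p', q') ->
    tomita_graph setT phi Lam (c *: p + p', c^* *: q + q').
  move=> [x [xN xN' [-> ->]]] [y [yN yN' [-> ->]]]; exists (c *: x + y); split.
  - by apply: (left_idealD wP) => //; exact: (left_idealZ wP).
  - by rewrite adjD adjZ; apply: (left_idealD wP) => //; exact: (left_idealZ wP).
  - by rewrite adjD adjZ !(gnsP gP).
have g0 : tomita_graph setT phi Lam (0, 0).
  have N0 : N 0 by exact: (left_ideal0 wP).
  by exists 0; rewrite adj0 (gns0 wP gP).
have gt u v : tomita_graph setT phi Lam (A (tau u v), J0 (B (tau u v))).
  exists (rk1 (a u) (a v)); split.
  - exact: (weight_dom_rk1 wP e1).
  - by rewrite adj_rk1; exact: (weight_dom_rk1 wP e1).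
  - by rewrite /A /B !(tensE tT eb) Jt !ts adj_rk1.
have [g gl' gk] := dense_cvg k (tau_lspan_dense tT).
apply: (@closure_pair_seq _ _ _ (fun n => A (g n)) (fun n => J0 (B (g n)))).
- move=> n; move: (g n) (gl' n); apply: lspan_ind.
    have := antiunitary_rnorm 0 Ja0; rewrite rnorm0 => /rnorm0_eq0 J00.
    by rewrite !bop_lin0 J00.
  move=> c _ k' [[u v] _ <-] IH /=.
  rewrite !bop_linD !bop_linZ (antiunitary_linear Ja0); exact: gl.
- exact: cvg_bop.
- apply/cvg_rnormn => eps eps0.
  have /cvg_rnormn/(_ _ eps0)[M MP] : (fun n => B (g n)) @ \oo --> B k by exact: cvg_bop.
  exists M => n /MP; have -> : rnorm (J0 (B k) - J0 (B (g n))) = rnorm (B k - B (g n)); last by [].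
  have -> : J0 (B k) - J0 (B (g n)) = J0 (- B (g n) + B k).
    by rewrite -[- B (g n)]scaleN1r (antiunitary_linear Ja0) rmorphN rmorph1 scaleN1r addrC.
  by rewrite (antiunitary_rnorm _ Ja0) addrC.
Qed.

(** This says that the adjoint of Tomita's operator sends [J0 (B (A k))] to [B (B k)]. It is checked
    against the vectors [tau u (s v)], on which [gns_tau] computes the pairings. *)
Lemma tomita_graph_adjoint p q k : closure (tomita_graph setT phi Lam) (p, q) ->
  '[J0 (B (A k)), q] = '[p, B (B k)].
Proof.
move=> cl.
have main x : N x -> N (adj x) -> '[J0 (B (A k)), Lam (adj x)] = '[Lam x, B (B k)].
  move=> xN xN'.
  have Z0 : adj (B * B) (Lam x) - adj (B * A) (J0 (Lam (adj x))) = 0.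
    apply: tau_total_sqrt => u v; rewrite innerBl -!adjPr !bopME.
    rewrite /A /B !(tensE tT eb).
    have -> : a (a (s v)) = s (a (a v)) by rewrite -!bopME -mulrA -sa mulrA -sa -mulrA.
    have ssE z : s (s z) = a z - a (a z) by rewrite -bopME ss bopBE bopME.
    rewrite (gns_tau _ _ xN) -[tau _ (a (s (s v)))]Jt (antiunitary_inner Ja0).
    rewrite (innerC (tau _ _)) (gns_tau _ _ xN') -innerC -adjP !ssE (bop_linB a) subrr.
    by [].
  have := congr1 (fun z : K => '[z, k]) Z0.
  rewrite inner0l innerBl -!adjPr !bopME => /eqP; rewrite subr_eq0 => /eqP ->.
  by rewrite -{1}[Lam (adj x)]J0K (antiunitary_inner Ja0).
apply/eqP; rewrite -subr_eq0; apply/eqP; apply: rnorm_small_eq0 => eps eps0.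
pose M := rnorm (J0 (B (A k))) + rnorm (B (B k)) + 1.
have M0 : 0 < M by rewrite ltr_wpDl// addr_ge0 ?rnorm_ge0.
have d0 : 0 < eps / M by rewrite divr_gt0.
have [_ [[x [xN xN' ->]] /= h1 h2]] := closure_pair_approx d0 cl.
have -> : '[J0 (B (A k)), q] - '[p, B (B k)] =
    '[J0 (B (A k)), q - Lam (adj x)] - '[p - Lam x, B (B k)].
  by rewrite innerBr innerBl main// opprB addrA subrK.
apply: le_lt_trans (rnormB _ _) _.
have h3 := rnorm_cs (J0 (B (A k))) (q - Lam (adj x)).
have h4 := rnorm_cs (p - Lam x) (B (B k)).
have r1 := rnorm_ge0 (J0 (B (A k))); have r2 := rnorm_ge0 (B (B k)).
have h5 : rnorm (J0 (B (A k))) * rnorm (q - Lam (adj x)) <= rnorm (J0 (B (A k))) * (eps / M).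
  by apply: ler_wpM2l => //; exact: ltW.
have h6 : rnorm (p - Lam x) * rnorm (B (B k)) <= eps / M * rnorm (B (B k)).
  by apply: ler_wpM2r => //; exact: ltW.
have : eps / M * (rnorm (J0 (B (A k))) + rnorm (B (B k))) < eps.
  by rewrite -[ltRHS](divfK (lt0r_neq0 M0)) ltr_pM2l// /M ltrDl.
lra.
Qed.

(* With [Delta^(1/2)] the positive operator of the polar decomposition and
   [w = J^-1 J0], one has [Delta^(1/2) A = w B] and [Delta^(1/2) w B A = B^2];
   uniqueness of positive square roots forces [w = 1]. *)
Lemma modular_flip k : J k = J0 k.
Proof.
have [Ja [P psa PE]] := mJ.
have Jinj (u v : K) : J u = J v -> u = v.
  move=> uv; apply/eqP; rewrite -subr_eq0 -rnorm_eq0 -(antiunitary_rnorm _ Ja) addrC -scaleN1r.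
  by rewrite (antiunitary_linear Ja) rmorphN rmorph1 scaleN1r uv addNr rnorm0.
have /choice[wf wfP] k' : exists l, J l = J0 k' by exact: (antiunitary_surj Ja).
have wl : linear wf.
  move=> c u v; apply: Jinj; rewrite wfP (antiunitary_linear Ja0) (antiunitary_linear Ja).
  by rewrite !wfP.
have wi (u v : K) : '[wf u, wf v] = '[u, v].
  by rewrite -(antiunitary_inner Ja) !wfP (antiunitary_inner Ja0).
have [|w wE] := @bop_of_rbound R K wf 1 wl.
  move=> u; rewrite mul1r -ler_sqr ?nnegrE ?rnorm_ge0// !rnorm_inner wi.
  by [].
have Jw k' : J (w k') = J0 k' by rewrite wE.
have ww : adj w * w = 1.
  by apply: bopP => u; apply: inner_eql => v; rewrite bopME bop1E -adjPr !wE wi.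
have P1 k' : P (A k', w (B k')).
  have := tomita_graph_tens (k := k'); rewrite PE => -[[p q] Ppq /= [pA qB]].
  by rewrite -pA (_ : w (B k') = q)//; apply: Jinj; rewrite Jw.
have P2 k' : P (w (B (A k')), B (B k')).
  apply/(psa_adj psa) => u u' Pu.
  rewrite -(antiunitary_inner Ja) Jw; apply: tomita_graph_adjoint.
  by rewrite PE; exists (u, u').
have AB : A * B = B * A by rewrite /A /B !(tensM tT eb) sa.
have Aa : adj A = A by exact: (tens_self_adj tT eb).
have Ba : adj B = B by exact: (tens_self_adj tT eb).
pose NN := A * B; pose Y := A * A + B * B.
have NE : NN = tens tau (a * s) (a * s) by rewrite /NN (tensM tT eb) sa.
have Np : pos_op NN.
  by rewrite NE; apply: (tens_sqr_pos tT eb); apply: pos_mul_comm.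
have Ainj k' : A k' = 0 -> k' = 0 by exact: (tens_inj tT eb).
have Binj k' : B k' = 0 -> k' = 0 by exact: (tens_inj tT eb).
have Na : adj NN = NN by exact: pos_op_adj.
have Ya : adj Y = Y by rewrite /Y adjD !adjM Aa Ba.
have Yd : norm_dense (range Y).
  apply: range_dense => v; rewrite Ya => Yv; apply: Ainj.
  have := congr1 (fun z : K => '[z, v]) Yv; rewrite inner0l /Y bopDE !bopME innerDl.
  rewrite -{1}Aa -adjPr -{1}Ba -adjPr !inner_rnorm -rmorphD => /complexI h.
  apply/eqP; rewrite -rnorm_eq0 -sqrf_eq0; apply/eqP.
  by have := sqr_ge0 (rnorm (A v)); have := sqr_ge0 (rnorm (B v)); lra.
have Nd : norm_dense (range NN).
  by apply: range_dense => v; rewrite Na bopME => /Ainj/Binj.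
have NY (u : K) : rnorm (NN u) <= rnorm (Y u).
  rewrite -ler_sqr ?nnegrE ?rnorm_ge0//.
  have h : complex.Re '[A (A u), B (B u)] = rnorm (NN u) ^+ 2.
    have cAB (p : K) : A (B p) = B (A p) by rewrite -!bopME AB.
    have Bs (p q : K) : '[B p, q] = '[p, B q] by rewrite adjP Ba.
    by rewrite rnorm_inner /NN !bopME [in LHS]adjP Aa (cAB (B u)) -[in LHS]Bs -cAB.
  have := Re_inner_polar (A (A u)) (B (B u)); rewrite h /Y bopDE !bopME.
  have := sqr_ge0 (rnorm (A (A u))); have := sqr_ge0 (rnorm (B (B u))).
  by have := sqr_ge0 (rnorm (NN u)); lra.
have wNY (u : K) : 0 <= '[w (NN u), Y u].
  rewrite /NN {1}AB /Y bopDE innerDr !bopME.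
  have h1 := psa_pos psa (P1 (A u)); have h2 := psa_pos psa (P2 u).
  by apply: addr_ge0 => //; rewrite innerC conjC_ge0.
have NYp (u : K) : 0 <= '[NN u, Y u].
  have AN : A (NN u) = NN (A u) by rewrite -!bopME /NN -mulrA -AB.
  have BN : B (NN u) = NN (B u) by rewrite -!bopME /NN mulrA -AB.
  rewrite /Y bopDE innerDr (bopME A A) (bopME B B).
  rewrite (adjPr A (NN u)) (adjPr B (NN u)) Aa Ba AN BN.
  by apply: addr_ge0; exact: Np.
(* [Q0 = A B (A^2 + B^2)^-1] is formally the bounded operator [Delta^(1/2) (1 + Delta)^-1]. Both
   [Q0] and [w * Q0] turn out positive, with the same square. *)
have [Q0 Q0Y] := bop_factor Yd NY.
have Q0p : pos_op Q0 by apply: (pos_op_dense Yd) => u; rewrite -bopME Q0Y.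
have Qp : pos_op (w * Q0) by apply: (pos_op_dense Yd) => u; rewrite bopME -[Q0 _]bopME Q0Y.
have QQ : w * Q0 = Q0.
  apply: pos_sqrt_unique => //; rewrite -{1}(pos_op_adj Qp) adjM (pos_op_adj Q0p).
  by rewrite -mulrA [adj w * _]mulrA ww mul1r.
have w1 : w = 1.
  apply: (bop_eq_dense Nd) => _ [u _ <-]; rewrite bop1E -Q0Y -bopME mulrA QQ.
  by [].
by rewrite -Jw w1 bop1E.
Qed.

End ModularFlip.

Section ModularTensor.
Variables (R : realType) (H : hilbertType R) (e : nat -> H).
Hypothesis eb : orthobasis e.

Lemma modular_data_tensor (D : modular_data (Bfactor H)) :
  exists tau : H -> H -> md_space D,
    [/\ tensor tau, forall x u v, md_rep D x (tau u v) = tau (x u) v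
      & forall u v, md_J (tau u v) = tau v u].
Proof.
have wP := md_fns D; have gP := md_gns D; have mJ := md_conj D.
have [a aP] := resolvent_exists wP gP eb.
have [s [sp ss sa si]] := resolvent_sqrt wP gP eb aP.
have [tau [tT ts tpi]] := weight_tensor wP gP eb aP sp ss si.
have [J0 [Ja0 Jt]] := flip_exists tT eb.
exists tau; split=> // u v.
by rewrite (modular_flip wP gP mJ eb aP sp ss sa si tT ts Ja0 Jt).
Qed.

(** [x (x) y] is [md_rep x] times [1 (x) y], which lies in the commutant and is carried by the flip
    to [md_rep y]; the defining relation of the extension then applies. *)
Lemma modular_extension_tens (D : modular_data (Bfactor H)) tau theta Theta :
  tensor tau -> (forall x u v, md_rep D x (tau u v) = tau (x u) v) ->
  (forall u v, md_J (tau u v) = tau v u) ->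
  @modular_extension R H (Bfactor H) D theta Theta ->
  forall x y, Theta (tens tau x y) = tens tau (theta x) (theta y).
Proof.
move=> tT tpi tJ [_ ext] x y.
have c1 : commutant (md_rep D @` setT) (tens tau 1 y).
  move=> _ [z _ <-]; apply: (tau_bop_eq tT) => u v.
  by rewrite !bopME (tensE tT eb) !tpi (tensE tT eb).
have [Ja _] := md_conj D.
have pE z : md_rep D z = tens tau z 1.
  by apply: (tau_bop_eq tT) => u v; rewrite tpi (tensE tT eb).
have JJ : forall k : md_space D, md_J (md_J k) = k by exact: (flip_involutive tT Ja tJ).
have Jy z k : md_rep D z k = md_J (tens tau 1 z (md_J k)).
  by rewrite (flip_tens tT eb _ _ _ Ja tJ) pE.
apply: bopP => k.
have -> : tens tau x y = md_rep D x * tens tau 1 y.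
  by rewrite pE (tensM tT eb) mulr1 mul1r.
rewrite (ext x y _ I I c1) => [|k']; last exact: Jy.
by rewrite (Jy (theta y)) !JJ pE -bopME (tensM tT eb) mulr1 mul1r.
Qed.

End ModularTensor.

(** * The trace *)

Section TensorExistence.
Variables (R : realType) (H : hilbertType R) (e : nat -> H).
Hypothesis eb : orthobasis e.

(** A splitting family [w] turns [H] into a sum of copies of itself; [tau u v] has component
    ['[e n, v] *: u] in the [n]-th copy, so that [tau u (e n) = w n u]. *)
Lemma tensor_exists : exists tau : H -> H -> H, tensor tau.
Proof.
have [pr pi ps] := nat_pairing.
have [w [[wF w1] _]] := split_family_exists eb pi ps.
have /choice[t tP] (p : H * H) : exists k, forall n, adj (w n) k = '[e n, p.2] *: p.1.
  apply: (@split_family_sum _ _ w _ ((rnorm p.1 * rnorm p.2) ^+ 2)) => // n.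
  apply: (@le_trans _ _ (rnorm p.1 ^+ 2 * \sum_(0 <= i < n) rnorm ('[p.2, e i] : Cx R) ^+ 2)).
    rewrite mulr_sumr le_eqVlt; apply/orP; left; apply/eqP; apply: eq_bigr => i _.
    by rewrite rnormZ exprMn mulrC innerC rnorm_conj.
  by rewrite exprMn; apply: ler_wpM2l; [exact: sqr_ge0|exact: (orthobasis_bessel n p.2 eb)].
have wi u v : (forall n, adj (w n) u = adj (w n) v) -> u = v.
  move=> uv; apply/eqP; rewrite -subr_eq0; apply/eqP; apply: (pfam_total wF) => n.
  by rewrite bop_linB uv subrr.
exists (fun u v => t (u, v)); split.
- move=> c u u' v; apply: wi => n; rewrite bop_linD bop_linZ !tP /=.
  by rewrite scalerDr !scalerA mulrC.
- move=> c u v v'; apply: wi => n; rewrite bop_linD bop_linZ !tP /=.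
  by rewrite innerDr innerZr scalerDl scalerA.
- move=> u v u' v'.
  have h := amp_series wF (X := 1) (u := t (u, v)) (v := t (u', v')).
  rewrite (amp1 wF) bop1E in h; apply: (rnorm_cvg_unique (V := Cx R) h).
  have h2 : (fun n => '[u, u'] * series (fun i => '[v', e i] * '[e i, v]) n : Cx R) @ \oo --> ('[u, u'] * '[v', v] : Cx R).
    by apply: cvgM; [exact: cvg_cst|exact: parseval].
  rewrite (_ : series _ = (fun n => '[u, u'] * series (fun i => '[v', e i] * '[e i, v]) n))//.
  apply/funext => n; rewrite /series /= mulr_sumr; apply: eq_bigr => i _.
  by rewrite !tP /= innerZl innerZr -innerC; ring.
- move=> k kt; apply: (pfam_total wF) => n; apply: inner_eq0l => u.
  have twn : t (u, e n) = w n u.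
    apply: wi => m; rewrite tP /= eb.1 -bopME; have [->|mn] := eqVneq m n.
      by rewrite w1 scale1r.
    by rewrite (pfam_orth wF)// scale0r.
  by rewrite adjP adjK -twn kt.
Qed.

End TensorExistence.

(** * Normality of the trace *)

Section TraceWeight.
Variables (R : realType) (H : hilbertType R) (e : nat -> H).
Hypothesis eb : orthobasis e.
Implicit Types (x y d : bop H) (u v w : H).

Definition trace_weight x : \bar R := (\sum_(0 <= i <oo) (complex.Re '[x (e i), e i])%:E)%E.
Local Notation tr := trace_weight.

Let Re_ge0 x u : pos_op x -> 0 <= complex.Re '[x u, u].
Proof. by move=> xp; exact: ge0_Re. Qed.

Lemma trace_ge_partial x n : pos_op x ->
  ((\sum_(0 <= i < n) complex.Re '[x (e i), e i])%:E <= tr x)%E.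
Proof.
move=> xp; rewrite -sumEFin; apply: nneseries_lim_ge => i _ _.
by rewrite lee_fin; exact: Re_ge0.
Qed.

Lemma trace_le x (b : \bar R) : pos_op x ->
  (forall n, ((\sum_(0 <= i < n) complex.Re '[x (e i), e i])%:E <= b)%E) -> (tr x <= b)%E.
Proof.
move=> xp h; apply: lime_le.
  by apply: is_cvg_nneseries => n _ _; rewrite lee_fin; exact: Re_ge0.
by apply: nearW => n; rewrite sumEFin.
Qed.

Lemma trace_fin_bound x : pos_op x -> (tr x < +oo)%E ->
  forall n, \sum_(0 <= i < n) complex.Re '[x (e i), e i] <= fine (tr x).
Proof.
move=> xp xf n; rewrite -lee_fin fineK; first exact: trace_ge_partial.
rewrite ge0_fin_numE//; apply: nneseries_ge0 => i _ _.
by rewrite lee_fin; exact: Re_ge0.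
Qed.

(** From [0 <= y <= x] and the bound [C] on [x] one gets [y^2 <= C y]; Cauchy-Schwarz for the form
    of [y] at [u] and [y u]. *)
Lemma pos_sqr_le x y u (C : R) : pos_op y -> le_op y x -> (forall u, rnorm (x u) <= C * rnorm u) ->
  rnorm (y u) ^+ 2 <= C * complex.Re '[y u, u].
Proof.
move=> yp yx xC; have := pos_cs u (y u) yp; rewrite {1}inner_rnorm rnormC_real.
rewrite ger0_norm ?sqr_ge0// => h.
have h2 : complex.Re '[y (y u), y u] <= C * rnorm (y u) ^+ 2.
  have := ge0_Re (yx (y u)); rewrite bopBE innerBl ReD ReN subr_ge0 => /le_trans; apply.
  apply: le_trans (ler_Re_rnorm _) _; apply: le_trans (rnorm_cs _ _) _.
  by rewrite expr2 mulrA; apply: ler_wpM2r; [exact: rnorm_ge0|exact: xC].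
have q0 := ge0_Re (yp u); have [->|yu] := eqVneq (y u) 0.
  by rewrite rnorm0 expr0n inner0l mulr0.
have p : 0 < rnorm (y u) ^+ 2 by rewrite exprn_gt0// rnorm_gt0.
rewrite -(ler_pM2r p) -expr2; apply: le_trans h _.
rewrite mulrAC mulrC; apply: ler_wpM2r => //.
Qed.

(* If the weak supremum of [D] at [u] fell short of [x], a rank one positive
   operator could be subtracted from [x] while keeping an upper bound of [D]. *)
Lemma lub_weak (D : set (bop H)) x u (eps : R) : D `<=` pos_part setT -> D !=set0 ->
  (forall a b, D a -> D b -> exists c, [/\ D c, le_op a c & le_op b c]) ->
  pos_part setT x -> (forall d, D d -> le_op d x) ->
  (forall y, pos_part setT y -> (forall d, D d -> le_op d y) -> le_op x y) ->
  0 < eps -> exists2 d, D d & complex.Re '[x u, u] < complex.Re '[d u, u] + eps.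
Proof.
move=> Dp [d0 Dd0] Ddir [_ xp] Dx lub eps0; apply: contrapT => h.
have hd d : D d -> complex.Re '[d u, u] + eps <= complex.Re '[x u, u].
  by move=> Dd; rewrite leNgt; apply/negP => lt; apply: h; exists d.
pose E := [set complex.Re '[d u, u] | d in D].
have Esup : has_sup E.
  split; first by exists (complex.Re '[d0 u, u]); exists d0.
  by exists (complex.Re '[x u, u]) => _ [d Dd <-]; have := hd d Dd; lra.
pose q := sup E; pose dl := complex.Re '[x u, u] - q.
have Eq d : D d -> complex.Re '[d u, u] <= q.
  by move=> Dd; apply: sup_upper_bound => //; exists d.
have dl0 : 0 < dl.
  suff : q <= complex.Re '[x u, u] - eps by rewrite /dl; lra.
  apply: sup_le_ub; first exact: Esup.1.
  by move=> _ [d Dd <-]; have := hd d Dd; lra.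
have /choice[b bP] (n : nat) : exists b, D b /\ q - n.+1%:R^-1 < complex.Re '[b u, u].
  have n0 : 0 < n.+1%:R^-1 :> R by rewrite invr_gt0.
  by have [_ [d Dd <-] dP] := sup_adherent n0 Esup; exists d.
have [C C0 xC] := bop_rbound x.
have near b1 b2 n : D b1 -> D b2 -> le_op b1 b2 -> q - n.+1%:R^-1 < complex.Re '[b1 u, u] ->
    rnorm (b2 u - b1 u) ^+ 2 <= C * n.+1%:R^-1.
  move=> D1 D2 b12 b1q; rewrite -bopBE; have b2x : le_op (b2 - b1) x.
    move=> v; rewrite bopBE innerBl bopBE innerBl opprB addrCA addr_ge0 ?(Dp _ D1).2//.
    by have := Dx _ D2 v; rewrite bopBE innerBl.
  apply: le_trans (pos_sqr_le u b12 b2x xC) _; apply: ler_wpM2l; first exact: ltW.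
  by rewrite bopBE innerBl ReD ReN; have := Eq _ D2; move: b1q; set y := n.+1%:R^-1; lra.
have small (eta : R) : 0 < eta -> exists N, forall n, (N <= n)%N -> C * n.+1%:R^-1 < eta ^+ 2.
  move=> eta0; have e' : 0 < eta ^+ 2 / C by rewrite divr_gt0// exprn_gt0.
  have [N _ NP] := near_infty_natSinv_lt (PosNum e'); exists N => n /(NP n) /=.
  by rewrite ltr_pdivlMr// mulrC.
have sqlt (eta r : R) : 0 < eta -> 0 <= r -> r ^+ 2 < eta ^+ 2 -> r < eta.
  by move=> e0' r0; rewrite ltr_pXn2r ?nnegrE// ltW.
have [l lP] : exists l : H, (fun n => b n u) @ \oo --> l.
  apply: complete_rnorm => eta eta0; have eta2 : 0 < eta / 2 by rewrite divr_gt0.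
  have [N NP] := small _ eta2; exists N => m n Nm Nn.
  have [c [Dc bm bn]] := Ddir _ _ (bP m).1 (bP n).1.
  have h1 := near _ _ m (bP m).1 Dc bm (bP m).2; have h2 := near _ _ n (bP n).1 Dc bn (bP n).2.
  have h3 := sqlt _ _ eta2 (rnorm_ge0 _) (le_lt_trans h1 (NP m Nm)).
  have h4 := sqlt _ _ eta2 (rnorm_ge0 _) (le_lt_trans h2 (NP n Nn)).
  by have := rnorm_tri (c u) (b m u) (b n u); rewrite (rnormBC (b m u) (c u)); lra.
pose z := x u - l.
have zu : complex.Re '[z, u] = dl.
  have : (fun n => '[b n u, u] : Cx R) @ \oo --> ('[l, u] : Cx R) by exact: cvg_innerl.
  move=> /cvg_rnormn lu; rewrite /z innerBl ReD ReN; congr (_ - _).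
  apply/eqP; rewrite eq_le; apply/andP; split; apply/ler_addgt0Pr => eta eta0.
    have [N NP] := lu _ eta0; have := NP N (leqnn N) => h1.
    have := norm_Re_le ('[l, u] - '[b N u, u]); rewrite ReD ReN ler_norml => /andP[_ h2].
    by have := Eq _ (bP N).1; lra.
  have eta2 : 0 < eta / 2 by rewrite divr_gt0.
  have [N NP] := lu _ eta2; have [M _ MP] := near_infty_natSinv_lt (PosNum eta2).
  have h1 := NP (maxn N M) (leq_maxl _ _); have := MP (maxn N M) (leq_maxr _ _) => /= h3.
  have := norm_Re_le ('[l, u] - '[b (maxn N M) u, u]); rewrite ReD ReN ler_norml => /andP[h2 _].
  have := (bP (maxn N M)).2; move: h3; set y := _^-1; lra.
(* In operator terms |z><z| is at most [dl (x - d)]. This is the limit of Cauchy-Schwarz for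
   [x - c n], where directedness provides [c n] above both [d] and [b n]. *)
have zb d w : D d -> rnorm ('[z, w] : Cx R) ^+ 2 <= dl * complex.Re '[(x - d) w, w].
  move=> Dd.
  have /choice[c cP] n : exists c, [/\ D c, le_op d c & le_op (b n) c].
    by exact: Ddir Dd (bP n).1.
  have cl : (fun n => c n u) @ \oo --> l.
    apply/cvg_rnormn => eta eta0; have eta2 : 0 < eta / 2 by rewrite divr_gt0.
    have [N NP] := small _ eta2; have /cvg_rnormn/(_ _ eta2)[M MP] := lP.
    exists (maxn N M) => n; rewrite geq_max => /andP[nN nM].
    have [Dc _ bc] := cP n; have h1 := near _ _ n (bP n).1 Dc bc (bP n).2.
    have h2 := sqlt _ _ eta2 (rnorm_ge0 _) (le_lt_trans h1 (NP n nN)).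
    have := rnorm_tri (b n u) l (c n u); rewrite (rnormBC (b n u)); have := MP n nM; lra.
  have cz : (fun n => '[(x - c n) u, w] : Cx R) @ \oo --> ('[z, w] : Cx R).
    apply: cvg_innerl; under eq_fun do rewrite bopBE.
    by apply: cvgB => //; exact: cvg_cst.
  have P0 : 0 <= complex.Re '[(x - d) w, w] by apply: ge0_Re; exact: Dx.
  have f1 : (fun n => rnorm ('[(x - c n) u, w] : Cx R) ^+ 2) @ \oo --> rnorm ('[z, w] : Cx R) ^+ 2.
    rewrite expr2; under eq_fun do rewrite expr2.
    by apply: cvgM; exact: (cvg_rnormr (V := Cx R)).
  have g1 : (fun n => (dl + n.+1%:R^-1) * complex.Re '[(x - d) w, w]) @ \oo --> dl * complex.Re '[(x - d) w, w].
    apply: cvgM; last exact: cvg_cst.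
    rewrite -[X in _ --> X]addr0; apply: cvgD; [exact: cvg_cst|exact: cvg_harmonic].
  apply: (le_cvgn f1 g1) => n; have [Dc dc bc] := cP n.
  have xc : pos_op (x - c n) by exact: Dx.
  apply: le_trans (pos_cs u w xc) _; apply: ler_pM; try exact: ge0_Re.
    rewrite bopBE innerBl ReD ReN; have := (bP n).2.
    have := ge0_Re (bc u); rewrite bopBE innerBl ReD ReN /dl; set y := n.+1%:R^-1; lra.
  have := ge0_Re (dc w); rewrite !bopBE !innerBl !ReD !ReN; lra.
pose k : Cx R := ((dl^-1)%:C)%C.
have yd d : D d -> le_op d (x - k *: rk1 z z).
  move=> Dd w; rewrite [x - _ - d]addrAC bopBE innerBl bopZE rk1E !innerZl.
  rewrite (innerC z w) -normCK rnormE -rmorphXn -rmorphM.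
  rewrite [X in X - _]ge0_ReE; last exact: Dx.
  rewrite -rmorphB ler0c subr_ge0 -(ler_pM2l dl0) mulrA mulfV ?gt_eqF// mul1r.
  by have := zb d w Dd; rewrite innerC rnorm_conj.
have yp : pos_part setT (x - k *: rk1 z z).
  split=> // w; have := yd _ Dd0 w; have := (Dp _ Dd0).2 w.
  rewrite (bopBE (x - k *: rk1 z z) d0) innerBl => h1 h2.
  by have := addr_ge0 h1 h2; rewrite addrC subrK.
have := lub _ yp yd u; rewrite addrAC subrr add0r bopNE innerNl bopZE rk1E !innerZl.
rewrite (innerC z u) -normCK rnormE -rmorphXn -rmorphM -rmorphN ler0c oppr_ge0 => h1.
have : 0 < dl^-1 * rnorm ('[u, z] : Cx R) ^+ 2.
  rewrite mulr_gt0 ?invr_gt0// exprn_gt0// innerC rnorm_conj.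
  by apply: lt_le_trans (ler_Re_rnorm _); rewrite zu.
by lra.
Qed.

End TraceWeight.

Section TraceData.
Variables (R : realType) (H : hilbertType R) (e : nat -> H).
Hypothesis eb : orthobasis e.
Implicit Types (x y d : bop H) (u v w k : H).
Local Notation tr := (trace_weight e).

Lemma trace_mono x y : pos_op x -> le_op x y -> (tr x <= tr y)%E.
Proof.
move=> xp xy; have yp : pos_op y by move=> u; have := addr_ge0 (xy u) (xp u); rewrite bopBE innerBl subrK.
apply: trace_le => // n; apply: le_trans (trace_ge_partial e n yp); rewrite lee_fin.
by apply: ler_sum => i _; have := ge0_Re (xy (e i)); rewrite bopBE innerBl ReD ReN subr_ge0.
Qed.

Lemma fproj_tail m i : (m <= i)%N -> fproj e m (e i) = 0.
Proof.
move=> mi; rewrite fprojE /series /= big_nat big1// => j /andP[_ jm].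
by rewrite eb.1 gtn_eqF ?scale0r// (leq_trans jm).
Qed.

Lemma trace_adjM_partial x n :
  \sum_(0 <= i < n) complex.Re '[(adj x * x) (e i), e i] = \sum_(0 <= i < n) rnorm (x (e i)) ^+ 2.
Proof. by apply: eq_bigr => i _; rewrite bopME -adjPr || rewrite bopME adjP adjK; rewrite rnorm_inner. Qed.

Lemma trace_fns : fns_weight setT tr.
Proof.
have re0 x i : pos_op x -> (0 <= (complex.Re '[x (e i), e i])%:E)%E.
  by move=> xp; rewrite lee_fin; exact: ge0_Re.
split.
- by move=> x [_ xp]; apply: nneseries_ge0 => i _ _; exact: re0.
- move=> x y [_ xp] [_ yp]; rewrite /trace_weight -nneseriesD; [|by move=> *; exact: re0|by move=> *; exact: re0].
  by apply: eq_eseriesr => i _; rewrite bopDE innerDl ReD EFinD.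
- move=> a x a0 [_ xp]; rewrite /trace_weight -nneseriesZl; last by move=> *; exact: re0.
  by apply: eq_eseriesr => i _; rewrite bopZE innerZl ReMr EFinM.
- move=> x [_ xp] x0; apply: (orthobasis_bop_eq eb) => i; rewrite bop0E.
  apply: pos_eq0 => //; rewrite (ge0_ReE (xp (e i))).
  suff -> : complex.Re '[x (e i), e i] = 0 by [].
  apply/eqP; rewrite eq_le ge0_Re// andbT.
  have := trace_ge_partial e i.+1 xp; rewrite x0 lee_fin big_nat_recr//=; apply: le_trans.
  by rewrite lerDr; apply: sumr_ge0 => j _; exact: ge0_Re.
- move=> D x Dp D0 Ddir xp Dx lub.
  apply/eqP; rewrite eq_le; apply/andP; split; last first.
    apply: ub_ereal_sup => _ [d Dd <-]; apply: trace_mono; first exact: (Dp _ Dd).2.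
    exact: Dx.
  apply: trace_le => [|n]; first exact: xp.2.
  (* [lub_weak] serves one vector at a time; directedness merges the choices for the first [m] basis
     vectors into a single [d]. *)
  have approx m (eta : R) : 0 < eta -> exists2 d, D d &
      forall i, (i < m)%N -> complex.Re '[x (e i), e i] <= complex.Re '[d (e i), e i] + eta.
    move=> eta0; elim: m => [|m [d Dd dP]]; first by case: D0 => d Dd; exists d.
    have [b Db bP] := lub_weak (e m) Dp D0 Ddir xp Dx lub eta0.
    have [c [Dc dc bc]] := Ddir _ _ Dd Db; exists c => // i.
    rewrite ltnS leq_eqVlt => /orP[/eqP ->|im].
      have := ge0_Re (bc (e m)); rewrite bopBE innerBl ReD ReN; move: bP; lra.
    by have := ge0_Re (dc (e i)); rewrite bopBE innerBl ReD ReN; have := dP i im; lra.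
  apply/lee_addgt0Pr => eps eps0.
  have n0 : 0 < n.+1%:R :> R by rewrite ltr0n.
  have [d Dd dP] := approx n (eps / n.+1%:R) (divr_gt0 eps0 n0).
  apply: (@le_trans _ _ ((\sum_(0 <= i < n) complex.Re '[d (e i), e i])%:E + eps%:E)%E).
    rewrite -EFinD lee_fin.
    apply: (@le_trans _ _ (\sum_(0 <= i < n) (complex.Re '[d (e i), e i] + eps / n.+1%:R))).
      by rewrite !big_nat; apply: ler_sum => i /andP[_ /dP].
    rewrite big_split /= lerD2l sumr_const_nat subn0 -(mulr_natr (eps / _)).
    by rewrite mulrAC ler_pdivrMr// ler_wpM2l ?ler_nat// ltW.
  rewrite leeD2r//; apply: (@le_trans _ _ (tr d)).
    by apply: trace_ge_partial; exact: (Dp _ Dd).2.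
  by apply: ereal_sup_ubound; exists d.
- move=> x _ n rho rP eps eps0; have [C C0 xC] := bop_rbound x.
  (* Semifiniteness: the truncations [x * fproj e m] have finite Hilbert-Schmidt norm and converge
     weakly to [x] with a common bound. *)
  have cv i : (fun m => rho i (x * fproj e m)) @ \oo --> rho i x.
    apply: (predual_cvg eb (rP i) (ltW C0) xC).
      apply: nearW => m u; rewrite bopME; apply: le_trans (xC _) _; apply: ler_wpM2l; first exact: ltW.
      exact: (fproj_bound eb).
    move=> u v; under eq_fun do rewrite bopME.
    by apply: cvg_innerl; apply: cvg_bop; exact: (fproj_cvg eb).
  have /choice[M MP] i : exists M, forall m, (M <= m)%N -> rnorm (rho i x - rho i (x * fproj e m) : Cx R) < eps.
    by have /(cvg_rnormn (V := Cx R))/(_ eps eps0) := cv i.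
  pose m := (\max_(i < n) M i)%N; exists (x * fproj e m); last first.
    by move=> i; rewrite rnormE ltcR; apply: MP; exact: leq_bigmax.
  split=> //; set y := x * fproj e m.
  apply: (@le_lt_trans _ _ (\sum_(0 <= i < m) rnorm (y (e i)) ^+ 2)%:E); last by rewrite ltry.
  apply: trace_le => [|k]; first exact: pos_adjM.
  rewrite trace_adjM_partial lee_fin.
  have [km|mk] := leqP k m.
    by rewrite (big_cat_nat (n := k) (p := m))//= lerDl sumr_ge0// => i _; exact: sqr_ge0.
  rewrite (big_cat_nat (n := m) (p := k))//=; last exact: ltnW.
  rewrite gerDl big_nat big1// => i /andP[mi _].
  by rewrite /y /= fproj_tail// bop_lin0 rnorm0 expr0n.
Qed.

Variable tau : H -> H -> H.
Hypothesis tT : tensor tau.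

(** The inverse of [op]; on operators that are not Hilbert-Schmidt, hence outside the left ideal of
    the trace, it takes the default value [0]. *)
Definition trace_map x : H := xget 0 [set k | op tT k = x].

Lemma trace_mapE k : trace_map (op tT k) = k.
Proof.
have /(@xgetPex _ 0) : exists k', [set k' | op tT k' = op tT k] k' by exists k.
by move/(op_inj (tT := tT)).
Qed.

Lemma trace_op k : tr (adj (op tT k) * op tT k) = (rnorm k ^+ 2)%:E.
Proof.
have p : pos_op (adj (op tT k) * op tT k) by exact: pos_adjM.
have le1 : (tr (adj (op tT k) * op tT k)%R <= (rnorm k ^+ 2)%:E)%E.
  by apply: trace_le => // n; rewrite trace_adjM_partial lee_fin; exact: (op_bessel tT eb).
have fin : (tr (adj (op tT k) * op tT k)%R < +oo)%E by apply: le_lt_trans le1 _; rewrite ltry.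
have h := trace_fin_bound p fin.
apply/eqP; rewrite eq_le le1 /= -[leRHS]fineK; last first.
  rewrite ge0_fin_numE//; apply: nneseries_ge0 => i _ _.
  by rewrite lee_fin; exact: ge0_Re.
rewrite lee_fin; apply: (le_cvgn (op_rnorm_cvg tT eb (k := k)) (cvg_cst _)) => n.
by have := h n; rewrite trace_adjM_partial.
Qed.

Lemma trace_left_ideal x : left_ideal setT tr x <-> exists k, op tT k = x.
Proof.
split=> [[_ xf]|[k <-]]; last by split=> //; rewrite trace_op ltry.
have [|k [kx _ _]] := @vec_exists R H H tau tT e eb x (fine (tr (adj x * x)%R)); last by exists k.
by move=> n; have := trace_fin_bound (pos_adjM x) xf n; rewrite trace_adjM_partial.
Qed.

Lemma trace_gns : gns setT tr (fun x => tens tau x 1) trace_map.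
Proof.
split.
- move=> c x y /trace_left_ideal[k <-] /trace_left_ideal[k' <-].
  by rewrite -op_linear !trace_mapE.
- move=> x /trace_left_ideal[k <-]; rewrite trace_mapE trace_op /=.
  by rewrite rnormE rmorphXn.
- move=> O [k Ok] _; exists k; split=> //; exists (op tT k); last exact: trace_mapE.
  by apply/trace_left_ideal; exists k.
- move=> x y _ /trace_left_ideal[k <-].
  have := op_tens tT eb x 1 k; rewrite adj1 mulr1 => <-.
  by rewrite !trace_mapE.
Qed.

Lemma trace_conj J : antiunitary J -> (forall u v, J (tau u v) = tau v u) ->
  modular_conjugation setT tr trace_map J.
Proof.
(* The modular operator of the trace is the identity, whose graph is the diagonal. *)
move=> Ja Jt; split=> //; exists [set p | p.2 = p.1].
  split=> /=.
  - by move=> u v w -> ->.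
  - by move=> c u u' v v' -> ->.
  - by move=> O [k Ok] _; exists k; split=> //; exists k.
  - by move=> v w; split=> [-> u u' ->//|h]; apply: inner_eqr => u; rewrite -(h u u).
  - by move=> u u' ->; exact: inner_ge0.
have graphE p : tomita_graph setT tr trace_map p <-> p.2 = J p.1.
  split=> [[x [/trace_left_ideal[k <-] _ ->]] /=|].
    by rewrite -(flip_adj tT k Ja Jt) !trace_mapE.
  case: p => u v /= ->; exists (op tT u); split.
  - by apply/trace_left_ideal; exists u.
  - by apply/trace_left_ideal; exists (J u); exact: flip_adj.
  - by rewrite -(flip_adj tT u Ja Jt) !trace_mapE.
apply/seteqP; split=> [[u v] cl|_ [[u u'] /= -> <-]] /=; last first.
  by apply: subset_closure; apply/graphE.
exists (u, u) => //=; congr (_, _); apply/esym/eqP; rewrite -subr_eq0; apply/eqP.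
apply: rnorm_small_eq0 => eps eps0; have e2 : 0 < eps / 2 by rewrite divr_gt0.
have [[a b] [/graphE /= -> h1 h2]] := closure_pair_approx e2 cl.
have h3 : rnorm (J u - J a) = rnorm (u - a).
  rewrite -(antiunitary_rnorm (u - a) Ja); congr rnorm.
  by rewrite [u - a]addrC -[- a]scaleN1r (antiunitary_linear Ja) rmorphN rmorph1 scaleN1r addrC.
have := rnorm_tri (J a) v (J u); rewrite (rnormBC (J a)) h3; lra.
Qed.

End TraceData.

(** * The extended semigroup *)

Section WithinContinuity.
Variable R : realType.
Implicit Types (f g : R -> Cx R).

Definition hcont f := forall t : R, 0 <= t ->
  f s @[s --> within [set r : R | 0 <= r] (nbhs t)] --> f t.

Lemma hcontP f : hcont f <-> forall t eps : R, 0 <= t -> 0 < eps ->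
  \forall s \near within [set r : R | 0 <= r] (nbhs t), rnorm (f t - f s) < eps.
Proof.
split=> [h t eps t0 eps0|h t t0].
  by have /(cvg_rnorm (V := Cx R)) := h t t0; apply.
by apply/(cvg_rnorm (V := Cx R)) => eps eps0; exact: h.
Qed.

Lemma near_nonneg (t : R) : \forall s \near within [set r : R | 0 <= r] (nbhs t), 0 <= s.
Proof. exact: withinT. Qed.

Lemma hcont_ext f g : (forall s, 0 <= s -> f s = g s) -> hcont f -> hcont g.
Proof.
move=> fg /hcontP h; apply/hcontP => t eps t0 eps0; have := h t eps t0 eps0.
have := near_nonneg t; apply: filterS2 => s s0.
by rewrite !fg.
Qed.

Lemma hcontD f g : hcont f -> hcont g -> hcont (fun s => f s + g s).
Proof. by move=> hf hg t t0; apply: cvgD; [exact: hf | exact: hg]. Qed.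

Lemma hcontM f g : hcont f -> hcont g -> hcont (fun s => f s * g s).
Proof. by move=> hf hg t t0; apply: cvgM; [exact: hf | exact: hg]. Qed.

Lemma hcont_cst (c : Cx R) : hcont (fun=> c).
Proof. by move=> t t0; exact: cvg_cst. Qed.

(** Finite sums of elementary tensors approximate [k] uniformly in time. The map [f] is the identity
    or the conjugation, so that one statement serves linear and conjugate-linear dependence on
    [k]. *)
Lemma hcont_tau (H K : hilbertType R) (tau : H -> H -> K) (tT : tensor tau)
    (G : K -> R -> Cx R) (f : Cx R -> Cx R) (C : R) : 0 <= C -> f 1 = 1 ->
  (forall c k l s, 0 <= s -> G (c *: k + l) s = f c * G k s + G l s) ->
  (forall k s, 0 <= s -> rnorm (G k s : Cx R) <= C * rnorm k) ->
  (forall u v, hcont (G (tau u v))) -> forall k, hcont (G k).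
Proof.
move=> C0 f1 Gl Gb Gt k.
have Gs l : lspan [set tau p.1 p.2 | p in [set: H * H]] l -> hcont (G l).
  elim/lspan_ind => [|c _ v [[a b] _ <-] Gv].
    apply: (@hcont_ext (fun=> 0)); last exact: hcont_cst.
    move=> s s0; apply/esym/(@crnorm0_eq0 R)/eqP.
    by rewrite eq_le rnorm_ge0 andbT; have := Gb 0 s s0; rewrite rnorm0 mulr0.
  apply: (@hcont_ext (fun s => f c * G (tau a b) s + G v s)) => [s s0|]; first by rewrite Gl.
  by apply: hcontD Gv; apply: hcontM; [exact: hcont_cst | exact: Gt].
apply/hcontP => t eps t0 eps0.
have C1 : 0 < C + 1 by rewrite ltr_wpDl.
have d0 : 0 < eps / 3 / (C + 1) by rewrite !divr_gt0.
have [l lS ld] := tau_lspan_dense tT k d0.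
have /hcontP/(_ t (eps / 3) t0) := Gs l lS.
have e3 : 0 < eps / 3 by rewrite divr_gt0.
move/(_ e3); have := near_nonneg t; apply: filterS2 => s s0 h.
have b r : 0 <= r -> rnorm (G k r - G l r) <= eps / 3.
  move=> r0; have := Gl 1 (k - l) l r r0; rewrite scale1r subrK f1 mul1r => ->.
  rewrite addrK; apply: le_trans (Gb _ _ r0) _.
  apply: (@le_trans _ _ ((C + 1) * (eps / 3 / (C + 1)))); last by rewrite mulrC divfK// gt_eqF.
  by apply: ler_pM; rewrite ?rnorm_ge0 ?lerDl// ltW.
have -> : G k t - G k s = (G k t - G l t) + (G l t - G l s) - (G k s - G l s) by ring.
apply: le_lt_trans (rnormB _ _) _; have := rnormD (G k t - G l t) (G l t - G l s).
by have := b _ t0; have := b _ s0; lra.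
Qed.

End WithinContinuity.

Section EndoOps.
Variables (R : realType) (H : hilbertType R).
Implicit Types (theta eta : bop H -> bop H).

Lemma endo_id : normal_unital_endo setT (fun x : bop H => x).
Proof. by split. Qed.

Lemma endo_comp theta eta : normal_unital_endo setT theta -> normal_unital_endo setT eta ->
  normal_unital_endo setT (theta \o eta).
Proof.
move=> tE eE; split; rewrite /comp.
- by [].
- by move=> c x y _ _; rewrite (endo_linear eE)// (endo_linear tE).
- by move=> x y _ _; rewrite (endoM eE) (endoM tE).
- by move=> x _; rewrite (endoJ eE) (endoJ tE).
- by rewrite (endo_one eE) (endo_one tE).
- by move=> rho /(endo_normal tE)/(endo_normal eE).
Qed.

End EndoOps.

Section TensorSemigroup.
Variables (R : realType) (H : hilbertType R) (e : nat -> H) (tau : H -> H -> H).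
Hypotheses (eb : orthobasis e) (tT : tensor tau) (Hsep : separable_space H).
Implicit Types (x y : bop H) (u v k : H) (s t : R).

Lemma tens_endo_exists theta : normal_unital_endo setT theta ->
  exists Theta, normal_unital_endo setT Theta /\
    forall x y, Theta (tens tau x y) = tens tau (theta x) (theta y).
Proof.
move=> tE; have [g [go zF gfix gE]] := endo_amp tE eb Hsep.
pose V i := itw tE (e 0%N) (g i).
have VE i : intw theta (V i) by exact: itw_intw.
have [pr pi ps] := nat_pairing; have [un uk] := choice ps.
have pk : cancel pr un by move=> ij; apply: pi; rewrite uk.
pose Z m := tens tau (V (un m).1) (V (un m).2).
have ZF : pfam Z.
  split=> [m n mn|m|w h].
  - rewrite /Z (tensJ tT eb) (tensM tT eb).
    have [ij|ij] := eqVneq (un m).1 (un n).1; last by rewrite (pfam_orth zF ij) (tens0l tT eb).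
    have ij2 : (un m).2 != (un n).2.
      apply: contra mn => /eqP ij2; rewrite -(uk m) -(uk n); apply/eqP; congr pr.
      by rewrite [un m]surjective_pairing ij ij2 -surjective_pairing.
    by rewrite (pfam_orth zF ij2) (tens0r tT eb).
  - by rewrite /Z (tensJ tT eb) !(tensM tT eb) !(pfam_piso zF).
  - have opV j : op tT w * V j = 0.
      apply: bopP => u; rewrite bopME bop0E; apply: (pfam_total zF) => i.
      have := congr1 (op tT) (h (pr (i, j))).
      rewrite /Z pk (tensJ tT eb) (op_tens tT eb) adjK op0 => /(congr1 (fun X : bop H => X u)).
      by rewrite !bopME bop0E.
    apply: (op_inj (tT := tT)); rewrite op0 -[op tT w]adjK -[RHS]adj0; congr adj.
    apply: bopP => u; rewrite bop0E; apply: (pfam_total zF) => j.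
    by rewrite -bopME -adjM opV adj0 bop0E.
have ZC i X : X * (adj (Z i) * Z i) = (adj (Z i) * Z i) * X.
  have e1 : '[e 0%N, e 0%N] = 1 by rewrite eb.1.
  rewrite /Z (tensJ tT eb) (tensM tT eb) !(intw_adjM tE e1)// (tensZl tT eb) (tensZr tT eb).
  by rewrite (tens11 tT eb) scalerA bopZAl bopZAr mulr1 mul1r.
exists (amp Z); split=> [|x y]; first exact: (amp_endo eb ZF ZC).
by apply/esym/amp_unique => // i; rewrite /Z !(tensM tT eb) !VE.
Qed.

Lemma endo_tens_eq Theta Theta' :
  normal_unital_endo setT Theta -> normal_unital_endo setT Theta' ->
  (forall x y, Theta (tens tau x y) = Theta' (tens tau x y)) ->
  forall x : bop H, Theta x = Theta' x.
Proof.
move=> TE TE' h; pose k0 := tau (e 0%N) (e 0%N).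
have k1 : '[k0, k0] = 1 by rewrite (tau_inner tT) eb.1 mulr1.
apply: (endo_eq TE eb k1 TE') => k.
apply: bopP => w; rewrite -(itwE TE) -(itwE TE'); congr (bop_fun _ k).
by apply: (tau_bop_eq tT) => u v; rewrite !itwE /k0 (rk1_tau tT eb) h.
Qed.

Variables (alpha sigma : R -> bop H -> bop H).
Hypothesis aE : e0_semigroup setT alpha.
Hypothesis sE : forall t, 0 <= t -> normal_unital_endo setT (sigma t).
Hypothesis st : forall t, 0 <= t -> forall x y,
  sigma t (tens tau x y) = tens tau (alpha t x) (alpha t y).

Definition wcont x := forall u v, hcont (fun s => '[sigma s x u, v]).

Lemma sigma_inner_bound x (C : R) : 0 <= C -> (forall u, rnorm (x u) <= C * rnorm u) ->
  forall u v s, 0 <= s -> rnorm ('[sigma s x u, v] : Cx R) <= C * rnorm u * rnorm v.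
Proof.
move=> C0 xC u v s s0; apply: le_trans (rnorm_cs _ _) _; apply: ler_wpM2r; first exact: rnorm_ge0.
exact: (endo_bound (sE s0)).
Qed.

Lemma wcontP c x y : wcont x -> wcont y -> wcont (c *: x + y).
Proof.
move=> xc yc u v; apply: (@hcont_ext _ (fun s => c * '[sigma s x u, v] + '[sigma s y u, v])).
  by move=> s s0; rewrite (endo_linear (sE s0))// bopDE bopZE innerDl innerZl.
by apply: hcontD (yc u v); apply: hcontM (xc u v); exact: hcont_cst.
Qed.

Lemma wcont0 : wcont 0.
Proof.
move=> u v; apply: (@hcont_ext _ (fun=> 0)) => [s s0|]; last exact: hcont_cst.
by rewrite (endo0 (sE s0)) bop0E inner0l.
Qed.

Lemma wcont_sum n (F : nat -> bop H) : (forall i, wcont (F i)) ->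
  wcont (\sum_(0 <= i < n) F i).
Proof.
move=> Fc; elim: n => [|n IH]; first by rewrite big_geq//; exact: wcont0.
have -> : \sum_(0 <= i < n.+1) F i = 1 *: F n + \sum_(0 <= i < n) F i.
  by rewrite big_nat_recr// scale1r addrC.
exact: (wcontP (c := 1) (Fc n) IH).
Qed.

Lemma wcont_tens x y : wcont (tens tau x y).
Proof.
have [C C0 xC] := bop_rbound (tens tau x y).
have hc a b c : hcont (fun s => '[alpha s a b, c]).
  move=> t t0; have := e0_cont aE (x := a) (predual_vec b c) I.
  by rewrite subspace_continuousP; exact.
move=> u v; move: v.
apply: (@hcont_tau _ _ _ tau tT (fun v s => '[sigma s (tens tau x y) u, v]) (fun c : Cx R => c^*) (C * rnorm u)).
- by rewrite mulr_ge0 ?rnorm_ge0// ltW.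
- exact: conjC1.
- by move=> c k l s _; rewrite innerDr innerZr.
- by move=> k s s0; exact: (sigma_inner_bound (ltW C0) xC).
move=> u' v'; move: u.
apply: (@hcont_tau _ _ _ tau tT (fun u s => '[sigma s (tens tau x y) u, tau u' v']) id
  (C * rnorm (tau u' v'))).
- by rewrite mulr_ge0 ?rnorm_ge0// ltW.
- by [].
- by move=> c k l s _; rewrite bop_linD bop_linZ innerDl innerZl.
- by move=> k s s0; rewrite mulrAC; exact: (sigma_inner_bound (ltW C0) xC).
move=> u v; apply: (@hcont_ext _ (fun s => '[alpha s x u, u'] * '[alpha s (adj y) v', v])).
  move=> s s0; rewrite (st s0) (tensE tT eb) (tau_inner tT).
  by rewrite (endoJ (e0_endo aE s0)) -adjPr.
by apply: hcontM; exact: hc.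
Qed.

Lemma wcont_rk1 k l : wcont (rk1 k l).
Proof.
have b (a c u : H) : rnorm (rk1 a c u) <= rnorm a * rnorm c * rnorm u.
  by rewrite rk1E rnormZ mulrC -mulrA ler_wpM2l ?rnorm_ge0// mulrC rnorm_cs.
have b0 (a c : H) : 0 <= rnorm a * rnorm c by rewrite mulr_ge0 ?rnorm_ge0.
move=> u v; move: l.
apply: (@hcont_tau _ _ _ tau tT (fun l s => '[sigma s (rk1 k l) u, v]) (fun c : Cx R => c^*)
  (rnorm k * rnorm u * rnorm v)).
- by rewrite !mulr_ge0 ?rnorm_ge0.
- exact: conjC1.
- move=> c l l' s s0.
  have -> : rk1 k (c *: l + l') = c^* *: rk1 k l + rk1 k l'.
    by apply: bopP => w; rewrite bopDE bopZE !rk1E innerDr innerZr scalerDl scalerA.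
  by rewrite (endo_linear (sE s0))// bopDE bopZE innerDl innerZl.
- move=> l s s0; apply: le_trans (sigma_inner_bound (b0 k l) (b k l) u v s0) _.
  by rewrite le_eqVlt; apply/orP; left; apply/eqP; ring.
move=> u' v'; move: k.
apply: (@hcont_tau _ _ _ tau tT (fun k s => '[sigma s (rk1 k (tau u' v')) u, v]) id
  (rnorm (tau u' v') * rnorm u * rnorm v)).
- by rewrite !mulr_ge0 ?rnorm_ge0.
- by [].
- move=> c l l' s s0.
  have -> w : rk1 (c *: l + l') w = c *: rk1 l w + rk1 l' w.
    by apply: bopP => w'; rewrite bopDE bopZE !rk1E scalerDr !scalerA mulrC.
  by rewrite (endo_linear (sE s0))// bopDE bopZE innerDl innerZl.
- move=> l s s0; apply: le_trans (sigma_inner_bound (b0 l _) (b l _) u v s0) _.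
  by rewrite le_eqVlt; apply/orP; left; apply/eqP; ring.
move=> a c; rewrite (rk1_tau tT eb); exact: wcont_tens.
Qed.

(** Finite rank operators are not norm dense, so [x * fproj e n] is used with an error governed by
    [sigma_s (q n) u]. Its squared norm is ['[sigma_s (q n) u, u]], small at [t] by normality, and
    still small near [t] because [q n] is a finite rank perturbation of [1]. *)
Lemma wcont_all x : wcont x.
Proof.
move=> u v; apply/hcontP => t eps t0 eps0; have [C C0 xC] := bop_rbound x.
pose q n : bop H := 1 - fproj e n.
have qa n : adj (q n) = q n by rewrite /q adjB adj1 fprojJ.
have qq n : q n * q n = q n.
  rewrite /q mulrBl mul1r mulrBr mulr1 (fprojM eb).
  by rewrite subrr subr0.
have qn n s : 0 <= s -> rnorm (sigma s (q n) u) ^+ 2 = complex.Re '[sigma s (q n) u, u].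
  by move=> s0; rewrite rnorm_inner adjPr -(endoJ (sE s0)) -bopME -(endoM (sE s0)) qa qq.
pose B := C * rnorm v + 1.
have B0 : 0 < B by rewrite ltr_wpDl// mulr_ge0 ?rnorm_ge0// ltW.
pose d := eps / 3 / B; have d0 : 0 < d by rewrite !divr_gt0.
have d2 : 0 < d ^+ 2 / 2 by rewrite divr_gt0// exprn_gt0.
have [n nP] : exists n, rnorm ('[sigma t (q n) u, u] : Cx R) < d ^+ 2 / 2.
  have : (fun n => '[sigma t (fproj e n) u, u] : Cx R) @ \oo --> ('[sigma t 1 u, u] : Cx R).
    apply: (endo_weak_cvg (sE t0) eb (C := 1)) => //.
    - by move=> w; rewrite bop1E mul1r.
    - by apply: nearW => n w; rewrite mul1r; exact: (fproj_bound eb).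
    - by move=> a b; apply: cvg_innerl; exact: (fproj_cvg eb).
  move/(cvg_rnormn (V := Cx R))/(_ _ d2) => [n /(_ n (leqnn n))].
  by rewrite -innerBl -bopBE -(endoB (sE t0)); exists n.
have xq : wcont (x * fproj e n).
  rewrite /fproj mulr_sumr; apply: wcont_sum => i; rewrite mul_rk1; exact: wcont_rk1.
have qc : wcont (q n).
  rewrite /q addrC -scaleN1r; apply: wcontP; first by apply: wcont_sum => i; exact: wcont_rk1.
  by rewrite -(tens11 tT eb); exact: wcont_tens.
have e3 : 0 < eps / 3 by rewrite divr_gt0.
have /hcontP/(_ t _ t0 e3) h1 := xq u v.
have /hcontP/(_ t _ t0 d2) h2 := qc u u.
near=> s.
have s0 : 0 <= s by near: s; exact: near_nonneg.
have hs1 : rnorm ('[sigma t (x * fproj e n) u, v] - '[sigma s (x * fproj e n) u, v] : Cx R) < eps / 3.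
  by near: s; exact: h1.
have hs2 : rnorm ('[sigma t (q n) u, u] - '[sigma s (q n) u, u] : Cx R) < d ^+ 2 / 2.
  by near: s; exact: h2.
have key r : 0 <= r -> rnorm ('[sigma r (q n) u, u] : Cx R) <= d ^+ 2 ->
    rnorm ('[sigma r x u, v] - '[sigma r (x * fproj e n) u, v] : Cx R) <= eps / 3.
  move=> r0 hr; rewrite -innerBl -bopBE -(endoB (sE r0)).
  have -> : x - x * fproj e n = x * q n by rewrite /q mulrBr mulr1.
  rewrite (endoM (sE r0)) bopME; apply: le_trans (sigma_inner_bound (ltW C0) xC _ v r0) _.
  have hq : rnorm (sigma r (q n) u) <= d.
    rewrite -(ler_pXn2r (n := 2)) ?nnegrE ?rnorm_ge0// ?(ltW d0)// (qn n r r0).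
    by apply: le_trans hr; exact: ler_Re_rnorm.
  rewrite mulrAC; apply: (@le_trans _ _ (B * d)); last by rewrite /d mulrC divfK// gt_eqF.
  by apply: ler_pM => //; rewrite ?mulr_ge0 ?rnorm_ge0 ?(ltW C0)// lerDl.
have -> : '[sigma t x u, v] - '[sigma s x u, v] =
    ('[sigma t x u, v] - '[sigma t (x * fproj e n) u, v]) +
    ('[sigma t (x * fproj e n) u, v] - '[sigma s (x * fproj e n) u, v]) -
    ('[sigma s x u, v] - '[sigma s (x * fproj e n) u, v]) by ring.
have k1 := key t t0; have k2 := key s s0.
have dd : d ^+ 2 / 2 <= d ^+ 2 by lra.
have {}k1 := k1 (le_trans (ltW nP) dd).
have {}k2 : rnorm ('[sigma s x u, v] - '[sigma s (x * fproj e n) u, v] : Cx R) <= eps / 3.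
  apply: k2; have := rnormB ('[sigma t (q n) u, u] : Cx R) ('[sigma t (q n) u, u] - '[sigma s (q n) u, u]).
  rewrite opprB addrC subrK => hh; apply: le_trans hh _; lra.
apply: le_lt_trans (rnormB _ _) _; move: (rnormD ('[sigma t x u, v] - '[sigma t (x * fproj e n) u, v] : Cx R)
  ('[sigma t (x * fproj e n) u, v] - '[sigma s (x * fproj e n) u, v])); lra.
Unshelve. all: by end_near.
Qed.

Lemma tens_e0_semigroup : e0_semigroup setT sigma.
Proof.
split=> //.
- move=> x _; apply: (endo_tens_eq (sE (lexx 0)) (endo_id H)) => a b.
  by rewrite (st (lexx 0)) !(e0_zero aE).
- move=> s t x s0 t0 _.
  have stE := endo_comp (sE s0) (sE t0).
  apply: (endo_tens_eq stE (sE (addr_ge0 s0 t0))) => a b.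
  by rewrite /= !st ?addr_ge0// !(e0_add aE).
- move=> rho x rP _; rewrite subspace_continuousP => t t0.
  have [C C0 xC] := bop_rbound x.
  apply: (predual_cvg eb rP (ltW C0)).
  + exact: (endo_bound (sE t0) (ltW C0) xC).
  + have := near_nonneg t; apply: filterS => s s0; exact: (endo_bound (sE s0) (ltW C0) xC).
  + by move=> u v; exact: wcont_all.
Qed.

End TensorSemigroup.

Section ConcreteModularData.
Variables (R : realType) (H : hilbertType R) (e : nat -> H) (tau : H -> H -> H) (J : H -> H).
Hypotheses (eb : orthobasis e) (tT : tensor tau).
Hypotheses (Ja : antiunitary J) (Jt : forall u v, J (tau u v) = tau v u).

Definition trace_data : modular_data (Bfactor H) :=
  @ModularData R H (Bfactor H) _ _ _ _ _ (trace_fns eb) (trace_gns eb tT) (trace_conj eb tT Ja Jt).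

Lemma tens_modular_extension theta (Theta : bop H -> bop H) : normal_unital_endo setT Theta ->
  (forall x y, Theta (tens tau x y) = tens tau (theta x) (theta y)) ->
  modular_extension (D := trace_data) theta Theta.
Proof.
move=> TE Tt; split=> //= x z y' _ _ _ zy u.
have -> : y' = tens tau 1 z.
  apply: bopP => w; have := zy (J w); rewrite (flip_involutive tT Ja Jt) => /(congr1 J).
  by rewrite (flip_involutive tT Ja Jt) (flip_tens tT eb _ _ _ Ja Jt).
have -> : tens tau x 1 * tens tau 1 z = tens tau x z by rewrite (tensM tT eb) mulr1 mul1r.
rewrite Tt (flip_tens tT eb _ _ _ Ja Jt) -bopME (tensM tT eb) mulr1 mul1r.
by [].
Qed.

End ConcreteModularData.

Theorem mainTheorem8 (R : realType) (H : hilbertType R)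
    (alpha : R -> bop H -> bop H) :
  infinite_dimensional H ->
  separable_space H ->
  e0_semigroup (Bfactor H) alpha ->
  modularly_extendable (Bfactor H) alpha /\
  [/\ type_EI (Bfactor H) alpha <-> type_I alpha,
      type_EII (Bfactor H) alpha <-> type_II alpha
    & type_EIII (Bfactor H) alpha <-> type_III alpha].
Proof.
move=> Hinf Hsep aE; have {}aE : e0_semigroup setT alpha := aE.
have [e eb] := orthobasis_exists Hinf Hsep.
have [tau tT] := tensor_exists eb.
have [J [Ja Jt]] := flip_exists tT eb.
have /choice[sigma sP] t : exists Theta, 0 <= t -> normal_unital_endo setT Theta /\
    forall x y, Theta (tens tau x y) = tens tau (alpha t x) (alpha t y).
  have [t0|_] := boolP (0 <= t); last by exists id.
  by have [Theta h] := tens_endo_exists eb tT Hsep (e0_endo aE t0); exists Theta.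
have sE t t0 := (sP t t0).1; have st t t0 := (sP t t0).2.
have sS := tens_e0_semigroup eb tT aE sE st.
pose D := trace_data eb tT Ja Jt.
have ext t : 0 <= t -> modular_extension (D := D) (alpha t) (sigma t).
  by move=> t0; apply: tens_modular_extension; [exact: sE | exact: st].
(* Backwards the trace data serve as witness. Forwards the weight is arbitrary, and
   [modular_data_tensor] supplies the tensor structure on its GNS space. *)
have equiv (P : forall K : hilbertType R, (R -> bop K -> bop K) -> Prop) :
    (forall (K : hilbertType R) (ta : H -> H -> K) (sg : R -> bop K -> bop K), tensor ta ->
      e0_semigroup setT sg -> (forall t, 0 <= t -> forall x y,
        sg t (tens ta x y) = tens ta (alpha t x) (alpha t y)) -> P K sg <-> P H alpha) ->
    on_modular_extension P (Bfactor H) alpha <-> P H alpha.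
  move=> PP; split=> [[D' [sg [sgE sgext Psg]]]|Pa]; last first.
    by exists D, sigma; split=> //; apply/(PP H tau sigma).
  have [ta [taT tapi taJ]] := modular_data_tensor eb D'.
  apply/(PP _ ta sg taT sgE) => // t t0.
  exact: (modular_extension_tens eb taT tapi taJ (sgext t t0)).
split; first by move=> t t0; exists D, (sigma t); exact: ext.
split; apply: equiv => K ta sg taT sgE sgt.
- exact: (type_I_tens taT eb aE sgE sgt).
- exact: (type_II_tens taT eb aE sgE sgt).
- exact: (type_III_tens taT eb aE sgE sgt).
Qed.
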